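(* Let $\Gamma\le \mathrm{PSL}_2(\mathbb R)$ be a geometrically finite Fuchsian group having $\infty$ as cuspidal point, with $\Gamma\neq\Gamma_\infty$, satisfying condition (A): for each relevant isometric sphere of $\Gamma$, its summit is contained in $\partial\mathcal K$ but is not a vertex of $\mathcal K$. Let $Y=\Gamma\backslash\mathbb H$ and let $\mu$ be a measure on the space of geodesics on $Y$. Then $\widehat{\mathrm{CS}}$ is a cross section with respect to $\mu$ for the geodesic flow on $Y$ if and only if $\mu(\mathrm{NIC})=0$.
   Context: **Setting.** $\mathbb H=\{z\in\mathbb C:\operatorname{Im}z>0\}$ is the hyperbolic plane with the Möbius action $g.z$ of $\mathrm{PSL}_2(\mathbb R)$; $\overline{\mathbb H}^g=\{\operatorname{Im}z\ge0\}\cup\{\infty\}$, $\partial_g\mathbb H=\mathbb R\cup\{\infty\}$. For $V\subseteq \mathbb H$, $\partial_gV$ is the intersection of the closure of $V$ in $\overline{\mathbb H}^g$ with $\partial_g\mathbb H$; other closures, boundaries and interiors are taken in $\mathbb H$. Geodesic segments with endpoints in $\partial_g\mathbb H$ are considered as subsets of $\mathbb H$; they are complete if both endpoints are in $\partial_g\mathbb H$. For a Fuchsian group $\Gamma$, a fundamental region is an open $F\subseteq\mathbb H$ whose translates $g.F$ ($g\in\Gamma$) are pairwise disjoint and with $\bigcup_g g.\overline F=\mathbb H$; a closed fundamental region is a closed set whose interior is a fundamental region. $\Gamma$ is geometrically finite if it has a convex fundamental region with finitely many sides. $\infty$ is cuspidal if $\Gamma$ contains a parabolic element fixing $\infty$.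 $\Gamma_\infty$ is the stabilizer of $\infty$ in $\Gamma$. **Isometric spheres.** For $g=\begin{bmatrix}a&b\\c&d\end{bmatrix}\in\Gamma\setminus\Gamma_\infty$: $I(g)=\{z\in\mathbb H:|cz+d|=1\}$, $\mathrm{ext}\,I(g)=\{|cz+d|>1\}$; the summit of $I(g)$ is its point of maximal imaginary part; $\mathcal K=\bigcap_{g\in\Gamma\setminus\Gamma_\infty}\mathrm{ext}\,I(g)$. An isometric sphere $I$ is relevant if $I\cap\partial\mathcal K$ contains a one-dimensional submanifold; then $I\cap\partial\mathcal K$ is its relevant part. A vertex of $\mathcal K$ is an endpoint (in $\overline{\mathbb H}^g$) of a relevant part; it is inner if it lies in $\mathbb H$, otherwise infinite. An infinite vertex is two-sided if it is an endpoint of the relevant parts of two distinct relevant isometric spheres, otherwise one-sided. For a one-sided infinite vertex $v$ there is a unique one-sided infinite vertex $w\ne v$ such that the closed vertical strip of $\mathbb H$ between $v$ and $w$ lies in $\mathcal K$. **Precells.** An inner vertex $v$ is an endpoint of exactly two relevant parts, of spheres with summits $s_1,s_2$; the non-cuspidal precell attached to $v$ is the hyperbolic quadrilateral with vertices $s_1,v,s_2,\infty$ (including its boundary in $\mathbb H$), with vertical sides $[s_i,\infty]$ and non-vertical sides $[s_i,v]$. For an infinite vertex $v$ and each relevant isometric sphere whose relevant part has endpoint $v$, with summit $s$, the hyperbolic triangle with vertices $v,s,\infty$ is a cuspidal precell attached to $v$ (vertical sides $[v,\infty],[s,\infty]$, non-vertical side $[v,s]$). For a one-sided infinite vertex $v$,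 with $w\ne v$ the unique one-sided infinite vertex such that the closed vertical strip of $\mathbb H$ between $v$ and $w$ lies in $\mathcal K$, this closed vertical strip is a strip precell. A basal family is a set $\mathbb A$ of precells whose union is a closed fundamental region for $\Gamma$ (such families exist and are finite). **Cycles and cells.** Fix a basal family $\mathbb A$. For $\mathcal A\in\mathbb A$ and a non-vertical side $b$ of $\mathcal A$ there is a unique $g\in\Gamma\setminus\Gamma_\infty$ with $b\subseteq I(g)$ such that $g.b$ is a non-vertical side of some $\mathcal A'\in\mathbb A$; $g$ is called assigned to $\mathcal A$. If $\mathcal A$ is a strip precell, put $\mathcal B(\mathcal A)=\mathcal A$. If $\mathcal A$ is cuspidal with assigned $g$ and $\mathcal A'\in\mathbb A$ has non-vertical side $g.b$, put $\mathcal B(\mathcal A)=\mathcal A\cup g^{-1}.\mathcal A'$. If $\mathcal A$ is non-cuspidal, attached to $v$, let $h_1$ be one of its two assigned elements, $g_1=\mathrm{id}$, $g_{j+1}=h_jg_j$, $\mathcal A_j\in\mathbb A$ the precell attached to the inner vertex $g_j.v$, and for $j\ge2$ let $h_j$ be determined by the condition that $\{h_j,h_{j-1}^{-1}\}$ is the set of the two elements assigned to $\mathcal A_j$; let $k$ be the least index with $g_{k+1}=\mathrm{id}$; put $\mathcal B(\mathcal A)=\bigcup_{j=1}^kg_j^{-1}.\mathcal A_j$ (independent of the choice of $h_1$). The sets $\mathcal B(\mathcal A)$, $\mathcal A\in\mathbb A$, are the cells; they are convex polyhedra all of whose sides are complete geodesic segments. **Base set and cross section.** $\mathrm{BS}\subseteq\mathbb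 H$ is the union of all $\Gamma$-translates of all sides of all cells, and $\mathrm{bd}=\bigcup_{g\in\Gamma}\bigcup_{\mathcal A\in\mathbb A}g.\partial_g\mathcal B(\mathcal A)$; both are independent of the choice of $\mathbb A$. $\mathrm{CS}\subseteq S\mathbb H$ is the set of unit tangent vectors based on $\mathrm{BS}$ but not tangent to $\mathrm{BS}$. Let $\pi$ denote the projections $\mathbb H\to Y$, $S\mathbb H\to SY=\Gamma\backslash S\mathbb H$, $\overline{\mathbb H}^g\to\Gamma\backslash\overline{\mathbb H}^g$; $\widehat{\mathrm{CS}}=\pi(\mathrm{CS})$. Geodesics are parametrized by arc length; geodesics on $Y$ are the images $\widehat\gamma=\pi\circ\gamma$ of geodesics $\gamma$ on $\mathbb H$, with endpoints $\widehat\gamma(\pm\infty)=\pi(\gamma(\pm\infty))$. $\mathrm{NIC}$ is the set of geodesics on $Y$ at least one endpoint of which lies in $\pi(\mathrm{bd})$. **Cross section.** $\widehat{C}\subseteq SY$ is a cross section with respect to $\mu$ for the geodesic flow if (C1) $\mu$-almost every geodesic $\widehat\gamma$ on $Y$ intersects $\widehat C$ infinitely often in the past and in the future (there are $t_n\to\infty$ and $t'_n\to-\infty$ with $\widehat\gamma'(t_n),\widehat\gamma'(t'_n)\in\widehat C$), and (C2) if $\widehat\gamma'(t)\in\widehat C$, then there is $\varepsilon>0$ with $\widehat\gamma'((t-\varepsilon,t+\varepsilon))\cap\widehat C=\{\widehat\gamma'(t)\}$. *)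

(* Defs.v *)
From HB Require Import structures.
From mathcomp Require Import all_boot all_order all_algebra generic_quotient.
From mathcomp Require Import all_classical all_reals all_analysis.
From mathcomp.real_closed Require Import complex.
From mathcomp Require Import ring lra.

Set Implicit Arguments.
Unset Strict Implicit.
Unset Printing Implicit Defensive.

Import Order.TTheory GRing.Theory Num.Theory.
Import numFieldNormedType.Exports.

Local Open Scope classical_set_scope.
Local Open Scope ring_scope.
Local Open Scope complex_scope.

Set Warnings "-redundant-canonical-projection".
HB.instance Definition _ (R : realType) := NormedModule.copy R[i] R[i]^o.

Definition SL2 (R : realType) : Type :=
  set_type [set M : 'M[R]_2 | \det M = 1].

HB.instance Definition _ (R : realType) := Choice.on (SL2 R).
HB.instance Definition _ (R : realType) := Topological.on (SL2 R).

Section PSL2.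
Variable R : realType.
Implicit Types M N P : SL2 R.

Definition sl2_mx M : 'M[R]_2 := set_val M.

Lemma sl2_mx_inj : injective sl2_mx. Proof. exact: (@val_inj _ _ (set_type _)). Qed.

Lemma sl2_det M : \det (sl2_mx M) = 1.
Proof. exact: (@set_valP _ [set N : 'M[R]_2 | \det N = 1] M). Qed.

Definition sl2_of (A : 'M[R]_2) (detA : \det A = 1) : SL2 R := SigSub (mem_set detA).

Lemma sl2_ofK A (dA : \det A = 1) : sl2_mx (sl2_of dA) = A. Proof. by []. Qed.

Lemma sl2_unit M : sl2_mx M \in unitmx.
Proof. by rewrite unitmxE sl2_det unitr1. Qed.

Definition sl2_one : SL2 R := sl2_of (det1 R 2).

Lemma sl2_mul_subproof M N : \det (sl2_mx M *m sl2_mx N) = 1.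
Proof. by rewrite det_mulmx !sl2_det mulr1. Qed.
Definition sl2_mul M N : SL2 R := sl2_of (sl2_mul_subproof M N).

Lemma sl2_inv_subproof M : \det (invmx (sl2_mx M)) = 1.
Proof. by rewrite det_inv sl2_det invr1. Qed.
Definition sl2_inv M : SL2 R := sl2_of (sl2_inv_subproof M).

Definition pm_rel M N : bool :=
  (sl2_mx M == sl2_mx N) || (sl2_mx M == - sl2_mx N).

Lemma pm_rel_refl : reflexive pm_rel.
Proof. by move=> M; rewrite /pm_rel eqxx. Qed.
Lemma pm_rel_sym : symmetric pm_rel.
Proof. by move=> M N; rewrite /pm_rel eq_sym; congr orb; rewrite [RHS]eq_sym eqr_oppLR. Qed.
Lemma pm_rel_trans : transitive pm_rel.
Proof.
move=> N M P /orP[]/eqP MN /orP[]/eqP NP; rewrite /pm_rel MN NP ?opprK eqxx ?orbT //.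
Qed.

Canonical pm_equiv := EquivRel pm_rel pm_rel_refl pm_rel_sym pm_rel_trans.

Local Open Scope quotient_scope.

Definition PSL2 : Type := {eq_quot pm_equiv}.

HB.instance Definition _ := Quotient.on PSL2.
HB.instance Definition _ := Choice.on PSL2.
HB.instance Definition _ := EqQuotient.on PSL2.

Definition psl2_of (M : SL2 R) : PSL2 := \pi_PSL2 M.

Lemma psl2_ofP M N : psl2_of M = psl2_of N <-> pm_rel M N.
Proof. by split=> [/eqmodP|?]; [|apply/eqmodP]. Qed.

Lemma psl2_ofK (g : PSL2) : psl2_of (repr g) = g. Proof. exact: reprK. Qed.

Lemma psl2_repr M :
  sl2_mx (repr (psl2_of M)) = sl2_mx M \/ sl2_mx (repr (psl2_of M)) = - sl2_mx M.
Proof.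
by have /psl2_ofP/orP := psl2_ofK (psl2_of M); case=> /eqP; [left|right].
Qed.

Definition psl2_mul (g h : PSL2) := psl2_of (sl2_mul (repr g) (repr h)).
Definition psl2_inv (g : PSL2) := psl2_of (sl2_inv (repr g)).

Lemma psl2_of_mul M N : psl2_mul (psl2_of M) (psl2_of N) = psl2_of (sl2_mul M N).
Proof.
apply/psl2_ofP; rewrite /pm_rel !sl2_ofK.
by case: (psl2_repr M) => ->; case: (psl2_repr N) => ->;
   rewrite ?mulNmx ?mulmxN ?opprK eqxx ?orbT.
Qed.

Lemma psl2_of_inv M : psl2_inv (psl2_of M) = psl2_of (sl2_inv M).
Proof.
apply/psl2_ofP; rewrite /pm_rel !sl2_ofK.
case: (psl2_repr M) => ->; first by rewrite eqxx.
have -> : invmx (- sl2_mx M) = - invmx (sl2_mx M).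
  have uN : - sl2_mx M \in unitmx.
    by rewrite -scaleN1r unitmxZ ?unitrN1 ?sl2_unit.
  by apply: (can_inj (mulKmx uN)); rewrite mulmxV// mulNmx mulmxN opprK mulmxV ?sl2_unit.
by rewrite eqxx orbT.
Qed.

Lemma psl2_mulA : associative psl2_mul.
Proof.
move=> f g h; rewrite -(psl2_ofK f) -(psl2_ofK g) -(psl2_ofK h) !psl2_of_mul.
by congr psl2_of; apply: sl2_mx_inj; rewrite !sl2_ofK mulmxA.
Qed.
Lemma psl2_mul1g : left_id (psl2_of sl2_one) psl2_mul.
Proof.
move=> g; rewrite -(psl2_ofK g) psl2_of_mul.
by congr psl2_of; apply: sl2_mx_inj; rewrite !sl2_ofK mul1mx.
Qed.
Lemma psl2_mulg1 : right_id (psl2_of sl2_one) psl2_mul.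
Proof.
move=> g; rewrite -(psl2_ofK g) psl2_of_mul.
by congr psl2_of; apply: sl2_mx_inj; rewrite !sl2_ofK mulmx1.
Qed.
Lemma psl2_mulVg : left_inverse (psl2_of sl2_one) psl2_inv psl2_mul.
Proof.
move=> g; rewrite -(psl2_ofK g) psl2_of_inv psl2_of_mul.
by congr psl2_of; apply: sl2_mx_inj; rewrite !sl2_ofK mulVmx ?sl2_unit.
Qed.
Lemma psl2_mulgV : right_inverse (psl2_of sl2_one) psl2_inv psl2_mul.
Proof.
move=> g; rewrite -(psl2_ofK g) psl2_of_inv psl2_of_mul.
by congr psl2_of; apply: sl2_mx_inj; rewrite !sl2_ofK mulmxV ?sl2_unit.
Qed.

HB.instance Definition _ := isGroup.Build PSL2
  psl2_mulA psl2_mul1g psl2_mulg1 psl2_mulVg psl2_mulgV.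

End PSL2.

(* The bare names [Re], [Im] stand for the [R[i]]-valued parts. *)
Local Notation Re := (@complex.Re _).
Local Notation Im := (@complex.Im _).

Section HyperbolicPlane.
Variable R : realType.
Local Notation C := R[i].
(* The Riemann sphere; [None] is the point at infinity. *)
Local Notation Chat := (one_point_compactification R[i]).
Implicit Types (z w : C) (x y : Chat) (V S P : set C) (g : PSL2 R).

Definition HH : set C := [set z | 0 < Im z].

Definition bdgH : set Chat := [set x | if x is Some z then Im z = 0 else True].

Definition closureH V : set C := closure V `&` HH.
Definition boundaryH V : set C := closureH V `\` interior V.
Definition bdg V : set Chat := closure (Some @` V : set Chat) `&` bdgH.

Definition hdist z w : R :=
  let u := 1 + ((Re z - Re w) ^+ 2 + (Im z - Im w) ^+ 2) / (2 * Im z * Im w) in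
  ln (u + Num.sqrt (u ^+ 2 - 1)). (* arcosh u *)

Definition is_geodesic (c : R -> C) : Prop :=
  (forall t, HH (c t)) /\ (forall s t, hdist (c s) (c t) = `|s - t|).

(* [c] passes through [x] at the possibly infinite time [e]. *)
Definition reaches (c : R -> C) (e : \bar R) x : Prop :=
  match e with
  | r%:E => x = Some (c r)
  | +oo%E => Some (c t) @[t --> +oo] --> x
  | -oo%E => Some (c t) @[t --> -oo] --> x
  end.

(* The geodesic segment with endpoints [x] and [y] in the geodesic closure of
   [HH], as a subset of [HH]: endpoints at the boundary are left out. *)
Definition gseg x y : set C :=
  [set z | exists c a b t, [/\ is_geodesic c, reaches c a x, reaches c b y,
    (a <= t%:E <= b)%E & z = c t]].

Definition is_endpoint P x : Prop := exists2 y, y <> x & P = gseg x y.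

Definition hconvex V : Prop :=
  V `<=` HH /\
  forall z w, V z -> V w -> gseg (Some z) (Some w) `<=` V.

(* The hyperbolic polygon with the given vertices, as a subset of [HH]: the
   convex hull of the segments between the vertices. *)
Definition hpolygon (X : set Chat) : set C :=
  \bigcap_(V in [set V | hconvex V /\
    (forall x y, X x -> X y -> gseg x y `<=` V)]) V.

Definition is_side V S : Prop :=
  [/\ S !=set0, hconvex S, S `<=` boundaryH V &
    forall S', hconvex S' -> S' `<=` boundaryH V -> S `<=` S' -> S' = S].

Definition curve_deriv (c : R -> C) (t : R) : C :=
  derive1 (Re \o c) t +i* derive1 (Im \o c) t.

(* Around each of its points [S] is the image of a smooth immersed curve that
   is a homeomorphism onto its image. *)
Definition is_one_dim_submanifold S : Prop :=
  [/\ S !=set0, S `<=` HH &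
    forall p, S p -> exists (U : set C) (c : R -> C) (k : C -> R) (e : R),
      let J := `]- e, e[%classic in
      [/\ open U /\ U p, 0 < e /\ c 0 = p,
          (forall t : R, J t -> curve_deriv c t != 0 /\
             forall n, derivable (derive1n n (Re \o c)) t 1 /\
                       derivable (derive1n n (Im \o c)) t 1),
          c @` J = S `&` U &
          {within S `&` U, continuous k} /\ {in J, cancel c k}]].

(* One of the two matrices of [g]. The sign of [denom] depends on the choice,
   the action and the norm of [denom] do not. *)
Definition psl2_mx g : 'M[R]_2 := sl2_mx (repr g).

Definition denom g z : C := (psl2_mx g 1 0)%:C * z + (psl2_mx g 1 1)%:C.

Definition mob g z : C :=
  ((psl2_mx g 0 0)%:C * z + (psl2_mx g 0 1)%:C) / denom g z.

Definition mobhat g x : Chat :=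
  match x with
  | Some z => if denom g z == 0 then None else Some (mob g z)
  | None => if psl2_mx g 1 0 == 0 then None
            else Some (psl2_mx g 0 0 / psl2_mx g 1 0)%:C
  end.

Definition SH : set (C * C) :=
  [set v | HH v.1 /\ `|v.2| = (Im v.1)%:C].

Definition dmob g (v : C * C) : C * C :=
  (mob g v.1, v.2 / denom g v.1 ^+ 2).

Definition velocity (c : R -> C) (t : R) : C * C := (c t, curve_deriv c t).

(* [v] is the velocity of a curve that runs inside [S]. *)
Definition tangent_to S (v : C * C) : Prop :=
  exists c : R -> C, [/\ derivable (Re \o c) 0 1, derivable (Im \o c) 0 1,
    velocity c 0 = v & \forall t \near (0 : R), S (c t)].

Definition parabolic g : Prop := g <> 1%g /\ `|\tr (psl2_mx g)| = 2.

(* Measurable types are pointed, hence a witness that geodesics exist. *)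
Definition std_geodesic (t : R) : C := 0 +i* expR t.

Lemma std_geodesicP : is_geodesic std_geodesic.
Proof.
split=> [t|s t]; first by rewrite /HH/= expR_gt0.
rewrite /hdist /= subrr expr0n /= add0r.
set u := (X in X + Num.sqrt _).
have es := expR_gt0 s; have et := expR_gt0 t.
set a := expR `|s - t|.
have a1 : 1 <= a by rewrite /a -expR0 ler_expR normr_ge0.
have a0 : a != 0 by rewrite gt_eqF ?expR_gt0.
have uE : u = (a + a^-1) / 2.
  have st : expR s != 0 by rewrite gt_eqF.
  have tt : expR t != 0 by rewrite gt_eqF.
  rewrite /u /a; case: (leP 0 (s - t)) => ?.
    by rewrite ger0_norm// expRB; field; rewrite st tt.
  by rewrite ltr0_norm// opprB expRB; field; rewrite st tt.
have -> : u ^+ 2 - 1 = ((a - a^-1) / 2) ^+ 2 by rewrite uE; field.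
rewrite sqrtr_sqr ger0_norm; last first.
  by rewrite divr_ge0// subr_ge0 (le_trans _ a1)// invf_le1// (lt_le_trans ltr01).
have -> : u + (a - a^-1) / 2 = a by rewrite uE; field.
by rewrite /a expRK.
Qed.

End HyperbolicPlane.

Section FuchsianGroup.
Variables (R : realType) (Gamma : set (PSL2 R)).
Local Notation C := R[i].
Local Notation Chat := (one_point_compactification R[i]).
Implicit Types (z w : C) (x y v : Chat) (A B F I P : set C) (g : PSL2 R).

Definition is_fuchsian : Prop :=
  [/\ Gamma 1%g, (forall g h, Gamma g -> Gamma h -> Gamma (g * h)%g),
      (forall g, Gamma g -> Gamma g^-1%g) &
      forall g, Gamma g ->
        \forall h \near (g : quotient_topology (PSL2 R)), Gamma h -> h = g].

Definition fundamental_region F : Prop :=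
  [/\ open F, F `<=` @HH R, trivIset Gamma (fun g => mob g @` F) &
      \bigcup_(g in Gamma) (mob g @` closureH F) = @HH R].

Definition closed_fundamental_region F : Prop :=
  closureH F = F /\ fundamental_region (interior F).

Definition geometrically_finite : Prop :=
  exists F, [/\ fundamental_region F, hconvex F & finite_set (is_side F)].

Definition stab_infty : set (PSL2 R) :=
  [set g | Gamma g /\ mobhat g None = None].

Definition cuspidal_infty : Prop := exists2 g, stab_infty g & parabolic g.

Definition isosphere g : set C := [set z | HH z /\ `|denom g z| = 1].
Definition isosphere_ext g : set C := [set z | HH z /\ 1 < `|denom g z|].

Definition is_isosphere I : Prop :=
  exists g, [/\ Gamma g, ~ stab_infty g & I = isosphere g].

Definition is_summit I z : Prop := I z /\ forall w, I w -> Im w <= Im z.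

Definition KK : set C :=
  \bigcap_(g in Gamma `\` stab_infty) isosphere_ext g.

Definition relevant_part I : set C := I `&` boundaryH KK.

Definition relevant I : Prop :=
  is_isosphere I /\
  exists2 S, is_one_dim_submanifold S & S `<=` relevant_part I.

Definition is_vertex v : Prop :=
  exists2 I, relevant I & is_endpoint (relevant_part I) v.

Definition infinite_vertex v : Prop := is_vertex v /\ bdgH v.

Definition two_sided v : Prop :=
  infinite_vertex v /\ exists I1 I2, [/\ relevant I1, relevant I2, I1 <> I2,
    is_endpoint (relevant_part I1) v & is_endpoint (relevant_part I2) v].

Definition one_sided v : Prop := infinite_vertex v /\ ~ two_sided v.

Definition conditionA : Prop :=
  forall I z, relevant I -> is_summit I z ->
    boundaryH KK z /\ ~ is_vertex (Some z).

(* [A] is the non-cuspidal precell attached to the inner vertex [z], with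
   non-vertical sides [b1] and [b2]. *)
Definition noncuspidal_precell z (b1 b2 : set C) A : Prop :=
  HH z /\ exists I1 I2 s1 s2,
    [/\ [/\ relevant I1, relevant I2 & I1 <> I2],
        is_endpoint (relevant_part I1) (Some z),
        is_endpoint (relevant_part I2) (Some z),
        is_summit I1 s1 /\ is_summit I2 s2 &
        [/\ b1 = gseg (Some s1) (Some z), b2 = gseg (Some s2) (Some z) &
            A = hpolygon [set x | [\/ x = Some s1, x = Some z, x = Some s2
                                    | x = None]]]].

(* [A] is a cuspidal precell attached to the infinite vertex [v], with
   non-vertical side [b]. *)
Definition cuspidal_precell v (b : set C) A : Prop :=
  infinite_vertex v /\ exists I s,
    [/\ relevant I, is_endpoint (relevant_part I) v, is_summit I s,
        b = gseg v (Some s) &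
        A = hpolygon [set x | [\/ x = v, x = Some s | x = None]]].

Definition vertical_strip z w : set C :=
  [set u | HH u /\ Num.min (Re z) (Re w) <= Re u <= Num.max (Re z) (Re w)].

Definition strip_precell A : Prop :=
  exists z w, [/\ one_sided (Some z), one_sided (Some w), w <> z,
    vertical_strip z w `<=` KK & A = vertical_strip z w].

Definition is_precell A : Prop :=
  [\/ exists z b1 b2, noncuspidal_precell z b1 b2 A,
      exists v b, cuspidal_precell v b A
    | strip_precell A].

Definition nonvertical_side A (b : set C) : Prop :=
  (exists z b1 b2, noncuspidal_precell z b1 b2 A /\ (b = b1 \/ b = b2)) \/
  (exists v, cuspidal_precell v b A).

Variable AA : set (set C).

Definition basal_family : Prop :=
  AA `<=` is_precell /\ closed_fundamental_region (\bigcup_(A in AA) A).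

Definition assigned_to_side A (b : set C) g : Prop :=
  [/\ nonvertical_side A b, Gamma g, ~ stab_infty g, b `<=` isosphere g &
      exists2 A', AA A' & nonvertical_side A' (mob g @` b)].

Definition assigned A : set (PSL2 R) :=
  [set g | exists b, assigned_to_side A b g].

Definition cuspidal_cell A B : Prop :=
  exists v b g A', [/\ cuspidal_precell v b A, assigned_to_side A b g, AA A',
    nonvertical_side A' (mob g @` b) & B = A `|` mob g^-1%g @` A'].

(* Indices run from 1; the values at 0 are irrelevant. *)
Definition noncuspidal_cell A B : Prop :=
  exists z (k : nat) (h g : nat -> PSL2 R) (Aj : nat -> set C),
    [/\ exists b1 b2, noncuspidal_precell z b1 b2 A,
        assigned A (h 1%N) /\ g 1%N = 1%g,
        (forall j, (1 <= j <= k)%N ->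
          [/\ g j.+1 = (h j * g j)%g, AA (Aj j),
              exists b1 b2, noncuspidal_precell (mob (g j) z) b1 b2 (Aj j) &
              (2 <= j)%N -> [set h j; (h j.-1)^-1%g] = assigned (Aj j)]),
        [/\ (1 <= k)%N, g k.+1 = 1%g &
            forall j, (1 <= j < k)%N -> g j.+1 <> 1%g] &
        B = \bigcup_(j in [set j | (1 <= j <= k)%N]) (mob (g j)^-1%g @` Aj j)].

Definition cell_of A B : Prop :=
  [\/ strip_precell A /\ B = A, cuspidal_cell A B | noncuspidal_cell A B].

Definition cells : set (set C) := [set B | exists2 A, AA A & cell_of A B].

Definition BS : set C :=
  \bigcup_(g in Gamma) \bigcup_(B in cells) \bigcup_(S in is_side B)
    (mob g @` S).

Definition bd : set Chat :=
  \bigcup_(g in Gamma) \bigcup_(B in cells) (mobhat g @` bdg B).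

Definition CS : set (C * C) :=
  [set v | [/\ SH v, BS v.1 & ~ tangent_to BS v]].

(* Points of the quotients by [Gamma] are represented by orbits. *)
Definition piH z : set C := [set mob g z | g in Gamma].
Definition piS (v : C * C) : set (C * C) := [set dmob g v | g in Gamma].
Definition pihat x : set Chat := [set mobhat g x | g in Gamma].

Definition SY : set (set (C * C)) := piS @` @SH R.

Definition CShat : set (set (C * C)) := piS @` CS.

Definition geodesicY : Type :=
  set_type [set c : R -> set C | exists2 gam, is_geodesic gam & c = piH \o gam].

HB.instance Definition _ := Choice.on geodesicY.

Lemma std_geodesicY_subproof :
  [set c : R -> set C | exists2 gam, is_geodesic gam & c = piH \o gam]
    (piH \o @std_geodesic R).
Proof. by exists (@std_geodesic R) => //; exact: std_geodesicP. Qed.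

HB.instance Definition _ :=
  isPointed.Build geodesicY (SigSub (mem_set std_geodesicY_subproof)).

Implicit Types c : geodesicY.

Lemma liftY_subproof c : exists gam, is_geodesic gam /\ set_val c = piH \o gam.
Proof. by have [gam ? ?] := set_valP c; exists gam. Qed.

(* A geodesic on H above [c]; for a discrete [Gamma] it is unique up to the
   action of [Gamma], since [Gamma] is countable. *)
Definition liftY c : R -> C := sval (cid (liftY_subproof c)).

Definition velocityY c (t : R) : set (C * C) := piS (velocity (liftY c) t).

Definition NIC : set geodesicY :=
  [set c | exists2 e : \bar R, e = +oo%E \/ e = -oo%E &
    exists2 x, reaches (liftY c) e x & (pihat @` bd) (pihat x)].

Definition intersects_infinitely_often (X : set (set (C * C))) c : Prop :=
  (exists2 u : R^nat, u n @[n --> \oo] --> +oo & forall n, X (velocityY c (u n)))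
  /\
  (exists2 u : R^nat, u n @[n --> \oo] --> -oo & forall n, X (velocityY c (u n))).

(* The sigma-algebra on the space of geodesics is arbitrary: any sigma-algebra
   [G] is the one generated by [G]. *)
Definition is_cross_section (G : set (set geodesicY))
    (mu : {measure set (g_sigma_algebraType G) -> \bar R})
    (X : set (set (C * C))) : Prop :=
  [/\ X `<=` SY,
      {ae mu, forall c, intersects_infinitely_often X c} &
      forall c t, X (velocityY c t) -> exists2 e : R, 0 < e &
        (velocityY c @` `]t - e, t + e[) `&` X = [set velocityY c t]].

End FuchsianGroup.

(* Main.v *)
(* The sides of the cells are the translates ("leaves") of the vertical lines over the centers of
   the relevant isometric spheres and over the infinite vertices. These leaves are pairwise
   disjoint and locally finite, so a geodesic that is not a leaf crosses them transversally, at
   isolated times; this gives (C2). Between two crossings a geodesic stays in one cell. If it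
   stops crossing in one time direction, it ends at a boundary point of a translate of a cell,
   that is, in [bd]; conversely a geodesic ending in [bd] eventually stays in a cell or is a
   leaf, because crossings close to such an end would contradict local finiteness. Hence the
   geodesics that fail to meet the cross section infinitely often in both directions are exactly
   those in [NIC].

   Local finiteness is where geometric finiteness enters: the centers of the relevant spheres
   have no limit point [v]. If [e] is a center at small distance [d] from [v], the part of the
   strip between [e] and [v] above height [d] lies in [KK]. A point there is moved by [Gamma] to a
   low point of a convex polygon [F] with finitely many sides. This point is not inside a
   half-plane contained in [F], since a translate of that half-plane would contain a
   neighbourhood of the cusp; hence it lies in one of finitely many cusp-like ends of [F], in
   which distinct heights [k] give hyperbolically small blocks of Euclidean diameter [O(d / k)].
   As [k] is bounded below by a large constant, the total area of these blocks is too small to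
   cover a square of side [d / 3]. *)
Require Import Defs.

From mathcomp Require Import all_boot all_order all_algebra.
From mathcomp Require Import all_classical all_reals all_analysis.
From mathcomp.real_closed Require Import complex.
From mathcomp Require Import ring lra zify.

Set Implicit Arguments.
Unset Strict Implicit.
Unset Printing Implicit Defensive.

Import Order.TTheory GRing.Theory Num.Theory.
Import numFieldNormedType.Exports.

Local Open Scope classical_set_scope.
Local Open Scope ring_scope.
Local Open Scope complex_scope.

Local Notation Re := (@complex.Re _).
Local Notation Im := (@complex.Im _).

(** * Moebius transformations *)

Section Mobius.
Variable R : realType.
Local Notation C := R[i].
Implicit Types (g h : PSL2 R) (z w : C).

(** Convexity is handled in the coordinates [(Re, nsq)], where geodesics are chords and half-planes
    are linear inequalities. Condition (A) puts the center of a relevant sphere strictly between the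
    ends of its relevant arc. As [g] maps the vertical line over the center of I(g) to the one over
    the center of I(g^-1), every leaf, once moved into the closed Ford domain, is vertical there
    ([leaf_KKb]); disjointness and local finiteness of the leaves thus reduce to the isolation of
    the set [EE] of real numbers. The obstacle is that geometric finiteness provides some convex
    polygon with finitely many sides, which need not be the Ford domain and whose translates are not
    given to be locally finite; hence the detour through an area estimate. The covering by the Ford
    domain and the isolation of [EE] are carried as the hypotheses [hcov] and [hE] and established
    afterwards. For a non-cuspidal cell the delicate point is that the translated precells close up
    around the inner vertex, a combinatorial argument on the cycle ([cycle_closed]). *)

Definition pa g : R := psl2_mx g 0 0.
Definition pb g : R := psl2_mx g 0 1.
Definition pc g : R := psl2_mx g 1 0.
Definition pd g : R := psl2_mx g 1 1.

Lemma det22 (A : 'M[R]_2) : \det A = A 0 0 * A 1 1 - A 0 1 * A 1 0.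
Proof.
rewrite (expand_det_row _ 0) !big_ord_recl big_ord0 addr0 /cofactor !det_mx11 !mxE /=.
rewrite expr0 expr1 mul1r mulN1r mulrN.
by do ?[congr (_ * _ - _ * _) | congr (A _ _) | apply/val_inj].
Qed.

Lemma pdet g : pa g * pd g - pb g * pc g = 1.
Proof. by rewrite -(sl2_det (repr g)) det22. Qed.

Lemma mul22 (A B : 'M[R]_2) i j : (A *m B) i j = A i 0 * B 0 j + A i 1 * B 1 j.
Proof. by rewrite mxE !big_ord_recl big_ord0 addr0; congr (_ + A _ _ * B _ _); apply/val_inj. Qed.

Lemma opp22 (A : 'M[R]_2) i j : (- A) i j = - A i j.
Proof. by rewrite mxE. Qed.

(** The entries are those of chosen representatives, so products of group elements give products of
    matrices only up to a common sign [s]. *)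
Lemma psl2_mul_entries g h : exists2 s : R, s ^+ 2 = 1 &
  [/\ pa (g * h)%g = s * (pa g * pa h + pb g * pc h),
      pb (g * h)%g = s * (pa g * pb h + pb g * pd h),
      pc (g * h)%g = s * (pc g * pa h + pd g * pc h) &
      pd (g * h)%g = s * (pc g * pb h + pd g * pd h)].
Proof.
have [E|E] : psl2_mx (g * h)%g = psl2_mx g *m psl2_mx h \/
             psl2_mx (g * h)%g = - (psl2_mx g *m psl2_mx h) by exact: psl2_repr.
  by exists 1; rewrite ?expr1n // /pa /pb /pc /pd E !mul22 !mul1r.
exists (-1); first by rewrite sqrrN expr1n.
by rewrite /pa /pb /pc /pd E !opp22 !mul22 !mulN1r.
Qed.

Lemma psl2_one_entries : exists2 s : R, s ^+ 2 = 1 &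
  [/\ pa 1%g = s, pb 1%g = 0, pc 1%g = 0 & pd 1%g = s].
Proof.
have [E|E] : psl2_mx (1%g : PSL2 R) = 1%:M \/ psl2_mx (1%g : PSL2 R) = - 1%:M by exact: psl2_repr.
  by exists 1; rewrite ?expr1n // /pa /pb /pc /pd E !mxE.
by exists (-1); rewrite ?sqrrN ?expr1n // /pa /pb /pc /pd E !mxE /= oppr0.
Qed.

Definition mk_mx (a b c d : R) : 'M[R]_2 :=
  \matrix_(i, j) if i == 0 then (if j == 0 then a else b) else (if j == 0 then c else d).

Lemma psl2_mk (a b c d : R) : a * d - b * c = 1 ->
  exists g, exists2 s : R, s ^+ 2 = 1 & [/\ pa g = s * a, pb g = s * b, pc g = s * c & pd g = s * d].
Proof.
move=> D; have dA : \det (mk_mx a b c d) = 1 by rewrite det22 !mxE.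
exists (psl2_of (sl2_of dA)).
have [E|E] : psl2_mx (psl2_of (sl2_of dA)) = mk_mx a b c d \/
             psl2_mx (psl2_of (sl2_of dA)) = - mk_mx a b c d by exact: psl2_repr.
  by exists 1; rewrite ?expr1n // /pa /pb /pc /pd E !mxE /= !mul1r.
by exists (-1); rewrite ?sqrrN ?expr1n // /pa /pb /pc /pd E !mxE /= !mulN1r.
Qed.

Lemma psl2_ext g h (s : R) : s ^+ 2 = 1 ->
  pa g = s * pa h -> pb g = s * pb h -> pc g = s * pc h -> pd g = s * pd h -> g = h.
Proof.
move=> s2 Ha Hb Hc Hd; rewrite -(psl2_ofK g) -(psl2_ofK h); apply/psl2_ofP.
have ext2 (A B : 'M[R]_2) : A 0 0 = B 0 0 -> A 0 1 = B 0 1 -> A 1 0 = B 1 0 -> A 1 1 = B 1 1 -> A = B.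
  move=> *; apply/matrixP => i j.
  have I2 (k : 'I_2) : k = 0 \/ k = 1 by case: k => [[|[|//]] Hk]; [left|right]; apply/val_inj.
  by case: (I2 i) => ->; case: (I2 j) => ->.
have /orP[/eqP s1|/eqP s1] : (s == 1) || (s == -1) by rewrite -eqf_sqr s2 expr1n.
  by apply/orP; left; apply/eqP/ext2; rewrite -/(psl2_mx _) -/(psl2_mx _);
    rewrite ?[LHS]Ha ?[LHS]Hb ?[LHS]Hc ?[LHS]Hd s1 mul1r.
apply/orP; right; apply/eqP/ext2; rewrite -/(psl2_mx _) -/(psl2_mx _) mxE;
    rewrite ?[LHS]Ha ?[LHS]Hb ?[LHS]Hc ?[LHS]Hd s1 mulN1r //.
Qed.

(* The square of [|c z + d|]: the isometric sphere of [g] is [nd g z = 1]. *)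
Definition nd g z : R := (pc g * Re z + pd g) ^+ 2 + (pc g * Im z) ^+ 2.

Lemma nd_gt0 g z : HH z -> 0 < nd g z.
Proof.
case: z => x y; rewrite /HH /nd /= => y0.
have D := pdet g.
have [c0|c0] := eqVneq (pc g) 0.
  have : pd g != 0 by apply/eqP => d0; move: D; rewrite c0 d0 => /eqP; rewrite !mulr0 subrr eq_sym oner_eq0.
  by rewrite c0 => d0; rewrite !mul0r add0r expr0n addr0 exprn_even_gt0.
by apply: ltr_wpDl; rewrite ?sqr_ge0 // exprn_even_gt0 //= mulf_neq0 // gt_eqF.
Qed.

Lemma denomE g z : denom g z = (pc g * Re z + pd g) +i* (pc g * Im z).
Proof. by case: z => x y; rewrite /denom /pc /pd; simpc. Qed.

Lemma norm_denom g z : `|denom g z| = (Num.sqrt (nd g z))%:C.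
Proof. by rewrite denomE normc_def. Qed.

Lemma denom_neq0 g z : HH z -> denom g z != 0.
Proof.
by move=> /(nd_gt0 g) n0; rewrite -normr_eq0 norm_denom eq_complex /= eqxx andbT sqrtr_eq0 -ltNge.
Qed.

(** Multiply numerator and denominator by the conjugate of [c z + d]. The assumption is
    [nd g z != 0] rather than [HH z], so that the formula also serves boundary points. *)
Lemma mobE g z : nd g z != 0 -> mob g z =
  (((pa g * Re z + pb g) * (pc g * Re z + pd g) + pa g * pc g * Im z ^+ 2) / nd g z)
  +i* (Im z / nd g z).
Proof.
move=> n0; rewrite /mob.
have d0 : denom g z != 0.
  rewrite -normr_eq0 norm_denom eq_complex /= eqxx andbT sqrtr_eq0 -ltNge lt_def n0 /=.
  by rewrite /nd addr_ge0 // sqr_ge0.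
apply: (mulIf d0); rewrite divfK //; rewrite denomE; move: n0; rewrite /nd.
case: z d0 => x y _ /=; rewrite -/(pa g) -/(pb g); have := pdet g.
set a := pa g; set b := pb g; set c := pc g; set d := pd g => D n0; simpc.
apply/eqP; rewrite eq_complex /=; apply/andP; split; apply/eqP.
  rewrite -/a -/b -/c -/d; apply/eqP; rewrite -subr_eq0; apply/eqP.
  transitivity (c * y ^+ 2 * (1 - (a * d - b * c)) / ((c * x + d) ^+ 2 + (c * y) ^+ 2)); first by field.
  by rewrite D subrr mulr0 mul0r.
apply/eqP; rewrite -subr_eq0; apply/eqP.
transitivity (y * (c * x + d) * ((a * d - b * c) - 1) / ((c * x + d) ^+ 2 + (c * y) ^+ 2)); first by field.
by rewrite D subrr mulr0 mul0r.
Qed.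
End Mobius.

Section MobiusAction.
Variable R : realType.
Local Notation C := R[i].
Implicit Types (g h : PSL2 R) (z w : C).

Lemma Re_mob g z : HH z -> Re (mob g z) =
  ((pa g * Re z + pb g) * (pc g * Re z + pd g) + pa g * pc g * Im z ^+ 2) / nd g z.
Proof. by move=> /(nd_gt0 g) n0; rewrite mobE ?gt_eqF. Qed.

Lemma Im_mob g z : HH z -> Im (mob g z) = Im z / nd g z.
Proof. by move=> /(nd_gt0 g) n0; rewrite mobE ?gt_eqF. Qed.

Lemma HH_mob g z : HH z -> HH (mob g z).
Proof. by move=> Hz; rewrite /HH /= Im_mob // divr_gt0 // nd_gt0. Qed.

Lemma complex_ext (u v : C) : Re u = Re v -> Im u = Im v -> u = v.
Proof. by case: u v => a b [c d] /= -> ->. Qed.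

Lemma sqr1_neq0 (s : R) : s ^+ 2 = 1 -> s != 0.
Proof. by move=> s2; apply/eqP => s0; move: s2; rewrite s0 expr0n => /esym/eqP; rewrite oner_eq0. Qed.

(** The squared form of the cocycle relation of the automorphy factor [c z + d]. *)
Lemma nd_mul g h z : HH z -> nd (g * h)%g z = nd g (mob h z) * nd h z.
Proof.
move=> Hz; have n0 := lt0r_neq0 (nd_gt0 h Hz).
have [s s2 [_ _ Ec Ed]] := psl2_mul_entries g h.
rewrite {1 2}/nd Re_mob // Im_mob // Ec Ed.
have -> : (s * (pc g * pa h + pd g * pc h) * Re z + s * (pc g * pb h + pd g * pd h)) ^+ 2 +
  (s * (pc g * pa h + pd g * pc h) * Im z) ^+ 2 = s ^+ 2 * (
   ((pc g * pa h + pd g * pc h) * Re z + (pc g * pb h + pd g * pd h)) ^+ 2 +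
  ((pc g * pa h + pd g * pc h) * Im z) ^+ 2) by ring.
rewrite s2 mul1r; move: n0; rewrite /nd; have := pdet h.
move: (pa h) (pb h) (pc h) (pd h) (pc g) (pd g) Hz; case: z => x y /= a b c d e f Hz D.
set n := (X in X != 0) => n0.
have E : n = (c * x + d) ^+ 2 + (c * y) ^+ 2 by [].
have -> : (e * (((a * x + b) * (c * x + d) + a * c * y ^+ 2) / n) + f) ^+ 2 + (e * (y / n)) ^+ 2
  = (((e * ((a * x + b) * (c * x + d) + a * c * y ^+ 2) + f * n) ^+ 2 + (e * y) ^+ 2) / n) / n by field.
rewrite divfK //; apply: (mulIf n0); rewrite divfK //.
have -> : (e * y) ^+ 2 = (e * y) ^+ 2 * (a * d - b * c) ^+ 2 by rewrite D expr1n mulr1.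
by rewrite E; ring.
Qed.

Lemma mob_mul g h z : HH z -> mob (g * h)%g z = mob g (mob h z).
Proof.
move=> Hz; have d0 := denom_neq0 h Hz; have d1 := denom_neq0 g (HH_mob h Hz).
have [s s2 [Ea Eb Ec Ed]] := psl2_mul_entries g h.
have d2 := denom_neq0 (g * h)%g Hz.
have s0 : (s%:C : C) != 0 by rewrite eq_complex /= eqxx andbT sqr1_neq0.
move: d0 d1 d2; rewrite /mob /denom -!/(pa _) -!/(pb _) -!/(pc _) -!/(pd _) Ea Eb Ec Ed !rmorphM !rmorphD !rmorphM /=.
move: ((pa g)%:C) ((pb g)%:C) ((pc g)%:C) ((pd g)%:C) ((pa h)%:C) ((pb h)%:C) ((pc h)%:C) ((pd h)%:C) s0 => a b c d e f i j.
move: (s%:C) => t t0 d0 d1 d2.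
have d3 : c * (e * z + f) + d * (i * z + j) != 0.
  have -> : c * (e * z + f) + d * (i * z + j) = (c * ((e * z + f) / (i * z + j)) + d) * (i * z + j) by field.
  by rewrite mulf_neq0.
field; rewrite d0 d3 /=.
by move: d2; congr (_ != 0); ring.
Qed.

Lemma mob1 z : mob 1%g z = z.
Proof.
have [s s2 [Ea Eb Ec Ed]] := psl2_one_entries R.
rewrite /mob /denom -!/(pa _) -!/(pb _) -!/(pc _) -!/(pd _) Ea Eb Ec Ed mul0r add0r addr0.
by rewrite mulrAC divff ?mul1r // eq_complex /= eqxx andbT sqr1_neq0.
Qed.

Lemma mobK g z : HH z -> mob g^-1%g (mob g z) = z.
Proof. by move=> Hz; rewrite -mob_mul // mulVg mob1. Qed.

Lemma mobVK g z : HH z -> mob g (mob g^-1%g z) = z.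
Proof. by move=> Hz; rewrite -mob_mul // mulgV mob1. Qed.

Lemma nd1 z : nd 1%g z = 1.
Proof.
have [s s2 [Ea Eb Ec Ed]] := psl2_one_entries R.
by rewrite /nd Ec Ed !mul0r add0r expr0n addr0.
Qed.

Lemma nd_inv g z : HH z -> nd g^-1%g (mob g z) = (nd g z)^-1.
Proof.
move=> Hz; have n0 := lt0r_neq0 (nd_gt0 g Hz).
by apply: (mulIf n0); rewrite -nd_mul // mulVg nd1 mulVf.
Qed.

Definition ds z w : R := (Re z - Re w) ^+ 2 + (Im z - Im w) ^+ 2.

(** The squared modulus of the identity [g z - g w = (z - w) / ((c z + d) (c w + d))]. *)
Lemma ds_mob0 g z w : nd g z != 0 -> nd g w != 0 ->
  ds (mob g z) (mob g w) = ds z w / (nd g z * nd g w).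
Proof.
move=> nz nw; rewrite /ds !mobE //=.
move: nz nw; have := pdet g.
rewrite /nd; case: z w => x y [u v] /=.
move: (pa g) (pb g) (pc g) (pd g) => a b c d D.
set n := (X in X != 0) => n0; set m := (X in X != 0) => m0.
have -> : (x - u) ^+ 2 + (y - v) ^+ 2 = ((x - u) ^+ 2 + (y - v) ^+ 2) * (a * d - b * c) ^+ 2.
  by rewrite D expr1n mulr1.
apply: (mulIf (mulf_neq0 n0 m0)); rewrite divfK ?mulf_neq0 //.
have -> : y / n - v / m = ((y * m - v * n) * (a * d - b * c)) / (n * m) by rewrite D; field; rewrite m0.
have -> : ((a * x + b) * (c * x + d) + a * c * y ^+ 2) / n - ((a * u + b) * (c * u + d) + a * c * v ^+ 2) / m
   = (((a * x + b) * (c * x + d) + a * c * y ^+ 2) * m - ((a * u + b) * (c * u + d) + a * c * v ^+ 2) * n) / (n * m).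
  by field; rewrite m0.
rewrite !expr_div_n -mulrDl; apply: (mulIf (mulf_neq0 n0 m0)); rewrite mulrAC -mulrA -expr2 divfK ?expf_neq0 ?mulf_neq0 //.
by rewrite /n /m; ring.
Qed.

Lemma ds_mob g z w : HH z -> HH w -> ds (mob g z) (mob g w) = ds z w / (nd g z * nd g w).
Proof. by move=> Hz Hw; rewrite ds_mob0 // lt0r_neq0 // nd_gt0. Qed.

Lemma hdist_mob g z w : HH z -> HH w -> hdist (mob g z) (mob g w) = hdist z w.
Proof.
move=> Hz Hw; have nz := lt0r_neq0 (nd_gt0 g Hz); have nw := lt0r_neq0 (nd_gt0 g Hw).
have Iz : Im z != 0 by rewrite gt_eqF.
have Iw : Im w != 0 by rewrite gt_eqF.
rewrite /hdist -!/(ds _ _).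
suff -> : ds (mob g z) (mob g w) / (2 * Im (mob g z) * Im (mob g w)) = ds z w / (2 * Im z * Im w) by [].
rewrite ds_mob // !Im_mob //.
by move: (ds z w) => e; field; rewrite nz nw Iz Iw.
Qed.

(** Inverts the arcosh in [hdist]: its argument [u] satisfies [(e - u) ^+ 2 = u ^+ 2 - 1] for
    [e = expR |t|], hence is cosh of [t]. *)
Lemma hdist_ds z w (t : R) : HH z -> HH w -> hdist z w = `|t| ->
  ds z w = Im z * Im w * (expR t + expR (- t) - 2).
Proof.
move=> Hz Hw; rewrite /hdist -/(ds z w).
have Iz : 0 < Im z by []. have Iw : 0 < Im w by [].
have ds0 : 0 <= ds z w by rewrite addr_ge0 ?sqr_ge0.
set u := 1 + _; have u1 : 1 <= u by rewrite /u lerDl divr_ge0 // !mulr_ge0 // ltW.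
have u2 : 0 <= u ^+ 2 - 1 by rewrite subr_ge0 -(expr1n _ 2) lerXn2r ?nnegrE ?ler01 ?(le_trans ler01).
move=> /(congr1 expR); rewrite lnK; last first.
  by rewrite posrE ltr_pwDl ?sqrtr_ge0 // (lt_le_trans ltr01).
set e := expR `|t| => E.
have e0 : e != 0 by rewrite gt_eqF ?expR_gt0.
have : (e - u) ^+ 2 = u ^+ 2 - 1 by rewrite -E addrAC subrr add0r sqr_sqrtr.
move=> Q; have : u = (e + e^-1) / 2.
  apply: (mulIf e0); apply: (mulIf (_ : 2 != 0 :> R)) => //.
  have -> : (e + e^-1) / 2 * e * 2 = e ^+ 2 + 1 by field.
  have -> : u * e * 2 = e ^+ 2 + u ^+ 2 - (e - u) ^+ 2 by ring.
  by rewrite Q; ring.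
have -> : e + e^-1 = expR t + expR (- t).
  rewrite /e; case: (leP 0 t) => t0; first by rewrite ger0_norm // expRN.
  by rewrite ltr0_norm // -expRN opprK addrC.
rewrite /u => H; have n0 : 2 * Im z * Im w != 0 by rewrite !mulf_neq0 // gt_eqF.
have -> : ds z w = ds z w / (2 * Im z * Im w) * (2 * Im z * Im w) by rewrite divfK.
rewrite -[X in X * _](addrK 1) [X in X - 1]addrC H; field => //.

Qed.

(* Geodesic lines are the zero sets of the forms [Phi q], on which Moebius
   transformations act linearly by [fmob]. *)
Definition cform := (R * R * R)%type.

Definition Phi (q : cform) z : R := q.1.1 * (Re z ^+ 2 + Im z ^+ 2) + q.1.2 * Re z + q.2.

Definition fmob (q : cform) g : cform :=
  (q.1.1 * pa g ^+ 2 + q.1.2 * (pa g * pc g) + q.2 * pc g ^+ 2,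
   2 * q.1.1 * pa g * pb g + q.1.2 * (pa g * pd g + pb g * pc g) + 2 * q.2 * pc g * pd g,
   q.1.1 * pb g ^+ 2 + q.1.2 * (pb g * pd g) + q.2 * pd g ^+ 2).

Lemma Phi_mob q g z : HH z -> Phi q (mob g z) * nd g z = Phi (fmob q g) z.
Proof.
move=> Hz; have n0 := lt0r_neq0 (nd_gt0 g Hz).
rewrite /Phi Re_mob // Im_mob //; case: q => [[al be] ga] /=.
move: n0; rewrite /nd; case: z {Hz} => x y /=; have := pdet g.
move: (pa g) (pb g) (pc g) (pd g) => a b c d D; set n := (X in X != 0) => n0.
have -> : (y / n) ^+ 2 = (y * (a * d - b * c)) ^+ 2 / n ^+ 2 by rewrite D; field.
have -> : (((a * x + b) * (c * x + d) + a * c * y ^+ 2) / n) ^+ 2 + (y * (a * d - b * c)) ^+ 2 / n ^+ 2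
  = ((a * x + b) ^+ 2 + (a * y) ^+ 2) / n.
  apply: (mulIf (expf_neq0 2 n0)).
  have -> : ((a * x + b) ^+ 2 + (a * y) ^+ 2) / n * n ^+ 2 = ((a * x + b) ^+ 2 + (a * y) ^+ 2) * n by field.
  rewrite mulrDl expr_div_n !divfK ?expf_neq0 // /n; ring.
have -> : (al * (((a * x + b) ^+ 2 + (a * y) ^+ 2) / n) +
   be * (((a * x + b) * (c * x + d) + a * c * y ^+ 2) / n) + ga) * n =
   al * ((a * x + b) ^+ 2 + (a * y) ^+ 2) + be * ((a * x + b) * (c * x + d) + a * c * y ^+ 2) + ga * n by field.
by rewrite /n; ring.
Qed.

End MobiusAction.

#[global] Opaque mob denom.

(** * The plane and its one-point compactification *)

Section Topology.
Variable R : realType.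
Local Notation C := R[i].

Lemma nbhs_box (z : C) (V : set C) : nbhs z V <->
  exists2 e : R, 0 < e & forall w, `|Re w - Re z| < e -> `|Im w - Im z| < e -> V w.
Proof.
split.
  move=> /nbhs_ballP[e /= e0 eV].
  (* The radius of a ball is an element of [C]; being positive, it is real. *)
  have eR : e = (Re e)%:C by case: e e0 {eV} => a b; rewrite ltcE /= => /andP[/eqP -> _].
  have Re0 : 0 < Re e by move: e0; rewrite ltcE /= => /andP[_].
  exists (Re e / 2) => [|w Hr Hi]; first by rewrite divr_gt0.
  apply: eV; rewrite -ball_normE /= distrC eR normc_def ltcR.
  rewrite -(ger0_norm (ltW Re0)) -sqrtr_sqr ltr_sqrt ?exprn_gt0 //.
  have r1 : (Re w - Re z) ^+ 2 < (Re e / 2) ^+ 2.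
    by rewrite -real_normK ?num_real // ltrXn2r ?nnegrE ?divr_ge0 // ltW.
  have r2 : (Im w - Im z) ^+ 2 < (Re e / 2) ^+ 2.
    by rewrite -real_normK ?num_real // ltrXn2r ?nnegrE ?divr_ge0 // ltW.
  have -> : (Re (w - z) ^+ 2 + Im (w - z) ^+ 2 = (Re w - Re z) ^+ 2 + (Im w - Im z) ^+ 2)%R.
    by case: (w) (z) => a b [c d].
  by nra.
move=> [e e0 eV]; apply/nbhs_ballP; exists e%:C; first by rewrite /= ltcR.
move=> w; rewrite -ball_normE /= distrC normc_def ltcR => H.
have H2 : Re (w - z) ^+ 2 + Im (w - z) ^+ 2 < e ^+ 2.
  by rewrite -ltr_sqrt ?exprn_gt0 // sqrtr_sqr ger0_norm // ltW.
have E1 : Re (w - z) = Re w - Re z by case: (w) (z) => a b [].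
have E2 : Im (w - z) = Im w - Im z by case: (w) (z) => a b [].
apply: eV; rewrite -ltr_sqr ?nnegrE ?normr_ge0 // ?(ltW e0) // real_normK ?num_real //.
  by rewrite -E1 (le_lt_trans _ H2) // lerDl sqr_ge0.
by rewrite -E2 (le_lt_trans _ H2) // lerDr sqr_ge0.
Qed.

Lemma nbhs_ds (z : C) (V : set C) : nbhs z V <->
  exists2 e : R, 0 < e & forall w, ds w z < e -> V w.
Proof.
split=> [/nbhs_box|] [e e0 eV].
  exists (e ^+ 2) => [|w]; first by rewrite exprn_gt0.
  rewrite /ds => H; apply: eV; rewrite -ltr_sqr ?nnegrE ?normr_ge0 // ?(ltW e0) // real_normK ?num_real //.
    by rewrite (le_lt_trans _ H) // lerDl sqr_ge0.
  by rewrite (le_lt_trans _ H) // lerDr sqr_ge0.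
apply/nbhs_box; exists (Num.min 1 (e / 2)) => [|w]; first by rewrite lt_min ltr01 divr_gt0.
rewrite !lt_min => /andP[r1 r2] /andP[i1 i2]; apply: eV; rewrite /ds.
have sq (t : R) : `|t| < 1 -> `|t| < e / 2 -> t ^+ 2 < e / 2.
  move=> t1 t2; rewrite -real_normK ?num_real // expr2 (le_lt_trans _ t2) //.
  by rewrite ler_piMl // ltW.
by rewrite [e]splitr ltrD // sq.
Qed.

Definition nsq (w : C) : R := Re w ^+ 2 + Im w ^+ 2.

Lemma nsq_continuous : continuous nsq.
Proof.
have cR : continuous (@complex.Re R : C -> R).
  move=> z V /nbhs_ballP[e /= e0 eV]; apply/nbhs_box; exists e => // w H _; apply: eV.
  by rewrite -ball_normE /= distrC.
have cI : continuous (@complex.Im R : C -> R).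
  move=> z V /nbhs_ballP[e /= e0 eV]; apply/nbhs_box; exists e => // w _ H; apply: eV.
  by rewrite -ball_normE /= distrC.
have -> : nsq = (fun w : C => Re w * Re w + Im w * Im w) by apply/funext => w; rewrite /nsq !expr2.
by move=> z; exact: (cvgD (cvgM (cR z) (cR z)) (cvgM (cI z) (cI z))).
Qed.

Lemma box_compact (M : R) : compact [set w : C | - M <= Re w <= M /\ - M <= Im w <= M].
Proof.
pose f (p : R * R) : C := p.1 +i* p.2.
have cf : continuous f.
  move=> [x y] V /nbhs_box[e e0 eV].
  exists (ball x e, ball y e); first by split; exact: nbhsx_ballx.
  by move=> [u v] [/=]; rewrite -!ball_normE /= => H1 H2; apply: eV => /=; rewrite distrC.
have -> : [set w : C | - M <= Re w <= M /\ - M <= Im w <= M] = f @` (`[- M, M] `*` `[- M, M]).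
  rewrite eqEsubset; split=> [[x y] /= [h1 h2]|_ [[x y] /= [h1 h2] <-]].
    by exists (x, y) => //=; rewrite !in_itv.
  by move: h1 h2; rewrite /= !in_itv.
apply: continuous_compact; last by apply: compact_setX; exact: segment_compact.
exact: continuous_subspaceT.
Qed.

Local Notation Chat := (one_point_compactification R[i]).

(** Neighbourhoods of infinity contain complements of compact sets: [nsq] is bounded on a compact
    set, and conversely a point outside a compact box has large [nsq]. *)
Lemma nbhs_None (V : set Chat) : nbhs (None : Chat) V <->
  V None /\ exists M : R, forall w, M < nsq w -> V (Some w).
Proof.
split.
  move=> [K [cK _]] KV; split; first by apply: KV; right.
  have cI : compact (nsq @` K).
    by apply: continuous_compact => //; apply: continuous_subspaceT; exact: nsq_continuous.
  have [M [_ HM]] := compact_bounded cI.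
  exists (M + 1) => w Mw; apply: KV; left; exists w => // Kw.
  have /(_ (M + 1)) := HM; rewrite ltrDl ltr01 => /(_ isT (nsq w) (ex_intro2 _ _ _ Kw erefl)).
  by move=> H; have := lt_le_trans Mw (le_trans (ler_norm _) H); rewrite ltxx.
move=> [VN [M HM]]; exists [set w : C | - (`|M| + 1) <= Re w <= `|M| + 1 /\ - (`|M| + 1) <= Im w <= `|M| + 1].
  split; first exact: box_compact.
  move=> z; apply: contraPP => nz; move=> H.
  have : nbhs z [set w | ~ (- (`|M| + 1) <= Re w <= `|M| + 1 /\ - (`|M| + 1) <= Im w <= `|M| + 1)].
    move/not_andP : nz => [nz|nz]; apply/nbhs_box.
      exists (`|Re z| - (`|M| + 1)); first by rewrite subr_gt0 ltNge ler_norml; apply/negP.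
      move=> w H1 _ [+ _]; rewrite -ler_norml => H2.
      move: nz; rewrite -ler_norml => /negP; rewrite -ltNge => nz.
      have := lerB_dist (Re z) (Re w); rewrite distrC; lra.
    exists (`|Im z| - (`|M| + 1)); first by rewrite subr_gt0 ltNge ler_norml; apply/negP.
    move=> w _ H1 [_ +]; rewrite -ler_norml => H2.
    move: nz; rewrite -ler_norml => /negP; rewrite -ltNge => nz.
    have := lerB_dist (Im z) (Im w); rewrite distrC; lra.
  by move=> /H [w []].
move=> [w|] //= [[u nu [<-]]|//]; apply: HM.
move/not_andP : nu => [nu|nu]; move: nu; rewrite -ler_norml => /negP; rewrite -ltNge => nu; rewrite /nsq.
  have : (`|M| + 1) ^+ 2 < Re u ^+ 2 by rewrite -[ltRHS]real_normK ?num_real // ltr_pXn2r ?nnegrE // addr_ge0.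
  by have := ler_norm M; have := normr_ge0 M; have := sqr_ge0 (Im u); nra.
have : (`|M| + 1) ^+ 2 < Im u ^+ 2 by rewrite -[ltRHS]real_normK ?num_real // ltr_pXn2r ?nnegrE // addr_ge0.
by have := ler_norm M; have := normr_ge0 M; have := sqr_ge0 (Re u); nra.
Qed.

Lemma ds_ge0 (z w : C) : 0 <= ds z w.
Proof. by rewrite addr_ge0 ?sqr_ge0. Qed.

Lemma ds_eq0 (z w : C) : ds z w = 0 -> z = w.
Proof.
move/eqP; rewrite paddr_eq0 ?sqr_ge0 // !sqrf_eq0 !subr_eq0 => /andP[/eqP h1 /eqP h2].
exact: complex_ext.
Qed.

Lemma ds_triangle (a b c : C) : ds a c <= 2 * (ds a b + ds b c).
Proof.
rewrite /ds; case: a b c => a1 a2 [b1 b2] [c1 c2] /=.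
have := sqr_ge0 (a1 - b1 - (b1 - c1)); have := sqr_ge0 (a2 - b2 - (b2 - c2)); nra.
Qed.

(** The Riemann sphere is Hausdorff. This gives uniqueness of limits, and it lets identities for
    [mobhat] at boundary points be deduced from those inside [HH]. *)
Lemma nbhs_opc_sep (x y : Chat) : x <> y ->
  exists U V : set Chat, [/\ nbhs x U, nbhs y V & forall w, U w -> ~ V w].
Proof.
have far (z : C) : exists U V : set Chat, [/\ nbhs (Some z : Chat) U, nbhs (None : Chat) V & forall w, U w -> ~ V w].
  exists (Some @` [set w | ds w z < 1]), [set x | if x is Some w then 2 * (nsq z + 1) < nsq w else True]; split.
  - by apply: one_point_compactification_some_nbhs; apply/nbhs_ds; exists 1.
  - by apply/nbhs_None; split => //; exists (2 * (nsq z + 1)).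
  - move=> _ [w /= h <-]; have := ds_triangle w z 0; move: h.
    rewrite [ds _ 0]/ds [ds z 0]/ds /= !subr0 -!/(nsq _); lra.
case: x y => [x|] [y|] // xy.
- have xy' : x <> y by move=> h; apply: xy; rewrite h.
  have d0 : 0 < ds x y by rewrite lt_def ds_ge0 andbT; apply/eqP => /ds_eq0.
  exists (Some @` [set w | ds w x < ds x y / 4]), (Some @` [set w | ds w y < ds x y / 4]); split.
  + by apply: one_point_compactification_some_nbhs; apply/nbhs_ds; exists (ds x y / 4); rewrite ?divr_gt0.
  + by apply: one_point_compactification_some_nbhs; apply/nbhs_ds; exists (ds x y / 4); rewrite ?divr_gt0.
  + move=> _ [w /= h <-] [w' h' [E]]; move: h'; rewrite {}E => h'.
    have := ds_triangle x w y; rewrite [ds x w](_ : _ = ds w x); last by rewrite /ds; ring.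
    by move: h h' d0; lra.
- have [U [V [h1 h2 h3]]] := far y; exists V, U; split => // w Vw Uw; exact: (h3 w Uw Vw).
Qed.

Lemma opc_cvg_unique (c : R -> Chat) (F : set_system R) : ProperFilter F -> forall x y : Chat,
  c @ F --> x -> c @ F --> y -> x = y.
Proof.
move=> FF x y cx cy; apply: contrapT => /nbhs_opc_sep[U [V [nU nV UV]]].
have /filter_ex [t [/UV]] : F ((c @^-1` U) `&` (c @^-1` V)) by apply: filterI; [exact: cx|exact: cy].
by [].
Qed.

End Topology.

(** * Geodesics and segments *)

Section Geodesics.
Variable R : realType.
Local Notation C := R[i].
Local Notation Chat := (one_point_compactification R[i]).
Implicit Types (g h : PSL2 R) (z w : C).

Definition clH (x : Chat) : Prop := if x is Some z then 0 <= Im z else True.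

Lemma denom_eq0 g z : (denom g z == 0) = (nd g z == 0).
Proof.
rewrite -normr_eq0 norm_denom eq_complex /= eqxx andbT sqrtr_eq0 eq_le.
by rewrite [0 <= _]addr_ge0 ?sqr_ge0 ?andbT.
Qed.

Lemma nd_ge0 g z : 0 <= nd g z. Proof. by rewrite addr_ge0 ?sqr_ge0. Qed.

Lemma nsq_mob g z : nd g z != 0 ->
  nsq (mob g z) = ((pa g * Re z + pb g) ^+ 2 + (pa g * Im z) ^+ 2) / nd g z.
Proof.
move=> n0; rewrite /nsq mobE //=; move: n0; rewrite /nd; case: z => x y /=; have := pdet g.
move: (pa g) (pb g) (pc g) (pd g) => a b c d D; set n := (X in X != 0) => n0.
apply: (mulIf (expf_neq0 2 n0)).
have -> : (y / n) ^+ 2 = (y * (a * d - b * c)) ^+ 2 / n ^+ 2 by rewrite D; field.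
have -> : ((a * x + b) ^+ 2 + (a * y) ^+ 2) / n * n ^+ 2 = ((a * x + b) ^+ 2 + (a * y) ^+ 2) * n by field.
by rewrite mulrDl expr_div_n !divfK ?expf_neq0 // /n; ring.
Qed.

(** Continuity of [mobhat g] at a point of the geodesic closure, approached from inside [HH]; the
    four cases are [x] finite or not and its image finite or not. *)
Lemma mobhat_nbhs g (x : Chat) (U : set Chat) : clH x -> nbhs (mobhat g x) U ->
  nbhs x [set y | if y is Some w then HH w -> U (Some (mob g w)) else True].
Proof.
case: x => [z|] /= cz.
  rewrite denom_eq0; case: eqVneq => [n0|n0].
    move=> /nbhs_None[UN [M HM]].
    (* A pole: [nd g] vanishes to second order at [z], while the squared numerator stays close to
       [k], which is positive because numerator and denominator have no common zero. *)
    apply/nbhs_ds; set k := (pa g * Re z + pb g) ^+ 2 + (pa g * Im z) ^+ 2.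
    have k0 : 0 < k.
      rewrite lt_def addr_ge0 ?sqr_ge0 // andbT /k; apply/eqP => /eqP.
      rewrite paddr_eq0 ?sqr_ge0 // !sqrf_eq0 => /andP[/eqP h1 /eqP h2].
      move: n0 => /eqP; rewrite paddr_eq0 ?sqr_ge0 // !sqrf_eq0 => /andP[/eqP h3 /eqP h4].
      have := pdet g.
      have -> : pa g * pd g - pb g * pc g = pa g * (pc g * Re z + pd g) - pc g * (pa g * Re z + pb g) by ring.
      by rewrite h1 h3 !mulr0 subr0 => /eqP; rewrite eq_sym oner_eq0.
    pose A := 1 + pa g ^+ 2 + pc g ^+ 2; pose m : R := `|M| + 1.
    have m1 : 1 <= m by rewrite lerDr.
    have A1 : 1 <= A by rewrite /A; have := sqr_ge0 (pa g); have := sqr_ge0 (pc g); lra.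
    have mA : 0 < 8 * m * A by rewrite !mulr_gt0 // (lt_le_trans ltr01).
    exists (k / (8 * m * A)) => [|w]; first by rewrite divr_gt0.
    rewrite ltr_pdivlMr // => H Hw; apply: HM.
    have nw := nd_gt0 g Hw.
    rewrite nsq_mob ?gt_eqF // ltr_pdivlMr //.
    have d0 := ds_ge0 w z.
    have E1 : nd g w = pc g ^+ 2 * ds w z.
      move: n0 => /eqP; rewrite paddr_eq0 ?sqr_ge0 // !sqrf_eq0 => /andP[/eqP h3 /eqP h4].
      have -> : nd g w = (pc g * (Re w - Re z) + (pc g * Re z + pd g)) ^+ 2 + (pc g * (Im w - Im z) + pc g * Im z) ^+ 2.
        by rewrite /nd; ring.
      by rewrite h3 h4 !addr0 /ds; ring.
    have E2 : k <= 2 * (((pa g * Re w + pb g) ^+ 2 + (pa g * Im w) ^+ 2)) + 2 * (pa g ^+ 2 * ds w z).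
      rewrite /k /ds; case: (z) (w) => x y [u v] /=.
      have := sqr_ge0 ((pa g * u + pb g) + (pa g * (u - x))); have := sqr_ge0 (pa g * v + pa g * (v - y)); nra.
    have E3 : pa g ^+ 2 * ds w z <= A * ds w z by rewrite ler_wpM2r // /A; have := sqr_ge0 (pc g); lra.
    have E4 : pc g ^+ 2 * ds w z <= A * ds w z by rewrite ler_wpM2r // /A; have := sqr_ge0 (pa g); lra.
    have Ad : 0 <= A * ds w z by rewrite mulr_ge0 // (le_trans ler01).
    have E5 : A * ds w z <= m * (A * ds w z) by rewrite ler_peMl.
    have E6 : M * nd g w <= m * (A * ds w z).
      rewrite (le_trans (ler_wpM2r (nd_ge0 _ _) (ler_norm M))) // E1; apply: ler_pM => //; last by rewrite /m lerDl.
      by apply: mulr_ge0; rewrite // sqr_ge0.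
    by move: H; rewrite [_ * (8 * m * A)](_ : _ = 8 * (m * (A * ds w z))); [lra|ring].
  move=> /nbhs_ds[e e0 eU]; apply/nbhs_ds; set n := nd g z in n0 *.
  have np : 0 < n by rewrite lt_def n0 nd_ge0.
  pose A := 1 + pc g ^+ 2; have A1 : 1 <= A by rewrite /A lerDl sqr_ge0.
  have A0 : 0 < A by rewrite (lt_le_trans ltr01).
  exists (Num.min (n / (4 * A)) (e * (n * (n / 4)))) => [|w].
    by rewrite lt_min !divr_gt0 ?mulr_gt0 ?divr_gt0 // (lt_le_trans ltr01).
  rewrite lt_min ltr_pdivlMr ?mulr_gt0 // => /andP[H1 H2] Hw.
  have nw := nd_gt0 g Hw; apply: eU.
  have d0 := ds_ge0 w z.
  have E4 : pc g ^+ 2 * ds w z <= A * ds w z by rewrite ler_wpM2r // /A; lra.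
  have E2 : n <= 2 * nd g w + 2 * (pc g ^+ 2 * ds w z).
    rewrite /n /nd /ds; case: (z) (w) => x y [u v] /=.
    have := sqr_ge0 ((pc g * u + pd g) + (pc g * (u - x))); have := sqr_ge0 (pc g * v + pc g * (v - y)); nra.
  have E3 : n / 4 <= nd g w by lra.
  rewrite ds_mob0 ?(gt_eqF nw) // -/n ltr_pdivrMr ?mulr_gt0 // (lt_le_trans H2) // ler_pM2l // [leRHS]mulrC.
  by rewrite ler_pM2l.
have D := pdet g.
case: eqVneq => [c0|c0].
  move=> /nbhs_None[UN [M HM]]; apply/nbhs_None; split => //.
  rewrite -/(pc g) in c0; rewrite c0 mulr0 subr0 in D.
  have a0 : pa g != 0 by apply/eqP => a0; move: D; rewrite a0 mul0r => /esym/eqP; rewrite oner_eq0.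
  have d0 : pd g != 0 by apply/eqP => d0; move: D; rewrite d0 mulr0 => /esym/eqP; rewrite oner_eq0.
  have a2 : 0 < pa g ^+ 2 by rewrite exprn_even_gt0.
  have d2 : 0 < pd g ^+ 2 by rewrite exprn_even_gt0.
  exists ((2 * (`|M| * pd g ^+ 2 + pb g ^+ 2)) / pa g ^+ 2) => w H Hw; apply: HM.
  have nE : nd g w = pd g ^+ 2 by rewrite /nd c0 !mul0r add0r expr0n addr0.
  rewrite nsq_mob nE ?gt_eqF // ltr_pdivlMr //.
  move: H; rewrite ltr_pdivrMr // /nsq => H.
  have h1 : M * pd g ^+ 2 <= `|M| * pd g ^+ 2 by rewrite ler_wpM2r ?ler_norm // ltW.
  have := sqr_ge0 (pa g * Re w + pb g + pb g); have := sqr_ge0 (pa g * Im w); nra.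
move=> /nbhs_ds[e e0 eU]; apply/nbhs_None; split => //.
rewrite -/(pc g) in c0.
have c2 : 0 < pc g ^+ 2 by rewrite exprn_even_gt0.
exists ((2 * ((e * pc g ^+ 2)^-1 + pd g ^+ 2)) / pc g ^+ 2) => w H Hw; apply: eU.
have nw := nd_gt0 g Hw.
have -> : ds (mob g w) (psl2_mx g 0 0 / psl2_mx g 1 0)%:C = (pc g ^+ 2 * nd g w)^-1.
  rewrite /ds mobE ?gt_eqF //= -/(pa g) -/(pc g) subr0.
  move: nw c0; rewrite /nd; case: (w) {H Hw} => x y /=; move: D {c2}.
  move: (pa g) (pb g) (pc g) (pd g) => a b c d D; set n := (X in 0 < X) => np c0.
  have n0 : n != 0 by rewrite gt_eqF.
  have -> : ((a * x + b) * (c * x + d) + a * c * y ^+ 2) / n - a / c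
    = (- (c * x + d) * (a * d - b * c) + (a * (c * x + d) ^+ 2 + a * (c * y) ^+ 2 - a * n)) / (c * n) by field; rewrite n0 c0.
  have -> : a * (c * x + d) ^+ 2 + a * (c * y) ^+ 2 - a * n = 0 by rewrite /n; ring.
  rewrite D mulr1 addr0.
  have -> : (- (c * x + d) / (c * n)) ^+ 2 + (y / n) ^+ 2 = ((c * x + d) ^+ 2 + (c * y) ^+ 2) / (c ^+ 2 * n ^+ 2) by field; rewrite n0 c0.
  by rewrite -/n; field; rewrite n0 c0.
move: H; rewrite ltr_pdivrMr // => H.
rewrite invf_plt ?posrE //; last by rewrite (mulr_gt0 c2).
have -> : e^-1 = pc g ^+ 2 * (e * pc g ^+ 2)^-1 by field; rewrite c0 gt_eqF.
rewrite ltr_pM2l //.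
have := sqr_ge0 (pc g * Re w + pd g + pd g); rewrite /nd; move: H; rewrite /nsq; nra.
Qed.
End Geodesics.

Section ClassificationOfGeodesics.
Variable R : realType.
Local Notation C := R[i].
Local Notation Chat := (one_point_compactification R[i]).
Implicit Types (g h : PSL2 R) (z w : C).

Lemma HH_std (t : R) : HH (std_geodesic t). Proof. by rewrite /HH /= expR_gt0. Qed.

Lemma psl2_mkP (a b c d : R) : a * d - b * c = 1 -> exists g,
  [/\ forall z, nd g z = (c * Re z + d) ^+ 2 + (c * Im z) ^+ 2,
      forall z, HH z -> Re (mob g z) = ((a * Re z + b) * (c * Re z + d) + a * c * Im z ^+ 2) / nd g z &
      exists2 s : R, s ^+ 2 = 1 & [/\ pa g = s * a, pb g = s * b, pc g = s * c & pd g = s * d]].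
Proof.
move=> D; have [g [s s2 [Ea Eb Ec Ed]]] := psl2_mk D; exists g; split; last by exists s.
  move=> z; rewrite /nd Ec Ed.
  have -> : (s * c * Re z + s * d) ^+ 2 + (s * c * Im z) ^+ 2 = s ^+ 2 * ((c * Re z + d) ^+ 2 + (c * Im z) ^+ 2) by ring.
  by rewrite s2 mul1r.
move=> z Hz; rewrite Re_mob // Ea Eb Ec Ed; congr (_ / _).
have -> : (s * a * Re z + s * b) * (s * c * Re z + s * d) + s * a * (s * c) * Im z ^+ 2 =
 s ^+ 2 * ((a * Re z + b) * (c * Re z + d) + a * c * Im z ^+ 2) by ring.
by rewrite s2 mul1r.
Qed.

Lemma is_geodesic_mob g (c : R -> C) : is_geodesic c -> is_geodesic (mob g \o c).
Proof.
by move=> [Hc dc]; split=> [t|s t] /=; [exact: HH_mob|rewrite hdist_mob].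
Qed.

Lemma to_axis z0 z1 : HH z0 -> HH z1 -> exists g, Re (mob g z0) = 0 /\ Re (mob g z1) = 0.
Proof.
move=> H0 H1; have [E|E] := eqVneq (Re z0) (Re z1).
  have /psl2_mkP[g [nE rE _]] : 1 * 1 - (- Re z0) * 0 = 1 :> R by ring.
  by exists g; rewrite !rE // -E; split; rewrite [X in X / _](_ : _ = 0) ?mul0r //; ring.
(* The two points lie on a half circle with center [m] and radius [r]. The map sends its ends
   [m + r] to 0 and [m - r] to infinity; [k] normalises the determinant. *)
pose m := (nsq z1 - nsq z0) / (2 * (Re z1 - Re z0)).
have E' : Re z1 - Re z0 != 0 by rewrite subr_eq0 eq_sym.
pose r := Num.sqrt ((Re z0 - m) ^+ 2 + Im z0 ^+ 2).
have r2 : r ^+ 2 = (Re z0 - m) ^+ 2 + Im z0 ^+ 2 by rewrite sqr_sqrtr // addr_ge0 ?sqr_ge0.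
have r0 : 0 < r by rewrite sqrtr_gt0 ltr_wpDl ?sqr_ge0 // exprn_gt0.
pose k := (Num.sqrt (2 * r))^-1.
have k2 : k ^+ 2 = (2 * r)^-1 by rewrite exprVn sqr_sqrtr // mulr_ge0 // ltW.
have /psl2_mkP[g [nE rE _]] : k * (- k * (m - r)) - (- k * (m + r)) * k = 1 :> R.
  have -> : k * (- k * (m - r)) - (- k * (m + r)) * k = k ^+ 2 * (2 * r) by ring.
  by rewrite k2 mulVf // mulf_neq0 // gt_eqF.
have Z z : HH z -> r ^+ 2 = (Re z - m) ^+ 2 + Im z ^+ 2 -> Re (mob g z) = 0.
  move=> Hz Er; rewrite rE //.
  have -> : (k * Re z + - k * (m + r)) * (k * Re z + - k * (m - r)) + k * k * Im z ^+ 2 = k ^+ 2 * ((Re z - m) ^+ 2 + Im z ^+ 2 - r ^+ 2) by ring.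
  by rewrite Er subrr mulr0 mul0r.
exists g; split; apply: Z => //; rewrite r2.
have : 2 * m * (Re z1 - Re z0) = nsq z1 - nsq z0 by rewrite /m; field.
by rewrite /nsq; lra.
Qed.

Lemma expR_pm1_neq0 : (expR 1 : R) ^+ 2 - 1 != 0.
Proof.
have h : 1 < expR 1 :> R by rewrite -[ltLHS]expR0 ltr_expR.
by rewrite gt_eqF // subr_gt0 expr_gt1 // ltW // (lt_trans ltr01).
Qed.

(** The distances of [c t] to [c 0] and [c 1] give two equations whose difference is linear in the
    height and determines it; either of them then forces the real part to vanish. The alternatives
    are the two directions of travel. *)
Lemma geodesic_axis (c : R -> C) : is_geodesic c -> Re (c 0) = 0 -> Re (c 1) = 0 ->
  exists2 k, 0 < k & (forall t, c t = 0 +i* (k * expR t)) \/ (forall t, c t = 0 +i* (k * expR (- t))).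
Proof.
move=> [Hc dc] c0 c1.
have D s t : ds (c s) (c t) = Im (c s) * Im (c t) * (expR (s - t) + expR (- (s - t)) - 2).
  exact: hdist_ds.
set k := Im (c 0); set l := Im (c 1).
have k0 : 0 < k by exact: Hc. have l0 : 0 < l by exact: Hc.
have e0 : 0 < expR 1 :> R by exact: expR_gt0.
exists k => //; set e := expR 1 in e0.
have en : e != 0 by rewrite gt_eqF.
have kl : l = k * e \/ k = l * e.
  have := D 1 0; rewrite subr0 /ds c0 c1 -/k -/l subrr expr0n add0r expRN -/e => E.
  have : (l - k * e) * (l * e - k) = 0.
    have : (l - k) ^+ 2 * e = (l * k * (e + e^-1 - 2)) * e by rewrite E.
    have -> : (l * k * (e + e^-1 - 2)) * e = l * k * (e ^+ 2 + 1 - 2 * e) by field.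
    by move=> ?; nra.
  by move/eqP; rewrite mulf_eq0 !subr_eq0 => /orP[/eqP ?|/eqP ?]; [left|right].
have e2 := expR_pm1_neq0; rewrite -/e in e2.
case: kl => kl; [left|right] => t; have := D t 0; have := D t 1; rewrite /ds c0 c1 -/k -/l !subr0.
  have -> : expR (t - 1) = expR t / e by rewrite expRB.
  have -> : expR (- (t - 1)) = e / expR t by rewrite opprB expRB.
  have t0 : expR t != 0 by rewrite gt_eqF ?expR_gt0.
  rewrite expRN kl; case: (c t) (Hc t) => x y; rewrite /HH /= => y0; set T := expR t in t0 *.
  move=> E1 E2.
  have F1 : x ^+ 2 + y ^+ 2 + (k * e) ^+ 2 = y * k * (T + e ^+ 2 / T).
    have <- : y * (k * e) * (T / e + e / T - 2) + 2 * (y * (k * e)) = y * k * (T + e ^+ 2 / T) by field; rewrite en t0.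
    by rewrite -E1; ring.
  have F2 : x ^+ 2 + y ^+ 2 + k ^+ 2 = y * k * (T + 1 / T).
    have <- : y * k * (T + T^-1 - 2) + 2 * (y * k) = y * k * (T + 1 / T) by field.
    by rewrite -E2; ring.
  have F3 : (e ^+ 2 - 1) * (k * (k - y / T)) = 0.
    have -> : (e ^+ 2 - 1) * (k * (k - y / T)) = (k * e) ^+ 2 - k ^+ 2 - (y * k * (T + e ^+ 2 / T) - y * k * (T + 1 / T)) by field.
    by rewrite -F1 -F2; ring.
  have yE : y = k * T.
    move/eqP: F3; rewrite !mulf_eq0 (negPf e2) (gt_eqF k0) /= subr_eq0 => /eqP ->; by field.
  apply: complex_ext => //=; move: F2; rewrite yE => F2.
  have : x ^+ 2 = 0.
    have -> : x ^+ 2 = k * T * k * (T + 1 / T) - (k * T) ^+ 2 - k ^+ 2 by rewrite -F2; ring.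
    by field.
  by move/eqP; rewrite sqrf_eq0 => /eqP.
have -> : expR (t - 1) = expR t / e by rewrite expRB.
have -> : expR (- (t - 1)) = e / expR t by rewrite opprB expRB.
have t0 : expR t != 0 by rewrite gt_eqF ?expR_gt0.
rewrite expRN kl; case: (c t) (Hc t) => x y; rewrite /HH /= => y0; set T := expR t in t0 *.
move=> E1 E2.
have F1 : x ^+ 2 + y ^+ 2 + l ^+ 2 = y * l * (T / e + e / T).
  have <- : y * l * (T / e + e / T - 2) + 2 * (y * l) = y * l * (T / e + e / T) by ring.
  by rewrite -E1; ring.
have F2 : x ^+ 2 + y ^+ 2 + (l * e) ^+ 2 = y * l * (T * e + e / T).
  have <- : y * (l * e) * (T + T^-1 - 2) + 2 * (y * (l * e)) = y * l * (T * e + e / T) by field.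
  by rewrite -E2; ring.
have F3 : (e ^+ 2 - 1) * (l * (l - y * T / e)) = 0.
  have -> : (e ^+ 2 - 1) * (l * (l - y * T / e)) = (l * e) ^+ 2 - l ^+ 2 - (y * l * (T * e + e / T) - y * l * (T / e + e / T)) by field; rewrite en t0.
  by rewrite -F1 -F2; ring.
have yE : y = l * e / T.
  move/eqP: F3; rewrite !mulf_eq0 (negPf e2) (gt_eqF l0) /= subr_eq0 => /eqP lE.
  by rewrite lE; field; rewrite en t0.
apply: complex_ext => //=; move: F2; rewrite yE => F2.
have : x ^+ 2 = 0.
  have -> : x ^+ 2 = l * e / T * l * (T * e + e / T) - (l * e / T) ^+ 2 - (l * e) ^+ 2 by rewrite -F2; ring.
  by field.
by move/eqP; rewrite sqrf_eq0 => /eqP.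
Qed.

Lemma geodesicP (c : R -> C) : is_geodesic c -> exists g, forall t, c t = mob g (std_geodesic t).
Proof.
move=> gc; have [Hc _] := gc.
have [h [h0 h1]] := to_axis (Hc 0) (Hc 1).
have [k k0 cE] := geodesic_axis (is_geodesic_mob h gc) h0 h1.
have s0 : 0 < Num.sqrt k by rewrite sqrtr_gt0.
have s2 : Num.sqrt k ^+ 2 = k by rewrite sqr_sqrtr // ltW.
suff [f fE] : exists f, forall t, mob h (c t) = mob f (std_geodesic t).
  by exists (h^-1 * f)%g => t; rewrite (mob_mul _ _ (HH_std t)) -(fE t) (mobK h (Hc t)).
set s := Num.sqrt k in s0 s2; have sn : s != 0 by rewrite gt_eqF.
case: cE => cE.
  have /psl2_mkP[f [nE rE _]] : s * s^-1 - 0 * 0 = 1 :> R by rewrite mulfV // mul0r subr0.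
  exists f => t; rewrite -[LHS]/((mob h \o c) t) cE; apply: complex_ext => /=.
    by rewrite (rE _ (HH_std t)) /= !(mulr0, mul0r, add0r, addr0).
  rewrite (Im_mob _ (HH_std t)) nE /= -s2; set e := expR t; field; rewrite ?sn //.
have /psl2_mkP[f [nE rE _]] : 0 * 0 - (- s) * s^-1 = 1 :> R by rewrite mulNr opprK mulfV // mul0r add0r.
exists f => t; rewrite -[LHS]/((mob h \o c) t) cE; apply: complex_ext => /=.
  by rewrite (rE _ (HH_std t)) /= !(mulr0, mul0r, add0r, addr0).
rewrite (Im_mob _ (HH_std t)) nE /= -s2 expRN; have e0 := expR_gt0 t; set e := expR t in e0 *.
have en : e != 0 by rewrite gt_eqF.
by rewrite !(mulr0, mul0r, add0r, addr0); field; rewrite sn en.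
Qed.

Lemma reaches_std_p : reaches (@std_geodesic R) +oo%E None.
Proof.
move=> V /nbhs_None[VN [M HM]]; rewrite nbhs_filterE.
exists (Num.max 1 M); split; first exact: num_real.
move=> t; rewrite gt_max => /andP[t1 tM] /=; apply: HM; rewrite /nsq /= expr0n add0r.
have := expR_ge1Dx t; nra.
Qed.

Lemma reaches_std_n : reaches (@std_geodesic R) -oo%E (Some 0).
Proof.
move=> V /nbhs_ds[e e0 HM]; rewrite nbhs_filterE.
have s0 : 0 < Num.sqrt e by rewrite sqrtr_gt0.
exists (ln (Num.sqrt e)); split; first exact: num_real.
move=> t tl /=; apply: HM; rewrite /ds /= subrr subr0 expr0n add0r.
have h : expR t < Num.sqrt e by rewrite -[ltRHS]lnK ?ltr_expR.
by rewrite -[ltRHS](sqr_sqrtr (ltW e0)) ltr_pXn2r // nnegrE ?expR_ge0 // ltW.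
Qed.

Lemma reaches_mob g (c : R -> C) (e : \bar R) (x : Chat) : (forall t, HH (c t)) -> clH x ->
  reaches c e x -> reaches (mob g \o c) e (mobhat g x).
Proof.
move=> Hc cx.
case: e => [r|rc|rc].
- move=> xE; move: cx; rewrite xE /= => cx.
  by rewrite (negPf (denom_neq0 g (Hc r))).
- move=> V /(mobhat_nbhs cx) /rc; rewrite !nbhs_filterE.
  by move=> [M [Mr HM]]; exists M; split => // t /HM /= /(_ (Hc t)).
- move=> V /(mobhat_nbhs cx) /rc; rewrite !nbhs_filterE.
  by move=> [M [Mr HM]]; exists M; split => // t /HM /= /(_ (Hc t)).
Qed.

Lemma reaches_unique (c : R -> C) (e : \bar R) (x y : Chat) : reaches c e x -> reaches c e y -> x = y.
Proof.
case: e => [r -> -> //|rx ry|rx ry].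
  exact: (@opc_cvg_unique R (fun t => Some (c t)) (pinfty_nbhs R) _ _ _ rx ry).
exact: (@opc_cvg_unique R (fun t => Some (c t)) (ninfty_nbhs R) _ _ _ rx ry).
Qed.

End ClassificationOfGeodesics.

Section Segments.
Variable R : realType.
Local Notation C := R[i].
Local Notation Chat := (one_point_compactification R[i]).
Implicit Types (g h : PSL2 R) (z w p : C).

(* Homogeneous coordinates of [(x, x^2 + y^2)]: in these coordinates the
   half-plane is the inside of a parabola and geodesics are straight chords. *)
Definition vw g (e : \bar R) : R * R * R :=
  match e with
  | r%:E => (pa g * pc g * expR r ^+ 2 + pb g * pd g, pa g ^+ 2 * expR r ^+ 2 + pb g ^+ 2,
             pc g ^+ 2 * expR r ^+ 2 + pd g ^+ 2)
  | +oo%E => (pa g * pc g, pa g ^+ 2, pc g ^+ 2)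
  | -oo%E => (pb g * pd g, pb g ^+ 2, pd g ^+ 2)
  end.

Lemma nd_std g (t : R) : nd g (std_geodesic t) = (vw g t%:E).2.
Proof. by rewrite /nd /=; ring. Qed.

Lemma Re_std g (t : R) : Re (mob g (std_geodesic t)) = (vw g t%:E).1.1 / (vw g t%:E).2.
Proof. by rewrite (Re_mob _ (HH_std t)) nd_std /=; congr (_ / _); ring. Qed.

Lemma Im_std g (t : R) : Im (mob g (std_geodesic t)) = expR t / (vw g t%:E).2.
Proof. by rewrite (Im_mob _ (HH_std t)) nd_std. Qed.

Lemma nsq_std g (t : R) : nsq (mob g (std_geodesic t)) = (vw g t%:E).1.2 / (vw g t%:E).2.
Proof.
rewrite nsq_mob ?(gt_eqF (nd_gt0 g (HH_std t))) // nd_std /=; congr (_ / _); ring.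
Qed.

Lemma vw_gt0 g (t : R) : 0 < (vw g t%:E).2.
Proof. by rewrite -nd_std nd_gt0 //; exact: HH_std. Qed.

Lemma reaches_geo g (e : \bar R) (x : Chat) : reaches (mob g \o @std_geodesic R) e x ->
  x = match e with r%:E => Some (mob g (std_geodesic r)) | +oo%E => mobhat g None | -oo%E => mobhat g (Some 0) end.
Proof.
case: e => [r//|rx|rx]; apply: (reaches_unique rx); apply: reaches_mob => //=.
- by move=> t; exact: HH_std.
- exact: reaches_std_p.
- by move=> t; exact: HH_std.
- exact: reaches_std_n.
Qed.

Lemma nd_0 g : nd g 0 = pd g ^+ 2.
Proof. by rewrite /nd /= !mulr0 add0r expr0n addr0. Qed.

Lemma vw_some g e z : reaches (mob g \o @std_geodesic R) e (Some z) ->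
  [/\ 0 < (vw g e).2, Re z * (vw g e).2 = (vw g e).1.1, nsq z * (vw g e).2 = (vw g e).1.2 & 0 <= Im z].
Proof.
move/reaches_geo; case: e => [r| |].
- move=> [->]; have v0 := vw_gt0 g r.
  by rewrite Re_std nsq_std !divfK ?gt_eqF //; split => //; rewrite Im_std divr_ge0 ?expR_ge0 // ltW.
- rewrite /mobhat; case: eqVneq => // c0 [->] /=; rewrite /nsq /= -/(pa g) -/(pc g) in c0 *.
  by split => //; [rewrite exprn_even_gt0|field|field].
- rewrite /mobhat denom_eq0; case: eqVneq => // n0 [->] /=.
  rewrite /nsq mobE //= nd_0; rewrite nd_0 in n0.
  have d0 : pd g != 0 by apply: contra n0 => /eqP ->; rewrite expr0n.
  by split; [rewrite exprn_even_gt0|field|field|rewrite mul0r].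
Qed.

Lemma vw_none g e : reaches (mob g \o @std_geodesic R) e None -> [/\ (vw g e).2 = 0, (vw g e).1.1 = 0 & 0 <= (vw g e).1.2].
Proof.
move/reaches_geo; case: e => [r//| |].
  rewrite /mobhat -/(pc g); case: eqVneq => // c0 _ /=.
  by rewrite c0 mulr0 expr0n sqr_ge0.
rewrite /mobhat denom_eq0 nd_0 sqrf_eq0; case: eqVneq => // d0 _ /=.
by rewrite d0 mulr0 expr0n sqr_ge0.
Qed.

(** The homogeneous coordinates are affine in [expR t ^+ 2], so an intermediate point lies in the
    cone spanned by the two end vectors. Finite and infinite times are treated alike in this
    form. *)
Lemma vw_comb g (e1 e2 : \bar R) (t : R) : (e1 <= t%:E <= e2)%E -> exists l1 l2 : R,
  [/\ 0 <= l1, 0 <= l2, (vw g t%:E).1.1 = l1 * (vw g e1).1.1 + l2 * (vw g e2).1.1,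
     (vw g t%:E).1.2 = l1 * (vw g e1).1.2 + l2 * (vw g e2).1.2 &
     (vw g t%:E).2 = l1 * (vw g e1).2 + l2 * (vw g e2).2].
Proof.
have E0 := expR_gt0 t.
case: e1 => [r1| |]; case: e2 => [r2| |] //=; rewrite ?lee_fin ?leey ?leNye ?andbT //=.
- move=> /andP[r1t tr2]; have E1 := expR_gt0 r1.
  have h1 : expR r1 <= expR t by rewrite ler_expR.
  have h2 : expR t <= expR r2 by rewrite ler_expR.
  set E := expR t in E0 h1 h2 *; set F := expR r1 in E1 h1 *; set G := expR r2 in h2 *.
  have [FG|FG] := eqVneq F G.
    have -> : E = F by apply/eqP; rewrite eq_le h1 FG h2.
    by exists 1, 0; rewrite !mul1r !mul0r !addr0 ler01 lexx.
  have FG' : F < G by rewrite lt_def eq_sym FG (le_trans h1).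
  have D : 0 < G ^+ 2 - F ^+ 2 by rewrite subr_gt0 ltr_pXn2r // nnegrE ltW // (lt_trans E1).
  have Dn : G ^+ 2 - F ^+ 2 != 0 by rewrite gt_eqF.
  exists ((G ^+ 2 - E ^+ 2) / (G ^+ 2 - F ^+ 2)), ((E ^+ 2 - F ^+ 2) / (G ^+ 2 - F ^+ 2)).
  split; try field => //.
    by rewrite divr_ge0 ?(ltW D) // subr_ge0 lerXn2r // nnegrE ltW // (lt_trans E1).
  by rewrite divr_ge0 ?(ltW D) // subr_ge0 lerXn2r // nnegrE ltW.
- move=> r1t; have E1 := expR_gt0 r1; have h1 : expR r1 <= expR t by rewrite ler_expR.
  exists 1, (expR t ^+ 2 - expR r1 ^+ 2); split; try ring => //; rewrite ?ler01 //.
  by rewrite subr_ge0 lerXn2r // nnegrE ltW.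
- by rewrite leeNy_eq /= andbF.
- move=> tr2; have h2 : expR t <= expR r2 by rewrite ler_expR.
  have G0 := expR_gt0 r2; set G := expR r2 in h2 G0 *; set E := expR t in E0 h2 *.
  have Gn : G != 0 by rewrite gt_eqF.
  exists ((G ^+ 2 - E ^+ 2) / G ^+ 2), (E ^+ 2 / G ^+ 2); split; try field => //.
    by rewrite divr_ge0 ?sqr_ge0 // subr_ge0 lerXn2r // nnegrE ltW.
  by rewrite divr_ge0 ?sqr_ge0.
- by move=> _; exists 1, (expR t ^+ 2); split; rewrite ?ler01 ?sqr_ge0 //; ring.
Qed.

Arguments vw : simpl never.

Lemma gseg_sym (x y : Chat) : gseg x y = gseg y x.
Proof.
suff H (x' y' : Chat) : gseg x' y' `<=` gseg y' x' by rewrite eqEsubset; split.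
move=> z [c [a [b [t [gc rx ry /andP[at_ tb] zE]]]]].
have gc' : is_geodesic (c \o -%R).
  by case: gc => Hc dc; split=> [s|s u] /=; [exact: Hc|rewrite dc -opprD normrN].
have rc (e : \bar R) (w : Chat) : reaches c e w -> reaches (c \o -%R) (- e)%E w.
  case: e => [r /=|rw|rw]; first by rewrite opprK.
    move=> V /rw; rewrite !nbhs_filterE => -[M [Mr HM]].
    by exists (- M); rewrite ?num_real; split => // s sM; apply: HM; rewrite ltrNr.
  move=> V /rw; rewrite !nbhs_filterE => -[M [Mr HM]].
  by exists (- M); rewrite ?num_real; split => // s sM; apply: HM; rewrite ltrNl.
exists (c \o -%R), (- b)%E, (- a)%E, (- t); split => //; try exact: rc.
  by rewrite EFinN leeN2 tb leeN2.
by rewrite /= opprK.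
Qed.

Lemma gseg_HH (x y : Chat) : gseg x y `<=` @HH R.
Proof. by move=> _ [c [a [b [t [[Hc _] _ _ _ ->]]]]]. Qed.

(* [p] divides the straight chord from [z] to [w] in the coordinates [(x, x^2 + y^2)] in the ratio [s]. *)
Definition kl z w (s : R) p : Prop :=
  Re p = (1 - s) * Re z + s * Re w /\ nsq p = (1 - s) * nsq z + s * nsq w.

Lemma gseg_sub z w p : gseg (Some z) (Some w) p -> exists2 s, 0 <= s <= 1 & kl z w s p.
Proof.
move=> [c [a [b [t [gc rx ry ab ->]]]]].
have [g cE] := geodesicP gc; have {cE} cE : c = mob g \o @std_geodesic R by apply/funext => u; rewrite cE.
rewrite cE in rx ry *.
have [n1 h1 k1 _] := vw_some rx; have [n2 h2 k2 _] := vw_some ry.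
have [l1 [l2 [l10 l20 E1 E2 E3]]] := vw_comb g ab.
have v0 := vw_gt0 g t.
have vn : (vw g t%:E).2 != 0 by rewrite gt_eqF.
exists (l2 * (vw g b).2 / (vw g t%:E).2).
  rewrite divr_ge0 ?mulr_ge0 ?(ltW n2) ?(ltW v0) // andTb ler_pdivrMr // mul1r E3 lerDr.
  by rewrite mulr_ge0 // ltW.
rewrite /kl; have -> : 1 - l2 * (vw g b).2 / (vw g t%:E).2 = l1 * (vw g a).2 / (vw g t%:E).2.
  rewrite -[1](mulfV vn) -mulrBl; congr (_ / _); rewrite E3; ring.
split; first by rewrite [LHS](Re_std g t) E1 -h1 -h2; field.
by rewrite [LHS](nsq_std g t) E2 -k1 -k2; field.
Qed.

Lemma gseg_ray_sub z p : gseg (Some z) None p -> [/\ HH p, Re p = Re z & Im z <= Im p].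
Proof.
move=> [c [a [b [t [gc rx ry ab ->]]]]]; have Hc := gc.1 t.
have [g cE] := geodesicP gc; have {cE} cE : c = mob g \o @std_geodesic R by apply/funext => u; rewrite cE.
rewrite cE in rx ry Hc *; have [n1 h1 k1 i1] := vw_some rx; have [n2 h2 k2] := vw_none ry.
have [l1 [l2 [l10 l20 E1 E2 E3]]] := vw_comb g ab.
have v0 := vw_gt0 g t; rewrite E3 n2 mulr0 addr0 in v0.
have HR : Re ((mob g \o @std_geodesic R) t) = Re z.
  by rewrite [LHS](Re_std g t) E1 E3 n2 h2 -h1 !mulr0 !addr0 mulrCA mulfK // gt_eqF.
have : nsq z <= nsq ((mob g \o @std_geodesic R) t).
  rewrite [leRHS](nsq_std g t) E2 E3 n2 -k1 !mulr0 !addr0 ler_pdivlMr // [leLHS]mulrCA lerDl.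
  by rewrite mulr_ge0.
move: Hc HR; move: ((mob g \o @std_geodesic R) t) => q Hq HR; rewrite /nsq HR lerD2l.
by rewrite ler_pXn2r ?nnegrE //; exact: ltW.
Qed.

Lemma vert_geo (x0 : R) : exists g,
  (forall t, mob g (std_geodesic t) = x0 +i* expR t) /\ mobhat g (Some 0) = Some x0%:C /\ mobhat g None = None.
Proof.
have /psl2_mkP[g [nE rE [s s2 [Ea Eb Ec Ed]]]] : 1 * 1 - x0 * 0 = 1 :> R by ring.
have c0 : pc g = 0 by rewrite Ec mulr0.
exists g; split.
  move=> t; apply: complex_ext => /=; rewrite ?(rE _ (HH_std t)) ?(Im_mob g (HH_std t)) nE /=;
    by rewrite [X in _ / X](_ : _ = 1) ?divr1; ring.
have n1 : nd g 0 = 1 by rewrite nE /=; ring.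
rewrite /mobhat denom_eq0 n1 oner_eq0 -/(pc g) c0 eqxx; split => //; congr Some.
rewrite mobE n1 ?oner_neq0 //; apply: complex_ext => /=; rewrite ?divr1 //.
by rewrite c0 Ea Eb Ed mulr0 !mulr0 !mulr1 !add0r mul0r addr0 mulrAC -expr2 s2 mul1r.
Qed.

Lemma vert_reach (c : R -> C) (z : C) : (forall t, c t = Re z +i* expR t) -> 0 <= Im z ->
  reaches c -oo%E (Some (Re z)%:C) ->
  exists2 a : \bar R, reaches c a (Some z) & forall t : R, (a <= t%:E)%E = (Im z <= expR t).
Proof.
move=> cE; rewrite le_eqVlt => /orP[/eqP z0|z0] cr.
  exists -oo%E => [|t]; last by rewrite leNye -z0 expR_ge0.
  by have -> : z = (Re z)%:C by apply: complex_ext => //=.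
exists (ln (Im z))%:E => [|t]; last by rewrite lee_fin -[in RHS](lnK z0) ler_expR.
by rewrite /= cE (lnK z0); congr Some; apply: complex_ext.
Qed.

Lemma gseg_ray z : 0 <= Im z -> gseg (Some z) None = [set p | [/\ HH p, Re p = Re z & Im z <= Im p]].
Proof.
move=> z0; rewrite eqEsubset; split => p; first exact: gseg_ray_sub.
move=> [Hp pz zp]; have [g [gE [g0 gI]]] := vert_geo (Re z).
have r0 : reaches (mob g \o @std_geodesic R) -oo%E (Some (Re z)%:C).
  by rewrite -g0; apply: reaches_mob => //=; [move=> t; exact: HH_std|exact: reaches_std_n].
have [a ra aE] := vert_reach gE z0 r0.
exists (mob g \o @std_geodesic R), a, +oo%E, (ln (Im p)); split => //.
- exact/is_geodesic_mob/std_geodesicP.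
- by rewrite -gI; apply: reaches_mob => //=; [move=> t; exact: HH_std|exact: reaches_std_p].
- by rewrite aE lnK // zp leey.
- by rewrite /= gE lnK //; apply: complex_ext.
Qed.

(** The map [g] carries 0 and infinity to the ends [m - r] and [m + r]. The time at which [p] is
    reached is the logarithm of the ratio of its distances to these ends, which equals
    [Im p / (m + r - Re p)] on the circle. *)
Lemma circ_geo (m r : R) : 0 < r -> exists g,
  [/\ forall (p : C), HH p -> (Re p - m) ^+ 2 + Im p ^+ 2 = r ^+ 2 -> p = mob g (std_geodesic (ln (Im p / (m + r - Re p)))),
   forall p, HH p -> (Re p - m) ^+ 2 + Im p ^+ 2 = r ^+ 2 -> Re p < m + r,
   mobhat g (Some 0) = Some (m - r)%:C & mobhat g None = Some (m + r)%:C].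
Proof.
move=> r0; pose k := (Num.sqrt (2 * r))^-1.
have k2 : k ^+ 2 = (2 * r)^-1 by rewrite exprVn sqr_sqrtr // mulr_ge0 // ltW.
have k0 : k != 0 by rewrite invr_eq0 sqrtr_eq0 -ltNge mulr_gt0.
have rn : r != 0 by rewrite gt_eqF.
have /psl2_mkP[g [nE rE [s s2 [Ea Eb Ec Ed]]]] : (k * (m + r)) * k - (k * (m - r)) * k = 1 :> R.
  have -> : (k * (m + r)) * k - (k * (m - r)) * k = k ^+ 2 * (2 * r) by ring.
  by rewrite k2 mulVf // mulf_neq0.
have lt p : HH p -> (Re p - m) ^+ 2 + Im p ^+ 2 = r ^+ 2 -> Re p < m + r.
  by rewrite /HH /= => p0 E; rewrite ltNge; apply/negP => h; nra.
have sn : s != 0 by exact: sqr1_neq0.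
have n0 : nd g 0 = k ^+ 2 by rewrite nE /=; ring.
exists g; split => //.
- move=> p Hp E; have l := lt _ Hp E; have d0 : 0 < m + r - Re p by rewrite subr_gt0.
  have e0 : 0 < Im p / (m + r - Re p) by rewrite divr_gt0.
  have E2 : (Im p / (m + r - Re p)) ^+ 2 = (Re p - m + r) / (m + r - Re p).
    have -> : (Im p / (m + r - Re p)) ^+ 2 = (r ^+ 2 - (Re p - m) ^+ 2) / (m + r - Re p) ^+ 2.
      by rewrite -E; field; rewrite gt_eqF.
    by field; rewrite gt_eqF.
  have nn : nd g (std_geodesic (ln (Im p / (m + r - Re p)))) = k ^+ 2 * (2 * r / (m + r - Re p)).
    rewrite nE /= lnK // [(k * _) ^+ 2]exprMn E2; field; rewrite gt_eqF //.
  apply: complex_ext; rewrite ?(rE _ (HH_std _)) ?(Im_mob g (HH_std _)) nn /= lnK // ?E2 ?k2.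
    have -> : k * (m + r) * k = k ^+ 2 * (m + r) by ring.
    have -> : (k * (m + r) * 0 + k * (m - r)) * (k * 0 + k) = k ^+ 2 * (m - r) by ring.
    by rewrite k2; field; rewrite rn gt_eqF.
  by field; rewrite rn gt_eqF.
- rewrite /mobhat denom_eq0 n0 expf_eq0 /= (negPf k0); congr Some.
  rewrite mobE n0 ?expf_neq0 //; apply: complex_ext => /=; rewrite ?mul0r //.
  rewrite Ea Eb Ec Ed -[k ^+ 2]mul1r -s2; field; rewrite sn k0 //.
- rewrite /mobhat -/(pc g) -/(pa g) Ec mulf_eq0 (negPf sn) (negPf k0) /=; congr Some; congr (_%:C).
  by rewrite Ea; field; rewrite sn k0.
Qed.

Lemma kl_Phi (q : cform R) z w s p : kl z w s p -> Phi q p = (1 - s) * Phi q z + s * Phi q w.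
Proof. by move=> [h1 h2]; rewrite /Phi -!/(nsq _) h1 h2; ring. Qed.

(** The converse of [gseg_sub]. The endpoints are ordered so that the geodesic runs upwards on a
    vertical line or to the right on a half circle; on the latter the time is monotone in the real
    part ([mono]), and an endpoint on the real axis is reached at infinite time. *)
Lemma gseg_kl z w s p : 0 <= Im z -> 0 <= Im w -> z <> w -> HH p -> 0 <= s <= 1 -> kl z w s p ->
  gseg (Some z) (Some w) p.
Proof.
wlog zw : z w s / (Re z < Re w) || ((Re z == Re w) && (Im z < Im w)) => [th|].
  move=> z0 w0 zw Hp s1 K.
  have [h|h] := boolP ((Re z < Re w) || ((Re z == Re w) && (Im z < Im w))); first exact: (th z w s).
  rewrite gseg_sym; apply: (th w z (1 - s)) => //.
  - move: h; rewrite negb_or negb_and -!leNgt => /andP[h1 h2].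
    have [e|ne] := eqVneq (Re z) (Re w); last by rewrite lt_def ne h1.
    move: h2; rewrite e eqxx /= => h2; rewrite ltxx /= lt_def h2 andbT.
    by apply/eqP => e2; apply: zw; apply: complex_ext.
  - by move=> e; apply: zw.
  - by move: s1 => /andP[? ?]; apply/andP; split; lra.
  - by case: K => K1 K2; split; rewrite ?K1 ?K2; ring.
move=> z0 w0 zwn Hp s01 K; have s0 : 0 <= s by case/andP: s01. have s1 : s <= 1 by case/andP: s01.
have := zw => /orP[lt|/andP[/eqP e lt]]; last first.
  have [g [gE [g0 gI]]] := vert_geo (Re z).
  have r0 : reaches (mob g \o @std_geodesic R) -oo%E (Some (Re z)%:C).
    by rewrite -g0; apply: reaches_mob => //=; [move=> t; exact: HH_std|exact: reaches_std_n].
  have [a ra aE] := vert_reach gE z0 r0.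
  have w1 : 0 < Im w by exact: le_lt_trans lt.
  have [K1 K2] := K.
  have Ep : Re p = Re z by rewrite K1 e; ring.
  have Np : Im p ^+ 2 = (1 - s) * Im z ^+ 2 + s * Im w ^+ 2 by move: K2; rewrite /nsq Ep -e; lra.
  have zw2 : Im z ^+ 2 <= Im w ^+ 2 by rewrite lerXn2r ?nnegrE // ltW.
  have p0 : 0 < Im p by exact: Hp.
  exists (mob g \o @std_geodesic R), a, (ln (Im w))%:E, (ln (Im p)); split => //.
  - exact/is_geodesic_mob/std_geodesicP.
  - by rewrite /= gE lnK //; congr Some; apply: complex_ext.
  - rewrite aE lnK // lee_fin ler_ln ?posrE //; apply/andP; split.
      by rewrite -(ler_pXn2r (_ : 0 < 2)%N) ?nnegrE ?(ltW p0) //; nra.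
    by rewrite -(ler_pXn2r (_ : 0 < 2)%N) ?nnegrE ?(ltW p0) ?(ltW w1) //; nra.
  - by rewrite /= gE lnK //; apply: complex_ext.
have wz : Re w - Re z != 0 by rewrite subr_eq0 gt_eqF.
pose m := (nsq w - nsq z) / (2 * (Re w - Re z)).
have mE : 2 * m * (Re w - Re z) = nsq w - nsq z by rewrite /m; field.
pose r := Num.sqrt ((Re z - m) ^+ 2 + Im z ^+ 2).
have r2 : r ^+ 2 = (Re z - m) ^+ 2 + Im z ^+ 2 by rewrite sqr_sqrtr // addr_ge0 ?sqr_ge0.
have r2w : r ^+ 2 = (Re w - m) ^+ 2 + Im w ^+ 2 by move: mE; rewrite r2 /nsq; lra.
have r0 : 0 < r.
  rewrite sqrtr_gt0 lt_def addr_ge0 ?sqr_ge0 // andbT; apply/eqP => E.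
  have r20 : r ^+ 2 = 0 by rewrite r2.
  move: E => /eqP; rewrite paddr_eq0 ?sqr_ge0 // !sqrf_eq0 => /andP[/eqP h1 _].
  move: r2w; rewrite r20 => /esym/eqP; rewrite paddr_eq0 ?sqr_ge0 // !sqrf_eq0 => /andP[/eqP h2 _].
  by move: lt h1 h2; lra.
have [g [gE gl g0 gI]] := circ_geo m r0.
have [K1 K2] := K.
have Cp : (Re p - m) ^+ 2 + Im p ^+ 2 = r ^+ 2.
  have -> : (Re p - m) ^+ 2 + Im p ^+ 2 = nsq p - 2 * m * Re p + m ^+ 2 by rewrite /nsq; ring.
  rewrite K1 K2.
  have -> : nsq z = r ^+ 2 + 2 * m * Re z - m ^+ 2 by rewrite r2 /nsq; ring.
  have -> : nsq w = r ^+ 2 + 2 * m * Re w - m ^+ 2 by rewrite r2w /nsq; ring.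
  by ring.
have pz : Re z <= Re p by rewrite K1; nra.
have pw : Re p <= Re w by rewrite K1; nra.
pose tau (q : C) := ln (Im q / (m + r - Re q)).
have mono q1 q2 : HH q1 -> HH q2 -> (Re q1 - m) ^+ 2 + Im q1 ^+ 2 = r ^+ 2 ->
    (Re q2 - m) ^+ 2 + Im q2 ^+ 2 = r ^+ 2 -> Re q1 <= Re q2 -> tau q1 <= tau q2.
  move=> H1 H2 C1 C2 le12; have l1 := gl _ H1 C1; have l2 := gl _ H2 C2.
  have i1 : 0 < Im q1 by []. have i2 : 0 < Im q2 by [].
  have d1 : 0 < m + r - Re q1 by lra. have d2 : 0 < m + r - Re q2 by lra.
  rewrite /tau ler_ln ?posrE ?divr_gt0 // ler_pdivrMr // mulrAC ler_pdivlMr //.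
  rewrite -(ler_pXn2r (_ : 0 < 2)%N) ?nnegrE ?mulr_ge0 ?(ltW i1) ?(ltW i2) ?(ltW d1) ?(ltW d2) // !exprMn.
  have -> : Im q1 ^+ 2 = (m + r - Re q1) * (Re q1 - m + r) by rewrite -[LHS](addKr ((Re q1 - m) ^+ 2)) C1; ring.
  have -> : Im q2 ^+ 2 = (m + r - Re q2) * (Re q2 - m + r) by rewrite -[LHS](addKr ((Re q2 - m) ^+ 2)) C2; ring.
  have -> : (m + r - Re q1) * (Re q1 - m + r) * (m + r - Re q2) ^+ 2 =
    (m + r - Re q1) * (m + r - Re q2) * ((Re q1 - m + r) * (m + r - Re q2)) by ring.
  have -> : (m + r - Re q2) * (Re q2 - m + r) * (m + r - Re q1) ^+ 2 =
    (m + r - Re q1) * (m + r - Re q2) * ((Re q2 - m + r) * (m + r - Re q1)) by ring.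
  rewrite ler_pM2l ?mulr_gt0 //.
  have : 0 <= 2 * r * (Re q2 - Re q1) by rewrite !mulr_ge0 // ?(ltW r0) // subr_ge0.
  by nra.
have Ha : exists2 a : \bar R, reaches (mob g \o @std_geodesic R) a (Some z) & (a <= (tau p)%:E)%E.
  move: z0; rewrite le_eqVlt => /orP[/eqP z0|z0]; last first.
    exists (tau z)%:E; first by rewrite /= -gE // r2.
    by rewrite lee_fin; apply: mono.
  exists -oo%E; last by rewrite leNye.
  have -> : z = (m - r)%:C.
    apply: complex_ext; rewrite /= -?z0 //; move: r2; rewrite -z0 expr0n addr0 => /eqP.
    rewrite eqf_sqr => /orP[/eqP h|/eqP h]; last by rewrite h; ring.
    have : r ^+ 2 < r ^+ 2 by rewrite [ltRHS]r2w; nra.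
    by rewrite ltxx.
  by rewrite -g0; apply: reaches_mob => //=; [move=> t; exact: HH_std|exact: reaches_std_n].
have Hb : exists2 b : \bar R, reaches (mob g \o @std_geodesic R) b (Some w) & ((tau p)%:E <= b)%E.
  move: w0; rewrite le_eqVlt => /orP[/eqP w0|w0]; last first.
    exists (tau w)%:E; first by rewrite /= -gE // r2w.
    by rewrite lee_fin; apply: mono.
  exists +oo%E; last by rewrite leey.
  have -> : w = (m + r)%:C.
    apply: complex_ext; rewrite /= -?w0 //; move: r2w; rewrite -w0 expr0n addr0 => /eqP.
    rewrite eqf_sqr => /orP[/eqP h|/eqP h]; first by rewrite h; ring.
    have : r ^+ 2 < r ^+ 2 by rewrite [ltRHS]r2; nra.
    by rewrite ltxx.
  by rewrite -gI; apply: reaches_mob => //=; [move=> t; exact: HH_std|exact: reaches_std_p].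
have [a ra ap] := Ha; have [b rb bp] := Hb.
exists (mob g \o @std_geodesic R), a, b, (tau p); split => //.
- exact/is_geodesic_mob/std_geodesicP.
- by rewrite ap bp.
- by rewrite /= -gE.
Qed.

Lemma gsegE z w : 0 <= Im z -> 0 <= Im w -> z <> w ->
  gseg (Some z) (Some w) = [set p | HH p /\ exists2 s, 0 <= s <= 1 & kl z w s p].
Proof.
move=> z0 w0 zw; rewrite eqEsubset; split => p.
  by move=> h; split; [exact: gseg_HH h|exact: gseg_sub].
by move=> [Hp [s s1 K]]; exact: gseg_kl K.
Qed.

End Segments.

(** * Convexity and circular arcs *)

Section Convexity.
Variable R : realType.
Local Notation C := R[i].
Local Notation Chat := (one_point_compactification R[i]).
Implicit Types (z w p : C).

Lemma nsq_inj z w : 0 <= Im z -> 0 <= Im w -> Re z = Re w -> nsq z = nsq w -> z = w.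
Proof.
rewrite /nsq => z0 w0 e; rewrite e => /addrI /eqP; rewrite eqrXn2 // => /eqP E.
exact: complex_ext.
Qed.

(** The region [x ^+ 2 <= u] of the coordinates [(Re, nsq)] is convex, so every point of a chord
    lifts to the closed half-plane. *)
Lemma kl_ex z w s : 0 <= Im z -> 0 <= Im w -> 0 <= s <= 1 ->
  exists2 p, 0 <= Im p & kl z w s p.
Proof.
move=> z0 w0 /andP[s0 s1].
pose x := (1 - s) * Re z + s * Re w; pose u := (1 - s) * nsq z + s * nsq w.
have xu : x ^+ 2 <= u.
  rewrite /x /u /nsq -subr_ge0.
  have -> : (1 - s) * (Re z ^+ 2 + Im z ^+ 2) + s * (Re w ^+ 2 + Im w ^+ 2) - ((1 - s) * Re z + s * Re w) ^+ 2
   = (1 - s) * s * (Re z - Re w) ^+ 2 + (1 - s) * Im z ^+ 2 + s * Im w ^+ 2 by ring.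
  have s1' : 0 <= 1 - s by rewrite subr_ge0.
  by apply: addr_ge0; [apply: addr_ge0|]; apply: mulr_ge0; rewrite ?sqr_ge0 // mulr_ge0.
exists (x +i* Num.sqrt (u - x ^+ 2)); first exact: sqrtr_ge0.
by split => //; rewrite /nsq /= sqr_sqrtr ?subr_ge0 // addrC subrK.
Qed.

(** Strict convexity of the parabola: an inner point of a chord with distinct ends is not on it. *)
Lemma kl_HH z w s p : kl z w s p -> 0 <= Im z -> 0 <= Im w -> 0 < s < 1 -> z <> w -> 0 <= Im p -> HH p.
Proof.
move=> [K1 K2] z0 w0 /andP[s0 s1] zw p0; rewrite /HH /= lt_def p0 andbT; apply/eqP => E.
have : (1 - s) * s * (Re z - Re w) ^+ 2 + (1 - s) * Im z ^+ 2 + s * Im w ^+ 2 = 0.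
  have : nsq p - Re p ^+ 2 = 0 by rewrite /nsq E; ring.
  by rewrite K2 K1 /nsq => h; rewrite -[RHS]h; ring.
have s1' : 0 < 1 - s by rewrite subr_gt0.
have g1 : 0 <= (1 - s) * s * (Re z - Re w) ^+ 2 by rewrite mulr_ge0 ?sqr_ge0 // mulr_ge0 // ltW.
have g2 : 0 <= (1 - s) * Im z ^+ 2 by rewrite mulr_ge0 ?sqr_ge0 // ltW.
have g3 : 0 <= s * Im w ^+ 2 by rewrite mulr_ge0 ?sqr_ge0 // ltW.
move=> /eqP; rewrite paddr_eq0 ?(addr_ge0 g1 g2) // paddr_eq0 //.
rewrite !mulf_eq0 !(gt_eqF s0) !(gt_eqF s1') /= ?orbb ?sqrf_eq0 ?subr_eq0 ?orbb => /andP[/andP[/eqP h1 /eqP h2] /eqP h3].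
by apply: zw; apply: complex_ext => //; rewrite h2 h3.
Qed.

Lemma kl_HHi z w s p : kl z w s p -> HH z -> HH w -> 0 <= s <= 1 -> 0 <= Im p -> HH p.
Proof.
move=> [K1 K2] z0 w0 /andP[s0 s1] p0; rewrite /HH /= lt_def p0 andbT; apply/eqP => E.
have : (1 - s) * s * (Re z - Re w) ^+ 2 + (1 - s) * Im z ^+ 2 + s * Im w ^+ 2 = 0.
  have : nsq p - Re p ^+ 2 = 0 by rewrite /nsq E; ring.
  by rewrite K2 K1 /nsq => h; rewrite -[RHS]h; ring.
have s1' : 0 <= 1 - s by rewrite subr_ge0.
have z1 : 0 < Im z ^+ 2 by rewrite exprn_gt0.
have w1 : 0 < Im w ^+ 2 by rewrite exprn_gt0.
have h : 0 <= (1 - s) * s * (Re z - Re w) ^+ 2 by rewrite mulr_ge0 ?sqr_ge0 // mulr_ge0.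
by move: s1' s0 h z1 w1; move: (Im z ^+ 2) (Im w ^+ 2) => a b; nra.
Qed.

Lemma hconvex_kl (V : set C) z w s p : hconvex V -> V z -> V w -> 0 <= s <= 1 -> 0 <= Im p -> kl z w s p -> V p.
Proof.
move=> [VH cV] Vz Vw s01 p0 K; have Hz := VH _ Vz; have Hw := VH _ Vw.
have Hp := kl_HHi K Hz Hw s01 p0.
have [e|ne] := pselect (z = w).
  suff -> : p = z by [].
  case: K; rewrite -e => K1 K2; apply: nsq_inj => //; [exact: ltW|rewrite K1; ring|rewrite K2; ring].
by apply: (cV z w) => //; apply: gseg_kl K => //; exact: ltW.
Qed.

Lemma hconvexP (V : set C) : V `<=` @HH R ->
  (forall z w s p, V z -> V w -> HH p -> 0 <= s <= 1 -> kl z w s p -> V p) -> hconvex V.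
Proof.
move=> VH h; split => // z w Vz Vw p G; have [s s1 K] := gseg_sub G.
by apply: (h z w s p) => //; exact: gseg_HH G.
Qed.

Lemma hconvexI (V W : set C) : hconvex V -> hconvex W -> hconvex (V `&` W).
Proof.
move=> [h1 c1] [h2 c2]; split => [z [/h1]//|z w [Vz Wz] [Vw Ww] p G].
by split; [exact: c1 G|exact: c2 G].
Qed.

Lemma hconvex_Phi (q : cform R) : hconvex [set z | HH z /\ 0 <= Phi q z].
Proof.
apply: hconvexP => [z []//|z w s p [_ h1] [_ h2] Hp /andP[s0 s1] K]; split => //.
by rewrite (kl_Phi _ K) addr_ge0 // mulr_ge0 // subr_ge0.
Qed.

Definition circ (a r : R) p := (Re p - a) ^+ 2 + Im p ^+ 2 = r ^+ 2.

Definition carc (a r al be : R) : set C := [set p | [/\ HH p, circ a r p & al <= Re p <= be]].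

Definition cpt (a r x : R) : C := x +i* Num.sqrt (r ^+ 2 - (x - a) ^+ 2).

Lemma sq_between (a r x : R) : 0 <= r -> a - r <= x <= a + r -> 0 <= r ^+ 2 - (x - a) ^+ 2.
Proof. by move=> r0 /andP[h1 h2]; nra. Qed.

Lemma circ_cpt a r x : 0 <= r -> a - r <= x <= a + r -> circ a r (cpt a r x).
Proof. by move=> r0 h; rewrite /circ /= sqr_sqrtr ?sq_between // addrC subrK. Qed.

Lemma circ_between a r p : 0 <= r -> HH p -> circ a r p -> a - r < Re p < a + r.
Proof. by rewrite /circ /HH /= => r0 h1 h2; apply/andP; split; rewrite ltNge; apply/negP => h; nra. Qed.

Lemma circ_eq a r p q : 0 <= Im p -> 0 <= Im q -> circ a r p -> circ a r q -> Re p = Re q -> p = q.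
Proof.
rewrite /circ => p0 q0 cp cq E; apply: complex_ext => //; apply/eqP.
rewrite -(eqrXn2 (_ : 0 < 2)%N) //; apply/eqP.
by apply: (@addrI _ ((Re p - a) ^+ 2)); rewrite cp E cq.
Qed.

Lemma HH_cpt a r x : 0 < r -> a - r < x < a + r -> HH (cpt a r x).
Proof. by move=> r0 /andP[h1 h2]; rewrite /HH /= sqrtr_gt0; nra. Qed.

Lemma kl_circ a r z w s p : circ a r z -> circ a r w -> kl z w s p -> circ a r p.
Proof.
rewrite /circ => cz cw [K1 K2].
have -> : (Re p - a) ^+ 2 + Im p ^+ 2 = nsq p - 2 * a * Re p + a ^+ 2 by rewrite /nsq; ring.
rewrite K1 K2.
have -> : nsq z = r ^+ 2 + 2 * a * Re z - a ^+ 2 by rewrite -cz /nsq; ring.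
have -> : nsq w = r ^+ 2 + 2 * a * Re w - a ^+ 2 by rewrite -cw /nsq; ring.
by ring.
Qed.

Lemma circ_kl a r z w p : circ a r z -> circ a r w -> circ a r p -> Re w - Re z != 0 ->
  kl z w ((Re p - Re z) / (Re w - Re z)) p.
Proof.
rewrite /circ => cz cw cp n0.
have -> : kl z w ((Re p - Re z) / (Re w - Re z)) p = (Re p = (1 - ((Re p - Re z) / (Re w - Re z))) * Re z + ((Re p - Re z) / (Re w - Re z)) * Re w /\ 
  nsq p = (1 - ((Re p - Re z) / (Re w - Re z))) * nsq z + ((Re p - Re z) / (Re w - Re z)) * nsq w) by [].
split; first by field.
have -> : nsq z = r ^+ 2 + 2 * a * Re z - a ^+ 2 by rewrite -cz /nsq; ring.
have -> : nsq w = r ^+ 2 + 2 * a * Re w - a ^+ 2 by rewrite -cw /nsq; ring.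
have -> : nsq p = r ^+ 2 + 2 * a * Re p - a ^+ 2 by rewrite -cp /nsq; ring.
by field.
Qed.

Lemma gseg_arc a r z w : 0 <= r -> circ a r z -> circ a r w -> 0 <= Im z -> 0 <= Im w -> Re z < Re w ->
  gseg (Some z) (Some w) = carc a r (Re z) (Re w).
Proof.
move=> r0 cz cw z0 w0 zw.
have d0 : 0 < Re w - Re z by rewrite subr_gt0.
have dn : Re w - Re z != 0 by rewrite gt_eqF.
rewrite gsegE //; last by move=> e; move: zw; rewrite e ltxx.
rewrite eqEsubset; split => p.
  move=> [Hp [s /andP[s0 s1] K]]; split => //; first exact: kl_circ K.
  by case: K => -> _; apply/andP; split; nra.
move=> [Hp cp /andP[h1 h2]]; split => //; exists ((Re p - Re z) / (Re w - Re z)); last exact: (circ_kl cz cw cp dn).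
by rewrite divr_ge0 ?subr_ge0 ?(ltW zw) //= ler_pdivrMr // mul1r lerD2r.
Qed.

Lemma gseg_cl (x y : Chat) p : gseg x y p -> [/\ clH x, clH y & x <> None \/ y <> None].
Proof.
move=> [c [a [b [t [gc rx ry ab _]]]]].
have [g cE] := geodesicP gc; have {cE} cE : c = mob g \o @std_geodesic R by apply/funext => u; rewrite cE.
rewrite cE in rx ry.
have hc (e : \bar R) (u : Chat) : reaches (mob g \o @std_geodesic R) e u -> clH u.
  by case: u => [u|] // /vw_some[].
split; [exact: hc rx|exact: hc ry|].
case: x rx => [x|] rx; first by left.
case: y ry => [y|] ry; first by right.
have [n1 _ _] := vw_none rx; have [n2 _ _] := vw_none ry.
have [l1 [l2 [_ _ _ _ E3]]] := vw_comb g ab.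
by have := vw_gt0 g t; rewrite E3 n1 n2 !mulr0 addr0 ltxx.
Qed.

(** A segment determines its endpoints. An infinite endpoint would make the real part constant. For
    finite ones the range of real parts gives the real parts of the ends, and two inner points of
    the arc put the ends on the circle, as [f] is affine along the chord. *)
Lemma gseg_arc_inv a r al be (x y : Chat) : 0 < r -> a - r <= al -> al < be -> be <= a + r -> x <> y ->
  gseg x y = carc a r al be ->
  (x = Some (cpt a r al) /\ y = Some (cpt a r be)) \/ (y = Some (cpt a r al) /\ x = Some (cpt a r be)).
Proof.
move=> r0 h1 h2 h3 xy G.
have inn u : al < u -> u < be -> carc a r al be (cpt a r u).
  move=> u1 u2; split; last by rewrite /= (ltW u1) (ltW u2).
    by apply: HH_cpt => //; apply/andP; split; lra.
  by apply: circ_cpt; [exact: ltW|apply/andP; split; lra].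
pose u1 := (2 * al + be) / 3; pose u2 := (al + 2 * be) / 3.
have u11 : al < u1 by rewrite /u1; lra.
have u12 : u1 < u2 by rewrite /u1 /u2; lra.
have u22 : u2 < be by rewrite /u2; lra.
have g1 : gseg x y (cpt a r u1) by rewrite G; apply: inn => //; exact: lt_trans u22.
have g2 : gseg x y (cpt a r u2) by rewrite G; apply: inn => //; exact: lt_trans u12.
have [cx cy nn] := gseg_cl g1.
have ray z : gseg (Some z) None (cpt a r u1) -> gseg (Some z) None (cpt a r u2) -> False.
  move=> /gseg_ray_sub[_ /= e1 _] /gseg_ray_sub[_ /= e2 _].
  by move: u12; rewrite e1 e2 ltxx.
case: x xy G g1 g2 cx nn => [z|] xy G g1 g2 cz nn; last first.
  case: y xy G g1 g2 cy nn => [w|] xy G g1 g2 cw nn; last by case: nn.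
  by case: (ray w); rewrite gseg_sym.
case: y xy G g1 g2 cy nn => [w|] xy G g1 g2 cw nn; last by case: (ray z).
rewrite /= in cz cw; have zw : z <> w by move=> e; apply: xy; rewrite e.
have main z' w' : 0 <= Im z' -> 0 <= Im w' -> Re z' < Re w' -> gseg (Some z') (Some w') = carc a r al be ->
   z' = cpt a r al /\ w' = cpt a r be.
  move=> {}cz {}cw lt {}G.
  have zwn : z' <> w' by move=> e; move: lt; rewrite e ltxx.
  have d0 : 0 < Re w' - Re z' by rewrite subr_gt0.
  have R1 u : al < u -> u < be -> Re z' <= u <= Re w'.
    move=> ua ub; have : gseg (Some z') (Some w') (cpt a r u) by rewrite G; exact: inn.
    move=> /gseg_sub[s /andP[s0 s1] [/= -> _]]; apply/andP; split; nra.
  have R2 u : Re z' < u -> u < Re w' -> exists2 p, carc a r al be p & Re p = u /\ exists2 s, kl z' w' s p & 0 < s < 1.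
    move=> ua ub; pose s := (u - Re z') / (Re w' - Re z').
    have s0 : 0 < s by rewrite divr_gt0 // subr_gt0.
    have s1 : s < 1 by rewrite ltr_pdivrMr // mul1r ltrD2r.
    have [|p p0 K] := @kl_ex z' w' s cz cw; first by rewrite !ltW.
    have Hp : HH p by apply: kl_HH K _ _ _ _ _ => //; rewrite s0.
    exists p; first by rewrite -G; apply: gseg_kl K => //; rewrite !ltW.
    split; last by exists s => //; rewrite s0.
    by case: K => -> _; rewrite /s; field; rewrite gt_eqF.
  have za : Re z' = al.
    apply/eqP; rewrite eq_le; apply/andP; split.
      rewrite leNgt; apply/negP => h.
      have := R1 (Num.min ((al + Re z') / 2) ((al + be) / 2)).
      rewrite lt_min gt_min le_min => /(_ _ _)/andP[]; [lra|lra|].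
      by move=> /andP[? _]; lra.
    rewrite leNgt; apply/negP => h.
    have [||p [_ _ /andP[pa _]] [pe _]] := R2 (Num.min ((al + Re z') / 2) ((Re w' + Re z') / 2)).
      by rewrite lt_min; lra.
      by rewrite gt_min; lra.
    by move: pa; rewrite pe le_min; lra.
  have wb : Re w' = be.
    apply/eqP; rewrite eq_le; apply/andP; split; last first.
      rewrite leNgt; apply/negP => h.
      have := R1 (Num.max ((be + Re w') / 2) ((al + be) / 2)).
      rewrite gt_max lt_max ge_max => /(_ _ _)/andP[]; [lra|lra|].
      by move=> _ /andP[? _]; lra.
    rewrite leNgt; apply/negP => h.
    have [||p [_ _ /andP[_ pa]] [pe _]] := R2 (Num.max ((be + Re w') / 2) ((Re w' + Re z') / 2)).
      by rewrite lt_max; lra.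
      by rewrite gt_max; lra.
    by move: pa; rewrite pe ge_max; lra.
  have [||p [_ cp _] [pu [s [K1 K2] /andP[s0 s1]]]] := R2 u1; rewrite ?za ?wb //; first exact: lt_trans u22.
  have [||q [_ cq _] [qu [t [L1 L2] /andP[t0 t1]]]] := R2 u2; rewrite ?za ?wb //; first exact: lt_trans u12.
  pose f (v : C) := nsq v - 2 * a * Re v + a ^+ 2 - r ^+ 2.
  have fc v : circ a r v -> f v = 0 by rewrite /circ /f => <-; rewrite /nsq; ring.
  have fc' v : f v = 0 -> circ a r v by rewrite /circ /f => E; apply/eqP; rewrite -subr_eq0 -E /nsq; apply/eqP; ring.
  have E1 : (1 - s) * f z' + s * f w' = 0 by rewrite -[RHS](fc _ cp) /f K1 K2; ring.
  have E2 : (1 - t) * f z' + t * f w' = 0 by rewrite -[RHS](fc _ cq) /f L1 L2; ring.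
  have st : s - t != 0.
    rewrite subr_eq0; apply/eqP => e; move: u12; rewrite -pu -qu K1 L1 e ltxx //.
  have fz : f z' = 0.
    apply: (mulfI st); rewrite mulr0.
    have -> : (s - t) * f z' = s * ((1 - t) * f z' + t * f w') - t * ((1 - s) * f z' + s * f w') by ring.
    by rewrite E1 E2 !mulr0 subr0.
  have fw : f w' = 0.
    apply: (mulfI st); rewrite mulr0.
    have -> : (s - t) * f w' = (1 - t) * ((1 - s) * f z' + s * f w') - (1 - s) * ((1 - t) * f z' + t * f w') by ring.
    by rewrite E1 E2 !mulr0 subr0.
  split; apply: (@circ_eq a r) => //=; rewrite ?sqrtr_ge0 //; try exact: fc'.
    by apply: circ_cpt; [exact: ltW|apply/andP; split; lra].
  by apply: circ_cpt; [exact: ltW|apply/andP; split; lra].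
have [lt|gt|e] := ltgtP (Re z) (Re w).
- by left; have [-> ->] := main _ _ cz cw lt G.
- by right; rewrite gseg_sym in G; have [-> ->] := main _ _ cw cz gt G.
- move: g1 g2 => /gseg_sub[s _ [/= e1 _]] /gseg_sub[t _ [/= e2 _]].
  exfalso; move: u12; rewrite e1 e2 e -subr_gt0.
  by rewrite [X in 0 < X](_ : _ = 0) ?ltxx //; ring.
Qed.

End Convexity.

(** * Fuchsian groups with a cusp *)

Section Fuchsian.
Variables (R : realType) (Gamma : set (PSL2 R)).
Local Notation C := R[i].
Implicit Types (g h : PSL2 R) (z w p : C).

Lemma psl2_inv_entries g : exists2 s : R, s ^+ 2 = 1 &
  [/\ pa g^-1%g = s * pd g, pb g^-1%g = - (s * pb g), pc g^-1%g = - (s * pc g) & pd g^-1%g = s * pa g].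
Proof.
have D : pd g * pa g - (- pb g) * (- pc g) = 1 by rewrite -(pdet g); ring.
have [k [s s2 [Ea Eb Ec Ed]]] := psl2_mk D.
suff -> : g^-1%g = k by exists s => //; rewrite Ea Eb Ec Ed !mulrN.
have [t t2 [Fa Fb Fc Fd]] := psl2_mul_entries k g.
have [u u2 [Ga Gb Gc Gd]] := psl2_one_entries R.
have : (k * g)%g = 1%g.
  have E : (t * s * u) ^+ 2 = 1 by rewrite !exprMn t2 s2 u2 !mulr1.
  apply: (psl2_ext E); rewrite ?Fa ?Fb ?Fc ?Fd ?Ga ?Gb ?Gc ?Gd ?Ea ?Eb ?Ec ?Ed ?mulr0.
  - have -> : t * s * u * u = t * s * u ^+ 2 by ring.
    rewrite u2 -[RHS]mulr1 -{2}(pdet g); ring.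
  - by ring.
  - by ring.
  - have -> : t * s * u * u = t * s * u ^+ 2 by ring.
    rewrite u2 -[RHS]mulr1 -{2}(pdet g); ring.
by move=> /(congr1 (fun x => x * g^-1)%g); rewrite -mulgA mulgV mulg1 mul1g.
Qed.

Lemma sqr1_norm (s : R) : s ^+ 2 = 1 -> `|s| = 1.
Proof.
by move=> s2; apply/eqP; rewrite -(eqrXn2 (_ : 0 < 2)%N) // real_normK ?num_real // s2 expr1n.
Qed.

Hypothesis hF : is_fuchsian Gamma.

(** Discreteness at the identity, pulled back from the quotient topology to matrices; [s] selects
    the representative close to the identity matrix. *)
Lemma discrete1 : exists2 e : R, 0 < e & forall g (s : R), Gamma g -> s ^+ 2 = 1 ->
  `|s * pa g - 1| < e -> `|s * pb g| < e -> `|s * pc g| < e -> `|s * pd g - 1| < e -> g = 1%g.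
Proof.
have [G1 _ _ /(_ _ G1) nb] := hF.
have : nbhs (sl2_one R) [set M | Gamma (psl2_of M) -> psl2_of M = 1%g].
  by have := @pi_continuous _ (PSL2 R) (sl2_one R) _ nb.
move=> [_ [[W oW <-] W1 WV]].
have /nbhs_ballP[e /= e0 eW] : nbhs (1%:M : 'M[R]_2) W by exact: open_nbhs_nbhs.
exists e => // g s Gg s2 ha hb hc hd.
have I2 (k : 'I_2) : k = 0 \/ k = 1 by case: k => [[|[|//]] Hk]; [left|right]; apply/val_inj.
have main M : psl2_of M = g -> (forall i j, sl2_mx M i j = s * psl2_mx g i j) -> g = 1%g.
  move=> Mg ME; rewrite -Mg; apply: WV; last by rewrite Mg.
  apply: eW; split => // i j; rewrite -ball_normE /= distrC -/(sl2_mx M) ME.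
  by case: (I2 i) => ->; case: (I2 j) => ->; rewrite mxE /= ?subr0.
have /orP[/eqP s1|/eqP s1] : (s == 1) || (s == -1) by rewrite -eqf_sqr s2 expr1n.
  by apply: (main (repr g)); [exact: psl2_ofK|move=> i j; rewrite s1 mul1r].
have dN : \det (- sl2_mx (repr g)) = 1.
  by rewrite -(sl2_det (repr g)) !det22 !mxE; ring.
apply: (main (sl2_of dN)); last by move=> i j; rewrite s1 mulN1r mxE.
rewrite -[RHS](psl2_ofK g); apply/psl2_ofP.
by rewrite /pm_rel sl2_ofK eqxx orbT.
Qed.

Lemma Gamma1 : Gamma 1%g. Proof. by have [] := hF. Qed.
Lemma GammaM g h : Gamma g -> Gamma h -> Gamma (g * h)%g. Proof. by have [_ h1 _ _] := hF; exact: h1. Qed.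
Lemma GammaV g : Gamma g -> Gamma g^-1%g. Proof. by have [_ _ h1 _] := hF; exact: h1. Qed.

(** Pigeonhole: the entries are rounded to a grid of mesh [eta]. If [g] and [h] fall into the same
    cell, the entries of [g * h^-1] differ from those of the identity by sums of two products of a
    number below [eta] and one at most [m], hence by less than [e]. *)
Lemma bounded_finite (M : R) : finite_set [set g | Gamma g /\
  [/\ `|pa g| <= M, `|pb g| <= M, `|pc g| <= M & `|pd g| <= M]].
Proof.
have [e e0 He] := discrete1.
set A := (X in finite_set X).
pose m : R := `|M| + 1; have m1 : 1 <= m by rewrite lerDr.
have m0 : 0 < m by exact: lt_le_trans m1.
pose eta := e / (4 * m); have eta0 : 0 < eta by rewrite divr_gt0 // mulr_gt0.
pose fl (x : R) := Num.truncn ((x + m) / eta).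
pose N := (Num.truncn (2 * m / eta)).+1.
pose f g : 'I_N * 'I_N * 'I_N * 'I_N := (inord (fl (pa g)), inord (fl (pb g)), inord (fl (pc g)), inord (fl (pd g))).
have flP (x y : R) : `|x| <= M -> `|y| <= M -> (inord (fl x) : 'I_N) = inord (fl y) -> `|x - y| < eta.
  move=> xM yM.
  have b (t : R) : `|t| <= M -> 0 <= (t + m) / eta /\ (t + m) / eta <= 2 * m / eta.
    move=> tM; have : `|t| <= m by rewrite (le_trans tM) // (le_trans (ler_norm M)) // lerDl.
    rewrite ler_norml => /andP[t1 t2]; split; first by rewrite divr_ge0 ?(ltW eta0) //; lra.
    by rewrite ler_pM2r ?invr_gt0 //; lra.
  have lt t : `|t| <= M -> (fl t < N)%N.
    by move=> /b[_ h]; rewrite ltnS /fl le_truncn.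
  move=> /(congr1 val); rewrite /= !inordK ?lt // => E.
  have [bx _] := b _ xM; have [by_ _] := b _ yM.
  have /andP[x1 x2] := truncn_itv bx; have /andP[y1 y2] := truncn_itv by_.
  rewrite -/(fl x) -/(fl y) in x1 x2 y1 y2; rewrite E in x1 x2.
  have : `|(x + m) / eta - (y + m) / eta| < 1.
    by move: x1 x2 y1 y2; rewrite -natr1 ltr_norml; lra.
  rewrite -mulrBl normrM [`|eta^-1|]gtr0_norm ?invr_gt0 // ltr_pdivrMr // mul1r.
  by have -> : x + m - (y + m) = x - y by ring.
have finj : {in A &, injective f}.
  move=> g h; rewrite !inE => -[Gg [ga gb gc gd]] [Gh [ha hb hc hd]] [] /(flP _ _ ga ha) ea /(flP _ _ gb hb) eb /(flP _ _ gc hc) ec /(flP _ _ gd hd) ed.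
  have [s s2 [Ia Ib Ic Id]] := psl2_inv_entries h.
  have [t t2 [Pa Pb Pc Pd]] := psl2_mul_entries g h^-1%g.
  have ts : (t * s) ^+ 2 = 1 by rewrite exprMn t2 s2 mulr1.
  have D := pdet h.
  have bnd (x y u v : R) : `|x| < eta -> `|y| < eta -> `|u| <= M -> `|v| <= M -> `|x * u + y * v| < e.
    move=> hx hy hu hv; have um : `|u| <= m by rewrite (le_trans hu) // (le_trans (ler_norm M)) // lerDl.
    have vm : `|v| <= m by rewrite (le_trans hv) // (le_trans (ler_norm M)) // lerDl.
    rewrite (le_lt_trans (ler_normD _ _)) // !normrM.
    have h1 : `|x| * `|u| <= eta * m by rewrite ler_pM // ltW.
    have h2 : `|y| * `|v| <= eta * m by rewrite ler_pM // ltW.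
    have h3 : eta * m = e / 4 by rewrite /eta; field; rewrite gt_eqF.
    by rewrite (le_lt_trans (lerD h1 h2)) // h3 -mulrDl ltr_pdivrMr // -mulr2n -[e *+ 2]mulr_natr ltr_pM2l // ltr_nat.
  have tsts (x : R) : t * s * (t * (s * x)) = x.
    have -> : t * s * (t * (s * x)) = (t * s) ^+ 2 * x by ring.
    by rewrite ts mul1r.
  have nN (x : R) : `|- x| <= M -> `|x| <= M by rewrite normrN.
  have gh : (g * h^-1)%g = 1%g.
    apply: (He _ (t * s)) => //; first by apply: GammaM => //; exact: GammaV.
    - have -> : t * s * pa (g * h^-1)%g - 1 = (pa g - pa h) * pd h + (pb g - pb h) * (- pc h).
        rewrite Pa Ia Ic; have -> : t * s * (t * (pa g * (s * pd h) + pb g * - (s * pc h))) = (t * s) ^+ 2 * (pa g * pd h - pb g * pc h) by ring.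
        by rewrite ts mul1r -[X in _ - X]D; ring.
      by apply: bnd; rewrite ?normrN.
    - have -> : t * s * pb (g * h^-1)%g = (pa g - pa h) * (- pb h) + (pb g - pb h) * pa h.
        rewrite Pb Ib Id; have -> : t * s * (t * (pa g * - (s * pb h) + pb g * (s * pa h))) = (t * s) ^+ 2 * (- (pa g * pb h) + pb g * pa h) by ring.
        by rewrite ts; ring.
      by apply: bnd; rewrite ?normrN.
    - have -> : t * s * pc (g * h^-1)%g = (pc g - pc h) * pd h + (pd g - pd h) * (- pc h).
        rewrite Pc Ia Ic; have -> : t * s * (t * (pc g * (s * pd h) + pd g * - (s * pc h))) = (t * s) ^+ 2 * (pc g * pd h - pd g * pc h) by ring.
        by rewrite ts; ring.
      by apply: bnd; rewrite ?normrN.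
    - have -> : t * s * pd (g * h^-1)%g - 1 = (pc g - pc h) * (- pb h) + (pd g - pd h) * pa h.
        rewrite Pd Ib Id; have -> : t * s * (t * (pc g * - (s * pb h) + pd g * (s * pa h))) = (t * s) ^+ 2 * (- (pc g * pb h) + pd g * pa h) by ring.
        by rewrite ts mul1r -[X in _ - X]D; ring.
      by apply: bnd; rewrite ?normrN.
  by move: gh => /(congr1 (fun x => x * h)%g); rewrite -mulgA mulVg mulg1 mul1g.
have E := inj_card_eq finj.
by rewrite -(eq_finite_set E); exact: finite_finset.
Qed.

End Fuchsian.

Section Cusp.
Variables (R : realType) (Gamma : set (PSL2 R)).
Local Notation C := R[i].
Implicit Types (g h : PSL2 R) (z w p : C).
Hypothesis hF : is_fuchsian Gamma.
Hypothesis hC : cuspidal_infty Gamma.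

Lemma stabP g : stab_infty Gamma g <-> Gamma g /\ pc g = 0.
Proof.
rewrite /stab_infty /mobhat /= -/(pc g); split=> -[Gg]; first by case: eqVneq.
by move=> ->; rewrite eqxx.
Qed.

Lemma tr22 (A : 'M[R]_2) : \tr A = A 0 0 + A 1 1.
Proof. by rewrite /mxtrace !big_ord_recl big_ord0 addr0; congr (_ + A _ _); apply/val_inj. Qed.

Lemma cusp_translation : exists g, exists2 s : R, s ^+ 2 = 1 &
  [/\ Gamma g, pa g = s, pb g != 0, pc g = 0 & pd g = s].
Proof.
have [g /stabP[Gg c0] [g1 tr]] := hC; have D := pdet g; rewrite c0 mulr0 subr0 in D.
rewrite tr22 -/(pa g) -/(pd g) in tr.
have : (pa g + pd g) ^+ 2 = 4 by rewrite -real_normK ?num_real // tr; ring.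
move=> T.
have E : (pa g - pd g) ^+ 2 = 0.
  have -> : (pa g - pd g) ^+ 2 = (pa g + pd g) ^+ 2 - 4 * (pa g * pd g) by ring.
  by rewrite T D; ring.
have ad : pd g = pa g by move/eqP: E; rewrite sqrf_eq0 subr_eq0 => /eqP.
rewrite ad -expr2 in D.
exists g, (pa g) => //; split => //; apply/eqP => b0; apply: g1.
have [u u2 [Ga Gb Gc Gd]] := psl2_one_entries R.
apply: (@psl2_ext _ _ _ (pa g * u)); rewrite ?ad ?b0 ?c0 ?Ga ?Gb ?Gc ?Gd ?mulr0 //.
- by rewrite exprMn D u2 mulr1.
- by rewrite -mulrA -expr2 u2 mulr1.
- by rewrite -mulrA -expr2 u2 mulr1.
Qed.

Lemma expr_lt_small (q e : R) : 0 <= q -> q < 1 -> 0 < e -> exists n, q ^+ n < e.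
Proof.
move=> q0 q1 e0; have : (fun n => q ^+ n) @ \oo --> (0 : R) by apply: cvg_expr; rewrite ger0_norm.
move=> /cvgrPdist_lt /(_ e e0) [N _ /(_ N (leqnn N))] /=.
by rewrite sub0r normrN ger0_norm ?exprn_ge0 // => ?; exists N.
Qed.

(** Conjugating the translation [p] by [h] multiplies its length by [pa h ^+ 2]. If this factor is
    below 1, iteration yields nontrivial translations arbitrarily close to the identity, against
    discreteness; a factor above 1 is handled by the inverse. *)
Lemma stab_unipotent g : Gamma g -> pc g = 0 -> pa g ^+ 2 = 1.
Proof.
have [p [s s2 [Gp pa1 pb1 pc1 pd1]]] := cusp_translation.
have [e e0 He] := discrete1 hF.
have noc h : Gamma h -> pc h = 0 -> ~ (pa h ^+ 2 < 1).
  move=> Gh c0 a1; have D := pdet h; rewrite c0 mulr0 subr0 in D.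
  have a0 : pa h != 0 by apply/eqP => a0; move: D; rewrite a0 mul0r => /esym/eqP; rewrite oner_eq0.
  have conj n : exists k, exists2 u : R, u ^+ 2 = 1 &
      [/\ Gamma k, pa k = u, pb k = u * ((pa h ^+ 2) ^+ n * (s * pb p)), pc k = 0 & pd k = u].
    elim: n => [|n [k [u u2 [Gk ka kb kc kd]]]].
      exists p, s => //; split => //; rewrite expr0 mul1r mulrA -expr2 s2 mul1r //.
    have [t t2 [Ia Ib Ic Id]] := psl2_inv_entries h.
    have [v v2 [Pa Pb Pc Pd]] := psl2_mul_entries (h * k)%g h^-1%g.
    have [w w2 [Qa Qb Qc Qd]] := psl2_mul_entries h k.
    exists ((h * k) * h^-1)%g, (v * w * t * u); first by rewrite !exprMn v2 w2 t2 u2 !mulr1.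
    split.
    - by apply: GammaM => //; [exact: GammaM|exact: GammaV].
    - rewrite Pa Ia Ic c0 Qa Qb ka kc kb kd; rewrite -[RHS]mulr1 -D; ring.
    - rewrite Pb Ib Id Qa Qb ka kc kb kd [(pa h ^+ 2) ^+ n.+1]exprS.
      have -> : v * (w * (pa h * u + pb h * 0) * - (t * pb h) + w * (pa h * (u * ((pa h ^+ 2) ^+ n * (s * pb p))) + pb h * u) * (t * pa h))
         = v * w * t * u * (pa h ^+ 2 * (pa h ^+ 2) ^+ n * (s * pb p)) by ring.
      by [].
    - by rewrite Pc Ia Ic c0 Qc Qd kc c0 ka kb; ring.
    - rewrite Pd Ib Id Qc Qd c0 ka kb kc kd; rewrite -[RHS]mulr1 -D; ring.
  pose b : R := `|s * pb p|.
  have b0 : 0 < b by rewrite normr_gt0 mulf_neq0 // sqr1_neq0.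
  have [|n hn] := @expr_lt_small (pa h ^+ 2) (e / b) (sqr_ge0 _) a1; first by rewrite divr_gt0.
  have [k [u u2 [Gk ka kb kc kd]]] := conj n.
  have k1 : k = 1%g.
    apply: (He k u) => //; rewrite ?ka ?kc ?kd ?mulr0 ?normr0 // -?expr2 ?u2 ?subrr ?normr0 //.
    rewrite kb mulrA -expr2 u2 mul1r normrM (ger0_norm (exprn_ge0 n (sqr_ge0 (pa h)))) -/b.
    by rewrite -ltr_pdivlMr.
  have [v v2 [Ga Gb Gc Gd]] := psl2_one_entries R.
  move: kb; rewrite k1 Gb => /esym/eqP.
  by rewrite !mulf_eq0 (negPf (sqr1_neq0 u2)) !expf_eq0 /= (negPf a0) !andbF (negPf (sqr1_neq0 s2)) (negPf pb1).
move=> Gg c0; have D := pdet g; rewrite c0 mulr0 subr0 in D.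
have [t t2 [Ia Ib Ic Id]] := psl2_inv_entries g.
apply/eqP; rewrite eq_le; apply/andP; split; rewrite leNgt; apply/negP => h; last exact: (noc g).
apply: (noc g^-1%g); rewrite ?Ic ?c0 ?mulr0 ?oppr0 //; first exact: GammaV.
rewrite Ia exprMn t2 mul1r.
have : pa g ^+ 2 * pd g ^+ 2 = 1 by rewrite -exprMn D expr1n.
have d0 : 0 < pd g ^+ 2.
  rewrite lt_def sqr_ge0 andbT; apply/eqP => d0; have : (pa g * pd g) ^+ 2 = 0 by rewrite exprMn d0 mulr0.
  by rewrite D expr1n => /eqP; rewrite oner_eq0.
by move=> <-; rewrite ltr_pMl.
Qed.

(** The length of the translation [mob g] for [g] in the stabilizer of infinity: there
    [pd g ^+ 2 = 1], so the product equals [pb g / pd g], and it does not depend on the sign of the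
    matrix. *)
Definition tau g : R := pb g * pd g.

Lemma stab_d2 g : Gamma g -> pc g = 0 -> pd g = pa g.
Proof.
move=> Gg c0; have a2 := stab_unipotent Gg c0; have D := pdet g; rewrite c0 mulr0 subr0 in D.
by rewrite -[LHS]mul1r -a2 expr2 -mulrA D mulr1.
Qed.

Lemma stab_nd g z : Gamma g -> pc g = 0 -> nd g z = 1.
Proof.
by move=> Gg c0; rewrite /nd c0 !mul0r add0r expr0n addr0 (stab_d2 Gg c0) stab_unipotent.
Qed.

Lemma stab_mob g z : Gamma g -> pc g = 0 -> mob g z = (Re z + tau g) +i* Im z.
Proof.
move=> Gg c0; have n1 := stab_nd z Gg c0; rewrite mobE n1 ?oner_neq0 // !divr1.
apply: complex_ext => //=; rewrite c0 mul0r add0r mulr0 mul0r addr0 /tau (stab_d2 Gg c0).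
by rewrite mulrDl mulrAC -expr2 stab_unipotent // mul1r.
Qed.

Lemma stabM g h : Gamma g -> pc g = 0 -> Gamma h -> pc h = 0 ->
  [/\ Gamma (g * h)%g, pc (g * h)%g = 0 & tau (g * h)%g = tau g + tau h].
Proof.
move=> Gg cg Gh ch; have [s s2 [Ea Eb Ec Ed]] := psl2_mul_entries g h.
split; first exact: GammaM.
  by rewrite Ec cg ch mul0r mulr0 addr0 mulr0.
rewrite /tau Eb Ed cg mul0r add0r (stab_d2 Gg cg) (stab_d2 Gh ch).
have -> : s * (pa g * pb h + pb g * pa h) * (s * (pa g * pa h)) =
  s ^+ 2 * (pa g ^+ 2 * (pb h * pa h) + pa h ^+ 2 * (pb g * pa g)) by ring.
by rewrite s2 (stab_unipotent Gg cg) (stab_unipotent Gh ch) !mul1r addrC.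
Qed.

Lemma stabV g : Gamma g -> pc g = 0 -> [/\ Gamma g^-1%g, pc g^-1%g = 0 & tau g^-1%g = - tau g].
Proof.
move=> Gg cg; have [s s2 [Ea Eb Ec Ed]] := psl2_inv_entries g.
split; first exact: GammaV.
  by rewrite Ec cg mulr0 oppr0.
rewrite /tau Eb Ed (stab_d2 Gg cg).
have -> : - (s * pb g) * (s * pa g) = - (s ^+ 2 * (pb g * pa g)) by ring.
by rewrite s2 mul1r.
Qed.

Lemma width : exists2 t, Gamma t /\ pc t = 0 & 0 < tau t.
Proof.
have [p [s s2 [Gp pa1 pb1 pc1 pd1]]] := cusp_translation.
have t0 : tau p != 0 by rewrite /tau mulf_neq0 // pd1 sqr1_neq0.
have [h|h|h] := ltgtP 0 (tau p); last by rewrite -h eqxx in t0.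
  by exists p.
by have [G1 c1 T1] := stabV Gp pc1; exists p^-1%g => //; rewrite T1 oppr_gt0.
Qed.

Lemma translate_into : exists2 l : R, 0 < l & forall x, exists h, [/\ Gamma h, pc h = 0 & 0 <= x + tau h <= l].
Proof.
have [t [Gt ct] t0] := width; exists (tau t) => // x.
have mul n : exists h, [/\ Gamma h, pc h = 0 & tau h = tau t *+ n].
  elim: n => [|n [h [Gh ch Th]]]; last by exists (h * t)%g; have [] := stabM Gh ch Gt ct; rewrite Th mulrSr.
  have [s s2 [Ea Eb Ec Ed]] := psl2_one_entries R.
  by exists 1%g; split => //; [exact: Gamma1|rewrite /tau Eb mul0r].
have int (m : int) : exists h, [/\ Gamma h, pc h = 0 & tau h = m%:~R * tau t].
  case: m => n; have [h [Gh ch Th]] := mul n.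
    by exists h; rewrite Th -mulr_natl.
  have [h' [Gh' ch' Th']] := mul n.+1.
  have [G1 c1 T1] := stabV Gh' ch'; exists h'^-1%g; split => //.
  by rewrite T1 Th' NegzE mulrNz mulNr -mulr_natl.
have [h [Gh ch Th]] := int (- Num.floor (x / tau t)); exists h; split => //.
have tn : tau t != 0 by rewrite gt_eqF.
have /andP[f1 f2] := floor_itv (x / tau t).
rewrite Th mulrNz; have E : x = x / tau t * tau t by rewrite divfK.
have -> : x + - (Num.floor (x / tau t))%:~R * tau t = (x / tau t - (Num.floor (x / tau t))%:~R) * tau t.
  by rewrite mulrBl -E mulNr.
move: f2; rewrite intrD => f2; apply/andP; split.
  by rewrite mulr_ge0 ?(ltW t0) // subr_ge0.
by rewrite -[leRHS]mul1r ler_pM2r //; lra.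
Qed.

Lemma tau_min : exists2 e : R, 0 < e & forall g, Gamma g -> pc g = 0 -> `|tau g| < e -> g = 1%g.
Proof.
have [e e0 He] := discrete1 hF; exists e => // g Gg c0 te.
have a2 := stab_unipotent Gg c0.
apply: (He g (pa g)) => //; rewrite ?c0 ?(stab_d2 Gg c0) ?mulr0 ?normr0 // -?expr2 ?a2 ?subrr ?normr0 //.
by rewrite mulrC -(stab_d2 Gg c0).
Qed.

End Cusp.

(** * Neighbourhoods, connectedness of intervals, finiteness *)

Section NearLemmas.
Variable R : realType.
Local Notation C := R[i].

Lemma finite_near (T : Type) (F : set_system T) (I : choiceType) (S : set I) (P : I -> set T) :
  Filter F -> finite_set S -> (forall i, S i -> F (P i)) -> F [set x | forall i, S i -> P i x].
Proof.
move=> FF /finite_seqP[X ->]; elim: X => [|a X IH] H.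
  by apply: filterS filterT => x _ i.
have h1 : F (P a) by apply: H; rewrite /= mem_head.
have h2 : F [set x | forall i, [set` X] i -> P i x].
  by apply: IH => i /= iX; apply: H; rewrite /= inE iX orbT.
apply: filterS (filterI h1 h2) => x [Pa PX] i /=.
by rewrite inE => /orP[/eqP ->//|]; exact: PX.
Qed.

Lemma Phi_continuous (q : cform R) : continuous (Phi q).
Proof.
have cR : continuous (@complex.Re R : C -> R).
  move=> z V /nbhs_ballP[e /= e0 eV]; apply/nbhs_box; exists e => // w H _; apply: eV.
  by rewrite -ball_normE /= distrC.
have -> : Phi q = (fun w : C => q.1.1 * nsq w + q.1.2 * Re w + q.2) by [].
move=> z; apply: (cvgD (cvgD (cvgM (cvg_cst _) (@nsq_continuous R z)) (cvgM (cvg_cst _) (cR z))) (cvg_cst _)).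
Qed.

Lemma Phi_gt_near (q : cform R) p k : k < Phi q p -> \forall w \near p, k < Phi q w.
Proof.
move=> h; have := @Phi_continuous q p => /cvgrPdist_lt /(_ (Phi q p - k)).
rewrite subr_gt0 => /(_ h); apply: filterS => w; rewrite ltr_norml; lra.
Qed.

Lemma Phi_lt_near (q : cform R) p k : Phi q p < k -> \forall w \near p, Phi q w < k.
Proof.
move=> h; have := @Phi_continuous q p => /cvgrPdist_lt /(_ (k - Phi q p)).
rewrite subr_gt0 => /(_ h); apply: filterS => w; rewrite ltr_norml; lra.
Qed.

Lemma Im_near (p : C) k : k < Im p -> \forall w \near p, k < Im w.
Proof.
move=> h; apply/nbhs_box; exists (Im p - k); first by rewrite subr_gt0.
by move=> w _; rewrite ltr_norml; lra.
Qed.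

Lemma Re_near (p : C) e : 0 < e -> \forall w \near p, `|Re w - Re p| < e.
Proof. by move=> h; apply/nbhs_box; exists e => // w. Qed.

Lemma HH_near (p : C) : HH p -> \forall w \near p, HH w. Proof. exact: Im_near. Qed.

Lemma nd_Phi g (z : C) : nd g z = Phi (pc g ^+ 2, 2 * pc g * pd g, pd g ^+ 2) z.
Proof. by rewrite /nd /Phi /=; ring. Qed.

Lemma mob_near g (p : C) (V : set C) : HH p -> (\forall w \near mob g p, V w) -> \forall w \near p, V (mob g w).
Proof.
move=> Hp nV; have c : clH (Some p) by exact: ltW.
have := @mobhat_nbhs R g (Some p) (Some @` V) c; rewrite /mobhat (negPf (denom_neq0 g Hp)).
move=> /(_ (@one_point_compactification_some_nbhs _ _ _ nV)) H.
have H1 : \forall w \near p, HH w -> (Some @` V) (Some (mob g w)) := H.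
apply: filterS2 (HH_near Hp) H1 => w Hw /(_ Hw) [v Vv [<-]].
exact: Vv.
Qed.

(** Connectedness of an interval as an induction principle: a relatively open and closed property
    spreads from one end to the other. *)
Lemma clopen_seg (P : set R) a b : a <= b -> (forall t, a <= t <= b -> P t -> \forall s \near t, a <= s <= b -> P s) ->
  (forall t, a <= t <= b -> ~ P t -> \forall s \near t, a <= s <= b -> ~ P s) -> P a -> P b.
Proof.
move=> ab Po Pc Pa.
have key : [set t | `[a, b]%classic t /\ P t] = `[a, b]%classic.
  apply: (@segment_connected R a b).
  - by exists a; split => //=; rewrite in_itv /= lexx.
  - exists (interior [set s | a <= s <= b -> P s]); first exact: open_interior.
    rewrite eqEsubset; split=> t [tr Pt]; split => //; have tr' : a <= t <= b by move: tr; rewrite /= in_itv.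
      exact: Po.
    by move: Pt => /(@interior_subset _ _) /=; apply.
  - exists (closure [set s | a <= s <= b /\ P s]); first exact: closed_closure.
    rewrite eqEsubset; split=> t [tr Pt]; split => //; have tr' : a <= t <= b by move: tr; rewrite /= in_itv.
      by apply: subset_closure; split.
    apply: contrapT => nP.
    by have [s [[sr Ps] /(_ sr)]] := Pt _ (Pc t tr' nP).
have : `[a, b]%classic b by rewrite /= in_itv /= lexx ab.
by rewrite -key => -[].
Qed.

Lemma path_stay (phi : R -> C) (B : set C) a b : a <= b -> continuous phi ->
  (forall t, a <= t <= b -> B (phi t) -> nbhs (phi t) B) ->
  (forall t, a <= t <= b -> closure B (phi t) -> B (phi t)) -> B (phi a) -> B (phi b).
Proof.
move=> ab cphi Bi Bc Ba.
have key : [set t | `[a, b]%classic t /\ B (phi t)] = `[a, b]%classic.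
  apply: (@segment_connected R a b).
  - by exists a; split => //=; rewrite in_itv /= lexx.
  - exists (phi @^-1` (interior B)); first by apply: open_comp; [move=> x _; exact: cphi|exact: open_interior].
    rewrite eqEsubset; split=> t [tr Bt]; split => //; last exact: (@interior_subset _ B).
    by apply: Bi => //; move: tr; rewrite /= in_itv.
  - exists (phi @^-1` (closure B)); first by apply: closed_comp; [move=> x _; exact: cphi|exact: closed_closure].
    rewrite eqEsubset; split=> t [tr Bt]; split => //; first exact: subset_closure.
    by apply: Bc => //; move: tr; rewrite /= in_itv.
have : `[a, b]%classic b by rewrite /= in_itv /= lexx ab.
by rewrite -key => -[].
Qed.

Lemma seg_continuous (z w : C) : continuous (fun t : R => ((1 - t) * Re z + t * Re w) +i* ((1 - t) * Im z + t * Im w) : C).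
Proof.
move=> t V /nbhs_box[e e0 He].
have [M [M0 M1 M2]] : exists M : R, [/\ 0 < M, `|Re w - Re z| < M & `|Im w - Im z| < M].
  exists (`|Re w - Re z| + `|Im w - Im z| + 1); have := normr_ge0 (Re w - Re z); have := normr_ge0 (Im w - Im z).
  by move=> ? ?; split; lra.
have d0 : 0 < e / M by rewrite divr_gt0.
apply/(@nbhs_ballP _ R^o); exists (e / M) => // s /=; rewrite /ball /= => st.
have st' : `|s - t| < e / M by rewrite distrC.
have hh u : `|u| < M -> `|(s - t) * u| < e.
  move=> uM; rewrite normrM; move: st'; rewrite ltr_pdivlMr //; apply: le_lt_trans.
  by rewrite ler_wpM2l // ltW.
by apply: He => /=; [have -> : (1 - s) * Re z + s * Re w - ((1 - t) * Re z + t * Re w) = (s - t) * (Re w - Re z) by ring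
  | have -> : (1 - s) * Im z + s * Im w - ((1 - t) * Im z + t * Im w) = (s - t) * (Im w - Im z) by ring]; exact: hh.
Qed.

Lemma cont_C (f g : R -> R) : continuous f -> continuous g -> continuous (fun t => f t +i* g t : C).
Proof.
move=> cf cg t V /nbhs_box[e e0 He].
have h1 : \forall s \near t, `|f t - f s| < e by have /cvgrPdist_lt/(_ e e0) := cf t.
have h2 : \forall s \near t, `|g t - g s| < e by have /cvgrPdist_lt/(_ e e0) := cg t.
have : \forall s \near t, V (f s +i* g s).
  by near=> s; apply: He => /=; rewrite distrC; near: s.
by [].
Unshelve. all: by end_near. Qed.

Lemma finite_inj (T : choiceType) (U : Type) (f : T -> U) (S : set T) : finite_set (f @` S) ->
  (forall a b, S a -> S b -> f a = f b -> a = b) -> finite_set S.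
Proof.
move=> fin inj; have [->|/set0P[a0 Sa0]] := eqVneq S set0; first exact: finite_set0.
apply: sub_finite_set (finite_image (fun y => xget a0 [set a | S a /\ f a = y]) fin) => a Sa.
exists (f a); first by exists a.
by case: xgetP => [b -> [Sb e]|/(_ a) []] //; exact: inj.
Qed.

Lemma finite_repeat (T : Type) (S : set T) (s : nat -> T) : finite_set S -> (forall n, S (s n)) ->
  exists i j, (i < j)%N /\ s i = s j.
Proof.
move=> fin Ss; apply: contrapT => nn; apply: infinite_nat.
apply: (@finite_inj _ _ s); first by apply: sub_finite_set fin => _ [n _ <-].
move=> a b _ _ e; have [lt|gt|//] := ltngtP a b; case: nn; first by exists a, b.
by exists b, a.
Qed.

Lemma closure_near (V : set C) p (P : set C) : closure V p -> (\forall w \near p, P w) -> exists2 w, V w & P w.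
Proof. by move=> cV nP; have [w [Vw Pw]] := cV _ nP; exists w. Qed.

End NearLemmas.

(** * Convex polygons near the boundary of the plane *)

Section ConvexPolygon.
Variable R : realType.
Local Notation C := R[i].
Implicit Types (a b c p z w f g : C) (S V : set C).

Lemma nsq_near z (e : R) : 0 < e -> \forall w \near z, `|nsq w - nsq z| < e.
Proof.
move=> e0; have /cvgrPdist_lt/(_ e e0) := @nsq_continuous R z.
by apply: filterS => w; rewrite distrC.
Qed.

(** The chart [(Re, nsq)] is open at [f]: its coordinates can be perturbed independently without
    leaving [V]. *)
Lemma klein_box f (V : set C) : HH f -> nbhs f V -> exists2 d, 0 < d & forall x u : R,
  `|x - Re f| < d -> `|u - nsq f| < d -> exists p, [/\ V p, HH p, Re p = x & nsq p = u].
Proof.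
move=> Hf /nbhs_box[e e0 He]; have f0 : 0 < Im f by [].
pose M : R := 2 * `|Re f| + 2; have M0 : 0 < M by rewrite ltr_wpDl ?mulr_ge0.
have f2 : 0 < Im f ^+ 2 by rewrite exprn_gt0.
pose d : R := Num.min (Num.min 1 e) (Num.min (Im f ^+ 2 / (2 * M)) (e * Im f / M)).
have d0 : 0 < d by rewrite !lt_min ltr01 e0 !divr_gt0 ?mulr_gt0.
have [d1 de d2 d3] : [/\ d <= 1, d <= e, d * M <= Im f ^+ 2 / 2 & d * M <= e * Im f].
  have dM : d <= Im f ^+ 2 / (2 * M) by rewrite /d !ge_min lexx !orbT.
  have dN : d <= e * Im f / M by rewrite /d !ge_min lexx !orbT.
  split; try by rewrite /d !ge_min lexx ?orbT.
    have := ler_wpM2r (ltW M0) dM; have -> : Im f ^+ 2 / (2 * M) * M = Im f ^+ 2 / 2 by field; rewrite gt_eqF.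
    by [].
  have := ler_wpM2r (ltW M0) dN; have -> : e * Im f / M * M = e * Im f by field; rewrite gt_eqF.
  by [].
exists d; first exact: d0.
move=> x u xd ud.
have key : `|u - x ^+ 2 - Im f ^+ 2| < d * M.
  have -> : u - x ^+ 2 - Im f ^+ 2 = (u - nsq f) - (x - Re f) * (x - Re f + 2 * Re f) by rewrite /nsq; ring.
  apply: (le_lt_trans (ler_normB _ _)); rewrite normrM.
  have h1 : `|x - Re f + 2 * Re f| <= d + 2 * `|Re f|.
    apply: (le_trans (ler_normD _ _)); rewrite normrM (ger0_norm (_ : (0:R) <= 2)) //; lra.
  have h2 : `|x - Re f| * `|x - Re f + 2 * Re f| <= d * (d + 2 * `|Re f|) by apply: ler_pM => //; exact: ltW.
  have h3 : d * d <= d by rewrite -[leRHS]mulr1 ler_pM2l.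
  rewrite /M; nra.
have s0 : 0 < u - x ^+ 2 by move: key; rewrite ltr_norml => /andP[? ?]; lra.
pose p : C := x +i* Num.sqrt (u - x ^+ 2).
have p0 : 0 < Im p by rewrite /= sqrtr_gt0.
have pI : Im p ^+ 2 = u - x ^+ 2 by rewrite /= sqr_sqrtr // ltW.
exists p; split => //; last by rewrite /nsq pI /=; ring.
apply: He; first by exact: lt_le_trans xd de.
rewrite ltNge; apply/negP => ge.
have : `|Im p ^+ 2 - Im f ^+ 2| = `|Im p - Im f| * (Im p + Im f).
  have -> : Im p ^+ 2 - Im f ^+ 2 = (Im p - Im f) * (Im p + Im f) by ring.
  by rewrite normrM (gtr0_norm (addr_gt0 p0 f0)).
rewrite pI => E; move: key; rewrite E ltNge => /negP; apply.
apply: (le_trans d3); apply: ler_pM => //; [exact: ltW|exact: ltW|].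
by rewrite lerDr ltW.
Qed.

Variable F : set C.
Hypothesis Fo : open F.
Hypothesis Fc : hconvex F.

Let FH : F `<=` @HH R := Fc.1.

(** Replace [w] by a nearby [w'] in [F] and compensate by moving [f] to some [f'], still in [F] by
    openness, so that [p] divides the new chord in the same ratio. *)
Lemma open_segment f w s p : F f -> closureH F w -> 0 <= s < 1 -> HH p -> kl f w s p -> F p.
Proof.
move=> Ff [cw Hw] /andP[s0 s1] Hp [k1 k2]; have Hf := FH Ff.
have t0 : 0 < 1 - s by rewrite subr_gt0.
have nF : nbhs f F by apply: open_nbhs_nbhs.
have [d d0 Hd] := klein_box Hf nF.
have e0 : 0 < d * (1 - s) by rewrite mulr_gt0.
have [w' Fw' [w1 w2]] := closure_near cw (filterI (Re_near w e0) (nsq_near w e0)).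
have sd (a b : R) : `|a - b| < d * (1 - s) -> `|s * (b - a) / (1 - s)| < d.
  move=> h; rewrite normrM normfV (gtr0_norm t0) ltr_pdivrMr // normrM (ger0_norm s0) distrC.
  by apply: le_lt_trans h; rewrite ler_piMl // ltW.
have [f' [Ff' Hf' f1 f2]] : exists f', [/\ F f', HH f', Re f' = Re f + s * (Re w - Re w') / (1 - s) & nsq f' = nsq f + s * (nsq w - nsq w') / (1 - s)].
  have [||f' [? ? ? ?]] := Hd (Re f + s * (Re w - Re w') / (1 - s)) (nsq f + s * (nsq w - nsq w') / (1 - s)).
  - by rewrite addrAC subrr add0r; exact: sd.
  - by rewrite addrAC subrr add0r; exact: sd.
  - by exists f'.
apply: (hconvex_kl Fc Ff' Fw' (_ : 0 <= s <= 1)); first by rewrite s0 ltW.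
  by apply: ltW.
split.
  by rewrite k1 f1; field; rewrite gt_eqF.
by rewrite k2 f2; field; rewrite gt_eqF.
Qed.

(** An open convex set is the interior of its closure: prolong the chord from a point [f] of [F]
    slightly beyond [p], to a point of the closure, and apply [open_segment]. *)
Lemma interior_closure p : HH p -> nbhs p (closureH F) -> F p.
Proof.
move=> Hp np; have [cp _] : closureH F p by exact: nbhs_singleton np.
have [f Ff _] := closure_near cp (HH_near Hp).
have [d d0 Hd] := klein_box Hp np.
pose A : R := `|Re p - Re f| + `|nsq p - nsq f| + 1.
have A0 : 0 < A by rewrite ltr_wpDl ?addr_ge0.
pose e : R := d / A / 2; have e0 : 0 < e by rewrite !divr_gt0.
have eA : e * A < d.
  have -> : e * A = d / 2 by rewrite /e; field; rewrite gt_eqF.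
  by rewrite ltr_pdivrMr // ltr_pMr // ltr1n.
have sm (a : R) : `|a| <= A -> `|e * a| < d.
  move=> aA; rewrite normrM (gtr0_norm e0); apply: le_lt_trans eA.
  by rewrite ler_pM2l.
have [||w [cw Hw w1 w2]] := Hd (Re p + e * (Re p - Re f)) (nsq p + e * (nsq p - nsq f)).
- rewrite addrAC subrr add0r; apply: sm; rewrite /A; have := normr_ge0 (nsq p - nsq f); lra.
- rewrite addrAC subrr add0r; apply: sm; rewrite /A; have := normr_ge0 (Re p - Re f); lra.
have e1 : 0 < 1 + e by rewrite addr_gt0.
apply: (open_segment (s := (1 + e)^-1) Ff cw) => //.
  by rewrite invr_ge0 ltW //= invf_lt1 // ltrDl.
split; [rewrite w1|rewrite w2]; field; rewrite gt_eqF //.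
Qed.

Lemma bdFP p : boundaryH F p <-> closureH F p /\ ~ F p.
Proof.
have -> : boundaryH F p <-> closureH F p /\ ~ interior F p by [].
by split=> -[cp nF]; split => // h; apply: nF; [exact: open_nbhs_nbhs|exact: interior_subset h].
Qed.

Lemma side_through p : boundaryH F p -> exists2 S, is_side F S & S p.
Proof.
move=> bp; have Hp : HH p by case: bp => -[].
pose P := [set S | [/\ S `<=` boundaryH F, hconvex S & S = set0 \/ S p]].
have [S [[sb cS pS] mS]] : exists S, P S /\ forall B, S `<` B -> ~ P B.
  apply: Zorn_bigcup => FF FP tot; split.
  - by move=> x [S /FP[sb _ _] Sx]; exact: sb.
  - apply: hconvexP; first by move=> x [S /FP[sb _ _] Sx]; case: (sb _ Sx) => -[].
    move=> z w s q [S FS Sz] [S' FS' Sw] Hq sr K.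
    have big T : FF T -> T z -> T w -> (\bigcup_(X in FF) X) q.
      by move=> FT Tz Tw; exists T => //; have [_ cT _] := FP _ FT; apply: (hconvex_kl cT Tz Tw sr _ K); exact: ltW.
    by case: (tot S S' FS FS') => sub; [apply: (big S') => //; exact: sub|apply: (big S) => //; exact: sub].
  - have [[S [FS [x Sx]]]|none] := pselect (exists S, FF S /\ exists x, S x).
      right; exists S => //; have [_ _ [S0|//]] := FP _ FS; by rewrite S0 in Sx.
    left; rewrite -subset0 => x [S FS Sx]; apply: none; exists S; split => //; by exists x.
have sing : P [set p].
  split; [by move=> _ ->| |by right].
  apply: hconvexP; first by move=> _ ->.
  move=> z w s q -> -> Hq _ [K1 K2]; apply: nsq_inj; [exact: ltW|exact: ltW|rewrite K1; ring|rewrite K2; ring].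
have Sp : S p.
  case: pS => // S0; exfalso; apply: (mS [set p]) => //; rewrite S0; split => //.
  by move=> /(_ p erefl).
exists S => //; split => //; first by exists p.
move=> S' cS' sb' SS'; apply: contrapT => ne; apply: (mS S'); last by split => //; right; exact: SS'.
by split => // S'S; apply: ne; rewrite eqEsubset.
Qed.

(** The form vanishing on the geodesic line through [a] and [b], a two by two determinant in the
    coordinates [(Re, nsq)]. *)
Definition chord (a b : C) : cform R :=
  (Re b - Re a, - (nsq b - nsq a), (nsq b - nsq a) * Re a - (Re b - Re a) * nsq a).

Lemma chordE a b p : Phi (chord a b) p = (Re b - Re a) * (nsq p - nsq a) - (nsq b - nsq a) * (Re p - Re a).
Proof. by rewrite /Phi /chord /= -/(nsq p); ring. Qed.

Lemma chord_neq0 a b : HH a -> HH b -> a <> b -> Re b - Re a != 0 \/ nsq b - nsq a != 0.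
Proof.
move=> Ha Hb ab; have [e|] := eqVneq (Re b - Re a) 0; last by left.
right; apply/eqP => e2; apply: ab; apply: nsq_inj; try exact: ltW.
  by apply/esym/eqP; rewrite -subr_eq0 e.
by apply/esym/eqP; rewrite -subr_eq0 e2.
Qed.

Lemma chord_param a b p : HH a -> HH b -> a <> b -> Phi (chord a b) p = 0 ->
  exists t, Re p = Re a + t * (Re b - Re a) /\ nsq p = nsq a + t * (nsq b - nsq a).
Proof.
move=> Ha Hb ab; rewrite chordE => /eqP; rewrite subr_eq0 => /eqP E.
have [n|n] := chord_neq0 Ha Hb ab.
  exists ((Re p - Re a) / (Re b - Re a)); split; first by field.
  apply: (mulfI n); have -> : (Re b - Re a) * (nsq a + (Re p - Re a) / (Re b - Re a) * (nsq b - nsq a)) = (Re b - Re a) * nsq a + (nsq b - nsq a) * (Re p - Re a) by field.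
  by rewrite -E; ring.
exists ((nsq p - nsq a) / (nsq b - nsq a)); split; last by field.
apply: (mulfI n); have -> : (nsq b - nsq a) * (Re a + (nsq p - nsq a) / (nsq b - nsq a) * (Re b - Re a)) = (nsq b - nsq a) * Re a + (Re b - Re a) * (nsq p - nsq a) by field.
by rewrite E; ring.
Qed.

Lemma side_notin S a : is_side F S -> S a -> closureH F a /\ ~ F a.
Proof. by move=> [_ _ sb _] /sb /bdFP. Qed.

(** A point [f] of [F] on the line through [a] and [b] would either be between them, hence on the
    side, or beyond one of them, and then [open_segment] would put that one into [F]. *)
Lemma chord_nonzero S a b f : is_side F S -> S a -> S b -> a <> b -> F f -> Phi (chord a b) f != 0.
Proof.
move=> sS Sa Sb ab Ff; apply/eqP => E.
have [[ca nFa] [cb nFb]] := (side_notin sS Sa, side_notin sS Sb).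
have [Ha Hb] := (ca.2, cb.2); have Hf := FH Ff.
have [t [t1 t2]] := chord_param Ha Hb ab E.
have [lt|ge] := ltP t 0.
  apply: nFa; apply: (open_segment (s := - t / (1 - t)) Ff cb) => //.
    by apply/andP; split; [rewrite divr_ge0 //; lra|rewrite ltr_pdivrMr //; lra].
  have n : 1 - t != 0 by rewrite gt_eqF //; lra.
  by split; [rewrite t1|rewrite t2]; field.
have [le|gt] := leP t 1.
  have : S f.
    have [_ cS _ _] := sS; apply: (hconvex_kl (s := t) cS Sa Sb); [by rewrite ge le|exact: ltW|].
    by split; [rewrite t1|rewrite t2]; ring.
  by move=> /(side_notin sS)[].
apply: nFb; apply: (open_segment (s := (t - 1) / t) Ff ca) => //.
  have t0 : 0 < t by lra.
  by apply/andP; split; [rewrite divr_ge0 //; lra|rewrite ltr_pdivrMr //; lra].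
have n : t != 0 by rewrite gt_eqF //; lra.
by split; [rewrite t1|rewrite t2]; field.
Qed.

Lemma chord_sign S a b f g : is_side F S -> S a -> S b -> a <> b -> F f -> F g ->
  0 < Phi (chord a b) f -> 0 < Phi (chord a b) g.
Proof.
move=> sS Sa Sb ab Ff Fg pf; have nz := chord_nonzero sS Sa Sb ab Fg.
rewrite lt_def nz /= leNgt; apply/negP => ng.
set x := Phi _ f in pf; set y := Phi _ g in ng nz.
have xy : 0 < x - y by lra.
have sr : 0 <= x / (x - y) <= 1.
  by apply/andP; split; [rewrite divr_ge0 // ltW|rewrite ler_pdivrMr // mul1r; lra].
have [q q0 K] := kl_ex (ltW (FH Ff)) (ltW (FH Fg)) sr.
have Fq : F q by exact: hconvex_kl Fc Ff Fg sr q0 K.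
have := chord_nonzero sS Sa Sb ab Fq; rewrite (kl_Phi _ K) -/x -/y.
have -> : (1 - x / (x - y)) * x + x / (x - y) * y = 0 by field; rewrite gt_eqF.
by rewrite eqxx.
Qed.

(* A side is contained in a line: three non-aligned points of the boundary would
   span a triangle with interior points in [F]. *)
Lemma side_on_chord S a b c : is_side F S -> S a -> S b -> a <> b -> S c -> Phi (chord a b) c = 0.
Proof.
move=> sS Sa Sb ab Sc; apply/eqP/negPn/negP => nz.
have [_ cS _ _] := sS.
have [[ca _] [cb _] [cc _]] := And3 (side_notin sS Sa) (side_notin sS Sb) (side_notin sS Sc).
have [Ha Hb Hc] := And3 ca.2 cb.2 cc.2.
have half : 0 <= (2^-1 : R) <= 1 by rewrite invr_ge0 ler0n /= invf_le1 // ler1n.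
have third : 0 <= (3^-1 : R) <= 1 by rewrite invr_ge0 ler0n /= invf_le1 // ler1n.
have [m m0 Km] := kl_ex (ltW Ha) (ltW Hb) half.
have Sm : S m by exact: hconvex_kl cS Sa Sb half m0 Km.
have Hm := (side_notin sS Sm).1.2.
have [g g0 Kg] := kl_ex (ltW Hm) (ltW Hc) third.
have Sg : S g by exact: hconvex_kl cS Sm Sc third g0 Kg.
have [[cg Hg] _] := side_notin sS Sg.
(* Barycentric coordinates with respect to [a], [b], [c]. *)
set D := Phi (chord a b) c in nz.
have Dbc : Phi (chord b c) a = D by rewrite /D !chordE; ring.
have Dca : Phi (chord c a) b = D by rewrite /D !chordE; ring.
have third_val : [/\ Phi (chord a b) g / D = 3^-1, Phi (chord b c) g / D = 3^-1 & Phi (chord c a) g / D = 3^-1].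
  rewrite !(kl_Phi _ Kg) !(kl_Phi _ Km) Dbc Dca -/D.
  have zz u v : Phi (chord u v) u = 0 /\ Phi (chord u v) v = 0 by split; rewrite chordE; ring.
  rewrite (zz a b).1 (zz a b).2 (zz b c).1 (zz b c).2 (zz c a).1 (zz c a).2.
  by split; field.
have near_pos (q : cform R) : Phi q g / D = 3^-1 -> \forall w \near g, 0 < Phi q w / D.
  move=> E; have n : 0 < Phi (q.1.1 / D, q.1.2 / D, q.2 / D) g.
    have -> : Phi (q.1.1 / D, q.1.2 / D, q.2 / D) g = Phi q g / D by rewrite /Phi /=; field.
    by rewrite E invr_gt0.
  apply: filterS (Phi_gt_near n) => w.
  by have -> : Phi (q.1.1 / D, q.1.2 / D, q.2 / D) w = Phi q w / D by rewrite /Phi /=; field.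
have [t1 t2 t3] := third_val.
have [f Ff [f1 [f2 f3]]] := closure_near cg (filterI (near_pos _ t1) (filterI (near_pos _ t2) (near_pos _ t3))).
set lc := Phi (chord a b) f / D in f1; set la := Phi (chord b c) f / D in f2; set lb := Phi (chord c a) f / D in f3.
have sum1 : la + lb + lc = 1 by rewrite /la /lb /lc -!mulrDl !chordE /D chordE; rewrite /D chordE in nz; field.
have bary1 : Re f = la * Re a + lb * Re b + lc * Re c.
  rewrite /la /lb /lc !chordE /D chordE; rewrite /D chordE in nz; field; exact: nz.
have bary2 : nsq f = la * nsq a + lb * nsq b + lc * nsq c.
  rewrite /la /lb /lc !chordE /D chordE; rewrite /D chordE in nz; field; exact: nz.
have lab : 0 < la + lb by rewrite addr_gt0.
have sr : 0 <= lb / (la + lb) <= 1 by apply/andP; split; [rewrite divr_ge0 ?ltW|rewrite ler_pdivrMr // mul1r lerDr ltW].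
have [r r0 [K1 K2]] := kl_ex (ltW Ha) (ltW Hb) sr.
have Sr : S r by exact: hconvex_kl cS Sa Sb sr r0 (conj K1 K2).
have lcr : 0 <= lc <= 1 by rewrite (ltW f1) /=; lra.
have Sf : S f.
  apply: (hconvex_kl cS Sr Sc lcr); first exact: ltW (FH Ff).
  have e1 : 1 - lc = la + lb by lra.
  split; rewrite e1.
    by rewrite bary1 K1; field; rewrite gt_eqF.
  by rewrite bary2 K2; field; rewrite gt_eqF.
by have [_] := side_notin sS Sf.
Qed.

Lemma kl_path z w : HH z -> HH w -> exists phi : R -> C, [/\ continuous phi, phi 0 = z, phi 1 = w &
  forall s, 0 <= s <= 1 -> HH (phi s) /\ kl z w s (phi s)].
Proof.
move=> Hz Hw; have z0 : 0 < Im z by []. have w0 : 0 < Im w by [].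
pose x (t : R) : R := (1 - t) * Re z + t * Re w; pose u (t : R) : R := (1 - t) * nsq z + t * nsq w.
pose phi (t : R) : C := x t +i* Num.sqrt (u t - x t ^+ 2).
have ux t : 0 <= t <= 1 -> 0 <= u t - x t ^+ 2.
  move=> /andP[t0 t1]; have -> : u t - x t ^+ 2 = (1 - t) * Im z ^+ 2 + t * Im w ^+ 2 + (1 - t) * t * (Re z - Re w) ^+ 2 by rewrite /u /x /nsq; ring.
  have t1' : 0 <= 1 - t by rewrite subr_ge0.
  by apply: addr_ge0; [apply: addr_ge0|]; apply: mulr_ge0; rewrite ?sqr_ge0 ?mulr_ge0.
have Kp t : 0 <= t <= 1 -> kl z w t (phi t).
  by move=> tr; split; [by []|rewrite {1}/nsq /= sqr_sqrtr; [rewrite /u; ring|exact: ux]].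
have lin_cont (a b : R) : continuous (fun t : R => (1 - t) * a + t * b).
  move=> t; apply: cvgD; apply: cvgM; try exact: cvg_cst; last exact: cvg_id.
  by apply: cvgB; [exact: cvg_cst|exact: cvg_id].
exists phi; split.
- apply: cont_C; first exact: lin_cont.
  move=> t; apply: (@continuous_comp _ _ _ (fun t => u t - x t ^+ 2) Num.sqrt); last exact: sqrt_continuous.
  by apply: cvgB; [exact: lin_cont|rewrite /GRing.exp /=; apply: cvgM; exact: lin_cont].
- have r0 : 0 <= (0 : R) <= 1 by rewrite lexx ler01.
  by have [E1 E2] := Kp _ r0; apply: nsq_inj; [exact: sqrtr_ge0|exact: ltW|rewrite E1; ring|rewrite E2; ring].
- have r0 : 0 <= (1 : R) <= 1 by rewrite lexx ler01.
  by have [E1 E2] := Kp _ r0; apply: nsq_inj; [exact: sqrtr_ge0|exact: ltW|rewrite E1; ring|rewrite E2; ring].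
- move=> s sr; split; last exact: Kp.
  by apply: (kl_HHi (Kp s sr) Hz Hw sr); exact: sqrtr_ge0.
Qed.

Lemma form_nonzero_point (q : cform R) f (V : set C) : HH f -> nbhs f V -> q <> (0, 0, 0) -> exists2 p, V p & Phi q p != 0.
Proof.
move=> Hf nV q0; have [d d0 Hd] := klein_box Hf nV.
have PE p : Phi q p = q.1.1 * nsq p + q.1.2 * Re p + q.2 by [].
have d2 : 0 < d / 2 by rewrite divr_gt0.
have d2' : d / 2 < d by rewrite ltr_pdivrMr // ltr_pMr // ltr1n.
have n1 (x : R) : `|x - x| < d by rewrite subrr normr0.
have n2 (x : R) : `|x + d / 2 - x| < d by rewrite addrAC subrr add0r gtr0_norm.
apply: contrapT => none.
have van p : V p -> Phi q p = 0 by move=> Vp; apply: contrapT => /eqP n; apply: none; exists p.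
have [p0 [V0 _ r0 u0]] := Hd (Re f) (nsq f) (n1 _) (n1 _).
have [p1 [V1 _ r1 u1]] := Hd (Re f + d / 2) (nsq f) (n2 _) (n1 _).
have [p2 [V2 _ r2 u2]] := Hd (Re f) (nsq f + d / 2) (n1 _) (n2 _).
have := van _ V0; have := van _ V1; have := van _ V2; rewrite !PE r0 u0 r1 u1 r2 u2 => e2 e1 e0.
have b0 : q.1.2 = 0.
  apply: (mulIf (lt0r_neq0 d2)); rewrite mul0r -[RHS](subrr 0) -{1}e1 -e0; ring.
have a0 : q.1.1 = 0.
  apply: (mulIf (lt0r_neq0 d2)); rewrite mul0r -[RHS](subrr 0) -{1}e2 -e0; ring.
have c0 : q.2 = 0 by rewrite -e0 a0 b0; ring.
by apply: q0; rewrite [q]surjective_pairing [q.1]surjective_pairing a0 b0 c0.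
Qed.

Lemma generic_point (D : set (cform R)) : F !=set0 -> finite_set D -> (forall q, D q -> q <> (0, 0, 0)) ->
  exists2 f, F f & forall q, D q -> Phi q f != 0.
Proof.
move=> [f0 Ff0] /finite_seqP[X ->].
suff : forall V : set C, open V -> V `<=` F -> V f0 \/ V !=set0 -> (forall q, q \in X -> q <> (0, 0, 0)) ->
    exists2 f, V f & forall q, q \in X -> Phi q f != 0.
  by move=> H HD; have [|f Ff Hf] := H F Fo (fun _ h => h) (or_introl Ff0); [move=> q qX; exact: HD|exists f].
elim: X => [|q X IH] V oV VF nV HX.
  by case: nV => [Vf|[f Vf]]; [exists f0|exists f].
have [f Vf] : V !=set0 by case: nV => // Vf; exists f0.
have [||p Vp np] := @form_nonzero_point q f V (FH (VF _ Vf)).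
- exact: open_nbhs_nbhs.
- by apply: HX; rewrite mem_head.
have oW : open (V `&` [set w | Phi q w != 0]).
  apply: openI => //; have -> : [set w | Phi q w != 0] = ~` (Phi q @^-1` [set 0]) by rewrite eqEsubset; split=> w /= /eqP.
  by apply: closed_openC; apply: closed_comp; [move=> w _; exact: Phi_continuous|exact: closed_eq].
have [|||f' [Vf' nf'] H'] := IH _ oW.
- by move=> w [/VF].
- by right; exists p.
- by move=> r rX; apply: HX; rewrite inE rX orbT.
by exists f' => // r; rewrite inE => /orP[/eqP ->|]; [|exact: H'].
Qed.

(** From a point [f] of [F] walk towards a point [z] outside the closure. The path leaves [F] on
    some side, whose form is positive at [f] and zero at the exit; were it nonnegative at [z], it
    would be positive at the exit. A side that is a single point determines no line; [f] is chosen
    so that the path avoids these points. *)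
Lemma polygon_forms : F !=set0 -> finite_set (is_side F) ->
  exists Fs : set (cform R), finite_set Fs /\ forall p, closureH F p <-> HH p /\ forall q, Fs q -> 0 <= Phi q p.
Proof.
move=> nF fin; have [f0 Ff0] := nF.
pose good S (q : cform R) := is_side F S -> (forall f, F f -> 0 <= Phi q f) /\
  (forall a b, S a -> S b -> a <> b -> (forall f, F f -> 0 < Phi q f) /\ forall c, S c -> Phi q c = 0).
have [sf Hsf] : {sf : set C -> cform R & forall S, good S (sf S)}.
  apply: (@choice _ _ good) => S; have [sS|nS] := pselect (is_side F S); last by exists (0, 0, 0).
  have [[a [b [Sa Sb ab]]]|none] := pselect (exists a b, [/\ S a, S b & a <> b]); last first.
    (* For a side with a single point the zero form imposes no condition. *)
    exists (0, 0, 0) => _; split; first by move=> f _; rewrite /Phi /= !mul0r !addr0.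
    by move=> a b Sa Sb ab; case: none; exists a, b.
  have ba : b <> a by move=> e; exact: ab.
  have rev p : Phi (chord b a) p = - Phi (chord a b) p by rewrite !chordE; ring.
  have [lt|le] := ltP 0 (Phi (chord a b) f0).
    exists (chord a b) => _; have pos f (Ff : F f) := chord_sign sS Sa Sb ab Ff0 Ff lt.
    split; first by move=> f Ff; rewrite ltW // pos.
    by move=> x y Sx Sy xy; split; [exact: pos|move=> c Sc; exact: (side_on_chord sS Sa Sb ab Sc)].
  have lt : 0 < Phi (chord b a) f0.
    by rewrite rev oppr_gt0 lt_neqAle le andbT; exact: chord_nonzero sS Sa Sb ab Ff0.
  exists (chord b a) => _; have pos f (Ff : F f) := chord_sign sS Sb Sa ba Ff0 Ff lt.
  split; first by move=> f Ff; rewrite ltW // pos.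
  by move=> x y Sx Sy xy; split; [exact: pos|move=> c Sc; exact: (side_on_chord sS Sb Sa ba Sc)].
exists (sf @` is_side F); split; first exact: finite_image.
move=> z; split.
  move=> [cz Hz]; split => // _ [S sS <-]; rewrite leNgt; apply/negP => lt.
  have [f Ff] := closure_near cz (Phi_lt_near lt).
  by rewrite /= ltNge ((Hsf S sS).1 f Ff).
move=> [Hz pos]; apply: contrapT => ncz.
pose D := [set d | is_side F [set d]].
have fD : finite_set D.
  by apply: (@finite_inj _ _ (fun d : C => [set d])); [apply: sub_finite_set fin => _ [d Dd <-]|move=> a b _ _ e; have : [set b] a by rewrite -e].
have zd d : D d -> d <> z by move=> Dd e; apply: ncz; rewrite -e; have [] := side_notin Dd (erefl d : [set d] d).
(* The start is taken off the finitely many lines joining [z] to the one-point sides. *)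
have [|||f Ff Hf] := @generic_point ((fun d => chord z d) @` D).
- exact: nF.
- exact: finite_image.
- move=> _ [d Dd <-] [e1 e2 _]; have Hd := (side_notin Dd (erefl d : [set d] d)).1.2.
  have zd' : z <> d by move=> e; exact: (zd d Dd).
  have [] := chord_neq0 Hz Hd zd'; first by rewrite e1 eqxx.
  by rewrite -oppr_eq0 e2 eqxx.
have Hff := FH Ff.
have [phi [cphi p0 p1 Hphi]] := kl_path Hff Hz.
have [s sr bs] : exists2 s, 0 <= s <= 1 & boundaryH F (phi s).
  apply: contrapT => none; apply: ncz; rewrite -p1; suff Fz : F (phi 1).
    by split; [exact: subset_closure|rewrite p1].
  apply: (@path_stay R phi F 0 1) => //; last by rewrite p0.
    by move=> t _ Ft; exact: open_nbhs_nbhs.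
  move=> t tr ct; apply: contrapT => nFt; apply: none; exists t => //.
  by apply/bdFP; split => //; split => //; exact: (Hphi t tr).1.
have [Hp K] := Hphi s sr; have [S sS Sp] := side_through bs.
have [cp _] := side_notin sS Sp.
have s1 : 1 - s != 0.
  apply/eqP => e; apply: ncz; have -> : z = phi s; last by [].
  by have -> : s = 1 by lra.
have s1' : 0 < 1 - s by rewrite lt_def s1 subr_ge0; case/andP: sr.
have [[b [Sb pb]]|none] := pselect (exists b, S b /\ phi s <> b).
  have [Hpos Hz0] := (Hsf S sS).2 _ _ Sp Sb pb.
  have := Hz0 _ Sp; rewrite (kl_Phi _ K) => /eqP; apply/negP; rewrite gt_eqF //.
  rewrite ltr_pwDl //; first by rewrite mulr_gt0 // Hpos.
  by rewrite mulr_ge0 //; [case/andP: sr|apply: pos; exists S].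
have SE : S = [set phi s].
  rewrite eqEsubset; split=> [c Sc|_ ->] //; apply: contrapT => n; apply: none; exists c; split => // e; exact: n.
have Dp : D (phi s) by rewrite /D /= -SE.
have zz : Phi (chord z (phi s)) z = 0 /\ Phi (chord z (phi s)) (phi s) = 0 by split; rewrite chordE; ring.
have := zz.2; rewrite (kl_Phi _ K) zz.1 mulr0 addr0 => /eqP; rewrite mulf_eq0 (negbTE s1) /=; apply/negP.
by apply: Hf; exists (phi s).
Qed.

End ConvexPolygon.

(** * Half-planes and cusp-like ends of a polygon *)

Section CuspRegion.
Variable R : realType.
Local Notation C := R[i].
Implicit Types (q : cform R) (m z w : C).

(** Far out inside the parabola [x ^+ 2 < u] an affine function has constant sign, decided by the
    first nonzero coefficient among [a], [b], [c]. *)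
Lemma quadratic_sign (a b c : R) : exists2 K0 : R, 0 < K0 &
  [\/ forall x u, K0 < x -> x ^+ 2 < u -> 0 <= a * u + b * x + c |
      forall x u, K0 < x -> x ^+ 2 < u -> a * u + b * x + c < 0].
Proof.
have key (A B G : R) : 0 < A -> exists2 K0 : R, 0 < K0 & forall x u, K0 < x -> x ^+ 2 < u -> 0 < A * u + B * x + G.
  move=> A0; exists (1 + (`|B| + `|G|) / A); first by rewrite ltr_pwDl // divr_ge0 ?addr_ge0 // ltW.
  move=> x u xK xu; set t := (`|B| + `|G|) / A in xK.
  have t0 : 0 <= t by rewrite divr_ge0 ?addr_ge0 // ltW.
  have At : A * t = `|B| + `|G| by rewrite /t; field; rewrite gt_eqF.
  have x1 : 1 < x by lra.
  have h1 : x * t <= x ^+ 2 by rewrite expr2 ler_pM2l; lra.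
  have h2 : A * (x * t) <= A * x ^+ 2 by rewrite ler_pM2l.
  have h3 : A * x ^+ 2 < A * u by rewrite ltr_pM2l.
  have h4 : A * (x * t) = x * `|B| + x * `|G| by rewrite mulrCA At; ring.
  have h5 : - (x * `|B|) <= B * x.
    have : - `|B| <= B by rewrite lerNl -normrN ler_norm.
    by rewrite -(ler_pM2r (lt_trans ltr01 x1)); lra.
  have h6 : - `|G| <= G by rewrite lerNl -normrN ler_norm.
  have h7 : `|G| <= x * `|G| by rewrite ler_peMl // ltW.
  lra.
have key1 (B G : R) : 0 < B -> exists2 K0 : R, 0 < K0 & forall x, K0 < x -> 0 < B * x + G.
  move=> B0; exists (1 + `|G| / B); first by rewrite ltr_pwDl // divr_ge0 // ltW.
  move=> x xK; have h : B * (`|G| / B) = `|G| by field; rewrite gt_eqF.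
  have : B * (`|G| / B) < B * x by rewrite ltr_pM2l //; lra.
  have : - `|G| <= G by rewrite lerNl -normrN ler_norm.
  lra.
have [a0|a0|a0] := ltgtP a 0.
- have na : 0 < - a by lra.
  have [K K0 H] := key _ (- b) (- c) na; exists K => //; right=> x u xK xu.
  by have := H x u xK xu; lra.
- by have [K K0 H] := key _ b c a0; exists K => //; left=> x u xK xu; exact: ltW (H x u xK xu).
have [b0|b0|b0] := ltgtP b 0.
- have nb : 0 < - b by lra.
  have [K K0 H] := key1 _ (- c) nb; exists K => //; right=> x u xK _.
  by have := H x xK; rewrite a0; lra.
- by have [K K0 H] := key1 _ c b0; exists K => //; left=> x u xK _; have := H x xK; rewrite a0; lra.
exists 1 => //; have [c0|c0] := ltP c 0; [right|left] => x u _ _; rewrite a0 b0; lra.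
Qed.

Lemma sqr_lt_nsq m : HH m -> Re m ^+ 2 < Re m ^+ 2 + Im m ^+ 2.
Proof. by move=> Hm; rewrite ltrDl exprn_gt0. Qed.

(* Far from the imaginary axis a finite intersection of half-planes either is
   empty or contains a half-plane bounded by a vertical line. *)
Lemma cusp_region (Psi : set (cform R)) : finite_set Psi -> exists2 K : R, 0 < K &
  forall m, HH m -> (forall q, Psi q -> 0 <= Phi q m) ->
  `|Re m| <= K \/ exists2 r : cform R, 0 < Phi r m & forall w, HH w -> 0 < Phi r w -> forall q, Psi q -> 0 <= Phi q w.
Proof.
move=> fin.
have one q : \forall K \near +oo%R, forall s m w, s ^+ 2 = 1 -> HH m -> HH w -> K < s * Re m -> K < s * Re w -> 0 <= Phi q m -> 0 <= Phi q w.
  have side s : s ^+ 2 = 1 -> exists2 K0 : R, 0 < K0 & forall m w, HH m -> HH w -> K0 < s * Re m -> K0 < s * Re w -> 0 <= Phi q m -> 0 <= Phi q w.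
    move=> s1; have [K0 K00 H] := quadratic_sign q.1.1 (s * q.1.2) q.2.
    have E z : Phi q z = q.1.1 * (Re z ^+ 2 + Im z ^+ 2) + s * q.1.2 * (s * Re z) + q.2.
      by rewrite /Phi; congr (_ + _ + _); rewrite -[LHS]mul1r -s1; ring.
    have E2 z : HH z -> (s * Re z) ^+ 2 < Re z ^+ 2 + Im z ^+ 2 by move=> Hz; rewrite exprMn s1 mul1r sqr_lt_nsq.
    exists K0 => // m w Hm Hw mK wK; rewrite !E.
    case: H => H; first by move=> _; apply: H => //; exact: E2.
    by rewrite leNgt (H _ _ mK (E2 _ Hm)).
  have [K1 K10 H1] := side 1 (expr1n _ _).
  have [K2 K20 H2] := side (-1) (sqrr_sign _ 1).
  near=> K => s m w s1 Hm Hw; have : s = 1 \/ s = -1.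
    by have /eqP := s1; rewrite sqrf_eq1 => /orP[]/eqP; [left|right].
  have k1 : K1 <= K by near: K; apply: nbhs_pinfty_ge; rewrite num_real.
  have k2 : K2 <= K by near: K; apply: nbhs_pinfty_ge; rewrite num_real.
  case=> -> mK wK; [apply: H1 | apply: H2] => //; exact: le_lt_trans mK || exact: le_lt_trans wK.
have all := finite_near (_ : Filter (+oo%R : set_system R)) fin (fun q _ => one q).
have [K [K0 HK]] : exists K : R, 0 < K /\ forall q, Psi q -> forall s m w, s ^+ 2 = 1 -> HH m -> HH w -> K < s * Re m -> K < s * Re w -> 0 <= Phi q m -> 0 <= Phi q w.
  have [K [K0 HK]] := filter_ex (filterI (nbhs_pinfty_gt (num_real (0 : R))) (all _)).
  by exists K.
exists K => // m Hm Pm; have [le|gt] := leP `|Re m| K; [by left|right].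
have [s s1 sm] : exists2 s : R, s ^+ 2 = 1 & K < s * Re m.
  have [ge|lt] := leP 0 (Re m); [exists 1 | exists (-1)]; rewrite ?expr1n ?sqrrN ?expr1n //.
    by rewrite mul1r; rewrite ger0_norm in gt.
  by rewrite mulN1r; rewrite ltr0_norm in gt.
have E w : Phi (0, s, - K) w = s * Re w - K by rewrite /Phi /=; ring.
exists (0, s, - K); first by rewrite E subr_gt0.
move=> w Hw; rewrite E subr_gt0 => sw q Pq; exact: (HK q Pq s m w s1 Hm Hw sm sw (Pm q Pq)).
Unshelve. all: by end_near.
Qed.

End CuspRegion.

Section LowPoints.
Variable R : realType.
Local Notation C := R[i].
Implicit Types (q : cform R) (m z w : C).
Variable V : set C.
Variable Psi : set (cform R).
Hypothesis fin : finite_set Psi.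
Hypothesis VE : forall p, V p <-> HH p /\ forall q, Psi q -> 0 <= Phi q p.

Definition in_half_plane p := exists2 r : cform R, 0 < Phi r p & forall w, HH w -> 0 < Phi r w -> V w.

(** The same alternative as [cusp_region], seen from the boundary point that [g] sends to
    infinity. *)
Lemma cusp_region_at (g : PSL2 R) : exists2 K : R, 0 < K & forall p, V p -> `|Re (mob g p)| <= K \/ in_half_plane p.
Proof.
have ff : finite_set ((fun q => fmob q g^-1%g) @` Psi) by exact: finite_image.
have [K K0 H] := cusp_region ff; exists K => // p Vp.
have [Hp Pp] := (VE p).1 Vp; have Hm : HH (mob g p) by exact: HH_mob.
have tr q w : HH w -> (0 <= Phi (fmob q g^-1%g) w) = (0 <= Phi q (mob g^-1%g w)).
  by move=> Hw; rewrite -Phi_mob // pmulr_lge0 // nd_gt0.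
have [|le|[r r0 Hr]] := H (mob g p) Hm; [|by left|right].
  by move=> _ [q Pq <-]; rewrite tr // mobK //; exact: Pp.
exists (fmob r g); first by rewrite -Phi_mob // mulr_gt0 // nd_gt0.
move=> w Hw; rewrite -Phi_mob // pmulr_lgt0 ?nd_gt0 // => rw.
apply/VE; split => // q Pq.
have := Hr _ (HH_mob g Hw) rw (fmob q g^-1%g); rewrite tr ?mobK //; last exact: HH_mob.
by apply; exists q.
Qed.

(** Here [g] is the map [z -> -1 / (z - x)]. A bounded real part of the image means
    [|Re p - x| <= K * nd g p]; within distance [d = 1 / (2 K)] of [x] this gives
    [|Re p - x| <= Im p], so [nd g p <= 2 * Im p ^+ 2] and the image is high. *)
Lemma low_near x : exists g : PSL2 R, exists2 K : R, 0 < K & exists2 d : R, 0 < d &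
  forall p, V p -> `|Re p - x| < d -> Im p < d ->
    in_half_plane p \/ `|Re (mob g p)| <= K /\ (2 * Im p)^-1 <= Im (mob g p).
Proof.
have [g [nE rE _]] := @psl2_mkP R 0 (-1) 1 (- x) ltac:(ring).
have [K K0 HK] := cusp_region_at g.
have K2 : 0 < 2 * K by lra.
exists g, K => //; exists (2 * K)^-1; first by rewrite invr_gt0.
move=> p Vp xd yd; have [le|] := HK p Vp; [right; split => //|by left].
have [Hp _] := (VE p).1 Vp; have y0 : 0 < Im p by [].
have n0 := nd_gt0 g Hp; have nE' : nd g p = (Re p - x) ^+ 2 + Im p ^+ 2 by rewrite nE; ring.
set n := nd g p in n0 nE'.
have Kd : 2 * K * (2 * K)^-1 = 1 by rewrite mulfV // gt_eqF.
have le' : `|Re p - x| <= K * n.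
  move: le; rewrite rE // -/n.
  have -> : (0 * Re p + -1) * (1 * Re p + - x) + 0 * 1 * Im p ^+ 2 = - (Re p - x) by ring.
  by rewrite normrM normrN (gtr0_norm (x := n^-1)) ?invr_gt0 // ler_pdivrMr.
set t := `|Re p - x| in xd le'; have t0 : 0 <= t by exact: normr_ge0.
have nt : n = t ^+ 2 + Im p ^+ 2 by rewrite nE' /t real_normK // num_real.
set e := (2 * K)^-1 in xd yd Kd.
have h1 : 2 * K * t <= 1 by rewrite -[leRHS]Kd; apply: ler_wpM2l; exact: ltW.
have h2 : t * (2 * K * t) <= t * 1 by rewrite ler_wpM2l.
have h3 : t <= 2 * K * Im p ^+ 2 by move: le'; rewrite nt; lra.
have h4 : 2 * K * t * t <= 2 * K * t * (2 * K * Im p ^+ 2) by rewrite ler_wpM2l // mulr_ge0 // ltW.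
have h5 : 2 * K * t * Im p ^+ 2 <= 1 * Im p ^+ 2 by rewrite ler_wpM2r // sqr_ge0.
have h6 : t * t <= Im p ^+ 2.
  rewrite -(ler_pM2l K2); lra.
have ny : n <= 2 * Im p ^+ 2 by rewrite nt expr2; lra.
rewrite Im_mob // -/n ler_pdivlMr // mulrC ler_pdivrMr ?mulr_gt0 //.
by move: ny; rewrite expr2; lra.
Qed.

(** Compactness: finitely many of the charts of [low_near] suffice for real parts in [[- K, K]], and
    beyond that interval [cusp_region_at] already provides a half-plane. *)
Lemma low_points : exists (L : seq (PSL2 R * R)) (y0 : R), 0 < y0 /\ forall p, V p -> Im p < y0 ->
  in_half_plane p \/ exists2 l, l \in L & `|Re (mob l.1 p)| <= l.2 /\ (2 * Im p)^-1 <= Im (mob l.1 p).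
Proof.
have [K K0 HK] := cusp_region_at 1%g.
pose good (L : seq (PSL2 R * R)) p := in_half_plane p \/ exists2 l, l \in L & `|Re (mob l.1 p)| <= l.2 /\ (2 * Im p)^-1 <= Im (mob l.1 p).
have goodL L L' p : {subset L <= L'} -> good L p -> good L' p.
  by move=> s [h|[l lL h]]; [left|right; exists l => //; exact: s].
pose P (b : R) := exists (L : seq (PSL2 R * R)) (y0 : R), 0 < y0 /\ forall p, V p -> Im p < y0 -> - K <= Re p <= b -> good L p.
have loc x : exists2 d : R, 0 < d & forall b b', `|b - x| < d -> `|b' - x| < d -> P b -> P b'.
  have [g [k k0 [d d0 H]]] := low_near x; exists d => // b b' bx b'x [L [y0 [y00 HL]]].
  exists ((g, k) :: L), (Num.min y0 d); split; first by rewrite lt_min y00.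
  move=> p Vp; rewrite lt_min => /andP[py pd] /andP[p1 p2].
  have [le|gt] := leP (Re p) b.
    by apply: goodL (HL p Vp py _); [move=> l lL; rewrite inE lL orbT|rewrite p1 le].
  have [|h|h] := H p Vp _ pd; [|by left|right; exists (g, k) => //; exact: mem_head].
  move: bx b'x; rewrite !ltr_norml => /andP[? ?] /andP[? ?]; apply/andP; split; lra.
have PK : P K.
  have KK' : - K <= K by lra.
  have lc x : \forall s \near x, P x <-> P s.
    have [d d0 H] := loc x; apply/nbhs_ballP; exists d => //= s; rewrite /ball /= distrC => sx.
    by split; apply: H; rewrite // subrr normr0.
  apply: (@clopen_seg R P (- K) K KK').
  - by move=> t _ Pt; apply: filterS (lc t) => s [h _] _; exact: h.
  - by move=> t _ Pt; apply: filterS (lc t) => s [_ h] _ Ps; exact: Pt (h Ps).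
  have [g [k k0 [d d0 H]]] := low_near (- K).
  exists [:: (g, k)], d; split => // p Vp pd /andP[p1 p2].
  have [|h|h] := H p Vp _ pd; [|by left|right; exists (g, k) => //; exact: mem_head].
  by have -> : Re p = - K; [lra|rewrite subrr normr0].
have [L [y0 [y00 H]]] := PK; exists L, y0; split => // p Vp py.
have [le|h] := HK p Vp; last by left.
by apply: H => //; rewrite mob1 ler_norml in le.
Qed.

End LowPoints.

(** * Covering a square by small squares *)

Section SquareCover.
Variable R : realType.

Let area : set (R * R) -> \bar R := (@lebesgue_measure R \x @lebesgue_measure R)%E.

Lemma area_square (a b w : R) : 0 <= w -> area (`[a, a + w] `*` `[b, b + w]) = (w ^+ 2)%:E.
Proof.
move=> w0; rewrite /area product_measure1E //.
have len (c : R) : lebesgue_measure `[c, c + w] = w%:E.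
  rewrite lebesgue_measure_itv /= lte_fin ltrDl; case: ltgtP w0 => // [w0|<-] _ //.
  by rewrite -EFinB (addrC c) addrK.
by rewrite expr2 EFinM; congr (_ * _)%E; exact: len.
Qed.

(** Countable subadditivity of the area: the excluded squares have total area at most [s], too small
    to cover a square of side [w]. *)
Lemma square_cover (N : nat) (c1 c2 : nat -> nat -> R) (r : nat -> R) (a b w s : R) : 0 < w -> (forall n, 0 <= r n) ->
  (forall n, \sum_(k < n) N%:R * (2 * r k) ^+ 2 <= s) -> s < w ^+ 2 ->
  exists x y, [/\ a <= x <= a + w, b <= y <= b + w &
    forall n i, (i < N)%N -> ~ (`|x - c1 n i| <= r n /\ `|y - c2 n i| <= r n)].
Proof.
move=> w0 r0 Hs sw; apply: contrapT => none.
pose Sq n i := `[c1 n i - r n, c1 n i - r n + 2 * r n] `*` `[c2 n i - r n, c2 n i - r n + 2 * r n] : set (R * R).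
pose E n := \big[setU/set0]_(i < N) Sq n i.
have mSq n i : measurable (Sq n i) by exact: measurableX.
have mE n : measurable (E n) by exact: bigsetU_measurable.
have cov : `[a, a + w] `*` `[b, b + w] `<=` \bigcup_n E n.
  move=> [x y] [] /=; rewrite !in_itv /= => xI yI; apply: contrapT => nE; apply: none.
  exists x, y; split => // n i iN [h1 h2]; apply: nE; exists n => //.
  rewrite /E -(bigcup_mkord N (Sq n)); exists i => //.
  rewrite /Sq /=; rewrite !in_itv /=; rewrite !ler_norml in h1 h2.
  case/andP: h1 => ? ?; case/andP: h2 => ? ?; split; apply/andP; split; lra.
have aE n : (area (E n) <= (N%:R * (2 * r n) ^+ 2)%:E)%E.
  apply: le_trans (Boole_inequality _ _) _; first by move=> i _; exact: mSq.
  rewrite (eq_bigr (fun=> ((2 * r n) ^+ 2)%:E)); last by move=> i _; apply: area_square; rewrite mulr_ge0.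
  by rewrite sumEFin sumr_const card_ord lee_fin (mulr_natl _ N).
pose Q : set (R * R) := `[a, a + w] `*` `[b, b + w].
have : (area Q <= \sum_(n <oo) area (E n))%E.
  apply: measure_sigma_subadditive => //; exact: measurableX.
rewrite (area_square _ _ (ltW w0)) leNgt => /negP; apply.
apply: (@le_lt_trans _ _ s%:E); last by rewrite lte_fin.
apply: lime_le; first by apply: is_cvg_nneseries => n _ _; exact: measure_ge0.
near=> n; rewrite big_mkord; apply: le_trans (_ : (\sum_(k < n) (N%:R * (2 * r k) ^+ 2)%:E <= _)%E).
  by apply: lee_sum => i _; exact: aE.
by rewrite sumEFin lee_fin.
Unshelve. all: by end_near.
Qed.

(** Telescoping, from [1 / m ^+ 2 <= 1 / (m - 1) - 1 / m]. *)
Lemma sum_inv_sqr (k n : nat) : (1 < k)%N -> \sum_(i < n) ((k + i)%:R ^+ 2)^-1 <= (k.-1%:R : R)^-1.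
Proof.
move=> k1; apply: (@le_trans _ _ ((k.-1)%:R^-1 - (k + n).-1%:R^-1)); last by rewrite lerBlDr lerDl invr_ge0.
elim: n => [|n IH]; first by rewrite big_ord0 addn0 subrr.
rewrite big_ord_recr /=; apply: le_trans (lerD IH (lexx _)) _.
have -> : (k + n.+1).-1 = (k + n)%N by lia.
have [m e] : exists m, (k + n)%N = m.+2 by exists (k + n - 2)%N; lia.
rewrite e /=; have m0 : 0 <= (m%:R : R) by [].
have m1 : (m.+1%:R : R) != 0 by rewrite pnatr_eq0.
have m2 : (m.+2%:R : R) != 0 by rewrite pnatr_eq0.
have s1 : (m.+1%:R : R) = m%:R + 1 by rewrite -natr1.
have s2 : (m.+2%:R : R) = m%:R + 2 by rewrite -addn2 natrD.
rewrite -addrA lerD2l s2 s1 in m1 m2 *.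
have h : (m%:R + 1 : R)^-1 - (m%:R + 2)^-1 - ((m%:R + 2) ^+ 2)^-1 = ((m%:R + 1) * (m%:R + 2) ^+ 2)^-1.
  by field; rewrite m1 m2.
have : 0 <= ((m%:R + 1 : R) * (m%:R + 2) ^+ 2)^-1 by rewrite invr_ge0 mulr_ge0 ?addr_ge0 ?sqr_ge0.
lra.
Qed.
End SquareCover.

(** * The Ford domain *)

Section IsometricSpheres.
Variables (R : realType) (Gamma : set (PSL2 R)).
Local Notation C := R[i].
Implicit Types (g h : PSL2 R) (z w p : C).

Definition cen g : R := - pd g / pc g.
Definition rad g : R := `|pc g|^-1.

Lemma rad_gt0 g : pc g != 0 -> 0 < rad g.
Proof. by move=> c0; rewrite invr_gt0 normr_gt0. Qed.

Lemma rad2 g : pc g != 0 -> rad g ^+ 2 = (pc g ^+ 2)^-1.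
Proof. by move=> c0; rewrite /rad exprVn real_normK ?num_real. Qed.

Lemma nd_cen g z : pc g != 0 -> nd g z = ((Re z - cen g) ^+ 2 + Im z ^+ 2) / rad g ^+ 2.
Proof. by move=> c0; rewrite rad2 // /nd /cen; field. Qed.

Lemma nd_eq1 g z : pc g != 0 -> nd g z = 1 <-> circ (cen g) (rad g) z.
Proof.
move=> c0; rewrite nd_cen // /circ; have r0 : rad g ^+ 2 != 0 by rewrite expf_neq0 // gt_eqF // rad_gt0.
by split=> [/(congr1 ( *%R^~ (rad g ^+ 2)))|->]; rewrite ?divfK // ?mul1r // divff.
Qed.

Lemma nd_ge1 g z : pc g != 0 -> (1 <= nd g z) = (rad g ^+ 2 <= (Re z - cen g) ^+ 2 + Im z ^+ 2).
Proof. by move=> c0; rewrite nd_cen // ler_pdivlMr ?mul1r // exprn_gt0 // rad_gt0. Qed.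

Lemma nd_gt1 g z : pc g != 0 -> (1 < nd g z) = (rad g ^+ 2 < (Re z - cen g) ^+ 2 + Im z ^+ 2).
Proof. by move=> c0; rewrite nd_cen // ltr_pdivlMr ?mul1r // exprn_gt0 // rad_gt0. Qed.

Lemma pcV_neq0 g : (pc g^-1%g != 0) = (pc g != 0).
Proof.
have [s s2 [_ _ -> _]] := psl2_inv_entries g.
by rewrite oppr_eq0 mulf_eq0 (negPf (sqr1_neq0 s2)).
Qed.

Lemma cenV g : cen g^-1%g = pa g / pc g.
Proof.
have [s s2 [_ _ Ec Ed]] := psl2_inv_entries g; rewrite /cen Ec Ed invrN mulrNN invfM.
have s0 := sqr1_neq0 s2; have [->|c0] := eqVneq (pc g) 0; first by rewrite invr0 !mulr0.
by field; rewrite ?s0 ?c0.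
Qed.

Lemma radV g : rad g^-1%g = rad g.
Proof. by have [s s2 [_ _ Ec _]] := psl2_inv_entries g; rewrite /rad Ec normrN normrM (sqr1_norm s2) mul1r. Qed.

(** With [Im_mob], this displays [g] as the inversion in its isometric circle followed by a
    reflection in a vertical line. *)
Lemma Re_mob_c g z : HH z -> pc g != 0 -> Re (mob g z) = cen g^-1%g - (Re z - cen g) / nd g z.
Proof.
move=> Hz c0; have n0 := lt0r_neq0 (nd_gt0 g Hz); rewrite Re_mob // cenV /cen.
have D := pdet g; move: n0; rewrite /nd; case: z {Hz} => x y /=; move: c0 D.
move: (pa g) (pb g) (pc g) (pd g) => a b c d c0 D; set n := (X in X != 0) => n0.
apply/eqP; rewrite -subr_eq0; apply/eqP.
transitivity ((a * (c * x + d) ^+ 2 + a * (c * y) ^+ 2 - a * n - (c * x + d) * (a * d - b * c - 1)) / (c * n)).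
  by rewrite -/n; field; rewrite n0 c0.
by rewrite D subrr mulr0 subr0 /n; rewrite [X in X / _](_ : _ = 0) ?mul0r //; ring.
Qed.

Lemma pc_mulV g h : exists2 s : R, s ^+ 2 = 1 & pc (g * h^-1)%g = s * (pc g * pd h - pd g * pc h).
Proof.
have [s s2 [_ _ Ec _]] := psl2_mul_entries g h^-1%g.
have [t t2 [Fa _ Fc _]] := psl2_inv_entries h.
by exists (s * t); rewrite ?exprMn ?s2 ?t2 ?mulr1 // Ec Fa Fc; ring.
Qed.

(** The center is the preimage of infinity, so [g * h^-1] fixes infinity. *)
Lemma same_cen g h : pc g != 0 -> pc h != 0 -> cen g = cen h -> pc (g * h^-1)%g = 0.
Proof.
move=> g0 h0 E; have [s _ ->] := pc_mulV g h.
have : pd g = pd h * pc g / pc h by move: E; rewrite /cen => /(congr1 (fun x => - x * pc g)); rewrite !mulNr !opprK divfK // => ->; ring.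
by move=> ->; field.
Qed.

Lemma isosphereP g z : isosphere g z <-> HH z /\ nd g z = 1.
Proof.
rewrite /isosphere /= norm_denom; split=> -[Hz]; last by move=> ->; rewrite sqrtr1.
move=> /(congr1 (@complex.Re R)) /= /(congr1 (fun x => x ^+ 2)); rewrite sqr_sqrtr ?nd_ge0 // expr1n //.
Qed.

Lemma isosphere_extP g z : isosphere_ext g z <-> HH z /\ 1 < nd g z.
Proof.
have E : (1 < `|denom g z|) = (1 < nd g z).
  rewrite norm_denom -[1]/(1%:C) ltcR.
  have [n0|n0] := ltP 0 (nd g z); first by rewrite -[X in X < _]sqrtr1 ltr_sqrt.
  have -> : nd g z = 0 by apply/eqP; rewrite eq_le n0 nd_ge0.
  by rewrite sqrtr0 ltr10.
by rewrite /isosphere_ext /= E.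
Qed.

(* The closed Ford domain, the closure of [KK]. *)
Definition KKb : set C := [set z | HH z /\ forall g, Gamma g -> pc g != 0 -> 1 <= nd g z].

Definition summit g : C := cen g +i* rad g.

Lemma circ_summit g : circ (cen g) (rad g) (summit g).
Proof. by rewrite /circ /= subrr expr0n add0r. Qed.

Lemma HH_summit g : pc g != 0 -> HH (summit g).
Proof. by move=> c0; rewrite /HH /=; exact: rad_gt0. Qed.

Hypothesis hF : is_fuchsian Gamma.
Hypothesis hC : cuspidal_infty Gamma.

Lemma nstabP g : (Gamma `\` stab_infty Gamma) g <-> Gamma g /\ pc g != 0.
Proof.
split=> -[Gg n0]; split => //; first by apply/eqP => c0; apply: n0; apply/stabP.
by move=> /stabP[_] /eqP; rewrite (negPf n0).
Qed.

Lemma is_isosphereP I : is_isosphere Gamma I <-> exists g, [/\ Gamma g, pc g != 0 & I = isosphere g].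
Proof.
split=> -[g [Gg n ->]]; exists g; split => //; first by have [_] := (nstabP g).1 (conj Gg n).
by have [] := (nstabP g).2 (conj Gg n).
Qed.

Hypothesis hne : Gamma <> stab_infty Gamma.

Lemma nstab_ex : exists g, Gamma g /\ pc g != 0.
Proof.
apply: contrapT => H; apply: hne; rewrite eqEsubset; split=> g; last by case.
move=> Gg; apply/stabP; split => //; apply/eqP; apply: contrapT => /negP c0; apply: H; by exists g.
Qed.

(** An empty intersection would be all of [C]; [hne] provides an index, and with it [HH z]. *)
Lemma KKP z : KK Gamma z <-> HH z /\ forall g, Gamma g -> pc g != 0 -> 1 < nd g z.
Proof.
split=> [Kz|[Hz H] g /nstabP[Gg g0]]; last by apply/isosphere_extP; split => //; exact: H.
have [g0 [Gg0 n0]] := nstab_ex.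
split; first by have [] := Kz _ ((nstabP g0).2 (conj Gg0 n0)).
by move=> g Gg n1; have /isosphere_extP[] := Kz _ ((nstabP g).2 (conj Gg n1)).
Qed.

Lemma KK_KKb z : KK Gamma z -> KKb z.
Proof. by move=> /KKP[Hz H]; split => // g Gg g0; apply: ltW; exact: H. Qed.

Lemma KKb_up z w : KKb z -> Re w = Re z -> Im z < Im w -> KK Gamma w.
Proof.
move=> [Hz H] E lt; apply/KKP; split; first by exact: lt_trans lt.
move=> g Gg g0; have := H g Gg g0; rewrite nd_ge1 // nd_gt1 // E => /le_lt_trans; apply.
by rewrite ltrD2l ltr_pXn2r // nnegrE ltW // (lt_trans Hz).
Qed.

Lemma KKb_up_le z w : KKb z -> Re w = Re z -> Im z <= Im w -> KKb w.
Proof.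
move=> Kz E; rewrite le_eqVlt => /orP[/eqP e|lt]; last by apply: KK_KKb; exact: KKb_up Kz E lt.
by have -> : w = z by apply: complex_ext.
Qed.

Lemma cusp_shift g h z : Gamma h -> pc h = 0 -> Gamma g -> HH z -> nd (h * g)%g z = nd g z.
Proof. by move=> Gh h0 Gg Hz; rewrite nd_mul // (stab_nd hF hC) // mul1r. Qed.

Lemma Im_stab g z : Gamma g -> pc g = 0 -> Im (mob g z) = Im z.
Proof. by move=> Gg g0; rewrite (stab_mob hF hC). Qed.

Lemma pcM_stab g h : pc g = 0 -> pc h = 0 -> pc (g * h)%g = 0.
Proof. by move=> g0 h0; have [s _ [_ _ -> _]] := psl2_mul_entries g h; rewrite g0 h0; ring. Qed.

Lemma pcV_stab g : pc g = 0 -> pc g^-1%g = 0.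
Proof. by move=> g0; have [s _ [_ _ -> _]] := psl2_inv_entries g; rewrite g0; ring. Qed.

(** Points of the closed Ford domain are the highest of their orbits; two of them in one orbit
    therefore have equal heights, which is the source of [KKb_both] and [KK_KKb_stab]. *)
Lemma KKb_Im g z : KKb z -> Gamma g -> Im (mob g z) <= Im z.
Proof.
move=> [Hz H] Gg; have [c0|c0] := eqVneq (pc g) 0; first by rewrite Im_stab.
by rewrite Im_mob // ler_pdivrMr ?nd_gt0 // ler_peMr // ?(ltW Hz) // H.
Qed.

Lemma KKb_both g z : KKb z -> Gamma g -> KKb (mob g z) -> nd g z = 1.
Proof.
move=> Kz Gg Kgz; have Hz := Kz.1; have n0 := nd_gt0 g Hz.
have h1 := KKb_Im Kz Gg; have := KKb_Im Kgz (GammaV hF Gg); rewrite mobK // => h2.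
have : Im (mob g z) = Im z by apply/eqP; rewrite eq_le h1 h2.
rewrite Im_mob // => /(congr1 ( *%R^~ (nd g z))); rewrite divfK ?gt_eqF // -[LHS]mulr1 => /mulfI -> //.
by rewrite gt_eqF.
Qed.

Lemma KK_KKb_stab g z : KK Gamma z -> Gamma g -> KKb (mob g z) -> pc g = 0.
Proof.
move=> Kz Gg Kgz; apply/eqP; apply: contrapT => /negP c0.
have := KKb_both (KK_KKb Kz) Gg Kgz; have /KKP[_ /(_ g Gg c0)] := Kz.
by move=> + e; rewrite e ltxx.
Qed.

Lemma KKb_mob g z : KKb z -> Gamma g -> nd g z = 1 -> KKb (mob g z).
Proof.
move=> [Hz H] Gg n1; split; first exact: HH_mob.
move=> h Gh h0; have := nd_mul h g Hz; rewrite n1 mulr1 => <-.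
have [c0|c0] := eqVneq (pc (h * g)%g) 0; last by apply: H => //; exact: GammaM.
by rewrite (stab_nd hF hC) //; exact: GammaM.
Qed.

Lemma KK_mob_stab g z : KK Gamma z -> Gamma g -> pc g = 0 -> KK Gamma (mob g z).
Proof.
move=> /KKP[Hz H] Gg g0; apply/KKP; split; first exact: HH_mob.
move=> h Gh h0; have := nd_mul h g Hz; rewrite (stab_nd hF hC _ Gg g0) mulr1 => <-.
apply: H; first exact: GammaM.
have [s s2 [_ _ -> _]] := psl2_mul_entries h g; rewrite g0 mulr0 addr0 !mulf_eq0 (negPf (sqr1_neq0 s2)) (negPf h0) /=.
by apply/eqP => a0; have := pdet g; rewrite a0 g0 mulr0 mul0r subr0 => /esym/eqP; rewrite oner_eq0.
Qed.

(** Provided later by [KKb_cover], from a basal family. *)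
Hypothesis hcov : forall z, HH z -> exists g, Gamma g /\ KKb (mob g z).

(** A point of the Ford domain, translated to horizontal distance at most [l] from the center of
    [g], still lies outside the circle of [g]; this bounds the radius. *)
Lemma rad_bound : exists2 M : R, 0 < M & forall g, Gamma g -> pc g != 0 -> rad g <= M.
Proof.
have Hi : HH (0 +i* (1 : R)) by rewrite /HH /= ltr01.
have [k [Gk Kz]] := hcov Hi; move: (mob k _) Kz => z Kz.
have [l l0 Hl] := translate_into hF hC.
exists (l + Im z); first by rewrite addr_gt0 //; exact: Kz.1.
move=> g Gg g0; have [h [Gh h0 /andP[b1 b2]]] := Hl (Re z - cen g).
have Kh : KKb (mob h z) by apply: KKb_mob => //; exact: (stab_nd hF hC).
have [_ /(_ g Gg g0)] := Kh; rewrite nd_ge1 // (stab_mob hF hC) //= => H.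
have r0 := rad_gt0 g0; have Hz := Kz.1.
have iz : 0 < Im z by [].
have e : Re z + tau h - cen g = Re z - cen g + tau h by ring.
rewrite e in H; nra.
Qed.

(** Left multiplication of [g] by a translation does not change its circle. It can be used to bring
    [pa g / pc g] into [[0, l]]; then all four entries are bounded by [B] and [bounded_finite]
    applies. *)
Lemma circles_finite (M e : R) : 0 < e -> finite_set [set x : R * R | exists g,
  [/\ Gamma g, pc g != 0, `|cen g| <= M, e <= rad g & x = (cen g, rad g)]].
Proof.
have sum (x y z w : R) : 0 <= x -> 0 <= y -> 0 <= z -> 0 <= w ->
    [/\ x <= x + y + z + w, y <= x + y + z + w, z <= x + y + z + w & w <= x + y + z + w].
  by move=> *; split; lra.
move=> e0; have [Rb Rb0 HR] := rad_bound; have [l l0 Hl] := translate_into hF hC.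
pose B := e^-1 + `|M| / e + l / e + Rb * (l / e * (`|M| / e) + 1).
apply: (sub_finite_set _ (finite_image (fun g => (cen g, rad g)) (bounded_finite hF B))).
move=> _ [g [Gg g0 cM er ->]].
have [h [Gh h0 /andP[b1 b2]]] := Hl (pa g / pc g).
have [s s2 [Ea Eb Ec Ed]] := psl2_mul_entries h g.
have ad := stab_d2 hF hC Gh h0; have a2 := stab_unipotent hF hC Gh h0.
have na := sqr1_norm a2; have ns := sqr1_norm s2.
have gM : `|cen g| <= `|M| by rewrite (le_trans cM) // ler_norm.
have M0 := normr_ge0 M.
have c1 : `|pc g| <= e^-1.
  by rewrite -[leLHS]invrK lef_pV2 // ?posrE ?invr_gt0 ?normr_gt0.
have c2 : `|pc g|^-1 <= Rb by exact: HR.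
have d1 : `|pd g| <= `|M| / e.
  have -> : pd g = - cen g * pc g by rewrite /cen; field.
  by rewrite normrM normrN ler_pM.
pose u := pa g / pc g + tau h.
have a1 : `|pa (h * g)%g| <= l / e.
  have -> : pa (h * g)%g = s * pa h * (u * pc g).
    rewrite Ea /u /tau ad.
    have -> : s * pa h * ((pa g / pc g + pb h * pa h) * pc g) = s * (pa h * pa g + (pa h ^+ 2) * (pb h * pc g)) by field.
    by rewrite a2; ring.
  rewrite !normrM ns na !mul1r ler_pM // ger0_norm //.
have cE : `|pc (h * g)%g| = `|pc g| by rewrite Ec h0 mul0r add0r !normrM ns ad na !mul1r.
have dE : `|pd (h * g)%g| = `|pd g| by rewrite Ed h0 mul0r add0r !normrM ns ad na !mul1r.
have hg0 : pc (h * g)%g != 0 by rewrite -normr_gt0 cE normr_gt0.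
have bE : `|pb (h * g)%g| <= Rb * (l / e * (`|M| / e) + 1).
  have D := pdet (h * g)%g.
  have -> : pb (h * g)%g = (pc (h * g)%g)^-1 * (pa (h * g)%g * pd (h * g)%g - 1) by rewrite -[X in _ - X]D; field.
  rewrite normrM normfV cE ler_pM // (le_trans (ler_normB _ _)) // normr1 lerD2r normrM dE ler_pM //.
have t1 : 0 <= e^-1 by rewrite invr_ge0 ltW.
have t2 : 0 <= `|M| / e by rewrite mulr_ge0.
have t3 : 0 <= l / e by rewrite mulr_ge0 // ltW.
have t4 : 0 <= Rb * (l / e * (`|M| / e) + 1) by rewrite mulr_ge0 ?(ltW Rb0) // addr_ge0 // mulr_ge0.
exists (h * g)%g; first split.
- exact: GammaM.
- have [s1 s2' s3 s4] := sum _ _ _ _ t1 t2 t3 t4.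
  split; rewrite ?cE ?dE /B; [exact: le_trans s3|exact: le_trans s4|exact: le_trans s1|exact: le_trans s2'].
- congr (_, _); last by rewrite /rad cE.
  rewrite /cen Ec Ed h0 !mul0r !add0r ad.
  have ha : pa h != 0 by rewrite -normr_gt0 na.
  by field; rewrite g0 ha sqr1_neq0.
Qed.

(** Local finiteness of the circles: one that contains a point [w] close to [p] in its closed disk
    has radius at least [Im p / 2] and, by [rad_bound], a center in a bounded interval. Each of
    these finitely many circles either contains [p] as well or stays away from it. *)
Lemma nd_near p : HH p -> \forall w \near p, HH w /\
  forall g, Gamma g -> pc g != 0 -> nd g w <= 1 -> nd g p <= 1.
Proof.
move=> Hp; have [Rb Rb0 HR] := rad_bound.
have p0 : 0 < Im p by [].
have e0 : 0 < Im p / 2 by rewrite divr_gt0.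
have fin := @circles_finite (`|Re p| + 1 + Rb) _ e0.
pose F (x : R * R) : cform R := (1, - 2 * x.1, x.1 ^+ 2 - x.2 ^+ 2).
have FE x z : Phi (F x) z = (Re z - x.1) ^+ 2 + Im z ^+ 2 - x.2 ^+ 2 by rewrite /Phi /=; ring.
have := @finite_near _ (nbhs p) _ _ (fun x => [set w | Phi (F x) w <= 0 -> Phi (F x) p <= 0]) _ fin.
move=> /(_ _) H; near=> w; have Hw : HH w by near: w; exact: HH_near.
split => // g Gg g0 nw.
have wI : Im p / 2 < Im w by near: w; apply: Im_near; lra.
have wR : `|Re w - Re p| < 1 by near: w; exact: Re_near.
have r0 := rad_gt0 g0.
have nle (z : C) : (nd g z <= 1) = (Phi (F (cen g, rad g)) z <= 0).
  by rewrite nd_cen // ler_pdivrMr ?exprn_gt0 // mul1r FE /= subr_le0.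
rewrite nle; move: nw; rewrite nle.
have : forall i, [set x : R * R | exists g, [/\ Gamma g, pc g != 0, `|cen g| <= `|Re p| + 1 + Rb, Im p / 2 <= rad g & x = (cen g, rad g)]] i -> [set w0 | Phi (F i) w0 <= 0 -> Phi (F i) p <= 0] w.
  near: w; apply: H => x _.
  have [h|h] := leP (Phi (F x) p) 0; first by near=> v.
  have := Phi_gt_near h; apply: filterS => v /= h1 h2; by move: (lt_le_trans h1 h2); rewrite ltxx.
move=> /(_ (cen g, rad g)) H1 H2; apply: H1 => //; exists g; split => //; last first.
  move: H2; rewrite FE /= subr_le0 => H2.
  by apply: ltW; apply: (lt_le_trans wI); rewrite -(ler_pXn2r (_ : 0 < 2)%N) ?nnegrE ?(ltW Hw) ?(ltW r0) //; have := sqr_ge0 (Re w - cen g); lra.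
move: H2; rewrite FE /= subr_le0 => H2.
have : `|Re w - cen g| <= rad g.
  rewrite -(ler_pXn2r (_ : 0 < 2)%N) ?nnegrE ?normr_ge0 ?(ltW r0) // real_normK ?num_real //.
  by have := sqr_ge0 (Im w); lra.
have := HR _ Gg g0; have := ler_normD (cen g - Re w) (Re w - Re p); have := ler_normD (cen g - Re p) (Re p).
rewrite (distrC (cen g) (Re w)) subrK [cen g - Re w + _]addrA subrK; lra.
Unshelve. all: by end_near. Qed.

Lemma KK_open p : KK Gamma p -> \forall w \near p, KK Gamma w.
Proof.
move=> /KKP[Hp H]; have := nd_near Hp; apply: filterS => w [Hw Hn]; apply/KKP; split => // g Gg g0.
by rewrite ltNge; apply/negP => /(Hn g Gg g0); rewrite leNgt H.
Qed.

Lemma KKb_nearP p : HH p -> ~ KKb p -> \forall w \near p, ~ KKb w.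
Proof.
move=> Hp nK.
have [g [Gg g0 lt]] : exists g, [/\ Gamma g, pc g != 0 & nd g p < 1].
  apply: contrapT => H; apply: nK; split => // g Gg g0; rewrite leNgt; apply/negP => lt.
  by apply: H; exists g.
have : \forall w \near p, nd g w < 1.
  have := @Phi_lt_near _ (pc g ^+ 2, 2 * pc g * pd g, pd g ^+ 2) p 1; rewrite -nd_Phi => /(_ lt).
  by apply: filterS => w; rewrite -nd_Phi.
by apply: filterS => w h [_ /(_ g Gg g0)]; rewrite leNgt h.
Qed.

Lemma boundaryKP p : boundaryH (KK Gamma) p <-> KKb p /\ exists g, [/\ Gamma g, pc g != 0 & nd g p = 1].
Proof.
have intK z : interior (KK Gamma) z <-> KK Gamma z.
  by split=> [/interior_subset//|/KK_open].
split.
  move=> [[cl Hp] /intK nK].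
  have Kp : KKb p.
    apply: contrapT => /(KKb_nearP Hp) /cl[w [Kw nw]]; apply: nw; exact: KK_KKb.
  split => //; apply: contrapT => H; apply: nK; apply/KKP; split => // g Gg g0.
  rewrite lt_def Kp.2 // andbT; apply/eqP => e; apply: H; by exists g.
move=> [Kp [g [Gg g0 n1]]]; split; last first.
  by move=> /intK /KKP[_ /(_ g Gg g0)]; rewrite n1 ltxx.
split; last exact: Kp.1.
move=> V /nbhs_box[e e0 eV].
exists (Re p +i* (Im p + e / 2)); split.
  by apply: (KKb_up Kp) => //=; rewrite ltrDl divr_gt0.
apply: eV => /=; first by rewrite subrr normr0.
by rewrite addrC addKr gtr0_norm ?divr_gt0 //; lra.
Qed.

(** The boundary of [KK] is a graph over part of the real axis, because everything strictly above a
    point of [KKb] is in [KK]. *)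
Lemma bK_uniq p q : boundaryH (KK Gamma) p -> boundaryH (KK Gamma) q -> Re p = Re q -> p = q.
Proof.
move=> /boundaryKP[Kp [g [Gg g0 gp]]] /boundaryKP[Kq [h [Gh h0 hq]]] E.
apply: complex_ext => //; apply/eqP; rewrite eq_le !leNgt; apply/andP; split; apply/negP => lt.
  by have /KKP[_ /(_ g Gg g0)] := KKb_up Kq E lt; rewrite gp ltxx.
by have /KKP[_ /(_ h Gh h0)] := KKb_up Kp (esym E) lt; rewrite hq ltxx.
Qed.

Lemma hconvex_KKb : hconvex KKb.
Proof.
apply: hconvexP => [z []//|z w s p [_ h1] [_ h2] Hp /andP[s0 s1] K]; split => // g Gg g0.
have := kl_Phi (pc g ^+ 2, 2 * pc g * pd g, pd g ^+ 2) K; rewrite -!nd_Phi => ->.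
by have := h1 g Gg g0; have := h2 g Gg g0; nra.
Qed.

(** * Relevant arcs, vertical lines and leaves *)

Hypothesis hA : conditionA Gamma.

(** The power, with respect to the circle of [h], of the point above [x] on the circle of [g]. The
    squares of [x] cancel, so the Ford domain cuts the circle of [g] by inequalities affine in
    [x]. *)
Definition lin g h (x : R) : R := (x - cen h) ^+ 2 + rad g ^+ 2 - (x - cen g) ^+ 2 - rad h ^+ 2.

Lemma lin_nd g h p : pc h != 0 -> circ (cen g) (rad g) p -> (1 <= nd h p) = (0 <= lin g h (Re p)).
Proof.
move=> h0 cp; rewrite nd_ge1 // -subr_ge0 /lin; congr (0 <= _).
have -> : Im p ^+ 2 = rad g ^+ 2 - (Re p - cen g) ^+ 2 by rewrite -cp; ring.
by ring.
Qed.

Lemma lin_eq g h p : pc h != 0 -> circ (cen g) (rad g) p -> nd h p = 1 <-> lin g h (Re p) = 0.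
Proof.
move=> h0 cp; rewrite nd_eq1 // /circ /lin.
have -> : Im p ^+ 2 = rad g ^+ 2 - (Re p - cen g) ^+ 2 by rewrite -cp; ring.
by split=> [<-|E]; [ring|rewrite -[LHS]subr0 -E; ring].
Qed.

Lemma lin_aff g h x y s : lin g h ((1 - s) * x + s * y) = (1 - s) * lin g h x + s * lin g h y.
Proof. by rewrite /lin; ring. Qed.

(* The part of the isometric circle of [g] on the boundary of the Ford domain,
   in terms of the real parts of its points. *)
Definition Arc g (al be : R) : Prop :=
  [/\ Gamma g /\ pc g != 0, cen g - rad g <= al, al < cen g < be, be <= cen g + rad g &
      forall p, HH p -> circ (cen g) (rad g) p -> (KKb p <-> al <= Re p <= be)].

Lemma KKb_lin g p : HH p -> circ (cen g) (rad g) p ->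
  KKb p <-> forall h, Gamma h -> pc h != 0 -> 0 <= lin g h (Re p).
Proof.
move=> Hp cp; split=> [[_ H] h Gh h0|H]; first by rewrite -lin_nd // H.
by split => // h Gh h0; rewrite (lin_nd _ cp) // H.
Qed.

(** The relevant part is where all affine functions [lin g h] are nonnegative, so its real parts
    form an interval. The submanifold supplies two points with distinct real parts; the ends are the
    infimum and supremum, to which the inequalities pass by continuity ([adh]). *)
Lemma relevant_arc I : relevant Gamma I -> exists g al be, [/\ I = isosphere g,
  [/\ Gamma g /\ pc g != 0, cen g - rad g <= al, al < be, be <= cen g + rad g &
      forall p, HH p -> circ (cen g) (rad g) p -> (KKb p <-> al <= Re p <= be)] &
  relevant_part Gamma I = carc (cen g) (rad g) al be].
Proof.
move=> [/is_isosphereP[g [Gg g0 IE]] [S [[p0 Sp0] SH mS] SP]].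
have r0 := rad_gt0 g0.
have RP p : relevant_part Gamma I p <-> [/\ HH p, circ (cen g) (rad g) p & KKb p].
  rewrite /relevant_part IE; split.
    by move=> [/isosphereP[Hp /(nd_eq1 _ g0) cp] /boundaryKP[Kp _]].
  move=> [Hp cp Kp]; split; first by apply/isosphereP; split => //; exact/nd_eq1.
  by apply/boundaryKP; split => //; exists g; split => //; exact/nd_eq1.
pose X : set R := [set x | exists p, relevant_part Gamma I p /\ Re p = x].
have [p1 [p2 [P1 P2 p12]]] : exists p1 p2, [/\ relevant_part Gamma I p1, relevant_part Gamma I p2 & Re p1 < Re p2].
  have [U [c [k [e]]]] := mS _ Sp0; move=> /= [[oU Up] [e0 c0] _ cJ [_ ck]].
  have J0 : `]- e, e[%classic (0 : R) by rewrite /= in_itv /=; lra.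
  have J1 : `]- e, e[%classic (e / 2 : R) by rewrite /= in_itv /=; lra.
  have m0 : (S `&` U) (c 0) by rewrite -cJ; exists 0.
  have m1 : (S `&` U) (c (e / 2)) by rewrite -cJ; exists (e / 2).
  have ne : c 0 <> c (e / 2).
    move=> /(congr1 k); rewrite !ck ?inE // => /esym/eqP.
    by rewrite mulf_eq0 (gt_eqF e0) /= invr_eq0 pnatr_eq0.
  have Q0 := SP _ m0.1; have Q1 := SP _ m1.1.
  have [H0 C0 _] := (RP _).1 Q0; have [H1 C1 _] := (RP _).1 Q1.
  have [lt|lt|e'] := ltgtP (Re (c 0)) (Re (c (e / 2))).
  - by exists (c 0), (c (e / 2)).
  - by exists (c (e / 2)), (c 0).
  - by case: ne; apply: (circ_eq _ _ C0 C1) => //; exact: ltW.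
have Xb x : X x -> cen g - rad g < x < cen g + rad g.
  by move=> [p [/RP[Hp cp _] <-]]; apply: circ_between => //; exact: ltW.
have X1 : X (Re p1) by exists p1.
have X2 : X (Re p2) by exists p2.
have ubX : has_sup X.
  by split; [exists (Re p1)|exists (cen g + rad g) => x /Xb /andP[_ /ltW]].
have lbX : has_inf X.
  by split; [exists (Re p1)|exists (cen g - rad g) => x /Xb /andP[/ltW]].
have le_inf x : X x -> inf X <= x by move=> Xx; apply: ge_inf => //; case: lbX.
have le_sup x : X x -> x <= sup X by move=> Xx; apply: ub_le_sup => //; case: ubX.
have XL h x : Gamma h -> pc h != 0 -> X x -> 0 <= lin g h x.
  by move=> Gh h0 [p [/RP[Hp cp Kp] <-]]; exact: (KKb_lin Hp cp).1.
have adh h y : Gamma h -> pc h != 0 -> (forall d, 0 < d -> exists2 x, X x & `|x - y| < d) -> 0 <= lin g h y.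
  move=> Gh h0 H; rewrite leNgt; apply/negP => neg.
  pose k := `|2 * (cen g - cen h)| + 1.
  have k0 : 0 < k by rewrite ltr_wpDl.
  have [|x Xx xy] := H (- lin g h y / k); first by rewrite divr_gt0 // oppr_gt0.
  have := XL h x Gh h0 Xx.
  have -> : lin g h x = lin g h y + 2 * (cen g - cen h) * (x - y) by rewrite /lin; ring.
  have : 2 * (cen g - cen h) * (x - y) <= k * `|x - y|.
    rewrite (le_trans (ler_norm _)) // normrM ler_wpM2r //.
    by rewrite /k lerDl.
  by move: xy; rewrite ltr_pdivlMr // mulrC; lra.
have Linf h : Gamma h -> pc h != 0 -> 0 <= lin g h (inf X).
  move=> Gh h0; apply: adh => // d d0; have [x Xx xd] := inf_adherent d0 lbX.
  by exists x => //; rewrite ger0_norm ?subr_ge0 ?le_inf // ltrBlDl.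
have Lsup h : Gamma h -> pc h != 0 -> 0 <= lin g h (sup X).
  move=> Gh h0; apply: adh => // d d0; have [x Xx xd] := sup_adherent d0 ubX.
  by exists x => //; rewrite ler0_norm ?subr_le0 ?le_sup // opprB ltrBlDl -ltrBlDr.
have is_lt : inf X < sup X by apply: (le_lt_trans (le_inf _ X1)); apply: (lt_le_trans p12); exact: le_sup.
have main p : HH p -> circ (cen g) (rad g) p -> (KKb p <-> inf X <= Re p <= sup X).
  move=> Hp cp; split=> [Kp|/andP[h1 h2]].
    have Xp : X (Re p) := ex_intro _ p (conj ((RP p).2 (And3 Hp cp Kp)) erefl).
    by rewrite le_inf // le_sup.
  apply/(KKb_lin Hp cp) => h Gh h0.
  pose s := (Re p - inf X) / (sup X - inf X).
  have d0 : 0 < sup X - inf X by rewrite subr_gt0.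
  have -> : Re p = (1 - s) * inf X + s * sup X by rewrite /s; field; rewrite gt_eqF.
  rewrite lin_aff addr_ge0 // mulr_ge0 ?Linf ?Lsup //.
    by rewrite subr_ge0 /s ler_pdivrMr // mul1r lerD2r.
  by rewrite divr_ge0 ?(ltW d0) // subr_ge0.
exists g, (inf X), (sup X); split => //; last first.
  rewrite eqEsubset; split => p.
    by move=> /RP[Hp cp Kp]; exact: (And3 Hp cp ((main p Hp cp).1 Kp)).
  by move=> [Hp cp ab]; exact: ((RP p).2 (And3 Hp cp ((main p Hp cp).2 ab))).
split => //.
- by apply: lb_le_inf; [exists (Re p1)|move=> x /Xb /andP[/ltW]].
- by apply: ge_sup; [exists (Re p1)|move=> x /Xb /andP[_ /ltW]].
Qed.

Lemma arc_ends (a r al be : R) : 0 < r -> a - r <= al -> al < be -> be <= a + r ->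
  is_endpoint (carc a r al be) (Some (cpt a r al)) /\ is_endpoint (carc a r al be) (Some (cpt a r be)).
Proof.
move=> r0 h1 h2 h3.
have ne : Some (cpt a r al) <> Some (cpt a r be).
  by move=> [e _]; move: h2; rewrite e ltxx.
have c1 : circ a r (cpt a r al) by apply: circ_cpt; [exact: ltW|lra].
have c2 : circ a r (cpt a r be) by apply: circ_cpt; [exact: ltW|lra].
have E := gseg_arc (ltW r0) c1 c2 (sqrtr_ge0 _) (sqrtr_ge0 _) h2.
split; first exact: (ex_intro2 _ _ (Some (cpt a r be)) (nesym ne) (esym E)).
by apply: (ex_intro2 _ _ (Some (cpt a r al)) ne); rewrite gseg_sym; exact: (esym E).
Qed.

Lemma arc_end_inv (a r al be : R) (x : one_point_compactification R[i]) : 0 < r -> a - r <= al -> al < be -> be <= a + r ->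
  is_endpoint (carc a r al be) x -> x = Some (cpt a r al) \/ x = Some (cpt a r be).
Proof.
move=> r0 h1 h2 h3 [y yx E].
by have [[-> _]|[_ ->]] := gseg_arc_inv r0 h1 h2 h3 (nesym yx) (esym E); [left|right].
Qed.

Lemma is_summitP g z : pc g != 0 -> is_summit (isosphere g) z <-> z = summit g.
Proof.
move=> g0; have r0 := rad_gt0 g0.
have sI : isosphere g (summit g).
  by apply/isosphereP; split; [exact: HH_summit|apply/nd_eq1 => //; exact: circ_summit].
split=> [[/isosphereP[Hz /(nd_eq1 _ g0) cz] /(_ _ sI) /= h]|->].
  have e : Re z = cen g.
    have : (Re z - cen g) ^+ 2 = 0.
      have := sqr_ge0 (Re z - cen g).
      have : rad g ^+ 2 <= Im z ^+ 2 by rewrite lerXn2r ?nnegrE ?(ltW r0) // ltW.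
      by move: cz; rewrite /circ; lra.
    by move/eqP; rewrite sqrf_eq0 subr_eq0 => /eqP.
  apply: (circ_eq _ _ cz (circ_summit g)) => //; first exact: ltW.
  by rewrite /= ltW.
split => // w /isosphereP[Hw /(nd_eq1 _ g0)]; rewrite /circ /= => cw.
by rewrite -(ler_pXn2r (_ : 0 < 2)%N) ?nnegrE ?(ltW r0) ?(ltW Hw) // -cw lerDr sqr_ge0.
Qed.

(** Condition (A) enters here: the summit is on the boundary of [KK], so the center lies in
    [[al, be]], and as the summit is not a vertex the center is neither end. *)
Lemma relevant_Arc I : relevant Gamma I -> exists g al be,
  [/\ I = isosphere g, Arc g al be & relevant_part Gamma I = carc (cen g) (rad g) al be].
Proof.
move=> rI; have [g [al [be [IE [[Gg g0] h1 h2 h3 h4] RE]]]] := relevant_arc rI.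
have r0 := rad_gt0 g0; exists g, al, be; split => //; split => //.
have sm : is_summit I (summit g) by rewrite IE; exact/is_summitP.
have [bs nv] := hA rI sm.
have /h4 : KKb (summit g) by have /boundaryKP[] := bs.
move=> /(_ (HH_summit g0) (circ_summit g)) /= /andP[l1 l2] //.
have [e1 e2] := arc_ends r0 h1 h2 h3.
have ends x : x = al \/ x = be -> x <> cen g.
  move=> xe e; apply: nv; exists I; first exact: rI.
  rewrite RE.
  have <- : cpt (cen g) (rad g) x = summit g.
    by rewrite /cpt e subrr expr0n subr0 sqrtr_sqr gtr0_norm.
  by case: xe => ->.
apply/andP; split; rewrite lt_def ?l1 ?l2 andbT; apply/eqP => e; first by apply: (ends al); [left|].
by apply: (ends be); [right|].
Qed.

(** An affine function that is nonnegative on an interval and zero at an inner point is constant;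
    the slope of [lin g h] is [2 * (cen g - cen h)]. *)
Lemma Arc_uniq g al be h p : Arc g al be -> HH p -> circ (cen g) (rad g) p -> al < Re p < be ->
  Gamma h -> pc h != 0 -> nd h p = 1 -> cen h = cen g.
Proof.
move=> [[Gg g0] h1 /andP[h2 h2'] h3 h4] Hp cp /andP[p1 p2] Gh h0 /(lin_eq h0 cp) L0.
have r0 := rad_gt0 g0.
have Lb x : cen g - rad g < x < cen g + rad g -> al <= x <= be -> 0 <= lin g h x.
  move=> xr xb; have Hx := HH_cpt r0 xr.
  have cx : circ (cen g) (rad g) (cpt (cen g) (rad g) x).
    by apply: circ_cpt; [exact: ltW|case/andP: xr => ? ?; rewrite !ltW].
  by have /(KKb_lin Hx cx)/(_ h Gh h0) := (h4 _ Hx cx).2 xb.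
have l1 := Lb ((al + Re p) / 2); have l2 := Lb ((be + Re p) / 2).
have {}l1 : 0 <= lin g h ((al + Re p) / 2) by apply: l1; apply/andP; split; lra.
have {}l2 : 0 <= lin g h ((be + Re p) / 2) by apply: l2; apply/andP; split; lra.
have E x : lin g h x = lin g h (Re p) + 2 * (cen g - cen h) * (x - Re p) by rewrite /lin; ring.
rewrite E L0 add0r in l1; rewrite E L0 add0r in l2.
have d1 : (al + Re p) / 2 - Re p < 0 by lra.
have d2 : 0 < (be + Re p) / 2 - Re p by lra.
apply/eqP; rewrite eq_le; apply/andP; split; rewrite leNgt; apply/negP => lt; nra.
Qed.

Lemma circ_mob g p : HH p -> pc g != 0 -> circ (cen g) (rad g) p ->
  [/\ Re (mob g p) = cen g^-1%g - (Re p - cen g), Im (mob g p) = Im p &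
      circ (cen g^-1%g) (rad g^-1%g) (mob g p)].
Proof.
move=> Hp g0 cp; have n1 : nd g p = 1 by exact/nd_eq1.
have e1 : Re (mob g p) = cen g^-1%g - (Re p - cen g) by rewrite Re_mob_c // n1 divr1.
have e2 : Im (mob g p) = Im p by rewrite Im_mob // n1 divr1.
by split => //; rewrite /circ e1 e2 radV -cp; ring.
Qed.

(** On its isometric circle [g] keeps heights, reverses the horizontal offset from the center, and
    preserves membership in the Ford domain. *)
Lemma Arc_inv g al be : Arc g al be ->
  Arc g^-1%g (cen g^-1%g - (be - cen g)) (cen g^-1%g - (al - cen g)).
Proof.
move=> [[Gg g0] h1 /andP[h2 h2'] h3 h4].
have Gi := GammaV hF Gg; have gi0 : pc g^-1%g != 0 by rewrite pcV_neq0.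
split => //; rewrite ?radV; [lra|apply/andP; split; lra|lra|].
move=> p Hp cp; rewrite -radV in cp.
have [e1 e2 e3] := circ_mob Hp gi0 cp; rewrite invgK in e1 e3.
have Hq : HH (mob g^-1%g p) by exact: HH_mob.
have n1 : nd g^-1%g p = 1 by apply/nd_eq1.
have := h4 _ Hq e3; rewrite e1.
have -> : (al <= cen g - (Re p - cen g^-1%g) <= be) = (cen g^-1%g - (be - cen g) <= Re p <= cen g^-1%g - (al - cen g)).
  by apply/andP/andP => -[? ?]; split; lra.
move=> <-; split=> [Kp|Kq]; first exact: KKb_mob.
have := nd_inv g^-1%g Hp; rewrite invgK n1 invr1 => n2.
by have := KKb_mob Kq Gg n2; rewrite mobVK.
Qed.

Lemma aff_ends (A B : R) : (forall s, 0 < s < 1 -> 0 <= (1 - s) * A + s * B) -> 0 <= A /\ 0 <= B.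
Proof.
suff H (A' B' : R) : (forall s, 0 < s < 1 -> 0 <= (1 - s) * A' + s * B') -> 0 <= A'.
  move=> AB; split; first exact: H AB.
  apply: (H B A) => s /andP[s0 s1]; have /(_ _) := AB (1 - s).
  have -> : (0 < 1 - s < 1) by apply/andP; split; lra.
  by move=> /(_ isT); rewrite [1 - (1 - s)](_ : _ = s) 1?addrC //; ring.
move=> h; rewrite leNgt; apply/negP => neg.
have B0 := normr_ge0 B'; have B1 := ler_norm B'.
pose k := `|B'| - A' + 1; have k0 : 0 < k by rewrite /k; lra.
pose s := - A' / (2 * k).
have sk : s * (2 * k) = - A' by rewrite /s divfK // mulf_neq0 // gt_eqF.
have s0 : 0 < s by rewrite divr_gt0 ?oppr_gt0 // mulr_gt0.
have s1 : s < 1 by rewrite ltr_pdivrMr ?mulr_gt0 // /k; lra.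
have := h s; rewrite s0 s1 => /(_ isT); rewrite /k in sk; nra.
Qed.

(** The ends of an arc may be real, hence outside [KKb]; affinity carries the inequality over to
    them. *)
Lemma Arc_lin g al be h x : Arc g al be -> al <= x <= be -> Gamma h -> pc h != 0 -> 0 <= lin g h x.
Proof.
move=> [[Gg g0] h1 /andP[h2 h2'] h3 h4] xab Gh h0.
have r0 := rad_gt0 g0.
have inn y : al < y -> y < be -> 0 <= lin g h y.
  move=> y1 y2; have Hy : HH (cpt (cen g) (rad g) y) by apply: HH_cpt => //; apply/andP; split; lra.
  have cy : circ (cen g) (rad g) (cpt (cen g) (rad g) y) by apply: circ_cpt; [exact: ltW|apply/andP; split; lra].
  have Ky : KKb (cpt (cen g) (rad g) y) by apply/(h4 _ Hy cy) => /=; rewrite !ltW.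
  exact: (KKb_lin Hy cy).1 Ky h Gh h0.
have al_be : al < be by exact: lt_trans h2'.
have [La Lb] : 0 <= lin g h al /\ 0 <= lin g h be.
  by apply: aff_ends => s /andP[s0 s1]; rewrite -lin_aff; apply: inn; nra.
case/andP: xab => x1 x2; have ab0 : 0 < be - al by rewrite subr_gt0.
have -> : x = (1 - (x - al) / (be - al)) * al + (x - al) / (be - al) * be by field; rewrite gt_eqF.
rewrite lin_aff addr_ge0 // mulr_ge0 //.
  by rewrite subr_ge0 ler_pdivrMr // mul1r lerD2r.
by rewrite divr_ge0 ?(ltW ab0) // subr_ge0.
Qed.

(* Real parts of the vertical sides of precells: centers of relevant isometric spheres and
   infinite vertices. *)
Definition EE (x : R) : Prop := exists g al be, Arc g al be /\
  [\/ x = cen g, x = al /\ al = cen g - rad g | x = be /\ be = cen g + rad g].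

Definition vertK (x : R) : Prop := forall p, HH p -> Re p = x -> KK Gamma p.

Lemma Arc_vertK g al be x : Arc g al be -> al <= x <= be -> (x - cen g) ^+ 2 = rad g ^+ 2 -> vertK x.
Proof.
move=> A xab xr p Hp px; apply/KKP; split => // h Gh h0.
rewrite nd_gt1 // px; have := Arc_lin A xab Gh h0; rewrite /lin xr.
have : 0 < Im p ^+ 2 by rewrite exprn_gt0.
by lra.
Qed.

Lemma EE_cases x : EE x -> (exists g al be, Arc g al be /\ x = cen g) \/ vertK x.
Proof.
move=> [g [al [be [A]]]] [->|[xE E]|[xE E]]; first by left; exists g, al, be.
  right; apply: (Arc_vertK A); last by rewrite xE E; ring.
  by case: A => _ _ /andP[? ?] _ _; rewrite xE lexx ltW // (lt_trans (_ : al < cen g)).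
right; apply: (Arc_vertK A); last by rewrite xE E; ring.
by case: A => _ _ /andP[? ?] _ _; rewrite xE lexx andbT ltW // (lt_trans (_ : al < cen g)).
Qed.

Lemma bKP p : boundaryH (KK Gamma) p <-> KKb p /\ ~ KK Gamma p.
Proof.
split=> [/boundaryKP[Kp [g [Gg g0 n1]]]|[Kp nK]].
  by split => // /KKP[_ /(_ g Gg g0)]; rewrite n1 ltxx.
apply/boundaryKP; split => //; apply: contrapT => H; apply: nK; apply/KKP; split; first exact: Kp.1.
move=> g Gg g0; rewrite lt_def Kp.2 // andbT; apply/eqP => e; apply: H; by exists g.
Qed.

Lemma Arc_bK g al be p : Arc g al be -> HH p -> circ (cen g) (rad g) p -> al <= Re p <= be ->
  boundaryH (KK Gamma) p.
Proof.
move=> [[Gg g0] _ _ _ h4] Hp cp pab; apply/boundaryKP; split; first exact/(h4 p Hp cp).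
by exists g; split => //; exact/nd_eq1.
Qed.

Lemma Arc_summit_bK g al be : Arc g al be -> boundaryH (KK Gamma) (summit g).
Proof.
move=> A; apply: (Arc_bK A); [by apply: HH_summit; case: A => -[]|exact: circ_summit|].
by case: A => _ _ /andP[/ltW h1 /ltW h2] _ _; rewrite /= h1 h2.
Qed.

(** Above the inside of an arc there is a boundary point of [KK], which excludes a vertical line
    contained in [KK]; and if that point is a summit, [Arc_uniq] identifies the two centers. *)
Lemma Arc_gap g al be x : Arc g al be -> al < x < be -> EE x -> x = cen g.
Proof.
move=> A /andP[x1 x2] Ex; have [[Gg g0] h1 h2 h3 h4] := A; have r0 := rad_gt0 g0.
pose p := cpt (cen g) (rad g) x.
have Hp : HH p by apply: HH_cpt => //; apply/andP; split; lra.
have cp : circ (cen g) (rad g) p by apply: circ_cpt; [exact: ltW|apply/andP; split; lra].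
have bp : boundaryH (KK Gamma) p by apply: (Arc_bK A) => //=; rewrite !ltW.
case: (EE_cases Ex) => [[h [al' [be' [A' xE]]]]|V]; last by have /bKP[_ []] := bp; exact: V.
have [[Gh h0] _ _ _ _] := A'.
have pE : p = summit h by exact: (bK_uniq bp (Arc_summit_bK A') xE).
rewrite xE; apply: (Arc_uniq A Hp cp); rewrite /= ?x1 ?x2 //.
by rewrite pE; apply/nd_eq1 => //; exact: circ_summit.
Qed.

Lemma cen_stab g h : Gamma h -> pc h = 0 -> pc g != 0 ->
  [/\ pc (g * h^-1)%g != 0, cen (g * h^-1)%g = cen g + tau h & rad (g * h^-1)%g = rad g].
Proof.
move=> Gh h0 g0.
have [s s2 [_ _ Ec Ed]] := psl2_mul_entries g h^-1%g.
have [t t2 [Fa Fb Fc Fd]] := psl2_inv_entries h.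
have ad := stab_d2 hF hC Gh h0; have a2 := stab_unipotent hF hC Gh h0.
have s0 := sqr1_neq0 s2; have t0 := sqr1_neq0 t2; have a0 := sqr1_neq0 a2.
have cE : pc (g * h^-1)%g = s * t * pa h * pc g by rewrite Ec Fa Fc ad h0; ring.
split.
- by rewrite cE !mulf_neq0.
- rewrite /cen cE Ed Fb Fd /tau ad.
  have -> : pb h * pa h = pb h / pa h by rewrite -[LHS]mulr1 -[X in X / _]mulr1 -{2}a2; field.
  by field; rewrite s0 t0 a0 g0.
- by rewrite /rad cE !normrM (sqr1_norm s2) (sqr1_norm t2) (sqr1_norm a2) !mul1r.
Qed.

Lemma KKb_stab h p : Gamma h -> pc h = 0 -> HH p -> KKb (mob h p) <-> KKb p.
Proof.
move=> Gh h0 Hp; have [Gi i0 _] := stabV hF hC Gh h0.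
split=> K; last by apply: KKb_mob => //; exact: (stab_nd hF hC).
by have := KKb_mob K Gi (stab_nd hF hC _ Gi i0); rewrite mobK.
Qed.

Lemma Arc_shift g al be h : Arc g al be -> Gamma h -> pc h = 0 ->
  Arc (g * h^-1)%g (al + tau h) (be + tau h).
Proof.
move=> [[Gg g0] h1 h2 h3 h4] Gh h0; have [n0 cE rE] := cen_stab Gh h0 g0.
have [Gi i0 tE] := stabV hF hC Gh h0.
split.
- by split => //; apply: GammaM.
- by rewrite cE rE; lra.
- by rewrite cE; case/andP: h2 => ? ?; apply/andP; split; lra.
- by rewrite cE rE; lra.
move=> p Hp; rewrite cE rE => cp.
have e := stab_mob hF hC p Gi i0; rewrite tE in e.
rewrite -(KKb_stab Gi i0 Hp) h4 ?e /=; last 2 first.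
- by rewrite -e; exact: HH_mob.
- by move: cp; rewrite /circ /= => <-; ring.
by split=> /andP[? ?]; apply/andP; split; lra.
Qed.

Lemma EE_shift x h : EE x -> Gamma h -> pc h = 0 -> EE (x + tau h).
Proof.
move=> [g [al [be [A H]]]] Gh h0; have g0 : pc g != 0 by case: A => -[].
have [n0 cE rE] := cen_stab Gh h0 g0.
exists (g * h^-1)%g, (al + tau h), (be + tau h); split; first exact: Arc_shift.
case: H => [->|[-> e]|[-> e]]; [apply: Or31|apply: Or32|apply: Or33]; rewrite ?cE ?rE //; split => //.
  by rewrite e; ring.
by rewrite e; ring.
Qed.

(* The leaves, translates of the vertical lines over [EE], turn out to be the sides of the cells. *)
Definition leaf g (e : R) : set C := [set p | HH p /\ Re (mob g^-1%g p) = e].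

Definition is_leaf (l : set C) : Prop := exists g e, [/\ Gamma g, EE e & l = leaf g e].

Lemma leaf1 e p : leaf 1%g e p <-> HH p /\ Re p = e.
Proof. by rewrite /leaf /= invg1 mob1. Qed.

Lemma leaf_mul h g e p : HH p -> leaf (h * g)%g e p <-> leaf g e (mob h^-1%g p).
Proof.
move=> Hp; rewrite /leaf /= invgM mob_mul //.
by split=> -[_ ->]; split => //; exact: HH_mob.
Qed.

Lemma leaf_stab h e : Gamma h -> pc h = 0 -> leaf h e = leaf 1%g (e + tau h).
Proof.
move=> Gh h0; have [Gi i0 tE] := stabV hF hC Gh h0.
rewrite eqEsubset; split=> p.
  by move=> [Hp E]; apply/leaf1; split => //; move: E; rewrite (stab_mob hF hC) //= tE; lra.
by move=> /leaf1[Hp E]; split => //; rewrite (stab_mob hF hC) //= tE E; ring.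
Qed.

(** [h] maps the vertical line over the center of I(h) onto the one over the center of I(h^-1), so
    these leaves have two descriptions. *)
Lemma leaf_flip t h : pc h != 0 -> leaf (t * h)%g (cen h) = leaf t (cen h^-1%g).
Proof.
move=> h0; have i0 : pc h^-1%g != 0 by rewrite pcV_neq0.
have E p : HH p -> (leaf (t * h)%g (cen h) p <-> leaf t (cen h^-1%g) p).
  move=> Hp; rewrite leaf_mul // /leaf /= -/(mob _ _); have Hq : HH (mob t^-1%g p) by exact: HH_mob.
  have n0 := nd_gt0 h^-1%g Hq.
  rewrite Re_mob_c // invgK; split=> -[_ e]; split => //; last by rewrite e subrr mul0r subr0.
  have /eqP : (Re (mob t^-1%g p) - cen h^-1%g) / nd h^-1%g (mob t^-1%g p) = 0 by lra.
  by rewrite mulf_eq0 invr_eq0 (gt_eqF n0) orbF subr_eq0 => /eqP.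
by rewrite eqEsubset; split=> p lp; apply/E => //; case: lp.
Qed.

(** Write [p] as the image under [g] of a point [q] above [e]. If [q] is in [KK], then [g] fixes
    infinity. Otherwise [e] is the center of some [h] and [q] is not above the summit: strictly
    below it, [mob h q] is above the summit of [h^-1], hence in [KK], and [g * h^-1] fixes infinity;
    at the summit, [g] fixes infinity or has the circle of [h] by [Arc_uniq]. *)
Lemma leaf_KKb g e p : Gamma g -> EE e -> leaf g e p -> KKb p -> leaf g e = leaf 1%g (Re p) /\ EE (Re p).
Proof.
move=> Gg Ee [Hp pe] Kp.
set q := mob g^-1%g p in pe; have Hq : HH q by exact: HH_mob.
have pq : p = mob g q by rewrite /q mobVK.
have stab t e' : Gamma t -> pc t = 0 -> EE e' -> leaf g e = leaf t e' -> leaf g e = leaf 1%g (Re p) /\ EE (Re p).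
  move=> Gt t0 Ee' E; rewrite E leaf_stab //.
  have : leaf t e' p by rewrite -E; split.
  by rewrite leaf_stab // => /leaf1[_ ->]; split => //; exact: EE_shift.
have flip t h al be : Gamma t -> pc t = 0 -> Arc h al be -> e = cen h -> g = (t * h)%g ->
    leaf g e = leaf 1%g (Re p) /\ EE (Re p).
  move=> Gt t0 A eh gE; have h0 : pc h != 0 by case: A => -[].
  apply: (stab t (cen h^-1%g)) => //; last by rewrite gE eh leaf_flip.
  by have A' := Arc_inv A; eexists; eexists; eexists; split; [exact: A'|apply: Or31].
have vK : KK Gamma q -> leaf g e = leaf 1%g (Re p) /\ EE (Re p).
  by move=> Kq; apply: (stab g e) => //; apply: (KK_KKb_stab Kq Gg); rewrite -pq.
case: (EE_cases Ee) => [[h [al [be [A eh]]]]|V]; last by apply: vK; exact: V.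
have [[Gh h0] _ _ _ _] := A; have r0 := rad_gt0 h0.
have Ks := (bKP _).1 (Arc_summit_bK A).
have gh : (g * h^-1 * h)%g = g by rewrite -mulgA mulVg mulg1.
have Ggh : Gamma (g * h^-1)%g by apply: GammaM => //; exact: GammaV.
have [lt|gt|e1] := ltgtP (Im q) (rad h).
- have Hhq : HH (mob h q) by exact: HH_mob.
  have ne : nd h q = Im q ^+ 2 / rad h ^+ 2 by rewrite nd_cen // pe eh subrr expr0n add0r.
  have rE : Re (mob h q) = cen h^-1%g by rewrite Re_mob_c // pe eh subrr mul0r subr0.
  have iq : 0 < Im q by [].
  have iE : Im (mob h q) = rad h ^+ 2 / Im q by rewrite Im_mob // ne; field; rewrite !gt_eqF.
  have Khq : KK Gamma (mob h q).
    have A' := Arc_inv A; have [K' _] := (bKP _).1 (Arc_summit_bK A').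
    by apply: (KKb_up K') => //=; rewrite iE radV ltr_pdivlMr // expr2 ltr_pM2l.
  apply: (flip (g * h^-1)%g h al be) => //.
  apply: (KK_KKb_stab Khq Ggh).
  by rewrite -mob_mul // gh -pq.
- by apply: vK; apply: (KKb_up Ks.1); rewrite /= ?pe ?eh.
- have qE : q = summit h by apply: complex_ext; rewrite /= ?pe.
  have Kq : KKb q by rewrite qE; case: Ks.
  have n1 : nd g q = 1 by apply: (KKb_both Kq Gg); rewrite -pq.
  have [g0|g0] := eqVneq (pc g) 0; first by apply: (stab g e).
  apply: (flip (g * h^-1)%g h al be) => //; apply: same_cen => //.
  apply: (Arc_uniq A Hq) => //; first by rewrite qE; exact: circ_summit.
  by rewrite pe eh; case: A.
Qed.

(** Provided later by [EE_isolated]; this is how geometric finiteness reaches the leaves. *)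
Hypothesis hE : forall v, exists2 d : R, 0 < d & forall x, EE x -> `|x - v| < d -> x = v.

Lemma KKb_nd_le w k : HH w -> Gamma k -> KKb (mob k w) -> nd k w <= 1.
Proof.
move=> Hw Gk Kkw; have := KKb_Im Kkw (GammaV hF Gk); rewrite mobK // Im_mob //.
have n0 := nd_gt0 k Hw; rewrite ler_pdivlMr // -ler_pdivlMl // mulVf ?gt_eqF //.
Qed.

Lemma EE_unshift x h : EE (x + tau h) -> Gamma h -> pc h = 0 -> EE x.
Proof.
move=> E Gh h0; have [Gi i0 tE] := stabV hF hC Gh h0.
by have := EE_shift E Gi i0; rewrite tE addrK.
Qed.

Lemma leaf_lmul h l : is_leaf l -> Gamma h -> is_leaf [set p | HH p /\ l (mob h^-1%g p)].
Proof.
move=> [g [e [Gg Ee ->]]] Gh; exists (h * g)%g, e; split => //; first exact: GammaM.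
rewrite eqEsubset; split=> p; first by move=> [Hp lp]; exact: ((leaf_mul h g e Hp).2 lp).
by move=> lp; exact: (conj lp.1 ((leaf_mul h g e lp.1).1 lp)).
Qed.

(** Move [w] into the Ford domain by [k], where leaves are vertical lines over [EE]. Either [k] is a
    translation, or its circle passes through [p], which leaves finitely many circles; elements with
    one circle differ by translations, under which [EE] is invariant, so isolation of [EE] at one
    point per circle suffices. *)
Lemma leaf_near_KKb p : KKb p -> \forall w \near p, forall l, is_leaf l -> l w -> l p.
Proof.
move=> Kp; have Hp := Kp.1.
have p0 : 0 < Im p by [].
have [Rb Rb0 HR] := rad_bound.
have [d0 d00 Hd0] := hE (Re p).
have fin := @circles_finite (`|Re p| + Rb) (Im p) p0.
pose P (x : R * R) : set C := [set w | forall k, Gamma k -> pc k != 0 -> cen k = x.1 ->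
   nd k p = 1 -> EE (Re (mob k w)) -> Re (mob k w) = Re (mob k p)].
have HP : forall x, [set x : R * R | exists g, [/\ Gamma g, pc g != 0, `|cen g| <= `|Re p| + Rb, Im p <= rad g & x = (cen g, rad g)]] x -> nbhs p (P x).
  move=> x _.
  have [[k0 [Gk0 k00 ck0 n0]]|none] := pselect (exists k, [/\ Gamma k, pc k != 0, cen k = x.1 & nd k p = 1]); last first.
    by near=> w => k Gk k0 ck n; case: none; exists k.
  have [d d1 Hd] := hE (Re (mob k0 p)).
  have N1 : \forall w \near p, `|Re (mob k0 w) - Re (mob k0 p)| < d.
    by apply: (@mob_near _ k0 p [set u | `|Re u - Re (mob k0 p)| < d]) => //; exact: Re_near.
  near=> w; have Hw : HH w by near: w; exact: HH_near.
  move=> k Gk k1 ck n E.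
  have t0 : pc (k * k0^-1)%g = 0 by apply: same_cen => //; rewrite ck ck0.
  have Gt : Gamma (k * k0^-1)%g by apply: GammaM => //; exact: GammaV.
  have kk (u : C) : HH u -> Re (mob k u) = Re (mob k0 u) + tau (k * k0^-1)%g.
    move=> Hu; have {1}-> : k = (k * k0^-1 * k0)%g by rewrite -mulgA mulVg mulg1.
    by rewrite mob_mul // (stab_mob hF hC).
  rewrite kk // in E; rewrite !kk //; congr (_ + _); apply: Hd.
    exact: EE_unshift E Gt t0.
  by near: w.
have N2 := finite_near (nbhs_filter p) fin HP.
near=> w.
have Hw : HH w by near: w; exact: HH_near.
have [k [Gk Kkw]] := hcov Hw.
have nk := KKb_nd_le Hw Gk Kkw.
move=> l ll lw.
have llk := leaf_lmul ll Gk.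
have lkw : [set p | HH p /\ l (mob k^-1%g p)] (mob k w).
  by split; [exact: HH_mob|rewrite mobK].
have [lE EkW] : [set p | HH p /\ l (mob k^-1%g p)] = leaf 1%g (Re (mob k w)) /\ EE (Re (mob k w)).
  by move: llk lkw => [g [e [Gg Ee ->]]] lkw; exact: leaf_KKb.
suff E : Re (mob k w) = Re (mob k p).
  have : leaf 1%g (Re (mob k w)) (mob k p) by apply/leaf1; split => //; exact: HH_mob.
  by rewrite -lE => -[_]; rewrite mobK.
have [c0|c0] := eqVneq (pc k) 0.
  rewrite !(stab_mob hF hC) //=; congr (_ + _).
  have := EkW; rewrite (stab_mob hF hC) //= => /EE_unshift /(_ Gk c0) Ew.
  apply: Hd0 => //; near: w; exact: Re_near.
have n1 : nd k p = 1.
  apply/eqP; rewrite eq_le Kp.2 // andbT.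
  have : HH w /\ forall g, Gamma g -> pc g != 0 -> nd g w <= 1 -> nd g p <= 1 by near: w; exact: nd_near.
  by move=> [_]; apply.
have r0 := rad_gt0 c0; have cp : circ (cen k) (rad k) p by exact/nd_eq1.
have H2 : forall i, [set x : R * R | exists g, [/\ Gamma g, pc g != 0, `|cen g| <= `|Re p| + Rb, Im p <= rad g & x = (cen g, rad g)]] i -> P i w.
  by near: w.
apply: (H2 (cen k, rad k)) => //; exists k; split => //.
  have /andP[b1 b2] := circ_between (ltW r0) Hp cp; have rb := HR k Gk c0.
  have : `|cen k - Re p| <= Rb by rewrite ler_norml; apply/andP; split; lra.
  by have := ler_normD (Re p) (cen k - Re p); rewrite addrC subrK; lra.
rewrite -(ler_pXn2r (_ : 0 < 2)%N) ?nnegrE ?(ltW r0) ?(ltW p0) //.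
by move: cp; rewrite /circ; have := sqr_ge0 (Re p - cen k); lra.
Unshelve. all: by end_near. Qed.

Lemma leaf_HH l p : is_leaf l -> l p -> HH p.
Proof. by move=> [g [e [_ _ ->]]] []. Qed.

Lemma leaf_near p : HH p -> \forall w \near p, forall l, is_leaf l -> l w -> l p.
Proof.
move=> Hp; have [k [Gk Kk]] := hcov Hp.
have N1 := mob_near Hp (leaf_near_KKb Kk).
apply: filterS N1 => w N l ll lw; have Hw := leaf_HH ll lw.
by have := N _ (leaf_lmul ll Gk); rewrite /= !mobK // => /(_ (conj (HH_mob k Hw) lw)) [].
Qed.

(** After moving [p] into the Ford domain both leaves are the vertical line through it. *)
Lemma leaf_uniq l l' p : is_leaf l -> is_leaf l' -> l p -> l' p -> l = l'.
Proof.
move=> ll ll' lp lp'; have Hp := leaf_HH ll lp.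
have [k [Gk Kk]] := hcov Hp.
have tr m : is_leaf m -> m p -> [set p | HH p /\ m (mob k^-1%g p)] = leaf 1%g (Re (mob k p)).
  move=> lm mp; have := leaf_lmul lm Gk => -[g [e [Gg Ee E]]].
  have lk : leaf g e (mob k p) by rewrite -E /= mobK //; split; [exact: HH_mob|].
  by rewrite E; have [-> _] := leaf_KKb Gg Ee lk Kk.
have E : [set p | HH p /\ l (mob k^-1%g p)] = [set p | HH p /\ l' (mob k^-1%g p)] by rewrite !tr.
have half m m' : is_leaf m -> is_leaf m' -> [set p | HH p /\ m (mob k^-1%g p)] = [set p | HH p /\ m' (mob k^-1%g p)] -> m `<=` m'.
  move=> lm lm' e q mq; have Hq := leaf_HH lm mq.
  have : [set p | HH p /\ m (mob k^-1%g p)] (mob k q) by rewrite /= mobK //; split; [exact: HH_mob|].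
  by rewrite e /= mobK // => -[].
by rewrite eqEsubset; split; apply: half.
Qed.

(** * Precells *)

(* The precells are the columns [col lo hi] with [gap lo hi]; [side g x] is the non-vertical
   side between the summit of [I(g)] and the end of its relevant part above [x]. *)
Definition col (lo hi : R) : set C := [set p | KKb p /\ lo <= Re p <= hi].

Definition gap (lo hi : R) : Prop := [/\ lo < hi, EE lo, EE hi & forall x, lo < x < hi -> ~ EE x].

Definition side g (x : R) : set C :=
  [set p | [/\ HH p, circ (cen g) (rad g) p & Num.min (cen g) x <= Re p <= Num.max (cen g) x]].

Lemma hconvex_col lo hi : hconvex (col lo hi).
Proof.
have -> : col lo hi = KKb `&` ([set z | HH z /\ 0 <= Phi (0, 1, - lo) z] `&` [set z | HH z /\ 0 <= Phi (0, -1, hi) z]).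
  rewrite eqEsubset; split=> p.
    move=> [Kp /andP[h1 h2]]; split => //; split; (split; first exact: Kp.1); rewrite /Phi /=; lra.
  by move=> [Kp [[_ h1] [_ h2]]]; split => //; move: h1 h2; rewrite /Phi /= => h1 h2; apply/andP; split; lra.
apply: hconvexI; first exact: hconvex_KKb.
by apply: hconvexI; exact: hconvex_Phi.
Qed.

(** Join the two vertical rays by a geodesic between points at the great height [Y]: it passes above
    [u], and the vertical segment from there down to [p] contains [u]. *)
Lemma hconvex_fill (V : set C) lo hi T p u : hconvex V -> lo < hi ->
  (forall y, 0 < y -> T <= y -> V (lo +i* y)) -> (forall y, 0 < y -> T <= y -> V (hi +i* y)) ->
  V p -> lo <= Re p <= hi -> Re u = Re p -> Im p <= Im u -> V u.
Proof.
move=> cV lh Vl Vh Vp /andP[h1 h2] up pu; have Hp : HH p by case: cV => VH _; exact: VH.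
have p0 : 0 < Im p by []. have u0 : 0 < Im u by exact: lt_le_trans pu.
pose Y : R := `|T| + Im u; have Y0 : 0 < Y by rewrite ltr_wpDl.
have YT : T <= Y by rewrite (le_trans (ler_norm T)) // lerDl ltW.
have Yu : Im u <= Y by rewrite lerDr.
have d0 : 0 < hi - lo by rewrite subr_gt0.
pose s : R := (Re u - lo) / (hi - lo).
have s0 : 0 <= s by rewrite divr_ge0 ?(ltW d0) // subr_ge0 up.
have s1 : s <= 1 by rewrite ler_pdivrMr // mul1r lerD2r up.
have uE : Re u = (1 - s) * lo + s * hi by rewrite /s; field; rewrite gt_eqF.
have [|||q q0 K] := @kl_ex R (lo +i* Y) (hi +i* Y) s; rewrite ?s0 ?s1 //=; try exact: ltW.
have Vq : V q by apply: (hconvex_kl cV (Vl _ Y0 YT) (Vh _ Y0 YT) _ q0 K); rewrite s0 s1.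
have [K1 K2] := K.
have qu : Re q = Re u by rewrite K1 /= uE.
have qI : Im u <= Im q.
  rewrite -(ler_pXn2r (_ : 0 < 2)%N) ?nnegrE ?(ltW u0) //.
  have E : Im q ^+ 2 = nsq q - Re q ^+ 2 by rewrite /nsq; ring.
  have Y2 : Im u ^+ 2 <= Y ^+ 2 by rewrite lerXn2r // nnegrE ltW.
  rewrite (le_trans Y2) // E K2 qu uE /nsq /=.
  have := mulr_ge0 s0 (_ : 0 <= 1 - s); rewrite subr_ge0 => /(_ s1) ss.
  have := mulr_ge0 ss (sqr_ge0 (hi - lo)); nra.
have [e|ne] := eqVneq (nsq q) (nsq p).
  have -> : u = p; last by [].
  apply: nsq_inj => //; try exact: ltW.
  have : nsq p <= nsq u by rewrite /nsq up lerD2l lerXn2r // nnegrE ltW.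
  have : nsq u <= nsq q by rewrite /nsq qu lerD2l lerXn2r // nnegrE ltW.
  by rewrite e => h3 h4; apply/eqP; rewrite eq_le h3 h4.
have n1 : nsq p <= nsq u by rewrite /nsq up lerD2l lerXn2r // nnegrE ltW.
have n2 : nsq u <= nsq q by rewrite /nsq qu lerD2l lerXn2r // nnegrE ltW.
have n0 : 0 < nsq q - nsq p by rewrite subr_gt0 lt_def ne (le_trans n1).
apply: (hconvex_kl (s := (nsq u - nsq p) / (nsq q - nsq p)) cV Vp Vq) => //; last 1 first.
- split; last by field; rewrite gt_eqF.
  by rewrite qu up; ring.
- by rewrite divr_ge0 ?(ltW n0) ?subr_ge0 //= ler_pdivrMr // mul1r lerD2r.
- exact: ltW.
Qed.

Lemma col_ray lo hi p : KKb p -> lo <= Re p <= hi -> gseg (Some p) None `<=` col lo hi.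
Proof.
move=> Kp pr u /gseg_ray_sub[Hu e i]; split; last by rewrite e.
exact: KKb_up_le Kp e i.
Qed.

Lemma KKb_bK_le p u : boundaryH (KK Gamma) p -> KKb u -> Re u = Re p -> Im p <= Im u.
Proof.
move=> /bKP[_ nK] Ku e; rewrite leNgt; apply/negP => lt; apply: nK.
exact: KKb_up Ku (esym e) lt.
Qed.

Lemma linN g h x : lin h g x = - lin g h x. Proof. by rewrite /lin; ring. Qed.

Lemma side_gseg g z : pc g != 0 -> circ (cen g) (rad g) z -> 0 <= Im z -> Re z != cen g ->
  gseg (Some (summit g)) (Some z) = side g (Re z).
Proof.
move=> g0 cz z0 ne; have r0 := ltW (rad_gt0 g0); have cs := circ_summit g.
have sE x y : x < y -> carc (cen g) (rad g) x y = [set p | [/\ HH p, circ (cen g) (rad g) p & Num.min x y <= Re p <= Num.max x y]].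
  by move=> xy; rewrite /carc min_l ?max_r // ltW.
have [lt|gt|e] := ltgtP (cen g) (Re z); last by rewrite e eqxx in ne.
  by rewrite (gseg_arc r0 cs cz) //= sE.
rewrite gseg_sym (gseg_arc r0 cz cs) //= sE //.
by rewrite /side minC maxC.
Qed.

Lemma bK_EE g al be z : Arc g al be -> HH z -> circ (cen g) (rad g) z -> al <= Re z <= be -> EE (Re z) ->
  Re z = cen g.
Proof.
move=> A Hz cz zr Ez; have bz := Arc_bK A Hz cz zr; have [[Gg g0] _ _ _ _] := A.
case: (EE_cases Ez) => [[h [al' [be' [A' zE]]]]|V]; last by have /bKP[_ []] := bz; exact: V.
have [[Gh h0] _ hh _ _] := A'.
have zS : z = summit h by exact: (bK_uniq bz (Arc_summit_bK A') zE).
have := Arc_uniq A' (HH_summit h0) (circ_summit h) hh Gg g0.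
rewrite zE => -> //; rewrite -zS; exact/nd_eq1.
Qed.

(** The column is convex and contains the segments between the vertices; conversely, a convex set
    containing these segments contains the two arcs and, by [hconvex_fill], all points above them.
    It remains to see which end of each arc is [z]: two arcs with a common left end, or a common
    right end, would overlap. *)
Lemma noncusp_col z b1 b2 A : noncuspidal_precell Gamma z b1 b2 A ->
  exists gL gR al be, [/\ Arc gL al (Re z), Arc gR (Re z) be,
    [/\ HH z, circ (cen gL) (rad gL) z & circ (cen gR) (rad gR) z],
    gap (cen gL) (cen gR) /\ A = col (cen gL) (cen gR) &
    (b1 = side gL (Re z) /\ b2 = side gR (Re z)) \/ (b1 = side gR (Re z) /\ b2 = side gL (Re z))].
Proof.
move=> [Hz [I1 [I2 [s1 [s2 [[r1 r2 I12] e1 e2 [sm1 sm2] [-> -> ->]]]]]]].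
have [g1 [a1 [c1 [E1 A1 P1]]]] := relevant_Arc r1.
have [g2 [a2 [c2 [E2 A2 P2]]]] := relevant_Arc r2.
have main gL aL bL gR aR bR : Arc gL aL bL -> Arc gR aR bR -> bL = Re z -> aR = Re z ->
    circ (cen gL) (rad gL) z -> circ (cen gR) (rad gR) z ->
    gap (cen gL) (cen gR) /\ hpolygon [set x : one_point_compactification R[i] | [\/ x = Some (summit gL), x = Some z, x = Some (summit gR) | x = None]] = col (cen gL) (cen gR).
  move=> AL AR bz az cL cR; rewrite bz in AL; rewrite az in AR.
  have [[GL L0] l1 /andP[l2 l2'] l3 l4] := AL; have [[GR R0] m1 /andP[m2 m2'] m3 m4] := AR.
  have lh : cen gL < cen gR by exact: lt_trans m2.
  have EL : EE (cen gL) by exists gL, aL, (Re z); split => //; apply: Or31.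
  have ER : EE (cen gR) by exists gR, (Re z), bR; split => //; apply: Or31.
  have zL : aL <= Re z <= Re z by rewrite lexx andbT ltW // (lt_trans l2).
  have KsL := ((bKP _).1 (Arc_summit_bK AL)).1; have KsR := ((bKP _).1 (Arc_summit_bK AR)).1.
  have bz' := Arc_bK AL Hz cL zL; have Kz := ((bKP _).1 bz').1.
  split.
    split => // x /andP[x1 x2] Ex.
    have [lt|gt|e] := ltgtP x (Re z).
    - have xx : aL < x < Re z by rewrite lt andbT (lt_trans l2).
      by move: x1; rewrite (Arc_gap AL xx Ex) ltxx.
    - have xx : Re z < x < bR by rewrite gt (lt_trans x2).
      by move: x2; rewrite (Arc_gap AR xx Ex) ltxx.
    - by move: l2'; rewrite -(bK_EE AL Hz cL zL) ?ltxx // -e.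
  rewrite eqEsubset; split.
    apply: bigcap_inf; split; first exact: hconvex_col.
    have mid p : [\/ p = summit gL, p = z | p = summit gR] -> col (cen gL) (cen gR) p.
      by case=> ->; split => //=; rewrite ?lexx ?(ltW lh) // !ltW.
    have ray p : [\/ p = summit gL, p = z | p = summit gR] -> gseg (Some p) None `<=` col (cen gL) (cen gR).
      by move=> /mid[Kp pr]; exact: col_ray.
    have [_ hc] := hconvex_col (cen gL) (cen gR).
    have cas (x : one_point_compactification R[i]) : [\/ x = Some (summit gL), x = Some z, x = Some (summit gR) | x = None] ->
       x = None \/ exists2 p, [\/ p = summit gL, p = z | p = summit gR] & x = Some p.
      case=> ->; [right|right|right|by left]; [exists (summit gL)|exists z|exists (summit gR)] => //.
      - exact: Or31.
      - exact: Or32.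
      - exact: Or33.
    move=> x y /cas[->|[p hp ->]] /cas[->|[q hq ->]].
    - by move=> u /gseg_cl[_ _ []].
    - by rewrite gseg_sym; exact: ray.
    - exact: ray.
    - by apply: hc; exact: mid.
  move=> u [Ku /andP[u1 u2]] V [cV HV].
  have in1 : gseg (Some (summit gL)) None `<=` V by apply: HV; [exact: Or41|exact: Or44].
  have in2 : gseg (Some (summit gR)) None `<=` V by apply: HV; [exact: Or43|exact: Or44].
  have in3 : gseg (Some (summit gL)) (Some z) `<=` V by apply: HV; [exact: Or41|exact: Or42].
  have in4 : gseg (Some (summit gR)) (Some z) `<=` V by apply: HV; [exact: Or43|exact: Or42].
  have rL := rad_gt0 L0; have rR := rad_gt0 R0.
  have vL y : 0 < y -> rad gL <= y -> V (cen gL +i* y).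
    by move=> y0 ry; apply: in1; rewrite gseg_ray /= ?(ltW rL).
  have vR y : 0 < y -> rad gR <= y -> V (cen gR +i* y).
    by move=> y0 ry; apply: in2; rewrite gseg_ray /= ?(ltW rR).
  have [p [Vp pu bp]] : exists p, [/\ V p, Re p = Re u & boundaryH (KK Gamma) p].
    have [le|gt] := leP (Re u) (Re z).
      pose p := cpt (cen gL) (rad gL) (Re u).
      have Hp : HH p by apply: HH_cpt => //; have /andP[? ?] := circ_between (ltW rL) Hz cL; apply/andP; split; lra.
      have cp : circ (cen gL) (rad gL) p by apply: circ_cpt; [exact: ltW|have /andP[? ?] := circ_between (ltW rL) Hz cL; apply/andP; split; lra].
      exists p; split; [|by []|apply: (Arc_bK AL Hp cp) => /=; apply/andP; split; lra].
      apply: in3; rewrite side_gseg //; [|exact: ltW|by rewrite gt_eqF].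
      by split => //; rewrite min_l ?max_r ?(ltW l2') //= u1.
    pose p := cpt (cen gR) (rad gR) (Re u).
    have Hp : HH p by apply: HH_cpt => //; have /andP[? ?] := circ_between (ltW rR) Hz cR; apply/andP; split; lra.
    have cp : circ (cen gR) (rad gR) p by apply: circ_cpt; [exact: ltW|have /andP[? ?] := circ_between (ltW rR) Hz cR; apply/andP; split; lra].
    exists p; split; [|by []|apply: (Arc_bK AR Hp cp) => /=; apply/andP; split; lra].
    apply: in4; rewrite side_gseg //; [|exact: ltW|by rewrite lt_eqF].
    by split => //; rewrite min_r ?max_l ?(ltW m2) //= u2 ltW.
  apply: (@hconvex_fill V (cen gL) (cen gR) (rad gL + rad gR) p) => //.
  - by move=> y y0 ry; apply: vL => //; lra.
  - by move=> y y0 ry; apply: vR => //; lra.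
  - by rewrite pu u1.
  - by apply: KKb_bK_le => //; rewrite pu.
have sm g s : pc g != 0 -> is_summit (isosphere g) s -> s = summit g by move=> g0 /is_summitP; exact.
rewrite P1 in e1; rewrite P2 in e2; rewrite E1 in sm1; rewrite E2 in sm2.
have [[G1 g10] h1 /andP[h2 h2'] h3 h4] := A1; have [[G2 g20] k1 /andP[k2 k2'] k3 k4] := A2.
have ac1 : a1 < c1 by exact: lt_trans h2'. have ac2 : a2 < c2 by exact: lt_trans k2'.
have {}e1 := arc_end_inv (rad_gt0 g10) h1 ac1 h3 e1.
have {}e2 := arc_end_inv (rad_gt0 g20) k1 ac2 k3 e2.
rewrite (sm _ _ g10 sm1) (sm _ _ g20 sm2).
have crc g a b x : Arc g a b -> a <= x <= b -> Some z = Some (cpt (cen g) (rad g) x) -> circ (cen g) (rad g) z /\ Re z = x.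
  move=> [[_ g0] j1 j2 j3 _] xr [->]; split => //; apply: circ_cpt; first exact: ltW (rad_gt0 g0).
  by case/andP: xr => ? ?; apply/andP; split; lra.
(* Arcs overlapping in an open interval lie on the same circle, which contradicts that the two
   spheres are distinct. *)
have same : (forall x, a1 < x < c1 -> a2 < x < c2 -> (forall y, (a1 <= y <= c1) && (a2 <= y <= c2) = true -> lin g1 g2 y = 0) -> False).
  move=> x x1 x2 /(_ x) L; have {}L : lin g1 g2 x = 0.
    by apply: L; case/andP: x1 => ? ?; case/andP: x2 => ? ?; rewrite !ltW.
  have r1' := rad_gt0 g10.
  have cx : circ (cen g1) (rad g1) (cpt (cen g1) (rad g1) x) by apply: circ_cpt; [exact: ltW|case/andP: x1 => ? ?; apply/andP; split; lra].
  have Hx : HH (cpt (cen g1) (rad g1) x) by apply: HH_cpt => //; case/andP: x1 => ? ?; apply/andP; split; lra.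
  have e : cen g2 = cen g1 by apply: (Arc_uniq A1 Hx cx x1 G2 g20); exact: (lin_eq g20 cx).2 L.
  apply: I12; rewrite E1 E2; have t0 := same_cen g20 g10 e.
  have Gt : Gamma (g2 * g1^-1)%g by apply: GammaM => //; exact: GammaV.
  have E : (g2 * g1^-1 * g1)%g = g2 by rewrite -mulgA mulVg mulg1.
  rewrite eqEsubset; split=> w /isosphereP[Hw n1]; apply/isosphereP; split => //.
    by rewrite -E cusp_shift.
  by rewrite -E cusp_shift in n1.
have nn y : (a1 <= y <= c1) && (a2 <= y <= c2) = true -> lin g1 g2 y = 0.
  move=> /andP[y1 y2]; apply/eqP; rewrite eq_le (Arc_lin A1 y1 G2 g20) andbT.
  by rewrite -oppr_ge0 -linN (Arc_lin A2 y2 G1 g10).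
have b1r : a1 <= a1 <= c1 by rewrite lexx ltW. have b1r' : a1 <= c1 <= c1 by rewrite lexx ltW.
have b2r : a2 <= a2 <= c2 by rewrite lexx ltW. have b2r' : a2 <= c2 <= c2 by rewrite lexx ltW.
case: e1 => e1; case: e2 => e2.
- have [cz1 z1] := crc _ _ _ _ A1 b1r e1; have [cz2 z2] := crc _ _ _ _ A2 b2r e2.
  have aa : a1 = a2 by rewrite -z1 -z2.
  have [m [mm m1 m2]] : exists m, [/\ a1 < m, m <= c1 & m <= c2].
    by exists (Num.min c1 c2); rewrite lt_min ac1 aa ac2 !ge_min !lexx orbT.
  by case: (same ((a1 + m) / 2)) => //; apply/andP; split; lra.
- have [cz1 z1] := crc _ _ _ _ A1 b1r e1; have [cz2 z2] := crc _ _ _ _ A2 b2r' e2.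
  have [g_ h_] := main _ _ _ _ _ _ A2 A1 (esym z2) (esym z1) cz2 cz1.
  exists g2, g1, a2, c1; rewrite {1}z2 {1}z1; split => //.
    split => //; rewrite -h_; congr hpolygon; rewrite eqEsubset; split=> x /=;
      by case=> ->; [apply: Or43|apply: Or42|apply: Or41|apply: Or44].
  right; split; apply: side_gseg => //; try exact: ltW.
    by rewrite z1 lt_eqF.
  by rewrite z2 gt_eqF.
- have [cz1 z1] := crc _ _ _ _ A1 b1r' e1; have [cz2 z2] := crc _ _ _ _ A2 b2r e2.
  have [g_ h_] := main _ _ _ _ _ _ A1 A2 (esym z1) (esym z2) cz1 cz2.
  exists g1, g2, a1, c2; rewrite {1}z1 {1}z2; split => //.
  left; split; apply: side_gseg => //; try exact: ltW.
    by rewrite z1 gt_eqF.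
  by rewrite z2 lt_eqF.
- have [cz1 z1] := crc _ _ _ _ A1 b1r' e1; have [cz2 z2] := crc _ _ _ _ A2 b2r' e2.
  have cc : c1 = c2 by rewrite -z1 -z2.
  have [m [mm m1 m2]] : exists m, [/\ m < c1, a1 <= m & a2 <= m].
    by exists (Num.max a1 a2); rewrite gt_max ac1 cc ac2 !le_max !lexx orbT.
  by case: (same ((c1 + m) / 2)) => //; apply/andP; split; lra.
Qed.

Lemma vertK_ray e lo hi : vertK e -> lo <= e <= hi -> gseg (Some e%:C) None `<=` col lo hi.
Proof.
move=> V er u /gseg_ray_sub[Hu /= eu _]; split; last by rewrite eu.
exact: KK_KKb (V u Hu eu).
Qed.

Lemma gseg_diag_real (e : R) p : ~ gseg (Some e%:C) (Some e%:C) p.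
Proof.
move=> G; have Hp : HH p by exact: gseg_HH G.
have [s _ [/= e1 e2]] := gseg_sub G.
have p0 : 0 < Im p by [].
have h : Im p ^+ 2 = 0.
  have {}e1 : Re p = e by rewrite e1; ring.
  move: e2; rewrite /nsq /= e1 => e2; apply: (addrI (e ^+ 2)); rewrite e2; ring.
by move/eqP: h; rewrite sqrf_eq0 gt_eqF.
Qed.

Lemma Arc_cpt g al be x : Arc g al be -> al <= x <= be -> circ (cen g) (rad g) (cpt (cen g) (rad g) x).
Proof.
move=> [[_ g0] h1 _ h2 _] /andP[x1 x2]; apply: circ_cpt; first exact: ltW (rad_gt0 g0).
by apply/andP; split; lra.
Qed.

Lemma Arc_hull g al be e : Arc g al be -> al <= e <= be -> (e - cen g) ^+ 2 = rad g ^+ 2 ->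
  hpolygon [set x : one_point_compactification R[i] | [\/ x = Some e%:C, x = Some (summit g) | x = None]] =
  col (Num.min (cen g) e) (Num.max (cen g) e).
Proof.
move=> A er e2; have [[Gg g0] h1 /andP[h2 h2'] h3 h4] := A; have r0 := rad_gt0 g0.
have V := Arc_vertK A er e2; have Ks := ((bKP _).1 (Arc_summit_bK A)).1.
have ne : e != cen g by apply/eqP => E; move: e2; rewrite E subrr expr0n /= => /esym/eqP; rewrite sqrf_eq0 gt_eqF.
have ce : circ (cen g) (rad g) e%:C by rewrite /circ /= expr0n addr0.
have SE : gseg (Some e%:C) (Some (summit g)) = side g e.
  by rewrite gseg_sym side_gseg //=.
set lo := Num.min _ _; set hi := Num.max _ _.
have lc : lo <= cen g <= hi by rewrite /lo /hi ge_min le_max !lexx.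
have le_ : lo <= e <= hi by rewrite /lo /hi ge_min le_max !lexx !orbT.
have [er1 er2] := andP er.
have al_lo : al <= lo by rewrite /lo le_min er1 (ltW h2).
have hi_be : hi <= be by rewrite /hi ge_max er2 (ltW h2').
have lh : lo < hi by rewrite /lo /hi; case: (ltgtP (cen g) e) ne => [| |->] //; rewrite eqxx.
have lE : lo = cen g \/ lo = e by rewrite /lo; case: (leP (cen g) e); [left|right].
have hiE : hi = cen g \/ hi = e by rewrite /hi; case: (leP (cen g) e); [right|left].
have sc : side g e `<=` col lo hi.
  move=> p [Hp cp pr]; split; last exact: pr.
  apply/(h4 p Hp cp); case/andP: pr => p1 p2.
  by rewrite (le_trans al_lo p1) (le_trans p2 hi_be).
rewrite eqEsubset; split.
  apply: bigcap_inf; split; first exact: hconvex_col.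
  have [_ hc] := hconvex_col lo hi.
  have cs : col lo hi (summit g) by split.
  move=> x y [->|->|->] [->|->|->].
  - by move=> p /gseg_diag_real.
  - by rewrite SE.
  - exact: vertK_ray.
  - by rewrite gseg_sym SE.
  - exact: hc.
  - exact: col_ray.
  - by rewrite gseg_sym; exact: vertK_ray.
  - by rewrite gseg_sym; exact: col_ray.
  - by move=> u /gseg_cl[_ _ []].
move=> u [Ku /andP[u1 u2]] W [cW HW].
have in1 : gseg (Some e%:C) None `<=` W by apply: HW; [exact: Or31|exact: Or33].
have in2 : gseg (Some (summit g)) None `<=` W by apply: HW; [exact: Or32|exact: Or33].
have in3 : side g e `<=` W by rewrite -SE; apply: HW; [exact: Or31|exact: Or32].
have W1 y : 0 < y -> rad g <= y -> W (cen g +i* y).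
  by move=> y0 ry; apply: in2; rewrite gseg_ray /= ?(ltW r0).
have W2 y : 0 < y -> rad g <= y -> W (e +i* y).
  by move=> y0 ry; apply: in1; rewrite gseg_ray //=; split => //; exact: ltW.
have Hu : HH u by case: Ku.
have [ue|une] := eqVneq (Re u) e.
  by apply: in1; rewrite gseg_ray //=; split => //; exact: ltW.
pose p := cpt (cen g) (rad g) (Re u).
have ur : al <= Re u <= be by rewrite (le_trans al_lo u1) (le_trans u2 hi_be).
have cp : circ (cen g) (rad g) p by exact: Arc_cpt A ur.
have Hp : HH p.
  rewrite /HH /= sqrtr_gt0 subr_gt0 -e2.
  move: u1 u2 ne une; rewrite /lo /hi; case: (leP (cen g) e) => ce' u1 u2 ne une.
    have : Re u < e by rewrite lt_neqAle une u2.
    move=> lt; rewrite ltrXn2r ?nnegrE ?subr_ge0 ?ltrD2r //.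
  have : e < Re u by rewrite lt_neqAle eq_sym une u1.
  move=> lt; rewrite -[ltLHS]sqrrN -[ltRHS]sqrrN ltrXn2r ?nnegrE ?oppr_ge0 ?subr_le0 ?ltrN2 ?ltrD2r //.
have Wp : W p by apply: in3; split => //; rewrite u1 u2.
apply: (@hconvex_fill W lo hi (rad g) p) => //.
- by case: lE => ->.
- by case: hiE => ->.
- by rewrite /= u1.
- by apply: KKb_bK_le => //; exact: Arc_bK A Hp cp ur.
Qed.

Lemma Arc_gap_ends g al be e : Arc g al be -> (e = al /\ al = cen g - rad g) \/ (e = be /\ be = cen g + rad g) ->
  [/\ al <= e <= be, (e - cen g) ^+ 2 = rad g ^+ 2 & gap (Num.min (cen g) e) (Num.max (cen g) e)].
Proof.
move=> A; have [[Gg g0] h1 /andP[h2 h2'] h3 h4] := A; have r0 := rad_gt0 g0.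
have Ec : EE (cen g) by exists g, al, be; split => //; exact: Or31.
move=> [] [-> eE]; split.
- by rewrite lexx (ltW (lt_trans h2 h2')).
- by rewrite eE; ring.
- rewrite min_r ?max_l ?(ltW h2) //; split => //; first by exists g, al, be; split => //; exact: Or32.
  move=> x /andP[x1 x2] Ex; have xx : al < x < be by rewrite x1 (lt_trans x2).
  by move: x2; rewrite (Arc_gap A xx Ex) ltxx.
- by rewrite lexx (ltW (lt_trans h2 h2')).
- by rewrite eE; ring.
- rewrite min_l ?max_r ?(ltW h2') //; split => //; first by exists g, al, be; split => //; exact: Or33.
  move=> x /andP[x1 x2] Ex; have xx : al < x < be by rewrite x2 (lt_trans h2).
  by move: x1; rewrite (Arc_gap A xx Ex) ltxx.
Qed.

Lemma Arc_end_real g al be v : Arc g al be -> bdgH v -> is_endpoint (carc (cen g) (rad g) al be) v ->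
  exists2 e, v = Some e%:C & (e = al /\ al = cen g - rad g) \/ (e = be /\ be = cen g + rad g).
Proof.
move=> A bv; have [[Gg g0] h1 /andP[h2 h2'] h3 h4] := A; have r0 := rad_gt0 g0.
have key x : (cen g - rad g <= x <= cen g + rad g) -> Im (cpt (cen g) (rad g) x) = 0 -> x = cen g - rad g \/ x = cen g + rad g.
  move=> xr /= /eqP; rewrite sqrtr_eq0 subr_le0 => h.
  have {}h : (x - (cen g - rad g)) * (x - (cen g + rad g)) = 0.
    by apply/eqP; rewrite eq_le; apply/andP; split; case/andP: xr => ? ?; nra.
  by move/eqP: h; rewrite mulf_eq0 !subr_eq0 => /orP[]/eqP; [left|right].
move=> /(arc_end_inv r0 h1 (lt_trans h2 h2') h3) [] vE.
- exists al; last left.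
    by move: bv; rewrite vE /= => b0; congr Some; apply: complex_ext.
  split => //; have [||//|] := key al; last by lra.
    by apply/andP; split; lra.
  by move: bv; rewrite vE.
- exists be; last right.
    by move: bv; rewrite vE /= => b0; congr Some; apply: complex_ext.
  split => //; have [|||//] := key be; last by lra.
    by apply/andP; split; lra.
  by move: bv; rewrite vE.
Qed.

Lemma cusp_col v b A : cuspidal_precell Gamma v b A ->
  exists g al be e, [/\ Arc g al be, (e = al /\ al = cen g - rad g) \/ (e = be /\ be = cen g + rad g),
    v = Some e%:C, b = side g e &
    gap (Num.min (cen g) e) (Num.max (cen g) e) /\ A = col (Num.min (cen g) e) (Num.max (cen g) e)].
Proof.
move=> [[_ bv] [I [s [rI eI sI -> ->]]]].
have [g [al [be [IE A1 P1]]]] := relevant_Arc rI.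
have [[Gg g0] _ _ _ _] := A1; have r0 := rad_gt0 g0.
rewrite P1 in eI; rewrite IE in sI.
have sE : s = summit g by move/is_summitP: sI; exact.
have [e vE eE] := Arc_end_real A1 bv eI.
have [er e2 gp] := Arc_gap_ends A1 eE.
exists g, al, be, e; split => //.
  rewrite vE sE gseg_sym (@side_gseg g e%:C) //=.
    by rewrite /circ /= expr0n addr0.
  by apply/eqP => E; move: e2; rewrite E subrr expr0n /= => /esym/eqP; rewrite sqrf_eq0 gt_eqF.
by split => //; rewrite vE sE; exact: Arc_hull A1 er e2.
Qed.

Lemma strip_col A : strip_precell Gamma A ->
  exists lo hi, [/\ gap lo hi, A = col lo hi & forall p, HH p -> lo <= Re p <= hi -> KK Gamma p].
Proof.
move=> [z [w [[[[I rI eI] bz] _] [[[J rJ eJ] bw] _] wz sK ->]]].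
have vert v K : relevant Gamma K -> is_endpoint (relevant_part Gamma K) (Some v) -> bdgH (Some v : one_point_compactification R[i]) ->
    EE (Re v) /\ v = (Re v)%:C.
  move=> rK eK bK; have [g [al [be [IE A1 P1]]]] := relevant_Arc rK.
  rewrite P1 in eK; have [e [vE] eE] := Arc_end_real A1 bK eK; rewrite vE /=; split => //.
  by exists g, al, be; split => //; case: eE => eE; [apply: Or32|apply: Or33].
have [Ez zE] := vert z I rI eI bz; have [Ew wE] := vert w J rJ eJ bw.
set lo := Num.min (Re z) (Re w); set hi := Num.max (Re z) (Re w).
have lh : lo < hi by rewrite /lo /hi; case: (ltgtP (Re z) (Re w)) => // E; case: wz; rewrite zE wE E.
have K p : HH p -> lo <= Re p <= hi -> KK Gamma p by move=> Hp pr; apply: sK.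
exists lo, hi; split => //.
  split => //; [by rewrite /lo; case: (leP (Re z) (Re w))|by rewrite /hi; case: (leP (Re z) (Re w))|].
  move=> x /andP[x1 x2] [g [al [be [A1 xE]]]].
  have [[Gg g0] h1 /andP[h2 h2'] h3 h4] := A1; have r0 := rad_gt0 g0.
  have bad y : lo <= y <= hi -> al <= y <= be -> cen g - rad g < y < cen g + rad g -> False.
    move=> yl ya yr; have Hp : HH (cpt (cen g) (rad g) y) by exact: HH_cpt.
    have := Arc_bK A1 Hp (Arc_cpt A1 ya) ya; move/bKP => -[_]; apply; exact: K.
  case: xE => [xE|[xE aE]|[xE bE]].
  - by apply: (bad x); rewrite ?(ltW x1) ?(ltW x2) // xE; apply/andP; split; lra.
  - have [y y1 [y2 y3]] : exists2 y, x < y & y < hi /\ y < cen g.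
      exists ((x + Num.min hi (cen g)) / 2).
        by rewrite midf_lt // lt_min x2 xE.
      have m1 : (x + Num.min hi (cen g)) / 2 < Num.min hi (cen g) by rewrite midf_lt // lt_min x2 xE.
      by move: m1; rewrite lt_min => /andP[].
    by apply: (bad y); apply/andP; split; lra.
  - have [y y1 [y2 y3]] : exists2 y, y < x & lo < y /\ cen g < y.
      exists ((Num.max lo (cen g) + x) / 2).
        by rewrite midf_lt // gt_max x1 xE.
      have m1 : Num.max lo (cen g) < (Num.max lo (cen g) + x) / 2 by rewrite midf_lt // gt_max x1 xE.
      by move: m1; rewrite gt_max => /andP[].
    by apply: (bad y); apply/andP; split; lra.
rewrite eqEsubset; split=> p.
  by move=> [Hp pr]; split => //; apply: KK_KKb; exact: K.
by move=> [[Hp _] pr].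
Qed.

(* [x] is an end of the relevant part of [I(g)] and the half of this part between the summit and
   [x] bounds the column over [lo, hi] from below. *)
Definition Half g x lo hi : Prop := exists al be, Arc g al be /\
  ([/\ x = be, lo = cen g & x <= hi] \/ [/\ x = al, hi = cen g & lo <= x]).

Lemma gap_uniq lo hi lo' hi' x : gap lo hi -> gap lo' hi' -> lo < x < hi -> lo' <= x <= hi' ->
  lo = lo' /\ hi = hi'.
Proof.
move=> [lh El Eh G] [lh' El' Eh' G'] /andP[x1 x2] /andP[y1 y2]; split.
  have [lt|gt|//] := ltgtP lo lo'.
    by case: (G lo') => //; rewrite lt (le_lt_trans y1).
  by case: (G' lo) => //; rewrite gt (lt_le_trans x1).
have [lt|gt|//] := ltgtP hi hi'.
  by case: (G' hi) => //; rewrite lt (le_lt_trans y1).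
by case: (G hi') => //; rewrite gt (lt_le_trans x1).
Qed.

Lemma KK_above x : exists p, KK Gamma p /\ Re p = x.
Proof.
have [M M0 HM] := rad_bound; exists (x +i* (M + 1)); split => //; apply/KKP.
have HHp : HH (x +i* (M + 1)) by rewrite /HH /= addr_gt0.
split => // g Gg g0; rewrite nd_gt1 //=.
have := HM _ Gg g0; have r0 := rad_gt0 g0 => h; have := sqr_ge0 (x - cen g); nra.
Qed.

Lemma col_inj lo hi lo' hi' : gap lo hi -> gap lo' hi' -> col lo hi = col lo' hi' -> lo = lo' /\ hi = hi'.
Proof.
move=> g g' E; have [lh _ _ _] := g.
have [p [Kp pE]] := KK_above ((lo + hi) / 2).
have m : lo < Re p < hi by rewrite pE midf_lt // midf_lt.
have : col lo hi p by split; [exact: KK_KKb|case/andP: m => ? ?; apply/andP; split; exact: ltW].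
by rewrite E => -[_ m']; apply: (gap_uniq g g' m).
Qed.

Lemma same_circle g h : Gamma g -> Gamma h -> pc g != 0 -> pc h != 0 -> cen g = cen h -> rad g = rad h.
Proof.
move=> Gg Gh g0 h0 c; have t0 := same_cen g0 h0 c.
have E : (g * h^-1 * h)%g = g by rewrite -mulgA mulVg mulg1.
have Hs := HH_summit h0; have := (nd_eq1 (summit h) h0).2 (circ_summit h).
rewrite -(@cusp_shift h (g * h^-1)%g) //; last by apply: GammaM => //; exact: GammaV.
rewrite E => /(nd_eq1 _ g0); rewrite /circ /summit /= c subrr expr0n add0r => /eqP.
by rewrite eqrXn2 ?ltW ?rad_gt0 // => /eqP.
Qed.

Lemma Arc_same g al be h : Arc g al be -> Gamma h -> pc h != 0 -> cen g = cen h -> Arc h al be.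
Proof.
move=> A Gh h0 c; have [[Gg g0] h1 h2 h3 h4] := A.
have r := same_circle Gg Gh g0 h0 c.
by split; rewrite -?c -?r.
Qed.

Lemma Arc_ends_uniq g al be al' be' : Arc g al be -> Arc g al' be' -> al = al' /\ be = be'.
Proof.
have half a b a' b' : Arc g a b -> Arc g a' b' -> a' <= a /\ b <= b'.
  move=> A A'; have [[Gg g0] h1 /andP[h2 h2'] h3 h4] := A; have [_ k1 /andP[k2 k2'] k3 k4] := A'.
  have r0 := rad_gt0 g0.
  have key x : a < x < b -> a' <= x <= b'.
    move=> /andP[x1 x2]; have Hx : HH (cpt (cen g) (rad g) x) by apply: HH_cpt => //; apply/andP; split; lra.
    have xr : a <= x <= b by rewrite !ltW.
    by apply/(k4 _ Hx (Arc_cpt A xr)); apply/(h4 _ Hx (Arc_cpt A xr)).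
  split; rewrite leNgt; apply/negP => lt.
    have : a < (a + Num.min a' (cen g)) / 2 by rewrite midf_lt // lt_min lt h2.
    have : (a + Num.min a' (cen g)) / 2 < Num.min a' (cen g) by rewrite midf_lt // lt_min lt h2.
    rewrite lt_min => /andP[m1 m2] m3.
    have /andP[] : a' <= (a + Num.min a' (cen g)) / 2 <= b' by apply: key; rewrite m3 (lt_trans m2).
    by rewrite leNgt m1.
  have : Num.max b' (cen g) < (Num.max b' (cen g) + b) / 2 by rewrite midf_lt // gt_max lt h2'.
  have : (Num.max b' (cen g) + b) / 2 < b by rewrite midf_lt // gt_max lt h2'.
  rewrite gt_max => m3 /andP[m1 m2].
  have /andP[_] : a' <= (Num.max b' (cen g) + b) / 2 <= b' by apply: key; rewrite m3 (lt_trans h2).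
  by rewrite leNgt m1.
move=> A A'; have [h1 h2] := half _ _ _ _ A A'; have [h3 h4] := half _ _ _ _ A' A.
by split; apply/eqP; rewrite eq_le ?h1 ?h2 ?h3 ?h4.
Qed.

Lemma side_same g h x : Gamma g -> Gamma h -> pc g != 0 -> pc h != 0 -> cen g = cen h -> side g x = side h x.
Proof. by move=> Gg Gh g0 h0 c; rewrite /side c (same_circle Gg Gh g0 h0 c). Qed.

Lemma precell_cases A : is_precell Gamma A -> exists lo hi, [/\ gap lo hi, A = col lo hi &
  [\/ exists z gL gR al be, [/\ Arc gL al (Re z), Arc gR (Re z) be,
        [/\ HH z, circ (cen gL) (rad gL) z & circ (cen gR) (rad gR) z],
        lo = cen gL /\ hi = cen gR &
        noncuspidal_precell Gamma z (side gL (Re z)) (side gR (Re z)) A \/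
        noncuspidal_precell Gamma z (side gR (Re z)) (side gL (Re z)) A],
      exists g al be e, [/\ Arc g al be, (e = al /\ al = cen g - rad g) \/ (e = be /\ be = cen g + rad g),
        lo = Num.min (cen g) e /\ hi = Num.max (cen g) e & cuspidal_precell Gamma (Some e%:C) (side g e) A] |
      strip_precell Gamma A /\ forall p, HH p -> lo <= Re p <= hi -> KK Gamma p]].
Proof.
case=> [[z [b1 [b2 P]]]|[v [b P]]|P].
- have [gL [gR [al [be [AL AR cz [gp AE] bb]]]]] := noncusp_col P.
  exists (cen gL), (cen gR); split => //; apply: Or31; exists z, gL, gR, al, be; split => //.
  by case: bb => -[E1 E2]; [left|right]; rewrite -E1 -E2.
- have [g [al [be [e [A1 eE vE bE [gp AE]]]]]] := cusp_col P.
  eexists _, _; split; [exact: gp|exact: AE|]; apply: Or32; exists g, al, be, e; split => //.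
  by rewrite -vE -bE.
- have [lo [hi [gp AE K]]] := strip_col P.
  by exists lo, hi; split => //; apply: Or33.
Qed.

Lemma NS1 A b : nonvertical_side Gamma A b -> exists g x lo hi, [/\ gap lo hi, A = col lo hi, Half g x lo hi & b = side g x].
Proof.
case=> [[z [b1 [b2 [P bb]]]]|[v P]].
  have [gL [gR [al [be [AL AR cz [gp AE] E]]]]] := noncusp_col P.
  have [[_ _] _ /andP[_ l2] _ _] := AL; have [[_ _] _ /andP[r2 _] _ _] := AR.
  have HL : Half gL (Re z) (cen gL) (cen gR) by exists al, (Re z); split => //; left; split => //; exact: ltW.
  have HR : Half gR (Re z) (cen gL) (cen gR) by exists (Re z), be; split => //; right; split => //; exact: ltW.
  by case: bb => ->; case: E => -[E1 E2]; rewrite ?E1 ?E2; [exists gL|exists gR|exists gR|exists gL]; exists (Re z), (cen gL), (cen gR).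
have [g [al [be [e [A1 eE vE bE [gp AE]]]]]] := cusp_col P.
exists g, e, (Num.min (cen g) e), (Num.max (cen g) e); split => //.
exists al, be; split => //; have [[_ _] _ /andP[r1 r2] _ _] := A1.
by case: eE => -[-> _]; [right|left]; split; rewrite ?ge_min ?le_max ?lexx ?orbT //; [apply: max_l|apply: min_l]; exact: ltW.
Qed.

Lemma Half_summit g x lo hi : Half g x lo hi -> lo < hi -> lo <= cen g <= hi /\ boundaryH (KK Gamma) (summit g).
Proof.
move=> [al [be [A h]]] lh; split; last exact: Arc_summit_bK A.
by case: h => -[_ <- _]; rewrite lexx ltW.
Qed.

(** The converse of [NS1]. A strip is excluded since its column lies in [KK] while the summit of [g]
    does not; for the other kinds, the arc of [g] is determined by its center. *)
Lemma NS2 A lo hi g x : is_precell Gamma A -> gap lo hi -> A = col lo hi -> Half g x lo hi ->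
  nonvertical_side Gamma A (side g x).
Proof.
move=> pA gp AE H; have [lh _ _ _] := gp.
have [lo' [hi' [gp' AE' cs]]] := precell_cases pA.
have [lE hiE] : lo = lo' /\ hi = hi' by apply: col_inj => //; rewrite -AE -AE'.
subst lo' hi'; have [sr bs] := Half_summit H lh.
have [al [be [Ag h]]] := H; have [[Gg g0] _ /andP[g1 g2] _ _] := Ag.
case: cs => [[z [gL [gR [al' [be' [AL AR cz [lE hiE] nc]]]]]]|[g' [al' [be' [e [A' eE [lE hiE] cu]]]]]|[_ K]].
- have [[GL L0] _ /andP[_ l2] _ _] := AL; have [[GR R0] _ /andP[r2 _] _ _] := AR.
  left; exists z.
  have fin : side g x = side gL (Re z) \/ side g x = side gR (Re z) -> exists b1 b2, noncuspidal_precell Gamma z b1 b2 A /\ (side g x = b1 \/ side g x = b2).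
    case: nc => nc [] ->; [exists (side gL (Re z)), (side gR (Re z))|exists (side gL (Re z)), (side gR (Re z))|exists (side gR (Re z)), (side gL (Re z))|exists (side gR (Re z)), (side gL (Re z))]; split => //; by [left|right].
  apply: fin; case: h => -[xE cE _]; [left|right].
    have c : cen g = cen gL by rewrite -cE lE.
    have [_ E] := Arc_ends_uniq (Arc_same Ag GL L0 c) AL.
    by rewrite xE -E; exact: side_same.
  have c : cen g = cen gR by rewrite -cE hiE.
  have [E _] := Arc_ends_uniq (Arc_same Ag GR R0 c) AR.
  by rewrite xE -E; exact: side_same.
- have [[G' g'0] _ /andP[k1 k2] _ _] := A'.
  have [er e2 _] := Arc_gap_ends A' eE; have V := Arc_vertK A' er e2.
  have ng : cen g != e.
    by apply/eqP => E; have /bKP[_] := bs; apply; apply: V; [exact: HH_summit|].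
  right; exists (Some e%:C).
  have fin : side g x = side g' e -> cuspidal_precell Gamma (Some e%:C) (side g x) A by move=> ->.
  apply: fin; case: h => -[xE cE _].
    have c : cen g = cen g'.
      by move: ng; rewrite -cE lE; case: (leP (cen g') e) => //; rewrite eqxx.
    have [_ E] := Arc_ends_uniq (Arc_same Ag G' g'0 c) A'.
    have eb : e = be'.
      case: eE => -[eE _] //; move: cE; rewrite lE c min_r; last by rewrite eE ltW.
      by move=> ec; move: ng; rewrite c ec eqxx.
    by rewrite xE E -eb; exact: side_same.
  have c : cen g = cen g'.
    by move: ng; rewrite -cE hiE; case: (leP (cen g') e) => //; rewrite eqxx.
  have [E _] := Arc_ends_uniq (Arc_same Ag G' g'0 c) A'.
  have eb : e = al'.
    case: eE => -[eE _] //; move: cE; rewrite hiE c max_r; last by rewrite eE ltW.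
    by move=> ec; move: ng; rewrite c ec eqxx.
  by rewrite xE E -eb; exact: side_same.
- by have /bKP[_] := bs; case; apply: K; [exact: HH_summit|].
Qed.

(** * Basal families and assigned elements *)

Variable AA : set (set C).
Hypothesis hB : basal_family Gamma AA.

Lemma AA_col A : AA A -> exists lo hi, gap lo hi /\ A = col lo hi.
Proof. by move=> /hB.1 /precell_cases[lo [hi [gp AE _]]]; exists lo, hi. Qed.

Lemma AA_cover p : HH p -> exists g A, [/\ Gamma g, AA A & A (mob g p)].
Proof.
move=> Hp; have [_ [clF [_ _ _ cov]]] := hB.
move: Hp; rewrite -{1}cov => -[g Gg [w [cw Hw] <-]].
have : (\bigcup_(A in AA) A) w.
  rewrite -clF; split => //; move: cw; apply: closure_subset; exact: interior_subset.
move=> [A AAA Aw]; exists g^-1%g, A; split => //; first exact: GammaV.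
by rewrite mobK.
Qed.

Lemma AA_cover_KK p : KK Gamma p -> exists t A, [/\ Gamma t, pc t = 0, AA A & A (mob t p)].
Proof.
move=> Kp; have [Hp _] := KK_KKb Kp.
have [g [A [Gg AAA Ag]]] := AA_cover Hp; exists g, A; split => //.
have [lo [hi [_ AE]]] := AA_col AAA; rewrite AE in Ag; case: Ag => Kg _.
exact: KK_KKb_stab Kp Gg Kg.
Qed.

Lemma col_near p lo hi : KK Gamma p -> lo < Re p < hi -> \forall w \near p, col lo hi w.
Proof.
move=> Kp /andP[p1 p2].
have d0 : 0 < Num.min (Re p - lo) (hi - Re p) by rewrite lt_min !subr_gt0 p1.
have N1 := KK_open Kp; have N2 := Re_near p d0.
near=> w; split; first by apply: KK_KKb; near: w; exact: N1.
have : `|Re w - Re p| < Num.min (Re p - lo) (hi - Re p) by near: w; exact: N2.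
by rewrite lt_min !ltr_norml => /andP[/andP[? ?] /andP[? ?]]; apply/andP; split; lra.
Unshelve. all: by end_near. Qed.

Lemma AA_uniq A A' lo hi lo' hi' t p : AA A -> AA A' -> A = col lo hi -> A' = col lo' hi' ->
  Gamma t -> KK Gamma p -> KK Gamma (mob t p) -> lo < Re p < hi -> lo' < Re (mob t p) < hi' -> t = 1%g.
Proof.
move=> AAA AAA' AE AE' Gt Kp Kt pr tr.
have [_ [clF [_ _ tri _]]] := hB.
apply: (tri t 1%g) => //; first exact: Gamma1 hF.
exists (mob t p); split.
  exists p => //; have := col_near Kp pr; rewrite -AE /interior; apply: filterS => w Aw; by exists A.
exists (mob t p); last exact: mob1.
have := col_near Kt tr; rewrite -AE' /interior; apply: filterS => w Aw; by exists A'.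
Qed.

(** A test point inside the non-vertical side and inside the column; circles and group elements
    attached to sides are compared at it. *)
Lemma Half_mid k x lo hi : lo < hi -> Half k x lo hi ->
  let y := (cen k + x) / 2 in
  [/\ lo < y < hi, side k x (cpt (cen k) (rad k) y), HH (cpt (cen k) (rad k) y) & circ (cen k) (rad k) (cpt (cen k) (rad k) y)].
Proof.
move=> lh [al [be [A h]]] y; have [[Gk k0] h1 /andP[h2 h2'] h3 h4] := A; have r0 := rad_gt0 k0.
have yr : lo < y < hi by case: h => -[xE cE xl]; rewrite /y; apply/andP; split; lra.
have yc : cen k - rad k < y < cen k + rad k by case: h => -[xE cE xl]; rewrite /y; apply/andP; split; lra.
have ya : al <= y <= be by case: h => -[xE cE xl]; rewrite /y; apply/andP; split; lra.
have Hy := HH_cpt r0 yc; have cy := Arc_cpt A ya.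
split => //; split => //=.
by case: (leP (cen k) x) => cx; rewrite /y; apply/andP; split; lra.
Qed.

Lemma Half_mid_arc k x lo hi : Half k x lo hi -> exists al be, Arc k al be /\ al < (cen k + x) / 2 < be.
Proof.
move=> [al [be [A h]]]; have [_ _ /andP[h2 h2'] _ _] := A; exists al, be; split => //.
by case: h => -[xE _ _]; apply/andP; split; lra.
Qed.

Lemma Half_same g x lo hi h : Half g x lo hi -> Gamma h -> pc h != 0 -> cen g = cen h -> Half h x lo hi.
Proof.
move=> [al [be [A hh]]] Gh h0 c; exists al, be; split; first exact: Arc_same A Gh h0 c.
by rewrite -c.
Qed.

Lemma Half_G g x lo hi : Half g x lo hi -> Gamma g /\ pc g != 0.
Proof. by move=> [al [be [[] ]]]. Qed.

Lemma mob_side h x : pc h != 0 -> mob h @` side h x = side h^-1%g (cen h^-1%g - (x - cen h)).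
Proof.
move=> h0; have hv : pc h^-1%g != 0 by rewrite pcV_neq0.
have mm (c d y u : R) : Num.min c x <= u <= Num.max c x -> Num.min d (d - (x - c)) <= d - (u - c) <= Num.max d (d - (x - c)).
  by case: (leP c x) => cx /andP[? ?]; [rewrite min_r ?max_l|rewrite min_l ?max_r]; try lra; apply/andP; split; lra.
rewrite eqEsubset; split.
  move=> _ [p [Hp cp pr] <-]; have [e1 e2 e3] := circ_mob Hp h0 cp.
  by split => //; [exact: HH_mob|rewrite e1; exact: mm].
move=> q [Hq cq qr]; exists (mob h^-1%g q); last exact: mobVK.
have [e1 e2 e3] := circ_mob Hq hv cq; rewrite invgK in e1 e3.
split => //; first exact: HH_mob.
rewrite e1; move: qr; set c := cen h; set d := cen h^-1%g.
by case: (leP d (d - (x - c))) => dx /andP[? ?]; [rewrite min_r ?max_l|rewrite min_l ?max_r]; try lra; apply/andP; split; lra.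
Qed.

Lemma cen_lstab t g : Gamma t -> pc t = 0 -> pc g != 0 ->
  [/\ pc (t * g)%g != 0, cen (t * g)%g = cen g & cen (t * g)^-1%g = cen g^-1%g + tau t].
Proof.
move=> Gt t0 g0; have gv : pc g^-1%g != 0 by rewrite pcV_neq0.
have [s s1 [_ _ eC eD]] := psl2_mul_entries t g.
have d0 : pd t != 0.
  by have := pdet t; rewrite t0 mulr0 subr0; apply: contra_eq_neq => ->; rewrite mulr0 eq_sym oner_eq0.
have s0 := sqr1_neq0 s1.
have c0 : pc (t * g)%g != 0 by rewrite eC t0 mul0r add0r !mulf_neq0.
split => //.
  by rewrite /cen eC eD t0 !mul0r !add0r; field; rewrite g0 d0 s0.
by rewrite invgM; have [_ ->] := cen_stab Gt t0 gv.
Qed.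

Lemma Half_of_arc k al be lo hi y : Arc k al be -> gap lo hi -> lo < y < hi -> al < y < be ->
  (y < cen k -> Half k al lo hi) /\ (cen k < y -> Half k be lo hi).
Proof.
move=> A [lh El Eh G] /andP[y1 y2] /andP[y3 y4]; have [_ _ /andP[h2 h2'] _ _] := A.
have Ec : EE (cen k) by exists k, al, be; split => //; exact: Or31.
split=> lt; exists al, be; split => //; [right|left]; split => //.
- have [c1|c1|//] := ltgtP hi (cen k); last by case: (G (cen k)) => //; rewrite c1 (lt_trans y1).
  by apply: (Arc_gap A) => //; rewrite (lt_trans y3 y2) (lt_trans c1).
- rewrite leNgt; apply/negP => c1.
  have := Arc_gap A _ El; rewrite c1 (lt_trans y1 y4) => /(_ isT) E.
  by move: lt; rewrite -E ltNge (ltW y1).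
- have [c1|c1|//] := ltgtP lo (cen k); first by case: (G (cen k)) => //; rewrite c1 (lt_trans lt).
  by apply: (Arc_gap A) => //; rewrite (lt_trans y1 y4) (lt_trans h2).
- rewrite leNgt; apply/negP => c1.
  have := Arc_gap A _ Eh; rewrite c1 (lt_trans y3 y2) => /(_ isT) E.
  by move: lt; rewrite -E ltNge (ltW y2).
Qed.

(* [h] maps the point of [I(h)] above [x] to the point of [I(h^-1)] above [flip h x]. *)
Definition flip h x : R := cen h^-1%g - (x - cen h).

Lemma Half_flip h x lo hi lo' hi' : lo < hi -> Half h x lo hi -> gap lo' hi' ->
  lo' < flip h ((cen h + x) / 2) < hi' -> Half h^-1%g (flip h x) lo' hi'.
Proof.
move=> lh [al [be [A hx]]] gp' y'; have [_ _ /andP[h2 h2'] _ _] := A.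
have Ai := Arc_inv A.
have yr : cen h^-1%g - (be - cen h) < flip h ((cen h + x) / 2) < cen h^-1%g - (al - cen h).
  by rewrite /flip; case: hx => -[xE _ _]; apply/andP; split; lra.
have [K1 K2] := Half_of_arc Ai gp' y' yr.
case: hx => -[xE _ _]; rewrite {1}/flip xE; [apply: K1|apply: K2]; rewrite /flip xE; lra.
Qed.

(** Existence of the assigned element: [g] sends the middle of the side to the boundary of [KK], and
    a translation [t] brings this image under a member of the family; [t * g] is the wanted
    element. *)
Lemma assign_ex g x lo hi : lo < hi -> Half g x lo hi -> exists h A' lo' hi',
  [/\ Half h x lo hi, cen h = cen g, AA A' /\ A' = col lo' hi', gap lo' hi' & Half h^-1%g (flip h x) lo' hi'].
Proof.
move=> lh H; have [Gg g0] := Half_G H.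
have [ym sm Hm cm] := Half_mid lh H.
set m := cpt (cen g) (rad g) ((cen g + x) / 2) in sm Hm cm.
have nm : nd g m = 1 by exact/nd_eq1.
have [al [be [A hm]]] := Half_mid_arc H.
have Km : KKb m by have [_ _ _ _ h4] := A; apply/(h4 m Hm cm); case/andP: hm => ? ?; rewrite !ltW.
have Kg := KKb_mob Km Gg nm.
(* One unit higher the point is in [KK], so the element bringing it into the family fixes
   infinity. *)
have Kw : KK Gamma (Re (mob g m) +i* (Im (mob g m) + 1)) by apply: KKb_up Kg _ _ => //=; rewrite ltrDl.
have [t [A' [Gt t0 AA' At]]] := AA_cover_KK Kw.
have [lo' [hi' [gp' AE']]] := AA_col AA'.
have [h0 ch chV] := cen_lstab Gt t0 g0.
have Gh : Gamma (t * g)%g by exact: GammaM.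
have Hh : Half (t * g)%g x lo hi by apply: Half_same H Gh h0 _.
exists (t * g)%g, A', lo', hi'; split => //.
apply: (Half_flip lh Hh gp').
have [E1 _ _] := circ_mob Hm g0 cm.
rewrite AE' in At; case: At => _; rewrite (stab_mob hF hC) //= E1 => /andP[r1 r2].
have -> : flip (t * g)%g ((cen (t * g)%g + x) / 2) = cen g^-1%g - (Re m - cen g) + tau t.
  by rewrite /flip ch chV /=; ring.
move: r1 r2; set y := _ + tau t => r1 r2.
have nE : ~ EE y.
  move=> /EE_unshift /(_ Gt t0) Ey.
  have := Arc_gap (Arc_inv A) _ Ey; rewrite /= => K.
  have : cen g^-1%g - ((cen g + x) / 2 - cen g) = cen g^-1%g by apply: K; case/andP: hm => ? ?; apply/andP; split; lra.
  have [al2 [be2 [A2 hx]]] := H; have [_ _ /andP[h2 h2'] _ _] := A2.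
  by case: hx => -[xE _ _]; lra.
have [_ El Eh _] := gp'.
by rewrite !lt_neqAle r1 r2 !andbT; apply/andP; split; apply/eqP => E; apply: nE; rewrite -?E // E.
Qed.

(** Uniqueness of the assigned element: two candidates differ by a translation that moves an
    interior point of the family to an interior point, hence is trivial by [AA_uniq]. *)
Lemma land_uniq h1 h2 x A1 lo1 hi1 A2 lo2 hi2 : Gamma h1 -> Gamma h2 -> pc h1 != 0 -> pc h2 != 0 -> cen h1 = cen h2 ->
  AA A1 -> A1 = col lo1 hi1 -> lo1 < hi1 -> Half h1^-1%g (flip h1 x) lo1 hi1 ->
  AA A2 -> A2 = col lo2 hi2 -> lo2 < hi2 -> Half h2^-1%g (flip h2 x) lo2 hi2 -> h1 = h2.
Proof.
move=> G1 G2 p1 p2 c AA1 E1 l1 H1 AA2 E2 l2 H2.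
have t0 := same_cen p1 p2 c; set t := (h1 * h2^-1)%g in t0.
have Gt : Gamma t by apply: GammaM => //; exact: GammaV.
have E : h1 = (t * h2)%g by rewrite /t -mulgA mulVg mulg1.
have [_ _ cV] := cen_lstab Gt t0 p2; rewrite -E in cV.
have [y1 _ _ _] := Half_mid l1 H1; have [y2 _ _ _] := Half_mid l2 H2.
have [p [Kp pE]] := KK_above ((cen h2^-1%g + flip h2 x) / 2).
suff : t = 1%g by move=> tE; rewrite E tE mul1g.
have Kt := KK_mob_stab Kp Gt t0.
apply: (AA_uniq AA2 AA1 E2 E1 Gt Kp Kt); first by rewrite pE.
rewrite (stab_mob hF hC) //= pE.
have -> : (cen h2^-1%g + flip h2 x) / 2 + tau t = (cen h1^-1%g + flip h1 x) / 2 by rewrite /flip cV c; field.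
exact: y1.
Qed.

Lemma side_inj k x lo hi k' x' lo' hi' : lo < hi -> lo' < hi' -> Half k x lo hi -> Half k' x' lo' hi' -> side k x = side k' x' ->
  cen k = cen k' /\ x = x'.
Proof.
move=> lh lh' H H' E.
have [Gk k0] := Half_G H; have [Gk' k'0] := Half_G H'.
have [_ sm Hm cm] := Half_mid lh H; have [_ sm' Hm' cm'] := Half_mid lh' H'.
have [al [be [A hm]]] := Half_mid_arc H; have [al' [be' [A' hm']]] := Half_mid_arc H'.
rewrite E in sm; rewrite -E in sm'.
have c : cen k' = cen k.
  by apply: (Arc_uniq A Hm cm hm Gk' k'0); apply/nd_eq1 => //; case: sm.
split => //; have H2 := Half_same H Gk' k'0 (esym c).
have [al1 [be1 [A1 h1]]] := H2; have [al2 [be2 [A2 h2]]] := H'.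
have [E1 E2] := Arc_ends_uniq A1 A2; subst al2 be2.
have [_ _ /andP[r1 r2] _ _] := A1.
case: sm => _ _ /=; case: sm' => _ _ /=; rewrite -!c.
case: h1 => -[e1 _ _]; case: h2 => -[e2 _ _]; rewrite ?e1 ?e2 // ?(min_l (ltW r2)) ?(max_r (ltW r2)) ?(min_r (ltW r1)) ?(max_l (ltW r1)) => /andP[? ?] /andP[? ?]; lra.
Qed.

Lemma asgP A b h : assigned_to_side Gamma AA A b h -> exists x lo hi A' lo' hi',
  [/\ gap lo hi /\ A = col lo hi, Half h x lo hi, b = side h x, [/\ AA A', A' = col lo' hi' & gap lo' hi'] &
      Half h^-1%g (flip h x) lo' hi' /\ mob h @` b = side h^-1%g (flip h x)].
Proof.
move=> [/NS1[g [x [lo [hi [gp AE H bE]]]]] Gh nsh bh [A' AA' nA']].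
have h0 : pc h != 0.
  by apply/eqP => h0; apply: nsh; apply/stabP.
have [lh _ _ _] := gp; have [Gg g0] := Half_G H.
have [_ sm Hm cm] := Half_mid lh H; have [al [be [A1 hm]]] := Half_mid_arc H.
have c : cen h = cen g.
  apply: (Arc_uniq A1 Hm cm hm Gh h0).
  by move: sm; rewrite -bE => /bh /isosphereP[].
have Hh := Half_same H Gh h0 (esym c).
have bE' : b = side h x by rewrite bE; exact: side_same.
have mE : mob h @` b = side h^-1%g (flip h x) by rewrite bE' mob_side.
have [k [y [lo' [hi' [gp' AE' H' sE]]]]] := NS1 nA'; rewrite mE in sE.
have [lh' _ _ _] := gp'; have [Gk k0] := Half_G H'.
have [_ sk Hk ck] := Half_mid lh' H'; have [al' [be' [A2 hk]]] := Half_mid_arc H'.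
have hv : pc h^-1%g != 0 by rewrite pcV_neq0.
have GhV : Gamma h^-1%g by exact: GammaV.
rewrite -sE in sk.
have cV : cen h^-1%g = cen k.
  by apply: (Arc_uniq A2 Hk ck hk GhV hv); apply/nd_eq1 => //; case: sk.
have Hy := Half_same H' GhV hv (esym cV).
exists x, lo, hi, A', lo', hi'; split => //; split => //.
suff <- : y = flip h x by [].
have sE' : side k y = side h^-1%g y by exact: side_same.
have [al3 [be3 [A3 h3]]] := Hh; have A4 := Arc_inv A3; have [al5 [be5 [A5 h5]]] := Hy.
have [E1 E2] := Arc_ends_uniq A4 A5; have [_ _ /andP[r1 r2] _ _] := A5.
case: sk => _ _ /=; rewrite /flip -!cV.
case: h3 => -[e1 _ _]; case: h5 => -[e2 _ _]; rewrite e1 e2 -?E1 -?E2 // => /andP[].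
  by rewrite min_r ?max_l; lra.
by rewrite min_l ?max_r; lra.
Qed.

Lemma asgI A lo hi h x A' lo' hi' : AA A -> gap lo hi -> A = col lo hi -> Half h x lo hi ->
  AA A' -> gap lo' hi' -> A' = col lo' hi' -> Half h^-1%g (flip h x) lo' hi' ->
  assigned_to_side Gamma AA A (side h x) h.
Proof.
move=> AAA gp AE H AA' gp' AE' H'; have [Gh h0] := Half_G H; split => //.
- exact: NS2 (hB.1 _ AAA) gp AE H.
- by move/stabP => -[_ /eqP]; rewrite (negbTE h0).
- by move=> p [Hp cp _]; apply/isosphereP; split => //; exact/nd_eq1.
- exists A' => //; rewrite mob_side //; exact: NS2 (hB.1 _ AA') gp' AE' H'.
Qed.

Lemma Half_range k x lo hi : lo < hi -> Half k x lo hi -> forall y, Num.min (cen k) x <= y <= Num.max (cen k) x -> lo <= y <= hi.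
Proof.
move=> lh [al [be [A h]]] y; have [_ _ /andP[h1 h2] _ _] := A.
by case: h => -[-> -> xl]; rewrite ?(min_l (ltW h2)) ?(max_r (ltW h2)) ?(min_r (ltW h1)) ?(max_l (ltW h1)) => /andP[y1 y2];
  apply/andP; split; lra.
Qed.

Lemma glue_half h x lo hi q : lo < hi -> Half h x lo hi -> HH q -> circ (cen h) (rad h) q ->
  Num.min (cen h) x < Re q < Num.max (cen h) x -> \forall w \near q, 1 <= nd h w -> col lo hi w.
Proof.
move=> lh H Hq cq qr; have [Gh h0] := Half_G H.
have [al [be [A h3]]] := H; have [_ _ /andP[h1 h2] _ _] := A.
have qa : al < Re q < be.
  move: qr; case: h3 => -[-> _ _]; rewrite ?(min_l (ltW h2)) ?(max_r (ltW h2)) ?(min_r (ltW h1)) ?(max_l (ltW h1)) => /andP[? ?]; apply/andP; split; lra.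
have Kq : KKb q by have [_ _ _ _ h4] := A; apply/(h4 q Hq cq); case/andP: qa => ? ?; rewrite !ltW.
pose d := Num.min (Re q - Num.min (cen h) x) (Num.max (cen h) x - Re q).
have d0 : 0 < d by rewrite lt_min !subr_gt0.
have N1 := nd_near Hq; have N2 := Re_near q d0.
near=> w => nw.
have [Hw ndw] : HH w /\ forall g, Gamma g -> pc g != 0 -> nd g w <= 1 -> nd g q <= 1 by near: w; exact: N1.
have : `|Re w - Re q| < d by near: w; exact: N2.
rewrite lt_min !ltr_norml => /andP[/andP[? ?] /andP[? ?]].
split; last by apply: (Half_range lh H); apply/andP; split; lra.
split => // g Gg g0; rewrite leNgt; apply/negP => lt.
have c : cen g = cen h.
  apply: (Arc_uniq A Hq cq qa Gg g0); apply/eqP; rewrite eq_le Kq.2 // andbT.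
  exact: ndw Gg g0 (ltW lt).
by move: lt; rewrite nd_cen // c (same_circle Gg Gh g0 h0 c) -nd_cen // ltNge nw.
Unshelve. all: by end_near. Qed.

Lemma flip_range h x y : Num.min (cen h) x < y < Num.max (cen h) x ->
  Num.min (cen h^-1%g) (flip h x) < cen h^-1%g - (y - cen h) < Num.max (cen h^-1%g) (flip h x).
Proof.
rewrite /flip; case: (leP (cen h) x) => cx /andP[? ?]; [rewrite min_r ?max_l|rewrite min_l ?max_r]; try lra; apply/andP; split; lra.
Qed.

(** Near an inner point of the side, points outside the circle of [h] are in the column, and [h]
    maps those inside it to the outside of the circle of [h^-1], hence into the other column. So two
    adjacent precells fill a neighbourhood. *)
Lemma glue h x lo hi lo' hi' q : lo < hi -> lo' < hi' -> Half h x lo hi -> Half h^-1%g (flip h x) lo' hi' ->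
  HH q -> circ (cen h) (rad h) q -> Num.min (cen h) x < Re q < Num.max (cen h) x ->
  \forall w \near q, HH w /\ (col lo hi w \/ col lo' hi' (mob h w)).
Proof.
move=> lh lh' H H' Hq cq qr; have [Gh h0] := Half_G H.
have [e1 e2 e3] := circ_mob Hq h0 cq.
have N1 := glue_half lh H Hq cq qr.
have qr' : Num.min (cen h^-1%g) (flip h x) < Re (mob h q) < Num.max (cen h^-1%g) (flip h x).
  by rewrite e1; exact: flip_range.
have N2 := mob_near Hq (glue_half lh' H' (HH_mob h Hq) e3 qr').
have N3 := HH_near Hq.
near=> w; have Hw : HH w by near: w; exact: N3.
split => //; have [le|lt] := leP 1 (nd h w).
  by left; move: le; near: w; exact: N1.
right; have : 1 <= nd h^-1%g (mob h w).
  by rewrite nd_inv // -[leLHS]invr1 lef_pV2 ?posrE ?nd_gt0 ?ltr01 // ltW.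
near: w; exact: N2.
Unshelve. all: by end_near. Qed.

Definition onleaf p : Prop := exists2 l, is_leaf l & l p.

Lemma onleaf_mob g p : Gamma g -> HH p -> onleaf (mob g p) -> onleaf p.
Proof.
move=> Gg Hp [l ll lp]; exists [set w | HH w /\ l (mob g w)].
  by have := leaf_lmul ll (GammaV hF Gg); rewrite invgK.
by split.
Qed.

Lemma onleaf_KKb p : KKb p -> onleaf p <-> EE (Re p).
Proof.
move=> Kp; split.
  by move=> [l [g [e [Gg Ee ->]]] lp]; have [] := leaf_KKb Gg Ee lp Kp.
move=> Ep; exists (leaf 1%g (Re p)); first by exists 1%g, (Re p); split => //; exact: Gamma1 hF.
by apply/leaf1; split => //; case: Kp.
Qed.

(* Up to [Gamma] the points of [bd] are infinity, the points of [EE] and the real points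
   below strip precells. *)
Definition good (y : one_point_compactification R[i]) : Prop :=
  y = None \/ exists2 e, y = Some e%:C & EE e \/ exists lo hi,
  [/\ lo < e < hi, forall p, HH p -> lo <= Re p <= hi -> KK Gamma p & forall x, lo < x < hi -> ~ EE x].

Lemma col_real lo hi w : closure (col lo hi) w -> lo <= Re w <= hi /\ forall g, Gamma g -> pc g != 0 -> 1 <= nd g w.
Proof.
move=> cw; split.
  apply/andP; split; rewrite leNgt; apply/negP => lt.
    have d0 : 0 < lo - Re w by rewrite subr_gt0.
    have [v [_ /andP[v1 v2]]] := closure_near cw (Re_near w d0).
    by rewrite /= ltr_norml => /andP[? ?]; lra.
  have d0 : 0 < Re w - hi by rewrite subr_gt0.
  have [v [_ /andP[v1 v2]]] := closure_near cw (Re_near w d0).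
  by rewrite /= ltr_norml => /andP[? ?]; lra.
move=> g Gg g0; rewrite leNgt; apply/negP => lt.
have N : \forall v \near w, nd g v < 1.
  have h : Phi (pc g ^+ 2, 2 * pc g * pd g, pd g ^+ 2) w < 1 by rewrite -nd_Phi.
  by apply: filterS (Phi_lt_near h) => v; rewrite -nd_Phi.
have [v [[_ Kv] _] /=] := closure_near cw N.
by rewrite ltNge Kv.
Qed.

Lemma col_closed lo hi p : HH p -> closure (col lo hi) p -> col lo hi p.
Proof. by move=> Hp /col_real[pr np]. Qed.

Lemma col_dense lo hi p (V : set C) : lo < hi -> col lo hi p -> nbhs p V -> exists w, [/\ V w, KKb w & lo < Re w < hi].
Proof.
move=> lh [Kp /andP[p1 p2]] /nbhs_box[e e0 He].
have e2 : 0 < e / 2 by rewrite divr_gt0.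
pose q := Re p +i* (Im p + e / 2).
have Kq : KK Gamma q by apply: KKb_up Kp _ _ => //=; rewrite ltrDl.
have /nbhs_box[d d0 Hd] := KK_open Kq.
have m0 : 0 < Num.min (e / 2) (d / 2) by rewrite lt_min e2 divr_gt0.
have [x xr xp] : exists2 x, lo < x < hi & `|x - Re p| <= Num.min (e / 2) (d / 2).
  set m := Num.min _ _ in m0 *.
  have [lt|ge] := ltP (Re p) hi.
    exists (Num.min (Re p + m) ((Re p + hi) / 2)).
      rewrite lt_min gt_min; apply/andP; split; first by apply/andP; split; lra.
      by apply/orP; right; lra.
    rewrite ger0_norm; first by rewrite lerBlDl ge_min lexx.
    by rewrite subr_ge0 le_min; apply/andP; split; lra.
  have pE : Re p = hi by apply/eqP; rewrite eq_le p2 ge.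
  exists (Num.max (hi - m) ((lo + hi) / 2)).
    rewrite gt_max lt_max; apply/andP; split; last by apply/andP; split; lra.
    by apply/orP; right; lra.
  rewrite pE ler0_norm; first by rewrite opprB lerBlDl -lerBlDr le_max lexx.
  by rewrite subr_le0 ge_max; apply/andP; split; lra.
have [x1 x2] : `|x - Re p| < e /\ `|x - Re p| < d.
  by move: xp; rewrite le_min => /andP[? ?]; split; lra.
exists (x +i* (Im p + e / 2)); split => //.
  by apply: He => //=; rewrite addrAC subrr add0r gtr0_norm //; lra.
by apply: KK_KKb; apply: Hd => //=; rewrite subrr normr0.
Qed.

(** A column touches the real axis only where its lower boundary does: nowhere if it is
    non-cuspidal, at the real end of its arc if it is cuspidal, along the whole base if it is a
    strip. *)
Lemma precell_real A w : is_precell Gamma A -> closure A w -> Im w = 0 -> good (Some w).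
Proof.
move=> pA cw w0; have [lo [hi [[lh El Eh G] AE cs]]] := precell_cases pA.
rewrite AE in cw; have [wr nw] := col_real cw.
right; exists (Re w); first by congr Some; apply: complex_ext.
have nwc g : Gamma g -> pc g != 0 -> rad g ^+ 2 <= (Re w - cen g) ^+ 2.
  by move=> Gg g0; have := nw g Gg g0; rewrite nd_ge1 // w0 expr0n addr0.
case: cs => [[z [gL [gR [al [be [AL AR [Hz cL cR] [lE hiE] _]]]]]]|[g [al [be [e [Ag eE [lE hiE] _]]]]]|[_ K]].
- exfalso; have [[GL L0] _ /andP[_ l2] _ _] := AL; have [[GR R0] _ /andP[r2 _] _ _] := AR.
  have nL := nwc _ GL L0; have nR := nwc _ GR R0; have z0 : 0 < Im z by [].
  have zz : 0 < Im z ^+ 2 by rewrite exprn_gt0.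
  move: cL cR nL nR wr; rewrite /circ lE hiE => <- <- nL nR /andP[w1 w2].
  have [le|lt] := leP (Re w) (Re z).
    have : (Re w - cen gL) ^+ 2 <= (Re z - cen gL) ^+ 2 by rewrite lerXn2r ?nnegrE; lra.
    lra.
  have : (cen gR - Re w) ^+ 2 <= (cen gR - Re z) ^+ 2 by rewrite lerXn2r ?nnegrE; lra.
  by rewrite -sqrrN opprB -[X in _ <= X]sqrrN opprB; lra.
- left; have [[Gg g0] h1 /andP[h2 h2'] h3 _] := Ag; have n := nwc _ Gg g0.
  have r0 := rad_gt0 g0.
  have [_ e2 [lh' E1 E2 _]] := Arc_gap_ends Ag eE.
  have -> : Re w = e; last first.
    by move: E1 E2; case: (leP (cen g) e).
  move: wr; rewrite lE hiE; case: eE => -[eE aE]; rewrite eE ?(min_r (ltW h2)) ?(max_l (ltW h2)) ?(min_l (ltW h2')) ?(max_r (ltW h2')) => /andP[w1 w2].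
    apply/eqP; rewrite eq_le w1 andbT leNgt; apply/negP => lt.
    have : (cen g - Re w) ^+ 2 < rad g ^+ 2 by rewrite ltrXn2r ?nnegrE //; lra.
    by rewrite -sqrrN opprB ltNge n.
  apply/eqP; rewrite eq_le w2 /= leNgt; apply/negP => lt.
  have : (Re w - cen g) ^+ 2 < rad g ^+ 2 by rewrite ltrXn2r ?nnegrE //; lra.
  by rewrite ltNge n.
- case/andP: wr => w1 w2.
  have [->|n1] := eqVneq (Re w) lo; first by left.
  have [->|n2] := eqVneq (Re w) hi; first by left.
  by right; exists lo, hi; split => //; rewrite !lt_neqAle n2 w2 eq_sym n1 w1.
Qed.

Lemma mobhat_bdg g x : bdgH x -> bdgH (mobhat g x : one_point_compactification R[i]).
Proof.
case: x => [z|] /= z0.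
  rewrite denom_eq0; case: eqVneq => // n0 /=.
  by rewrite mobE //= z0 mul0r.
by case: eqVneq.
Qed.

Lemma clH_bdg (x : one_point_compactification R[i]) : bdgH x -> clH x.
Proof. by case: x => [z|] //= ->. Qed.

(** By continuity from inside [HH], where the identity is [mobK]. *)
Lemma mobhatK g x : bdgH x -> closure (Some @` @HH R : set (one_point_compactification R[i])) x ->
  mobhat g^-1%g (mobhat g x) = x.
Proof.
move=> bx cx; apply: contrapT => /nbhs_opc_sep[U [V [nU nV UV]]].
have N1 := mobhat_nbhs (clH_bdg (mobhat_bdg g bx)) nU.
have N2 := mobhat_nbhs (clH_bdg bx) N1.
have [_ [[w Hw <-] [/= h1 h2]]] := cx _ (filterI N2 nV).
have Hgw := HH_mob g Hw.
by apply: (UV (Some w)) => //; have := h1 Hw Hgw; rewrite mobK.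
Qed.

(** * Cells *)

(* The boundary of a cell is contained in the union of the leaves, so its sides are leaves. *)
Definition cellish (B : set C) : Prop :=
  [/\ B `<=` @HH R, (forall p, HH p -> closure B p -> B p),
      (forall p, B p -> ~ onleaf p -> nbhs p B),
      (forall p V, B p -> nbhs p V -> exists w, [/\ V w, B w & ~ onleaf w]) &
      forall x, bdg B x -> exists g y, [/\ Gamma g, x = mobhat g y & good y]].

Lemma patch_closed (J : set nat) (g : nat -> PSL2 R) (A : nat -> set C) :
  finite_set J -> (forall j, J j -> is_precell Gamma (A j)) ->
  forall p, HH p -> closure (\bigcup_(j in J) (mob (g j)^-1%g @` A j)) p -> (\bigcup_(j in J) (mob (g j)^-1%g @` A j)) p.
Proof.
move=> fJ HJ; set B := \bigcup_(j in J) _.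
have AH j : J j -> A j `<=` @HH R.
  by move=> Jj; have /precell_cases[lo [hi [_ -> _]]] := HJ j Jj; move=> p [[]].
move=> p Hp cB; apply: contrapT => nB.
have N : forall j, J j -> \forall w \near p, ~ (mob (g j)^-1%g @` A j) w.
  move=> j Jj; have pA := HJ j Jj; have [lo [hi [_ AE _]]] := precell_cases pA.
  apply: contrapT => nn; apply: nB; exists j => //; exists (mob (g j) p); last exact: mobK.
  rewrite AE; apply: col_closed; first exact: HH_mob.
  move=> V /(mob_near Hp) nV; apply: contrapT => dis; apply: nn.
  have N3 := HH_near Hp; near=> w.
  move=> [a Aa E]; apply: dis; exists a; rewrite -AE; split => //.
  have Ha := AH j Jj _ Aa.
  have -> : a = mob (g j) w by rewrite -E mobVK.
  by near: w; exact: nV.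
have NN := @finite_near _ _ _ J (fun j => [set w | ~ (mob (g j)^-1%g @` A j) w]) (nbhs_filter p) fJ N.
by have [w [j Jj Aw] /(_ j Jj)] := closure_near cB NN.
Unshelve. all: by end_near. Qed.

(** A cell is a finite union of translated precells. Closedness, density of points off the leaves
    and the location of the ideal points are inherited from the pieces; only openness off the leaves
    depends on how the pieces fit together. *)
Lemma patch_cellish (J : set nat) (g : nat -> PSL2 R) (A : nat -> set C) :
  finite_set J -> (forall j, J j -> Gamma (g j) /\ is_precell Gamma (A j)) ->
  (forall p, (\bigcup_(j in J) (mob (g j)^-1%g @` A j)) p -> ~ onleaf p -> nbhs p (\bigcup_(j in J) (mob (g j)^-1%g @` A j))) ->
  cellish (\bigcup_(j in J) (mob (g j)^-1%g @` A j)).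
Proof.
move=> fJ HJ Hi; set B := \bigcup_(j in J) _ in Hi *.
have AH j : J j -> A j `<=` @HH R.
  by move=> Jj; have [_ /precell_cases[lo [hi [_ -> _]]]] := HJ j Jj; move=> p [[]].
have BH : B `<=` @HH R by move=> _ [j Jj [a Aa <-]]; apply: HH_mob; exact: AH Aa.
split => //.
- by apply: patch_closed => // j /HJ[].
- move=> _ V [j Jj [a Aa <-]] nV; have [Gg pA] := HJ j Jj; have Ha := AH j Jj _ Aa.
  have [lo [hi [[lh El Eh G] AE _]]] := precell_cases pA.
  have nV' := mob_near Ha nV; rewrite AE in Aa.
  have [w [Vw Kw wr]] := col_dense lh Aa nV'.
  exists (mob (g j)^-1%g w); split => //.
    exists j => //; exists w => //; rewrite AE; split => //; by case/andP: wr => ? ?; rewrite !ltW.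
  move=> ol; have Hw : HH w by case: Kw.
  have : onleaf w by apply: onleaf_mob ol => //; exact: GammaV.
  by move/(onleaf_KKb Kw); exact: G.
- move=> x [cx bx].
  have [j Jj cj] : exists2 j, J j & closure (Some @` (mob (g j)^-1%g @` A j) : set (one_point_compactification R[i])) x.
    apply: contrapT => nn.
    have N : forall j, J j -> nbhs x (~` (Some @` (mob (g j)^-1%g @` A j)) : set (one_point_compactification R[i])).
      move=> j Jj; apply: contrapT => nN; apply: nn; exists j => // V nV; apply: contrapT => dis; apply: nN.
      apply: filterS nV => y Vy Sy; apply: dis; by exists y.
    have NN := @finite_near _ _ _ J (fun j => ~` (Some @` (mob (g j)^-1%g @` A j)) : set (one_point_compactification R[i])) (nbhs_filter x) fJ N.
    have [_ [[b [j Jj Ab] <-] /= /(_ j Jj)]] := cx _ NN.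
    by apply; exists b.
  have [Gg pA] := HJ j Jj.
  exists (g j)^-1%g, (mobhat (g j) x); split; first exact: GammaV.
    rewrite mobhatK //; move=> V nV; have [_ [[b Bb <-] Vb]] := cx _ nV.
    by exists (Some b); split => //; exists b => //; exact: BH.
  have cy : closure (Some @` A j : set (one_point_compactification R[i])) (mobhat (g j) x).
    move=> V /(mobhat_nbhs (clH_bdg bx)) nV; have [_ [[_ [a Aa <-] <-] /= h]] := cj _ nV.
    have Ha := AH j Jj _ Aa.
    exists (Some a); split; first by exists a.
    by have := h (HH_mob _ Ha); rewrite mobVK.
  move: cy (mobhat_bdg (g j) bx); case: (mobhat (g j) x) => [w|] cy /= by_; last by left.
  apply: (precell_real pA) => // V nV.
  have nS : nbhs (Some w : one_point_compactification R[i]) (Some @` V) by apply: one_point_compactification_some_nbhs.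
  have [_ [[a Aa <-] [b Vb [E]]]] := cy _ nS.
  by exists a; split => //; rewrite -E.
Unshelve. all: by end_near. Qed.

(** A punctured box is connected: starting above [z], the upper, right, left and lower half-boxes
    are reached in turn along segments that avoid [z]. *)
Lemma punctured (B : set C) z e w0 : 0 < e ->
  (forall w, `|Re w - Re z| < e -> `|Im w - Im z| < e -> w <> z -> (B w -> nbhs w B) /\ (closure B w -> B w)) ->
  `|Re w0 - Re z| < e -> Im z < Im w0 < Im z + e -> B w0 ->
  forall w, `|Re w - Re z| < e -> `|Im w - Im z| < e -> w <> z -> B w.
Proof.
move=> e0 HB r0 /andP[i0 i0'] B0.
(* The triple [q] is an open Euclidean half-plane with [z] on its edge; segments inside it avoid
   [z]. *)
have seg (u v : C) (q : R * R * R) : `|Re u - Re z| < e -> `|Im u - Im z| < e -> `|Re v - Re z| < e -> `|Im v - Im z| < e ->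
    q.1.1 * Re z + q.1.2 * Im z = q.2 -> q.2 < q.1.1 * Re u + q.1.2 * Im u -> q.2 < q.1.1 * Re v + q.1.2 * Im v -> B u -> B v.
  move=> u1 u2 v1 v2 qz qu qv Bu.
  pose phi := fun t : R => ((1 - t) * Re u + t * Re v) +i* ((1 - t) * Im u + t * Im v) : C.
  have p1 : phi 1 = v by rewrite /phi; apply: complex_ext => /=; ring.
  have p0 : phi 0 = u by rewrite /phi; apply: complex_ext => /=; ring.
  have ok t : 0 <= t <= 1 -> [/\ `|Re (phi t) - Re z| < e, `|Im (phi t) - Im z| < e & phi t <> z].
    move=> /andP[t0 t1].
    have cv (a b c : R) : `|a - c| < e -> `|b - c| < e -> `|(1 - t) * a + t * b - c| < e.
      move=> h1 h2; have -> : (1 - t) * a + t * b - c = (1 - t) * (a - c) + t * (b - c) by ring.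
      have [m [m1 m2 m3]] : exists m, [/\ `|a - c| <= m, `|b - c| <= m & m < e].
        by exists (Num.max `|a - c| `|b - c|); rewrite !le_max !lexx orbT gt_max h1.
      have t1' : 0 <= 1 - t by rewrite subr_ge0.
      rewrite (le_lt_trans (ler_normD _ _)) // !normrM (ger0_norm t0) (ger0_norm t1').
      have := ler_wpM2l t0 m2; have := ler_wpM2l t1' m1; lra.
    split; [exact: cv|exact: cv|move=> E].
    have : q.2 < q.1.1 * Re (phi t) + q.1.2 * Im (phi t).
      have -> : q.1.1 * Re (phi t) + q.1.2 * Im (phi t) = (1 - t) * (q.1.1 * Re u + q.1.2 * Im u) + t * (q.1.1 * Re v + q.1.2 * Im v) by rewrite /phi /=; ring.
      move: qu qv; set A := _ * _ + _; set D := q.1.1 * Re v + _ => qu qv.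
      have [m [m1 m2 m3]] : exists m, [/\ m <= A, m <= D & q.2 < m].
        by exists (Num.min A D); rewrite !ge_min !lexx orbT lt_min qu.
      have t1' : 0 <= 1 - t by rewrite subr_ge0.
      have := ler_wpM2l t0 m2; have := ler_wpM2l t1' m1; lra.
    by rewrite E qz ltxx.
  rewrite -p1; apply: (@path_stay R phi B 0 1) => //.
  - exact: seg_continuous.
  - by move=> t /ok[h1 h2 h3]; exact: (HB _ h1 h2 h3).1.
  - by move=> t /ok[h1 h2 h3]; exact: (HB _ h1 h2 h3).2.
  - by rewrite p0.
have e2 : 0 < e / 2 by rewrite divr_gt0.
have e2' : e / 2 < e by rewrite ltr_pdivrMr // ltr_pMr // ltr1n.
have w0i : `|Im w0 - Im z| < e by rewrite ltr_norml; apply/andP; split; lra.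
have n1 : `|e / 2| < e by rewrite gtr0_norm.
have n2 : `|- (e / 2)| < e by rewrite normrN.
have up w : `|Re w - Re z| < e -> `|Im w - Im z| < e -> Im z < Im w -> B w.
  by move=> h1 h2 h3; apply: (seg w0 w (0, 1, Im z)) => //=; rewrite ?mul0r ?mul1r ?add0r.
have cz (a b : R) : `|a| < e -> `|b| < e -> `|Re ((Re z + a) +i* (Im z + b)) - Re z| < e /\ `|Im ((Re z + a) +i* (Im z + b)) - Im z| < e.
  by move=> h1 h2; rewrite /=; split; rewrite addrAC subrr add0r.
have rt w : `|Re w - Re z| < e -> `|Im w - Im z| < e -> Re z < Re w -> B w.
  move=> h1 h2 h3; have [c1 c2] := cz _ _ n1 n1.
  apply: (seg ((Re z + e / 2) +i* (Im z + e / 2)) w (1, 0, Re z)) => //=; rewrite ?mul0r ?mul1r ?addr0 ?ltrDl //.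
  by apply: up => //=; rewrite ltrDl.
have lf w : `|Re w - Re z| < e -> `|Im w - Im z| < e -> Re w < Re z -> B w.
  move=> h1 h2 h3; have [c1 c2] := cz _ _ n2 n1.
  apply: (seg ((Re z + - (e / 2)) +i* (Im z + e / 2)) w (-1, 0, - Re z)) => //=; rewrite ?mul0r ?mulN1r ?addr0 ?ltrN2 //; try lra.
  by apply: up => //=; rewrite ltrDl.
have dn w : `|Re w - Re z| < e -> `|Im w - Im z| < e -> Im w < Im z -> B w.
  move=> h1 h2 h3; have [c1 c2] := cz _ _ n1 n2.
  apply: (seg ((Re z + e / 2) +i* (Im z + - (e / 2))) w (0, -1, - Im z)) => //=; rewrite ?mul0r ?mulN1r ?add0r ?ltrN2 //; try lra.
  by apply: rt => //=; rewrite ltrDl.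
move=> w h1 h2 wz; have [lt|gt|e1] := ltgtP (Re w) (Re z); [exact: lf|exact: rt|].
have [lt|gt|e3] := ltgtP (Im w) (Im z); [exact: dn|exact: up|].
by case: wz; exact: complex_ext.
Qed.

Lemma bK_half k x lo hi q : Half k x lo hi -> boundaryH (KK Gamma) q ->
  Num.min (cen k) x <= Re q <= Num.max (cen k) x -> circ (cen k) (rad k) q.
Proof.
move=> H bq qr; have [Gk k0] := Half_G H; have r0 := rad_gt0 k0.
have [al [be [A h]]] := H; have [_ a1 /andP[h1 h2] a2 _] := A.
have qa : al <= Re q <= be.
  move: qr; case: h => -[-> _ _]; rewrite ?(min_l (ltW h2)) ?(max_r (ltW h2)) ?(min_r (ltW h1)) ?(max_l (ltW h1)) => /andP[? ?]; apply/andP; split; lra.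
have cp := Arc_cpt A qa.
have [e|ne] := eqVneq ((Re q - cen k) ^+ 2) (rad k ^+ 2).
  have /bKP[Kq] := bq; case; apply: (Arc_vertK A qa e) => //; by case: Kq.
have s0 : 0 <= rad k ^+ 2 - (Re q - cen k) ^+ 2.
  by apply: sq_between; [exact: ltW|case/andP: qa => ? ?; apply/andP; split; lra].
have Hp : HH (cpt (cen k) (rad k) (Re q)).
  by rewrite /HH /= sqrtr_gt0 lt_def s0 andbT subr_eq0 eq_sym.
by rewrite (bK_uniq bq (Arc_bK A Hp cp qa) _).
Qed.

Lemma Half_full k x lo hi : Half k x lo hi -> gap lo hi -> EE x -> lo = Num.min (cen k) x /\ hi = Num.max (cen k) x.
Proof.
move=> [al [be [A h]]] [lh El Eh G] Ex; have [_ _ /andP[h1 h2] _ _] := A.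
case: h => -[xE cE xl].
  have -> : hi = x.
    by apply/eqP; rewrite eq_le xl andbT leNgt; apply/negP => lt; case: (G x) => //; rewrite lt cE xE h2.
  by rewrite cE xE (min_l (ltW h2)) (max_r (ltW h2)).
have -> : lo = x.
  by apply/eqP; rewrite eq_le xl /= leNgt; apply/negP => lt; case: (G x) => //; rewrite lt cE xE h1.
by rewrite cE xE (min_r (ltW h1)) (max_l (ltW h1)).
Qed.

Lemma EE_end k x lo hi : Half k x lo hi -> (x - cen k) ^+ 2 = rad k ^+ 2 -> EE x.
Proof.
move=> H e2; have [Gk k0] := Half_G H; have r0 := rad_gt0 k0.
have [al [be [A h]]] := H; have [_ a1 /andP[h1 h2] a2 _] := A.
have {}e2 : (x - cen k - rad k) * (x - cen k + rad k) = 0.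
  have -> : (x - cen k - rad k) * (x - cen k + rad k) = (x - cen k) ^+ 2 - rad k ^+ 2 by ring.
  by rewrite e2 subrr.
move/eqP: e2; rewrite mulf_eq0 => e2.
exists k, al, be; split => //; case: h => -[xE _ _]; [apply: Or33|apply: Or32]; split => //; case/orP: e2 => /eqP; lra.
Qed.

Lemma flipK h x : flip h^-1%g (flip h x) = x.
Proof. by rewrite /flip invgK; ring. Qed.

Lemma NS_Half A k y lo hi : nonvertical_side Gamma A (side k y) -> lo < hi -> Half k y lo hi ->
  exists lo' hi', [/\ gap lo' hi', A = col lo' hi' & Half k y lo' hi'].
Proof.
move=> /NS1[k' [y' [lo' [hi' [gp AE H' sE]]]]] lh H; exists lo', hi'; split => //.
have [lh' _ _ _] := gp.
have [c ->] := side_inj lh lh' H H' sE; have [Gk k0] := Half_G H.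
exact: Half_same H' Gk k0 (esym c).
Qed.

Lemma mob1_image (A : set C) : mob 1%g @` A = A.
Proof. by rewrite eqEsubset; split=> [_ [a Aa <-]|a Aa]; [|exists a]; rewrite ?mob1. Qed.

Lemma strip_cellish A : strip_precell Gamma A -> cellish A.
Proof.
move=> sA; have pA : is_precell Gamma A by exact: Or33.
have [lo [hi [[lh El Eh G] AE K]]] := strip_col sA.
have BE : \bigcup_(j in [set 1%N]) (mob (1 : PSL2 R)^-1%g @` A) = A by rewrite bigcup_set1 invg1 mob1_image.
rewrite -{}BE; apply: (@patch_cellish [set 1%N] (fun=> 1%g) (fun=> A)).
- exact: finite_set1.
- by move=> j _; split => //; exact: Gamma1 hF.
rewrite bigcup_set1 invg1 mob1_image AE => p [Kp /andP[p1 p2]] nl.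
have Hp : HH p by case: Kp.
have pr : lo < Re p < hi.
  rewrite !lt_neqAle p1 p2 !andbT; apply/andP; split; apply/eqP => E; apply: nl; apply/(onleaf_KKb Kp); rewrite -?E // E //.
by apply: col_near => //; apply: K => //; rewrite p1.
Qed.

(** As [x] is in [EE], the half arc is the whole bottom of the column, so a point off the leaves is
    either in [KK] or covered by [glue]. *)
Lemma piece_near h x lo hi lo' hi' a : gap lo hi -> gap lo' hi' -> Half h x lo hi -> Half h^-1%g (flip h x) lo' hi' ->
  EE x -> col lo hi a -> ~ onleaf a -> \forall w \near a, HH w /\ (col lo hi w \/ col lo' hi' (mob h w)).
Proof.
move=> gp gp' H H' Ex [Ka /andP[a1 a2]] nl; have [lh El Eh G] := gp; have [lh' _ _ _] := gp'.
have Ha : HH a by case: Ka.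
have ar : lo < Re a < hi.
  rewrite !lt_neqAle a1 a2 !andbT; apply/andP; split; apply/eqP => E; apply: nl; apply/(onleaf_KKb Ka); rewrite -?E // E //.
have [Kk|nK] := pselect (KK Gamma a).
  by apply: filterS (col_near Kk ar) => w Aw; split; [case: Aw => -[]|left].
have bK : boundaryH (KK Gamma) a by apply/bKP.
have [loE hiE] := Half_full H gp Ex.
have cq : circ (cen h) (rad h) a by apply: bK_half H bK _; rewrite -loE -hiE a1.
by apply: (glue lh lh' H H' Ha cq); rewrite -loE -hiE.
Qed.

Lemma cusp_cellish A B : AA A -> cuspidal_cell Gamma AA A B -> cellish B /\ A `<=` B.
Proof.
move=> AAA [v [b [g [A' [cu asg AA' nA' BE]]]]].
split; last by rewrite BE; left.
have [x [lo [hi [A2 [lo2 [hi2 [[gp AE] H bE [_ _ gp2] [H2 gb]]]]]]]] := asgP asg.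
have [Gg g0] := Half_G H; have [lh _ _ _] := gp; have [lh2 _ _ _] := gp2.
rewrite gb in nA'.
have [lo' [hi' [gp' AE' H']]] := NS_Half nA' lh2 H2.
have [k [al [be [e [Ak eE vE bE2 [gpe AEe]]]]]] := cusp_col cu.
have [er e2 [lhe Ee1 Ee2 _]] := Arc_gap_ends Ak eE.
have Hk : Half k e (Num.min (cen k) e) (Num.max (cen k) e).
  exists al, be; split => //; have [[_ _] _ /andP[r1 r2] _ _] := Ak.
  by case: eE => -[-> _]; [right|left]; split; rewrite ?ge_min ?le_max ?lexx ?orbT //; [apply: max_l|apply: min_l]; exact: ltW.
have [c xe] : cen g = cen k /\ x = e by apply: (side_inj lh lhe H Hk); rewrite -bE.
have [Gk k0] := Half_G Hk.
have e2' : (x - cen g) ^+ 2 = rad g ^+ 2 by rewrite xe c e2 (same_circle Gg Gk g0 k0 c).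
have Ex := EE_end H e2'.
have Ex' : EE (flip g x).
  by apply: (EE_end H'); rewrite radV -e2' /flip; ring.
have BE' : B = \bigcup_(j in [set 1%N; 2%N]) (mob (if j == 1%N then 1%g else g)^-1%g @` (if j == 1%N then A else A')).
  by rewrite bigcup_setU !bigcup_set1 /= invg1 mob1_image.
rewrite {1}BE'; apply: patch_cellish.
- exact: finite_set2.
- move=> j _; case: ifP => _; split => //; [exact: Gamma1 hF|exact: (hB.1 _ AAA)|exact: (hB.1 _ AA')].
rewrite -BE' BE AE AE' => p [Ap|[a Aa <-]] nl.
  apply: filterS (piece_near gp gp' H H' Ex Ap nl) => w [Hw [?|?]]; [by left|right].
  by exists (mob g w) => //; rewrite mobK.
have Ha : HH a by case: Aa => -[].
have nla : ~ onleaf a.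
  move=> ol; apply: nl; apply: (@onleaf_mob g); [by []|exact: HH_mob|by rewrite mobVK].
have H3 : Half g^-1^-1%g (flip g^-1%g (flip g x)) lo hi by rewrite flipK invgK.
have N := piece_near gp' gp H' H3 Ex' Aa nla.
have Hp := HH_mob g^-1%g Ha.
have N' := @mob_near _ g (mob g^-1%g a) _ Hp; rewrite mobVK // in N'.
have N4 := HH_near Hp.
near=> w; have Hw : HH w by near: w; exact: N4.
have : HH (mob g w) /\ (col lo' hi' (mob g w) \/ col lo hi (mob g^-1%g (mob g w))) by near: w; exact: N' N.
by rewrite mobK // => -[_ [?|?]]; [right; exists (mob g w) => //; rewrite mobK|left].
Unshelve. all: by end_near. Qed.

Lemma cusp_exists A v b : AA A -> cuspidal_precell Gamma v b A -> exists B, cuspidal_cell Gamma AA A B.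
Proof.
move=> AAA cu; have [k [al [be [e [Ak eE vE bE [gp AE]]]]]] := cusp_col cu.
have [lh _ _ _] := gp.
have Hk : Half k e (Num.min (cen k) e) (Num.max (cen k) e).
  exists al, be; split => //; have [[_ _] _ /andP[r1 r2] _ _] := Ak.
  by case: eE => -[-> _]; [right|left]; split; rewrite ?ge_min ?le_max ?lexx ?orbT //; [apply: max_l|apply: min_l]; exact: ltW.
have [h [A' [lo' [hi' [H c [AA' AE'] gp' H']]]]] := assign_ex lh Hk.
have [Gh h0] := Half_G H; have [Gk k0] := Half_G Hk.
have bE' : b = side h e by rewrite bE; exact: side_same.
exists (A `|` mob h^-1%g @` A'), v, b, h, A'; split => //.
- by rewrite bE'; exact: asgI AAA gp AE H AA' gp' AE' H'.
- rewrite bE' mob_side //; exact: NS2 (hB.1 _ AA') gp' AE' H'.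
Qed.

Definition vtx z A : Prop := AA A /\ exists b1 b2, noncuspidal_precell Gamma z b1 b2 A.

(** The side of [A'] on which [h] lands ends at [mob h z], a point of the plane; in a cuspidal
    precell the side would end on the real axis. *)
Lemma vtx_land h z lo hi A' lo' hi' : lo < hi -> Half h (Re z) lo hi -> HH z -> circ (cen h) (rad h) z ->
  AA A' -> gap lo' hi' -> A' = col lo' hi' -> Half h^-1%g (flip h (Re z)) lo' hi' -> vtx (mob h z) A'.
Proof.
move=> lh H Hz cz AA' gp' AE' H'; have [Gh h0] := Half_G H; have [lh' _ _ _] := gp'.
have [e1 e2 e3] := circ_mob Hz h0 cz; have Hhz := HH_mob h Hz.
have [Gv v0] := Half_G H'.
have ns := NS2 (hB.1 _ AA') gp' AE' H'.
split => //; case: ns => [[z' [b1 [b2 [nc bb]]]]|[v cu]].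
  have [gL [gR [al [be [AL AR [Hz' cL cR] [gp2 AE2] E]]]]] := noncusp_col nc.
  have [lh2 _ _ _] := gp2.
  have [[GL L0] _ /andP[_ l2] _ _] := AL; have [[GR R0] _ /andP[r2 _] _ _] := AR.
  have HL : Half gL (Re z') (cen gL) (cen gR) by exists al, (Re z'); split => //; left; split => //; exact: ltW.
  have HR : Half gR (Re z') (cen gL) (cen gR) by exists (Re z'), be; split => //; right; split => //; exact: ltW.
  have fin k : Half k (Re z') (cen gL) (cen gR) -> circ (cen k) (rad k) z' -> side h^-1%g (flip h (Re z)) = side k (Re z') -> mob h z = z'.
    move=> Hk ck sE; have [c xe] := side_inj lh' lh2 H' Hk sE.
    have [Gk k0] := Half_G Hk.
    rewrite c (same_circle Gv Gk v0 k0 c) in e3.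
    apply: (circ_eq _ _ e3 ck); [exact: ltW|exact: ltW|by rewrite e1 -xe].
  have -> : mob h z = z'; last by exists b1, b2.
  by case: E => -[E1 E2]; case: bb => bb; [apply: (fin gL)|apply: (fin gR)|apply: (fin gR)|apply: (fin gL)] => //; rewrite bb ?E1 ?E2.
exfalso; have [k [al [be [e [Ak eE vE bE [gpk AEk]]]]]] := cusp_col cu.
have [lhk _ _ _] := gpk; have [er ee _] := Arc_gap_ends Ak eE.
have Hk : Half k e (Num.min (cen k) e) (Num.max (cen k) e).
  exists al, be; split => //; have [[_ _] _ /andP[r1 r2] _ _] := Ak.
  by case: eE => -[-> _]; [right|left]; split; rewrite ?ge_min ?le_max ?lexx ?orbT //; [apply: max_l|apply: min_l]; exact: ltW.
have [c xe] := side_inj lh' lhk H' Hk bE; have [Gk k0] := Half_G Hk.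
move: e3; rewrite /circ e1 c (same_circle Gv Gk v0 k0 c) -ee.
have -> : cen k - (Re z - cen h) = e by rewrite -c -xe.
move=> /eqP; rewrite addrC -subr_eq0 addrK sqrf_eq0 => /eqP E.
by move: Hhz; rewrite /HH /= E ltxx.
Qed.

Lemma vtxP z A : vtx z A -> exists hL hR lo hi,
  [/\ [/\ gap lo hi, A = col lo hi, HH z, lo < Re z < hi & boundaryH (KK Gamma) z],
      [/\ Half hL (Re z) lo hi, cen hL = lo & circ (cen hL) (rad hL) z],
      [/\ Half hR (Re z) lo hi, cen hR = hi & circ (cen hR) (rad hR) z],
      assigned Gamma AA A = [set hL; hR] &
      forall h, [set hL; hR] h -> exists A' lo' hi', [/\ vtx (mob h z) A', A' = col lo' hi', gap lo' hi',
        Half h^-1%g (flip h (Re z)) lo' hi' & assigned Gamma AA A' h^-1%g]].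
Proof.
move=> [AAA [b1 [b2 nc]]].
have [gL [gR [al [be [AL AR [Hz cL cR] [gp AE] _]]]]] := noncusp_col nc.
have [[GL L0] _ /andP[l1 l2] _ _] := AL; have [[GR R0] _ /andP[r2 r3] _ _] := AR.
have HL : Half gL (Re z) (cen gL) (cen gR) by exists al, (Re z); split => //; left; split => //; exact: ltW.
have HR : Half gR (Re z) (cen gL) (cen gR) by exists (Re z), be; split => //; right; split => //; exact: ltW.
have [lh _ _ _] := gp.
have [hL [A1 [lo1 [hi1 [H1 c1 [AA1 AE1] gp1 H1']]]]] := assign_ex lh HL.
have [hR [A2 [lo2 [hi2 [H2 c2 [AA2 AE2] gp2 H2']]]]] := assign_ex lh HR.
have [G1 h10] := Half_G H1; have [G2 h20] := Half_G H2.
have k1 : circ (cen hL) (rad hL) z by rewrite c1 (same_circle G1 GL h10 L0 c1).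
have k2 : circ (cen hR) (rad hR) z by rewrite c2 (same_circle G2 GR h20 R0 c2).
have land h A' lo' hi' : Half h (Re z) (cen gL) (cen gR) -> circ (cen h) (rad h) z -> AA A' -> A' = col lo' hi' -> gap lo' hi' ->
    Half h^-1%g (flip h (Re z)) lo' hi' -> exists A' lo' hi', [/\ vtx (mob h z) A', A' = col lo' hi', gap lo' hi',
        Half h^-1%g (flip h (Re z)) lo' hi' & assigned Gamma AA A' h^-1%g].
  move=> H c AA' AE' gp' H'; exists A', lo', hi'; split => //.
    exact: (vtx_land lh H Hz c AA' gp' AE' H').
  exists (side h^-1%g (flip h (Re z))); apply: (asgI AA' gp' AE' H' AAA gp AE).
  by rewrite flipK invgK.
exists hL, hR, (cen gL), (cen gR); split => //.
- split => //; first by rewrite l2 r2.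
  by apply: (Arc_bK AL) => //; rewrite lexx (ltW (lt_trans l1 l2)).
- rewrite eqEsubset; split=> h.
    move=> [b /asgP[x [lo [hi [A' [lo' [hi' [[gpx AEx] H bE [AA' AE' gp'] [H' _]]]]]]]]].
    have [E1 E2] : lo = cen gL /\ hi = cen gR by apply: (col_inj gpx gp); rewrite -AEx.
    subst lo hi; have [Gh h0] := Half_G H; have [lh' _ _ _] := gp'.
    have [lh1 _ _ _] := gp1; have [lh2 _ _ _] := gp2.
    have [a [b' [Ah hh]]] := H; case: hh => -[xE cE _].
      left; have [_ E] := Arc_ends_uniq (Arc_same Ah GL L0 (esym cE)) AL; subst x b'.
      by apply: (land_uniq Gh G1 h0 h10 _ AA' AE' lh' H' AA1 AE1 lh1 H1'); rewrite c1 -cE.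
    right; have [E _] := Arc_ends_uniq (Arc_same Ah GR R0 (esym cE)) AR; subst x a.
    by apply: (land_uniq Gh G2 h0 h20 _ AA' AE' lh' H' AA2 AE2 lh2 H2'); rewrite c2 -cE.
  by case=> ->; [exists (side hL (Re z)); exact: asgI AAA gp AE H1 AA1 gp1 AE1 H1'|exists (side hR (Re z)); exact: asgI AAA gp AE H2 AA2 gp2 AE2 H2'].
- by move=> h [->|->]; [exact: land H1 k1 AA1 AE1 gp1 H1'|exact: land H2 k2 AA2 AE2 gp2 H2'].
Qed.

Lemma vtx_uniq z A A' : vtx z A -> vtx z A' -> A = A'.
Proof.
move=> /vtxP[hL [hR [lo [hi [[gp -> _ zr _] _ _ _ _]]]]] /vtxP[hL' [hR' [lo' [hi' [[gp' -> _ /andP[z1 z2] _] _ _ _ _]]]]].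
by have [-> ->] := gap_uniq gp gp' zr (introT andP (conj (ltW z1) (ltW z2))).
Qed.

Lemma asg_G A h : assigned Gamma AA A h -> Gamma h /\ pc h != 0.
Proof. by move=> [b /asgP[x [lo [hi [A' [lo' [hi' [_ H _ _ _]]]]]]]]; exact: Half_G H. Qed.

Lemma vtx_next z A h : vtx z A -> assigned Gamma AA A h -> exists A', vtx (mob h z) A' /\ assigned Gamma AA A' h^-1%g.
Proof.
by move=> /vtxP[hL [hR [lo [hi [_ _ _ -> H]]]]] /H[A' [lo' [hi' [? _ _ _ ?]]]]; exists A'.
Qed.

Lemma vtx_two z A h h' : vtx z A -> assigned Gamma AA A = [set h; h'] -> h <> h'.
Proof.
move=> /vtxP[hL [hR [lo [hi [[[lh _ _ _] _ _ _ _] [_ cL _] [_ cR _] -> _]]]]] E e; subst h'.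
have e1 : [set h; h] hL by rewrite -E; left.
have e2 : [set h; h] hR by rewrite -E; right.
have {e1 e2}E : hL = hR by case: e1 => ->; case: e2 => ->.
by move: lh; rewrite -cL -cR E ltxx.
Qed.

Lemma vtx_other z A h : vtx z A -> assigned Gamma AA A h -> exists h', [set h'; h] = assigned Gamma AA A.
Proof.
move=> /vtxP[hL [hR [lo [hi [_ _ _ -> _]]]]] [->|->]; [exists hR|exists hL] => //.
by rewrite setUC.
Qed.

Lemma pair_cancel (T : Type) (a b c : T) : [set a; b] = [set c; a] -> b = c.
Proof.
move=> E; have : [set c; a] b by rewrite -E; right.
case=> // ba; have : [set a; b] c by rewrite E; left.
by case=> ->.
Qed.

(** Both [z] and its image are on the boundary of [KK], so [g] fixes infinity or its circle passes
    through [z], which leaves finitely many circles. Two elements with one circle differ by a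
    translation between interior abscissas of the family, trivial by [AA_uniq]. *)
Lemma vtx_finite z A : vtx z A -> finite_set [set g | Gamma g /\ exists A', vtx (mob g z) A'].
Proof.
move=> vz; have [hL [hR [lo [hi [[gp AE Hz zr bz] _ _ _ _]]]]] := vtxP vz.
have Kz := ((bKP _).1 bz).1; have z0 : 0 < Im z by [].
have [M M0 HM] := rad_bound.
pose f g : R * R := if pc g == 0 then (0, 0) else (cen g, rad g).
apply: (@finite_inj _ _ f).
  apply: (@sub_finite_set _ _ ([set (0, 0)] `|` [set x : R * R | exists g, [/\ Gamma g, pc g != 0, `|cen g| <= `|Re z| + M, Im z <= rad g & x = (cen g, rad g)]])); last first.
    by rewrite finite_setU; split; [exact: finite_set1|exact: circles_finite].
  move=> _ [g [Gg [A' vg]] <-]; rewrite /f; case: eqVneq => [_|g0]; [by left|right].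
  exists g; split => //.
    have [hL' [hR' [lo' [hi' [[_ _ _ _ bg] _ _ _ _]]]]] := vtxP vg.
    have n1 := KKb_both Kz Gg ((bKP _).1 bg).1.
    have c1 : circ (cen g) (rad g) z by exact/nd_eq1.
    have r0 := rad_gt0 g0; have /andP[b1 b2] := circ_between (ltW r0) Hz c1; have := HM g Gg g0.
    have : `|cen g - Re z| <= rad g by rewrite ler_norml; apply/andP; split; lra.
    by have := ler_normD (Re z) (cen g - Re z); rewrite addrC subrK; lra.
  have [hL' [hR' [lo' [hi' [[_ _ _ _ bg] _ _ _ _]]]]] := vtxP vg.
  have n1 := KKb_both Kz Gg ((bKP _).1 bg).1.
  have c1 : circ (cen g) (rad g) z by exact/nd_eq1.
  have r0 := rad_gt0 g0; rewrite -(ler_pXn2r (_ : 0 < 2)%N) ?nnegrE ?(ltW r0) ?(ltW z0) //.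
  by move: c1; rewrite /circ; have := sqr_ge0 (Re z - cen g); lra.
move=> a b [Ga [A1 v1]] [Gb [A2 v2]] fe.
have t0 : pc (a * b^-1)%g = 0.
  move: fe; rewrite /f; case: eqVneq => [a0|a0]; case: eqVneq => [b0|b0].
  - by move=> _; apply: pcM_stab => //; exact: pcV_stab.
  - by move=> [_ /esym/eqP]; rewrite gt_eqF // rad_gt0.
  - by move=> [_ /eqP]; rewrite gt_eqF // rad_gt0.
  - by move=> [c _]; exact: same_cen.
set t := (a * b^-1)%g in t0; have Gt : Gamma t by apply: GammaM => //; exact: GammaV.
have E : a = (t * b)%g by rewrite /t -mulgA mulVg mulg1.
suff tE : t = 1%g by rewrite E tE mul1g.
have [hL1 [hR1 [lo1 [hi1 [[gp1 AE1 H1 r1 _] _ _ _ _]]]]] := vtxP v1.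
have [hL2 [hR2 [lo2 [hi2 [[gp2 AE2 H2 r2 _] _ _ _ _]]]]] := vtxP v2.
have [p [Kp pE]] := KK_above (Re (mob b z)).
apply: (AA_uniq v2.1 v1.1 AE2 AE1 Gt Kp (KK_mob_stab Kp Gt t0)); first by rewrite pE.
have e1 : Re (mob a z) = Re (mob b z) + tau t by rewrite E mob_mul // (stab_mob hF hC).
have e2 : Re (mob t p) = Re p + tau t by rewrite (stab_mob hF hC).
by rewrite e2 pE -e1.
Qed.

(** The walk around the vertex is a dynamical system on the pairs [(g_j, h_j)]. The set [S] of
    states is finite and a state is determined by its successor, so the walk returns to its start;
    [k] is the first return of the first component to the identity. *)
Lemma noncusp_exists z A : vtx z A -> exists B, noncuspidal_cell Gamma AA A B.
Proof.
move=> vz.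
pose S := [set s : PSL2 R * PSL2 R | Gamma s.1 /\ exists A', vtx (mob s.1 z) A' /\ assigned Gamma AA A' s.2].
have [_ [_ [_ [_ [[_ _ Hz _ _] _ _ _ _]]]]] := vtxP vz.
have finS : finite_set S.
  have fG := vtx_finite vz.
  apply: (@sub_finite_set _ _ (\bigcup_(g in [set g | Gamma g /\ exists A', vtx (mob g z) A']) [set s | s.1 = g /\ exists A', vtx (mob g z) A' /\ assigned Gamma AA A' s.2])).
    by move=> s [Gs [A' [v a]]]; exists s.1; [split => //; exists A'|split => //; exists A'].
  apply: bigcup_finite => // g [Gg [A' v]].
  have [hL [hR [_ [_ [_ _ _ aE _]]]]] := vtxP v.
  apply: (@sub_finite_set _ _ [set (g, hL); (g, hR)]); last exact: finite_set2.
  move=> [g' h] /= [-> [A2 [v2]]]; rewrite (vtx_uniq v2 v) aE => -[->|->]; [by left|by right].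
pose nxt s s' := S s -> S s' /\ s'.1 = (s.2 * s.1)%g /\ forall A', vtx (mob s'.1 z) A' -> [set s'.2; s.2^-1%g] = assigned Gamma AA A'.
have [nx Hnx] : {nx : PSL2 R * PSL2 R -> PSL2 R * PSL2 R & forall s, nxt s (nx s)}.
  apply: choice => s; have [Ss|nS] := pselect (S s); last by exists s.
  have [Gs [A' [v a]]] := Ss; have [A2 [v2 a2]] := vtx_next v a.
  have [h' hhE] := vtx_other v2 a2; have [Gh _] := asg_G a.
  exists ((s.2 * s.1)%g, h') => _; rewrite /= mob_mul //; split.
    split => /=; first exact: GammaM.
    by rewrite mob_mul //; exists A2; split => //; rewrite -hhE; left.
  by split => // A3 v3; rewrite (vtx_uniq v3 v2).
have [hL [hR [lo [hi [_ _ _ aE _]]]]] := vtxP vz.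
pose s n := iter n nx (1%g, hL).
have s0 : S (s 0%N).
  split => /=; first exact: Gamma1 hF.
  by rewrite mob1; exists A; split => //; rewrite aE; left.
have Ss n : S (s n) by elim: n => // n IH; have [] := Hnx _ IH.
(* The two assigned elements of a precell are the next step and the inverse of the previous one, so
   the previous one can be recovered. *)
have inj n m : s n.+1 = s m.+1 -> s n = s m.
  move=> e; have [[_ [A1 [v1 _]]] [n1 n2]] := Hnx _ (Ss n); have [_ [m1 m2]] := Hnx _ (Ss m).
  have E1 := n2 _ v1; rewrite -[nx (s n)]/(s n.+1) in n1 E1 v1; rewrite -[nx (s m)]/(s m.+1) -e in m1 m2.
  have E2 := m2 _ v1; rewrite -E1 in E2.
  have e2 : (s n).2^-1%g = (s m).2^-1%g.
    by apply: (@pair_cancel _ (s n.+1).2); rewrite [RHS]setUC E2.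
  have e3 : (s n).2 = (s m).2 by rewrite -[LHS]invgK e2 invgK.
  have e4 : (s n).1 = (s m).1 by apply: (mulgI (s n).2); rewrite -n1 e3 -m1.
  by rewrite [LHS]surjective_pairing [RHS]surjective_pairing e3 e4.
have [i [j [ij e]]] := finite_repeat finS Ss.
have [k k0 k1] : exists2 k, (0 < k)%N & (s k).1 = 1%g.
  exists (j - i)%N; first by rewrite subn_gt0.
  have : s 0%N = s (j - i)%N.
    elim: i j ij e => [|i IH] j ij e; first by rewrite subn0.
    case: j ij e => // j ij e; rewrite subSS; apply: IH => //; exact: inj.
  by move=> <-.
have exk : exists k, (0 < k)%N && ((s k).1 == 1%g) by exists k; rewrite k0 k1 eqxx.
case: (ex_minnP exk) => {k0 k1}k /andP[k0 /eqP k1] kmin.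
have [Aj HAj] : {Aj : nat -> set C & forall n, vtx (mob (s n).1 z) (Aj n) /\ assigned Gamma AA (Aj n) (s n).2}.
  by apply: (@choice _ _ (fun n A' => vtx (mob (s n).1 z) A' /\ assigned Gamma AA A' (s n).2)) => n; have [_ [A' ?]] := Ss n; exists A'.
(* Cycles are indexed from 1, the states from 0. *)
exists (\bigcup_(j in [set j | (1 <= j <= k)%N]) (mob (s j.-1).1^-1%g @` Aj j.-1)), z, k, (fun j => (s j.-1).2), (fun j => (s j.-1).1), (fun j => Aj j.-1).
have stepE n : (s n.+1).1 = ((s n).2 * (s n).1)%g by have [_ []] := Hnx _ (Ss n).
split => //.
- by case: vz.
- by split => //=; rewrite aE; left.
- move=> [|j'] //= jk; split => //.
  + exact: stepE j'.
  + exact: (HAj j').1.1.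
  + exact: (HAj j').1.2.
  + case: j' jk => // j' jk _ /=; have [_ [_ H]] := Hnx _ (Ss j').
    exact: H (HAj j'.+1).1.
- split => // -[|j'] //= jk; rewrite -/(s j'.+1) => e1.
  by have := kmin j'.+1; rewrite e1 eqxx /= => /(_ isT); rewrite leqNgt jk.
Qed.

(** The neighbour of a precell of the cycle across either side is again in the cycle. The crux is
    the first precell, whose second assigned element must be the inverse of [h k]. *)
Lemma cycle_closed (z : C) k (h g : nat -> PSL2 R) (Aj : nat -> set C) : HH z -> (1 <= k)%N ->
  g 1%N = 1%g -> g k.+1 = 1%g ->
  (forall j, (1 <= j <= k)%N -> g j.+1 = (h j * g j)%g /\ vtx (mob (g j) z) (Aj j)) ->
  assigned Gamma AA (Aj 1%N) (h 1%N) ->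
  (forall j, (2 <= j <= k)%N -> [set h j; (h j.-1)^-1%g] = assigned Gamma AA (Aj j)) ->
  forall j h', (1 <= j <= k)%N -> assigned Gamma AA (Aj j) h' -> exists2 j', (1 <= j' <= k)%N & g j' = (h' * g j)%g.
Proof.
move=> Hz k1 g1 gk st a1 aj.
have ah j : (1 <= j <= k)%N -> assigned Gamma AA (Aj j) (h j).
  case: j => [|[|j]] // jk; rewrite -aj //; by left.
have hk : assigned Gamma AA (Aj 1%N) (h k)^-1%g.
  have kk : (1 <= k <= k)%N by rewrite k1 leqnn.
  have [gE vk] := st k kk; have [A' [v' a']] := vtx_next vk (ah k kk).
  rewrite -mob_mul // -gE gk in v'.
  have [_ v1] : g 2%N = (h 1%N * g 1%N)%g /\ vtx (mob (g 1%N) z) (Aj 1%N) by apply: st; rewrite k1.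
  by rewrite g1 in v1; rewrite -(vtx_uniq v' v1).
have npal : (h k)^-1%g <> h 1%N.
  move=> pal.
  (* If the inverse of [h k] were [h 1], the cycle would retrace its steps and be a palindrome. *)
  have P i : (1 <= i <= k)%N -> g (k.+2 - i)%N = g i /\ h (k.+1 - i)%N = (h i)^-1%g.
    elim: i => // -[_ _|i IH ik].
      by rewrite !subSS !subn0 gk g1 -pal invgK.
    have ik' : (1 <= i.+1 <= k)%N by lia.
    have [e1 e2] := IH ik'.
    have mk : (1 <= k.+1 - i.+1 <= k)%N by lia.
    have [gE vg] := st _ mk.
    have e3 : (k.+1 - i.+1).+1 = (k.+2 - i.+1)%N by lia.
    rewrite e3 e1 e2 in gE.
    have [gE2 vg2] : g i.+3 = (h i.+2 * g i.+2)%g /\ vtx (mob (g i.+2) z) (Aj i.+2) by apply: st; lia.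
    have [gE3 _] := st _ ik'.
    have e4 : (k.+2 - i.+2)%N = (k.+1 - i.+1)%N by lia.
    have g4 : g (k.+1 - i.+1)%N = g i.+2 by rewrite gE3 gE mulgA mulgV mul1g.
    split; first by rewrite e4.
    rewrite g4 in vg; have AE := vtx_uniq vg vg2.
    have m2 : (2 <= k.+1 - i.+1 <= k)%N by lia.
    have i2 : (2 <= i.+2 <= k)%N by lia.
    have := aj _ m2; rewrite AE -(aj _ i2) e2 /=.
    have -> : (k.+1 - i.+1).-1 = (k.+1 - i.+2)%N by lia.
    by move=> EQ; have e5 := pair_cancel EQ; rewrite -e5 invgK.
  (* The middle of the palindrome is impossible: for even [k] the two assigned elements of a precell
     would coincide, for odd [k] an assigned element would be the identity. *)
  have [m km] : exists m, k = m.*2 \/ k = m.*2.+1.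
    by exists k./2; have := odd_double_half k; case: (odd k) => /= kE; [right|left]; lia.
  case: km => km.
    have mk : (1 <= m <= k)%N by lia.
    have [_ e2] := P m mk; have m2 : (2 <= m.+1 <= k)%N by lia.
    have e3 : (k.+1 - m)%N = m.+1 by lia.
    rewrite e3 in e2; have m1 : (1 <= m.+1 <= k)%N by lia.
    have [_ v] := st _ m1.
    by case: (vtx_two v (esym (aj _ m2))); rewrite e2.
  have mk : (1 <= m.+1 <= k)%N by lia.
  have [e1 _] := P m.+1 mk; have e3 : (k.+2 - m.+1)%N = m.+2 by lia.
  have [gE _] := st _ mk; rewrite e3 gE in e1.
  have h1 : h m.+1 = 1%g by apply: (mulIg (g m.+1)); rewrite e1 mul1g.
  have [_ h0] := asg_G (ah _ mk).
  by have [s _ [_ _ c1 _]] := psl2_one_entries R; move: h0; rewrite h1 c1 eqxx.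
move=> j h' jk a'.
have [hhE|hhn] := pselect (h' = h j).
  have [gE _] := st j jk; rewrite hhE -gE.
  have [lt|ge] := ltnP j k; first by exists j.+1 => //; lia.
  have -> : j = k by lia.
  by exists 1%N; [lia|rewrite gk g1].
case: j jk a' hhn => [|[|j]] // jk a' hhn; last first.
  have j2 : (2 <= j.+2 <= k)%N by lia.
  move: a'; rewrite -aj //= => -[//|e]; rewrite e.
  have jk' : (1 <= j.+1 <= k)%N by lia.
  have [gE _] := st _ jk'; exists j.+1; first by lia.
  by rewrite gE mulKg.
have [_ v1] := st _ jk; have [h2 hhE] := vtx_other v1 a1.
have kE : h' = (h k)^-1%g.
  have : [set h2; h 1%N] h' by rewrite hhE.
  have : [set h2; h 1%N] (h k)^-1%g by rewrite hhE.
  by case=> [->|//] [].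
exists k; first by lia.
have kk : (1 <= k <= k)%N by lia.
have [gE _] := st _ kk; rewrite gk in gE.
by rewrite kE g1 mulg1 -[LHS](mulKg (h k)) -gE mulg1.
Qed.

(** Away from the vertex a boundary point of a piece is glued to the adjacent piece, which
    [cycle_closed] places in the same cell. Around the vertex itself nothing is said about angles;
    connectedness of a punctured box does the work. *)
Lemma noncusp_cellish A B : AA A -> noncuspidal_cell Gamma AA A B -> cellish B /\ A `<=` B.
Proof.
move=> AAA [z [k [h [g [Aj [ncA [a1 g1] st [k1 gk _] BE]]]]]].
have vA : vtx z A by [].
have [_ [_ [lo0 [hi0 [[gp0 AE0 Hz zr0 bz] _ _ _ _]]]]] := vtxP vA.
have st' j : (1 <= j <= k)%N -> g j.+1 = (h j * g j)%g /\ vtx (mob (g j) z) (Aj j).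
  by move=> jk; have [? ? ? _] := st j jk.
have k11 : (1 <= 1 <= k)%N by rewrite k1.
have A1E : Aj 1%N = A.
  by have [_ v1] := st' _ k11; rewrite g1 mob1 in v1; exact: vtx_uniq v1 vA.
have aj j : (2 <= j <= k)%N -> [set h j; (h j.-1)^-1%g] = assigned Gamma AA (Aj j).
  move=> jk; have jk' : (1 <= j <= k)%N by lia.
  by have [_ _ _ H] := st j jk'; apply: H; lia.
have ah j : (1 <= j <= k)%N -> assigned Gamma AA (Aj j) (h j).
  case: j => [|[|j]] // jk; first by rewrite A1E.
  by rewrite -aj //; left.
have cl := cycle_closed Hz k1 g1 gk st' (ah _ k11) aj.
have Gg j : (1 <= j <= k)%N -> Gamma (g j).
  elim: j => // -[_ _|j IH jk]; first by rewrite g1; exact: Gamma1 hF.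
  have jk' : (1 <= j.+1 <= k)%N by lia.
  have [-> _] := st' _ jk'; have [Gh _] := asg_G (ah _ jk'); apply: GammaM => //; exact: IH.
have AB : A `<=` B.
  by move=> p Ap; rewrite BE; exists 1%N => //; rewrite g1 invg1 A1E mob1_image.
split => //.
have fJ : finite_set [set j | (1 <= j <= k)%N].
  apply: sub_finite_set (finite_II k.+1) => j /=; by lia.
have AH j : (1 <= j <= k)%N -> Aj j `<=` @HH R.
  by move=> jk p; have [_ v] := st' j jk; have [lo [hi [_ ->]]] := AA_col v.1; move=> [[]].
have main p : B p -> ~ onleaf p -> p <> z -> nbhs p B.
  rewrite {1}BE => -[j jk [a Aa <-]] nl nz.
  have [_ v] := st' j jk; have [hL [hR [lo [hi [[gp AE Hgz zr bgz] [HL cL crL] [HR cR crR] aE nb]]]]] := vtxP v.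
  have [lh El Eh G] := gp.
  have Ha := AH j jk _ Aa; have Hp := HH_mob (g j)^-1%g Ha; have Gj := Gg j jk.
  rewrite AE in Aa; have [Ka /andP[r1 r2]] := Aa.
  have nla : ~ onleaf a by move=> ol; apply: nl; apply: (@onleaf_mob (g j)) => //; rewrite mobVK.
  have ar : lo < Re a < hi.
    rewrite !lt_neqAle r1 r2 !andbT; apply/andP; split; apply/eqP => E; apply: nla; apply/(onleaf_KKb Ka); rewrite -?E // E //.
  suff N : \forall w \near a, HH w /\ (col lo hi w \/ exists2 j', (1 <= j' <= k)%N & Aj j' (mob (g j') (mob (g j)^-1%g w))).
    have N' := @mob_near _ (g j) (mob (g j)^-1%g a) _ Hp; rewrite mobVK // in N'.
    have N4 := HH_near Hp.
    near=> w; have Hw : HH w by near: w; exact: N4.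
    have : HH (mob (g j) w) /\ (col lo hi (mob (g j) w) \/ exists2 j', (1 <= j' <= k)%N & Aj j' (mob (g j') (mob (g j)^-1%g (mob (g j) w)))) by near: w; exact: N' N.
    rewrite mobK // BE => -[_ [cw|[j' jk' Aw]]].
      by exists j => //; exists (mob (g j) w); rewrite ?mobK // AE.
    by exists j' => //; exists (mob (g j') w); rewrite ?mobK.
  have [Kk|nK] := pselect (KK Gamma a).
    by apply: filterS (col_near Kk ar) => w Aw; split; [case: Aw => -[]|left].
  have bK : boundaryH (KK Gamma) a by apply/bKP.
  have side_case h' : [set hL; hR] h' -> Half h' (Re (mob (g j) z)) lo hi ->
      Num.min (cen h') (Re (mob (g j) z)) < Re a < Num.max (cen h') (Re (mob (g j) z)) ->
      \forall w \near a, HH w /\ (col lo hi w \/ exists2 j', (1 <= j' <= k)%N & Aj j' (mob (g j') (mob (g j)^-1%g w))).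
    move=> hh H' ra; have [A' [lo' [hi' [v' AE' gp' H2 _]]]] := nb h' hh; have [lh' _ _ _] := gp'.
    have ra' : Num.min (cen h') (Re (mob (g j) z)) <= Re a <= Num.max (cen h') (Re (mob (g j) z)) by case/andP: ra => ? ?; rewrite !ltW.
    have ca := bK_half H' bK ra'.
    have ah' : assigned Gamma AA (Aj j) h' by rewrite aE.
    have [j' jk' gE] := cl j h' jk ah'.
    have [_ v2] := st' j' jk'; rewrite gE mob_mul // in v2.
    have A'E := vtx_uniq v' v2.
    apply: filterS (glue lh lh' H' H2 Ha ca ra) => w [Hw [cw|cw]]; split => //; [by left|right].
    exists j' => //; rewrite gE mob_mul ?mobVK //; last exact: HH_mob.
    by rewrite -A'E AE'.
  have [z1 z2] := andP zr; have [y1 y2] := andP ar.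
  have [lt|gt|e] := ltgtP (Re a) (Re (mob (g j) z)).
  - by apply: (side_case hL) => //; [left|rewrite cL (min_l (ltW z1)) (max_r (ltW z1)) y1].
  - by apply: (side_case hR) => //; [right|rewrite cR (min_r (ltW z2)) (max_l (ltW z2)) gt].
  - by case: nz; rewrite (bK_uniq bK bgz e) mobK.
rewrite BE; apply: patch_cellish => //.
  by move=> j jk; split; [exact: Gg|have [_ [AAj _]] := st' j jk; exact: (hB.1 _ AAj)].
rewrite -BE => p Bp nl; have [pz|] := pselect (p = z); last exact: main.
(* At the vertex: a box around [z] meets no leaf, so inside it, off [z], the cell is both open and
   closed, and [punctured] fills the box. *)
subst p; have /nbhs_box[e e0 He] : \forall w \near z, HH w /\ ~ onleaf w.
  have N1 := HH_near Hz; have N2 := leaf_near Hz; near=> w; split; first by near: w; exact: N1.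
  have Hl : forall l, is_leaf l -> l w -> l z by near: w; exact: N2.
  by move=> [l ll lw]; apply: nl; exists l => //; exact: Hl.
have e2 : 0 < e / 2 by rewrite divr_gt0.
have e2' : e / 2 < e by rewrite ltr_pdivrMr // ltr_pMr // ltr1n.
have Bcl w : HH w -> closure B w -> B w.
  rewrite BE; apply: patch_closed => // j jk.
  by have [_ [AAj _]] := st' j jk; exact: (hB.1 _ AAj).
apply/nbhs_box; exists e => // w w1 w2; have [->//|wz] := pselect (w = z).
apply: (@punctured B z e (Re z +i* (Im z + e / 2))) => //=.
- move=> u u1 u2 uz; have [Hu nlu] := He u u1 u2; split; last exact: Bcl.
  by move=> Bu; exact: main.
- by rewrite subrr normr0.
- by apply/andP; split; [rewrite ltrDl|rewrite ltrD2l].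
- apply: AB; rewrite AE0; split; last by case/andP: zr0 => ? ? /=; rewrite !ltW.
  apply: KK_KKb; apply: (KKb_up ((bKP _).1 bz).1) => //=; by rewrite ltrDl.
Unshelve. all: by end_near. Qed.

Lemma cells_cellish B : cells Gamma AA B -> cellish B.
Proof.
move=> [A AAA [[sA ->]|cB|cB]]; first exact: strip_cellish.
  by have [] := cusp_cellish AAA cB.
by have [] := noncusp_cellish AAA cB.
Qed.

Lemma cells_cover p : HH p -> exists g B, [/\ Gamma g, cells Gamma AA B & B (mob g p)].
Proof.
move=> /AA_cover[g [A [Gg AAA Ap]]]; exists g.
have [[z [b1 [b2 P]]]|[v [b P]]|P] := hB.1 _ AAA.
- have vz : vtx z A by split => //; exists b1, b2.
  have [B cB] := noncusp_exists vz; exists B; split => //; first by exists A => //; exact: Or33.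
  by have [_] := noncusp_cellish AAA cB; apply.
- have [B cB] := cusp_exists AAA P; exists B; split => //; first by exists A => //; exact: Or32.
  by have [_] := cusp_cellish AAA cB; apply.
- by exists A; split => //; exists A => //; exact: Or31.
Qed.

(** * The sides of the cells are leaves *)

Definition polyhedral (B : set C) : Prop :=
  [/\ B `<=` @HH R, (forall p, HH p -> closure B p -> B p),
      (forall p, B p -> ~ onleaf p -> nbhs p B) &
      (forall p V, B p -> nbhs p V -> exists w, [/\ V w, B w & ~ onleaf w])].

Lemma cellish_polyhedral B : cellish B -> polyhedral B.
Proof. by move=> [? ? ? ? _]. Qed.

Lemma near_pull g (V : set C) p : HH p -> (\forall w \near mob g p, V w) -> \forall w \near p, HH w /\ V (mob g w).
Proof.
move=> Hp nV; have N1 := HH_near Hp; have N2 := mob_near Hp nV.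
by near=> w; split; near: w.
Unshelve. all: by end_near. Qed.

Lemma near_push g (V : set C) p : HH p -> (\forall w \near p, V w) -> \forall w \near mob g p, HH w /\ V (mob g^-1%g w).
Proof. by move=> Hp nV; apply: near_pull; [exact: HH_mob|rewrite mobK]. Qed.

Lemma polyhedral_pull B g : Gamma g -> polyhedral B -> polyhedral [set w | HH w /\ B (mob g w)].
Proof.
move=> Gg [BH Bc Bi Bd]; split.
- by move=> w [].
- move=> p Hp cp; split => //; apply: Bc; first exact: HH_mob.
  move=> V nV; have [w [[Hw Bw] [_ Vw]]] := cp _ (near_pull Hp nV).
  by exists (mob g w).
- move=> p [Hp Bp] nl; apply: near_pull => //; apply: Bi => // ol; apply: nl.
  exact: onleaf_mob ol.
- move=> p V [Hp Bp] nV; have [w [[Hw Vw] Bw nl]] := Bd _ _ Bp (near_push g Hp nV).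
  exists (mob g^-1%g w); split => //; first by split; [exact: HH_mob|rewrite mobVK].
  by move=> ol; apply: nl; apply: (onleaf_mob (GammaV hF Gg)).
Qed.

Lemma bdHP B p : polyhedral B -> boundaryH B p <-> B p /\ ~ nbhs p B.
Proof.
move=> [BH Bc _ _]; split.
  by move=> [[cp Hp] ni]; split; [exact: Bc|].
by move=> [Bp ni]; split => //; split; [exact: subset_closure|exact: BH].
Qed.

Lemma bdH_pull B g p : Gamma g -> polyhedral B -> HH p ->
  boundaryH [set w | HH w /\ B (mob g w)] p <-> boundaryH B (mob g p).
Proof.
move=> Gg pB Hp; have pB' := polyhedral_pull Gg pB.
split=> [/(bdHP _ pB')[[_ Bp] nn]|/(bdHP _ pB)[Bp nn]].
  apply: (bdHP _ pB).2; split; [exact: Bp|move=> nB; apply: nn; exact: near_pull].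
apply: (bdHP _ pB').2; split; first by split.
move=> nB; apply: nn; have := near_push g Hp nB; apply: filterS => w [Hw [_]].
by rewrite mobVK.
Qed.

Lemma bdH_onleaf B p : polyhedral B -> boundaryH B p -> onleaf p.
Proof.
move=> pB /(bdHP _ pB)[Bp nn]; apply: contrapT => nl; apply: nn.
by have [_ _ Bi _] := pB; exact: Bi.
Qed.

Lemma is_leaf1 e : EE e -> is_leaf (leaf 1%g e).
Proof. by move=> Ee; exists 1%g, e; split => //; exact: Gamma1 hF. Qed.

Lemma vline_near e p : EE e -> HH p -> Re p = e -> \forall w \near p, HH w /\ (onleaf w -> Re w = e).
Proof.
move=> Ee Hp pe; have lp : leaf 1%g e p by apply/leaf1.
have N1 := HH_near Hp; have N2 := leaf_near Hp.
near=> w; split; first by near: w; exact: N1.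
have H : forall l, is_leaf l -> l w -> l p by near: w; exact: N2.
move=> [l ll lw]; have E := leaf_uniq ll (is_leaf1 Ee) (H l ll lw) lp.
by move: lw; rewrite E => /leaf1[].
Unshelve. all: by end_near. Qed.

(** The sign [s] selects one open half of a box cut by the line over [e]. This half is connected and
    meets no leaf, so it lies in [B] or misses it. *)
Lemma half_box B (s : R) e p d (u v : C) : polyhedral B -> s ^+ 2 = 1 -> 
  (forall w, `|Re w - e| < d -> `|Im w - Im p| < d -> HH w /\ (onleaf w -> Re w = e)) ->
  `|Re u - e| < d -> `|Im u - Im p| < d -> `|Re v - e| < d -> `|Im v - Im p| < d ->
  0 < s * (Re u - e) -> 0 < s * (Re v - e) -> B u -> B v.
Proof.
move=> [BH Bc Bi Bd] s1 Hd u1 u2 v1 v2 u3 v3 Bu.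
pose phi := fun t : R => ((1 - t) * Re u + t * Re v) +i* ((1 - t) * Im u + t * Im v) : C.
have p1 : phi 1 = v by rewrite /phi; apply: complex_ext => /=; ring.
have p0 : phi 0 = u by rewrite /phi; apply: complex_ext => /=; ring.
have ok t : 0 <= t <= 1 -> HH (phi t) /\ ~ onleaf (phi t).
  move=> /andP[t0 t1]; have t1' : 0 <= 1 - t by rewrite subr_ge0.
  have cv (a b c : R) : `|a - c| < d -> `|b - c| < d -> `|(1 - t) * a + t * b - c| < d.
    move=> h1 h2; have -> : (1 - t) * a + t * b - c = (1 - t) * (a - c) + t * (b - c) by ring.
    have [m [m1 m2 m3]] : exists m, [/\ `|a - c| <= m, `|b - c| <= m & m < d].
      by exists (Num.max `|a - c| `|b - c|); rewrite !le_max !lexx orbT gt_max h1.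
    rewrite (le_lt_trans (ler_normD _ _)) // !normrM (ger0_norm t0) (ger0_norm t1').
    have := ler_wpM2l t0 m2; have := ler_wpM2l t1' m1; lra.
  have [||Hp ol] := Hd (phi t); [exact: cv|exact: cv|split => // /ol E].
  have : 0 < s * (Re (phi t) - e).
    have -> : s * (Re (phi t) - e) = (1 - t) * (s * (Re u - e)) + t * (s * (Re v - e)) by rewrite /phi /=; ring.
    have [m [m1 m2 m3]] : exists m, [/\ m <= s * (Re u - e), m <= s * (Re v - e) & 0 < m].
      by exists (Num.min (s * (Re u - e)) (s * (Re v - e))); rewrite !ge_min !lexx orbT lt_min u3.
    have := ler_wpM2l t0 m2; have := ler_wpM2l t1' m1; lra.
  by rewrite E subrr mulr0 ltxx.
rewrite -p1; apply: (@path_stay R phi B 0 1) => //.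
- exact: seg_continuous.
- by move=> t /ok[h1 h2] Bt; exact: Bi.
- by move=> t /ok[h1 h2] Bt; exact: Bc.
- by rewrite p0.
Qed.

(** [B] contains exactly one of the two half-boxes: one by the density of points off the leaves, not
    both because [p] is a boundary point. Hence the dividing segment consists of boundary points. *)
Lemma vline_open B e p : polyhedral B -> EE e -> Re p = e -> boundaryH B p ->
  exists2 d, 0 < d & forall w, Re w = e -> `|Im w - Im p| < d -> boundaryH B w.
Proof.
move=> pB Ee pe bp; have [Bp nn] := (bdHP p pB).1 bp; have [BH Bc Bi Bd] := pB.
have Hp := BH _ Bp.
have /nbhs_box[d d0 Hd0] := vline_near Ee Hp pe.
have Hd w : `|Re w - e| < d -> `|Im w - Im p| < d -> HH w /\ (onleaf w -> Re w = e) by move=> w1 w2; apply: Hd0 => //; rewrite pe.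
have d2 : 0 < d / 2 by rewrite divr_gt0.
have d2' : d / 2 < d by rewrite ltr_pdivrMr // ltr_pMr // ltr1n.
have hb (s : R) (u v : C) (s1 : s ^+ 2 = 1) := @half_box B s e p d u v pB s1 Hd.
have onein : exists2 s : R, s ^+ 2 = 1 & exists u, [/\ `|Re u - e| < d, `|Im u - Im p| < d, 0 < s * (Re u - e) & B u].
  have nb : nbhs p [set w | `|Re w - e| < d /\ `|Im w - Im p| < d] by apply/nbhs_box; exists d => // w; rewrite pe.
  have [w [[w1 w2] Bw nl]] := Bd _ _ Bp nb.
  have [lt|gt|E] := ltgtP (Re w) e.
  - by exists (-1); [ring|exists w; split => //; rewrite mulN1r opprB subr_gt0].
  - by exists 1; [ring|exists w; split => //; rewrite mul1r subr_gt0].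
  - exfalso; apply: nl; exists (leaf 1%g e); [exact: is_leaf1|apply/leaf1; split => //; exact: BH].
have [s s1 [u [u1 u2 u3 Bu]]] := onein.
have inn v : `|Re v - e| < d -> `|Im v - Im p| < d -> 0 < s * (Re v - e) -> B v.
  by move=> v1 v2 v3; exact: (hb s u v s1 u1 u2 v1 v2 u3 v3 Bu).
have close w : Re w = e -> `|Im w - Im p| < d -> B w.
  move=> we wi; have [Hw _] : HH w /\ (onleaf w -> Re w = e) by apply: Hd; rewrite // we subrr normr0.
  apply: Bc => // V /nbhs_box[r r0 Hr].
  pose m := Num.min (r / 2) (d / 2).
  have m0 : 0 < m by rewrite lt_min d2 divr_gt0.
  have sm : `|s * m| = m by rewrite normrM (sqr1_norm s1) mul1r gtr0_norm.
  have mr : m <= r / 2 by rewrite ge_min lexx.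
  have md : m <= d / 2 by rewrite ge_min lexx orbT.
  exists ((e + s * m) +i* Im w); split.
    apply: inn => //=; rewrite addrAC subrr add0r ?sm; first lra.
    by rewrite mulrA -expr2 s1 mul1r.
  by apply: Hr => /=; rewrite ?we ?subrr ?normr0 // addrAC subrr add0r sm; lra.
have out v : `|Re v - e| < d -> `|Im v - Im p| < d -> s * (Re v - e) < 0 -> ~ B v.
  move=> v1 v2 v3 Bv; apply: nn; apply/nbhs_box; exists d => // w; rewrite pe => w1 w2.
  have [lt|gt|E] := ltgtP (s * (Re w - e)) 0.
  - by apply: (hb (- s) v w) => //; rewrite ?sqrrN ?mulNr ?oppr_gt0.
  - exact: inn.
  - apply: close => //; apply/eqP; rewrite -subr_eq0; move/eqP: E.
    by rewrite mulf_eq0 (negbTE (sqr1_neq0 s1)).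
exists d; first exact: d0.
move=> w we wi; apply: (bdHP _ pB).2; split; first exact: close.
move=> /nbhs_box[r r0 Hr].
pose m := Num.min (r / 2) (d / 2).
have m0 : 0 < m by rewrite lt_min d2 divr_gt0.
have sm : `|s * m| = m by rewrite normrM (sqr1_norm s1) mul1r gtr0_norm.
have mr : m <= r / 2 by rewrite ge_min lexx.
have md : m <= d / 2 by rewrite ge_min lexx orbT.
apply: (out ((e - s * m) +i* Im w)) => //=.
- by rewrite addrAC subrr add0r normrN sm; lra.
- by rewrite addrAC subrr add0r mulrN mulrA -expr2 s1 mul1r oppr_lt0.
- by apply: Hr => /=; rewrite ?we ?subrr ?normr0 // addrAC subrr add0r normrN sm; lra.
Qed.

Lemma bdH_closed B p : polyhedral B -> HH p -> ~ boundaryH B p -> \forall w \near p, ~ boundaryH B w.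
Proof.
move=> pB Hp nb; have [BH Bc _ _] := pB.
have [nB|nnB] := pselect (nbhs p B).
  have : nbhs p (interior B) by exact: nbhs_interior.
  by apply: filterS => w iw [_].
have nBp : ~ B p by move=> Bp; apply: nb; apply/bdHP.
have : nbhs p (~` closure B).
  by apply: open_nbhs_nbhs; split; [exact/closed_openC/closed_closure|move=> cp; apply: nBp; exact: Bc].
by apply: filterS => w nc [[]].
Qed.

(** Along the line the boundary of [B] is open by [vline_open] and closed by [bdH_closed]; the line
    is connected. *)
Lemma vline_bd B e p q : polyhedral B -> EE e -> Re p = e -> boundaryH B p -> HH q -> Re q = e -> boundaryH B q.
Proof.
move=> pB Ee pe bp Hq qe; have [Bp _] := (bdHP p pB).1 bp; have [BH _ _ _] := pB; have Hp := BH _ Bp.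
pose P : set R := [set y | boundaryH B (e +i* y)].
have Po t : 0 < t -> P t -> \forall s \near t, P s.
  move=> t0 Pt; have [d d0 Hd] := vline_open pB Ee (erefl : Re (e +i* t) = e) Pt.
  apply/(@nbhs_ballP _ R^o); exists d; [exact: d0|move=> s; rewrite /ball /= distrC => st; exact: (Hd (e +i* s) (erefl _) st)].
have Pc t : 0 < t -> ~ P t -> \forall s \near t, ~ P s.
  move=> t0 nP; have /nbhs_box[d d0 Hd] := bdH_closed pB (t0 : HH (e +i* t)) nP.
  apply/(@nbhs_ballP _ R^o); exists d; [exact: d0|move=> s; rewrite /ball /= distrC => st; apply: (Hd (e +i* s)); rewrite /= ?subrr ?normr0; [exact: d0|exact: st]].
have p0 : 0 < Im p by []. have q0 : 0 < Im q by [].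
have pE : e +i* Im p = p by apply: complex_ext.
have qE : e +i* Im q = q by apply: complex_ext.
have Pp : P (Im p) by rewrite /P /= pE.
suff : P (Im q) by rewrite /P /= qE.
have [le|/ltW le] := leP (Im p) (Im q).
  apply: (clopen_seg le _ _ Pp) => t /andP[t1 t2]; [move=> Pt; apply: filterS (Po _ (lt_le_trans p0 t1) Pt) => s Ps _; exact: Ps|move=> nP; apply: filterS (Pc _ (lt_le_trans p0 t1) nP) => s Ps _; exact: Ps].
apply: contrapT => nq; have H : (~` P) (Im p).
  apply: (clopen_seg le _ _ nq) => t /andP[t1 t2].
    by move=> nP; apply: filterS (Pc _ (lt_le_trans q0 t1) nP) => s Ps _; exact: Ps.
  by move=> /contrapT Pt; apply: filterS (Po _ (lt_le_trans q0 t1) Pt) => s Ps _; exact.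
exact: H Pp.
Qed.

Lemma leaf_bd B l p : polyhedral B -> is_leaf l -> l p -> boundaryH B p -> l `<=` boundaryH B.
Proof.
move=> pB [g [e [Gg Ee ->]]] [Hp pe] bp q [Hq qe].
have Gv := GammaV hF Gg.
have pB' := polyhedral_pull Gg pB.
rewrite -(mobVK g Hq); apply/(bdH_pull Gg pB); first exact: HH_mob.
apply: (vline_bd pB' Ee pe _ _ qe); last exact: HH_mob.
by apply/(bdH_pull Gg pB); [exact: HH_mob|rewrite mobVK].
Qed.

Lemma leafPhi g e : exists q : cform R, leaf g e = [set p | HH p /\ Phi q p = 0].
Proof.
exists (fmob (0, 1, - e) g^-1%g); rewrite eqEsubset; split=> p [Hp h]; split => //.
  by rewrite -Phi_mob // /Phi /= h; ring.
move: h; rewrite -Phi_mob // => /eqP; rewrite mulf_eq0 (gt_eqF (nd_gt0 _ Hp)) orbF /Phi /= => /eqP h; lra.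
Qed.

Lemma hconvex_leaf g e : hconvex (leaf g e).
Proof.
have [q ->] := leafPhi g e.
have -> : [set p | HH p /\ Phi q p = 0] = [set p | HH p /\ 0 <= Phi q p] `&` [set p | HH p /\ 0 <= Phi (- q.1.1, - q.1.2, - q.2) p].
  have E p : Phi (- q.1.1, - q.1.2, - q.2) p = - Phi q p by rewrite /Phi /=; ring.
  rewrite eqEsubset; split=> p /=.
    by move=> [Hp h]; rewrite E h oppr0.
  by move=> [[Hp h1] [_]]; rewrite E oppr_ge0 => h2; split => //; apply/eqP; rewrite eq_le h1 h2.
by apply: hconvexI; exact: hconvex_Phi.
Qed.

(** Along the geodesic path from [p] to [q] the times spent on [l] form an open and closed set, by
    [leaf_near] and [leaf_uniq]. *)
Lemma hconvex_in_leaf (S : set C) l p : hconvex S -> (forall q, S q -> onleaf q) -> is_leaf l -> S p -> l p -> S `<=` l.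
Proof.
move=> cS So ll Sp lp q Sq; have [SH _] := cS; have Hp := SH _ Sp; have Hq := SH _ Sq.
have p0 : 0 < Im p by []. have q0 : 0 < Im q by [].
pose x t : R := (1 - t) * Re p + t * Re q; pose u t : R := (1 - t) * nsq p + t * nsq q.
pose w t : C := x t +i* Num.sqrt (u t - x t ^+ 2).
have ux t : 0 <= t <= 1 -> 0 <= u t - x t ^+ 2.
  move=> /andP[t0 t1]; have -> : u t - x t ^+ 2 = (1 - t) * Im p ^+ 2 + t * Im q ^+ 2 + (1 - t) * t * (Re p - Re q) ^+ 2 by rewrite /u /x /nsq; ring.
  have t1' : 0 <= 1 - t by rewrite subr_ge0.
  by apply: addr_ge0; [apply: addr_ge0|]; apply: mulr_ge0; rewrite ?sqr_ge0 ?mulr_ge0.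
have wkl t : 0 <= t <= 1 -> kl p q t (w t).
  by move=> tr; split; [by []|rewrite {1}/nsq /= sqr_sqrtr; [rewrite /u; ring|exact: ux]].
have wS t : 0 <= t <= 1 -> S (w t).
  move=> tr; apply: (hconvex_kl cS Sp Sq tr _ (wkl t tr)); exact: sqrtr_ge0.
have lin_cont (a b : R) : continuous (fun t : R => (1 - t) * a + t * b).
  move=> t; apply: cvgD; apply: cvgM; try exact: cvg_cst; last exact: cvg_id.
  by apply: cvgB; [exact: cvg_cst|exact: cvg_id].
have cw : continuous w.
  apply: cont_C; first exact: lin_cont.
  move=> t; apply: (@continuous_comp _ _ _ (fun t => u t - x t ^+ 2) Num.sqrt); last exact: sqrt_continuous.
  by apply: cvgB; [exact: lin_cont|rewrite /GRing.exp /=; apply: cvgM; exact: lin_cont].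
have w0 : w 0 = p.
  have r0 : 0 <= (0 : R) <= 1 by rewrite lexx ler01.
  by have [E1 E2] := wkl _ r0; apply: nsq_inj; [exact: sqrtr_ge0|exact: ltW|rewrite E1; ring|rewrite E2; ring].
have w1 : w 1 = q.
  have r0 : 0 <= (1 : R) <= 1 by rewrite lexx ler01.
  by have [E1 E2] := wkl _ r0; apply: nsq_inj; [exact: sqrtr_ge0|exact: ltW|rewrite E1; ring|rewrite E2; ring].
have N (t : R) : 0 <= t <= 1 -> \forall s \near t, forall l', is_leaf l' -> l' (w s) -> l' (w t).
  by move=> tr; have Ht := SH _ (wS t tr); exact: (cw t [set v | forall l', is_leaf l' -> l' v -> l' (w t)] (leaf_near Ht)).
rewrite -w1; apply: (@clopen_seg R [set t | l (w t)] 0 1) => //.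
- move=> t tr /= lt; apply: filterS (N t tr) => s Hs sr.
  have [l' ll' ls] := So _ (wS s sr).
  by rewrite -(leaf_uniq ll' ll (Hs _ ll' ls) lt).
- by move=> t tr /= nl; apply: filterS (N t tr) => s Hs sr ls; apply: nl; exact: Hs.
- by rewrite /= w0.
Qed.

(** A convex subset of the boundary lies in one leaf by [hconvex_in_leaf], and that whole leaf is in
    the boundary by [leaf_bd]; so the maximal convex subsets are leaves. *)
Lemma is_sideE B S : polyhedral B -> is_side B S <-> is_leaf S /\ S `<=` boundaryH B.
Proof.
move=> pB.
have big S' l p : hconvex S' -> S' `<=` boundaryH B -> is_leaf l -> S' p -> l p -> S' `<=` l.
  by move=> cS sb ll Sp lp; apply: (hconvex_in_leaf cS _ ll Sp lp) => q /sb; exact: bdH_onleaf.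
split.
  move=> [[p Sp] cS sb mS]; have [l ll lp] := bdH_onleaf pB (sb _ Sp).
  have Sl := big S l p cS sb ll Sp lp; have lb := leaf_bd pB ll lp (sb _ Sp).
  suff -> : S = l by [].
  apply/esym; apply: mS => //; move: ll => [g [e [_ _ ->]]]; exact: hconvex_leaf.
move=> [ll sb]; have [g [e [Gg Ee E]]] := ll.
have Hi : HH (0 +i* 1 : C) by rewrite /HH /= ltr01.
have He : HH (e +i* 1 : C) by rewrite /HH /= ltr01.
have Sp : S (mob g (e +i* 1)) by rewrite E; split; [exact: HH_mob|rewrite mobK].
split => //; first by exists (mob g (e +i* 1)).
  by rewrite E; exact: hconvex_leaf.
move=> S' cS' sb' SS'; rewrite eqEsubset; split => //.
exact: (big S' S _ cS' sb' ll (SS' _ Sp) Sp).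
Qed.

Lemma BSP p : BS Gamma AA p <-> exists g B, [/\ Gamma g, cells Gamma AA B & exists2 q, boundaryH B q & p = mob g q].
Proof.
split.
  move=> [g Gg [B cB [S /(is_sideE _ (cellish_polyhedral (cells_cellish cB)))[_ sb] [q Sq <-]]]].
  by exists g, B; split => //; exists q => //; exact: sb.
move=> [g [B [Gg cB [q bq ->]]]].
have pB := cellish_polyhedral (cells_cellish cB); have [l ll lq] := bdH_onleaf pB bq.
exists g => //; exists B => //; exists l; last by exists q.
by apply: (is_sideE _ pB).2; split; [exact: ll|exact: leaf_bd pB ll lq bq].
Qed.

Lemma boundaryH_HH (B : set C) p : boundaryH B p -> HH p. Proof. by move=> [[]]. Qed.

Lemma BS_onleaf p : BS Gamma AA p -> HH p /\ onleaf p.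
Proof.
move=> /BSP[g [B [Gg cB [q bq ->]]]]; have Hq := boundaryH_HH bq; split; first exact: HH_mob.
apply: (onleaf_mob (GammaV hF Gg)); first exact: HH_mob.
by rewrite mobK //; exact: bdH_onleaf (cellish_polyhedral (cells_cellish cB)) bq.
Qed.

Lemma BS_leaf l p : is_leaf l -> l p -> BS Gamma AA p -> l `<=` BS Gamma AA.
Proof.
move=> ll lp /BSP[g [B [Gg cB [q bq pE]]]] w lw; have Hq := boundaryH_HH bq; have Hw := leaf_HH ll lw.
apply/BSP; exists g, B; split => //; exists (mob g^-1%g w); last by rewrite mobVK.
have ll' := leaf_lmul ll (GammaV hF Gg); rewrite invgK in ll'.
apply: (leaf_bd (cellish_polyhedral (cells_cellish cB)) ll' _ bq).
  by split => //; rewrite -pE.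
by split; [exact: HH_mob|rewrite mobVK].
Qed.

(** * Geodesics crossing the base set *)

Definition geo (m : PSL2 R) (t : R) : C := mob m (std_geodesic t).

Lemma geo_HH m t : HH (geo m t).
Proof. by apply: HH_mob; exact: HH_std. Qed.

Lemma geo_mul g m t : geo (g * m)%g t = mob g (geo m t).
Proof. by rewrite /geo mob_mul //; exact: HH_std. Qed.

Transparent mob denom.
Lemma denom_mul g h z : HH z -> exists2 s : R, s ^+ 2 = 1 & denom (g * h)%g z = s%:C * (denom g (mob h z) * denom h z).
Proof.
move=> Hz; have [s s1 [_ _ eC eD]] := psl2_mul_entries g h; exists s => //.
have d0 := denom_neq0 h Hz.
rewrite [denom (g * h)%g z]/denom -/(pc (g * h)%g) -/(pd (g * h)%g) eC eD {1}/denom /mob mulrDl -!mulrA mulVf // mulr1.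
rewrite /denom -/(pa h) -/(pb h) -/(pc h) -/(pd h) -/(pc g) -/(pd g).
by rewrite !rmorphM !rmorphD !rmorphM /=; ring.
Qed.
Opaque mob denom.

Definition gvel m t : C := (0 +i* expR t) / denom m (std_geodesic t) ^+ 2.

Lemma gvelE m t : let n := nd m (std_geodesic t) in let E := expR t in
  gvel m t = (2 * pc m * pd m * E ^+ 2 / n ^+ 2) +i* (E * (pd m ^+ 2 - pc m ^+ 2 * E ^+ 2) / n ^+ 2).
Proof.
move=> n E; have n0 : n != 0 by rewrite gt_eqF // nd_gt0 //; exact: HH_std.
have d0 : denom m (std_geodesic t) != 0 by apply: denom_neq0; exact: HH_std.
apply: (mulIf (expf_neq0 2 d0)); rewrite mulfVK ?expf_neq0 //.
have nE : n = pd m ^+ 2 + pc m ^+ 2 * E ^+ 2 by rewrite /n nd_std /= -/E; ring.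
move: n0; rewrite denomE /= mulr0 add0r -/E (expr2 (pd m +i* (pc m * E))) nE => n0.
by apply: complex_ext => /=; field; move: n0; apply: contra_neq => h0; rewrite -[RHS]h0; ring.
Qed.

Lemma geo_derive m t : is_derive (t : R^o) 1 (Re \o geo m : R^o -> R^o) (Re (gvel m t)) /\
  is_derive (t : R^o) 1 (Im \o geo m : R^o -> R^o) (Im (gvel m t)).
Proof.
rewrite gvelE /=; set E := expR t; set n := nd _ _.
pose v : R^o -> R^o := fun s => pc m ^+ 2 * expR s ^+ 2 + pd m ^+ 2.
have vE s : v s = nd m (std_geodesic s) by rewrite nd_std.
have v0 s : v s != 0 by rewrite vE gt_eqF // nd_gt0 //; exact: HH_std.
have e2 : is_derive (t : R^o) 1 (fun s : R^o => expR s ^+ 2 : R^o) (2 * E ^+ 2).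
  apply: (@is_derive_eq _ _ _ _ _ _ _ _ (is_deriveX 1 _)).
  by rewrite /GRing.scale /= -/E; ring.
have lin_ (a b : R) : is_derive (t : R^o) 1 (fun s : R^o => a * expR s ^+ 2 + b : R^o) (a * (2 * E ^+ 2)).
  apply: (@is_derive_eq _ _ _ _ _ _ _ _ (is_deriveD (is_deriveM (is_derive_cst a _ _) e2) (is_derive_cst b _ _))).
  by rewrite /GRing.scale /=; ring.
have dv : is_derive (t : R^o) 1 (fun s => (v s)^-1 : R^o) (- (v t) ^- 2 * (pc m ^+ 2 * (2 * E ^+ 2))).
  by apply: (@is_derive_eq _ _ _ _ _ _ _ _ (is_deriveV (v0 t) (lin_ _ _))).
have nv : n = v t by rewrite vE.
have nE : v t = pc m ^+ 2 * E ^+ 2 + pd m ^+ 2 by [].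
have vt := v0 t; rewrite nE in vt; split.
  have -> : (Re \o geo m : R^o -> R^o) = (fun s => (pa m * pc m * expR s ^+ 2 + pb m * pd m) * (v s)^-1).
    by apply/funext => s; rewrite /= /geo Re_std.
  apply: (@is_derive_eq _ _ _ _ _ _ _ _ (is_deriveM (lin_ _ _) dv)).
  rewrite /GRing.scale /= -/E nv nE.
  have -> : 2 * pc m * pd m = 2 * pc m * pd m * (pa m * pd m - pb m * pc m) by rewrite pdet mulr1.
  by field; move: vt; apply: contra_neq => h0; rewrite -[RHS]h0; ring.
have -> : (Im \o geo m : R^o -> R^o) = (fun s => expR s * (v s)^-1).
  by apply/funext => s; rewrite /= /geo Im_std.
apply: (@is_derive_eq _ _ _ _ _ _ _ _ (is_deriveM (is_derive_expR t) dv)).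
rewrite /GRing.scale /= -/E nv nE.
by field; move: vt; apply: contra_neq => h0; rewrite -[RHS]h0; ring.
Qed.

Lemma velocity_geo m t : velocity (geo m) t = (geo m t, gvel m t).
Proof.
rewrite /velocity /curve_deriv; congr pair; have [d1 d2] := geo_derive m t.
by apply: complex_ext => /=; rewrite derive1E derive_val.
Qed.

Lemma gvel_mul g m t : gvel m t / denom g (geo m t) ^+ 2 = gvel (g * m)%g t.
Proof.
rewrite /gvel; have [s s1 ->] := denom_mul g m (HH_std t).
by rewrite !exprMn -rmorphXn s1 /= mul1r (invfM (denom g _ ^+ 2)) [LHS]mulrAC mulrA.
Qed.

Lemma gvel_norm m t : `|gvel m t| = (Im (geo m t))%:C.
Proof.
rewrite /gvel normrM normfV normrX norm_denom -rmorphXn sqr_sqrtr ?nd_ge0 //.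
rewrite /geo Im_mob; last exact: HH_std.
rewrite rmorphM fmorphV; congr (_ * _).
by rewrite normc_def /= expr0n add0r sqrtr_sqr ger0_norm // expR_ge0.
Qed.

Lemma geo_Phi q m t : Phi q (geo m t) * nd m (std_geodesic t) = (fmob q m).1.1 * expR t ^+ 2 + (fmob q m).2.
Proof. by rewrite /geo Phi_mob; [rewrite /Phi /=; ring|exact: HH_std]. Qed.

(** Up to a positive factor the form is affine in [expR t ^+ 2] along the geodesic. *)
Lemma geo_once q m t : Phi q (geo m t) = 0 -> (forall s, Phi q (geo m s) = 0) \/ (forall s, Phi q (geo m s) = 0 -> s = t).
Proof.
move=> h0; have := geo_Phi q m t; rewrite h0 mul0r; set a := (fmob q m).1.1; set b := (fmob q m).2 => e0.
have [a0|a0] := eqVneq a 0.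
  left=> s; have := geo_Phi q m s; rewrite -/a -/b a0 mul0r add0r.
  have -> : b = 0 by rewrite e0 a0 mul0r add0r.
  by move=> /eqP; rewrite mulf_eq0 => /orP[/eqP //|]; rewrite gt_eqF // nd_gt0 //; exact: HH_std.
right=> s hs; have := geo_Phi q m s; rewrite hs mul0r -/a -/b [LHS]e0 => /addIr /(mulfI a0) /eqP.
by rewrite eqrXn2 ?expR_ge0 // => /eqP /expR_inj.
Qed.

Lemma geo_cont m : continuous (geo m).
Proof.
have -> : geo m = fun t => (Re \o geo m) t +i* (Im \o geo m) t by apply/funext => t; apply: complex_ext.
by apply: cont_C => t; have [d1 d2] := geo_derive m t;
  apply/differentiable_continuous/derivable1_diffP; [exact: (@ex_derive _ _ _ _ _ _ _ d1)|exact: (@ex_derive _ _ _ _ _ _ _ d2)].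
Qed.

Definition in_leaf m : Prop := exists l, is_leaf l /\ forall s, l (geo m s).

(** By [CShatP] this says that the velocity at time [t] projects into the cross section. *)
Definition crosses m t : Prop := BS Gamma AA (geo m t) /\ ~ in_leaf m.

Lemma leaf_formP l : is_leaf l -> exists q : cform R, l = [set p | HH p /\ Phi q p = 0].
Proof. by move=> [g [e [_ _ ->]]]; exact: leafPhi. Qed.

Lemma leaf_once l m t : is_leaf l -> l (geo m t) -> (forall s, l (geo m s)) \/ (forall s, l (geo m s) -> s = t).
Proof.
move=> /leaf_formP[q ->] [Ht h0]; have [h|h] := geo_once h0; [left|right] => s.
  by split; [exact: geo_HH|exact: h].
by move=> [_]; exact: h.
Qed.

Lemma in_leaf_mul g m : Gamma g -> in_leaf (g * m)%g -> in_leaf m.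
Proof.
move=> Gg [l [ll h]]; exists [set w | HH w /\ l (mob g w)]; split.
  by have := leaf_lmul ll (GammaV hF Gg); rewrite invgK.
by move=> s; split; [exact: geo_HH|rewrite -geo_mul].
Qed.

Lemma BS_mob g p : Gamma g -> HH p -> BS Gamma AA (mob g p) -> BS Gamma AA p.
Proof.
move=> Gg Hp /BSP[h [B [Gh cB [q bq E]]]]; apply/BSP; exists (g^-1 * h)%g, B; split => //.
  by apply: GammaM => //; exact: GammaV.
by exists q; [exact: bq|rewrite (mob_mul _ _ (boundaryH_HH bq)) -E mobK].
Qed.

Lemma crosses_mul g m t : Gamma g -> crosses (g * m)%g t <-> crosses m t.
Proof.
have imp h n : Gamma h -> crosses (h * n)%g t -> crosses n t.
  move=> Gh [b nl]; split; first by apply: (BS_mob Gh); [exact: geo_HH|rewrite -geo_mul].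
  move=> il; apply: nl; apply: (@in_leaf_mul h^-1%g); first exact: GammaV.
  by rewrite mulgA mulVg mul1g.
move=> Gg; split; first exact: imp.
by move=> c; apply: (imp g^-1%g); [exact: GammaV|rewrite mulgA mulVg mul1g].
Qed.

(** By local finiteness a curve in [BS] stays, near time 0, on the leaf through its initial point,
    so the derivative of the form of this leaf vanishes in the direction of the geodesic. Along the
    geodesic that form is affine in [expR s ^+ 2] up to a positive factor, so a double zero makes it
    vanish identically. *)
Lemma tangentP m t : BS Gamma AA (geo m t) -> tangent_to (BS Gamma AA) (velocity (geo m) t) <-> in_leaf m.
Proof.
move=> bt; have [Ht [l ll lt]] := BS_onleaf bt.
split; last first.
  move=> [l' [ll' h]]; have lb := BS_leaf ll' (h t) bt.
  exists (fun s => geo m (t + s)).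
  have [d1 d2] := geo_derive m t.
  have sh (f : R^o -> R^o) df : is_derive (t : R^o) 1 f df -> is_derive (0 : R^o) 1 (fun s : R^o => f (t + s)) df.
    move=> d; have d' : is_derive ((t + 0 : R) : R^o) 1 f df by rewrite addr0.
    have := @is_derive1_comp _ f (fun s : R^o => t + s) 0 df 1 d'.
    rewrite mulr1; apply.
    by apply: (@is_derive_eq _ _ _ _ _ _ _ _ (is_deriveD (is_derive_cst t _ _) (is_derive_id _ _))); rewrite add0r.
  have D1 := sh _ _ d1; have D2 := sh _ _ d2.
  split.
  - exact: (@ex_derive _ _ _ _ _ _ _ D1).
  - exact: (@ex_derive _ _ _ _ _ _ _ D2).
  - rewrite velocity_geo /velocity addr0; congr pair; apply: complex_ext => /=.
      by rewrite derive1E; exact: (@derive_val _ _ _ _ _ _ _ D1).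
    by rewrite derive1E; exact: (@derive_val _ _ _ _ _ _ _ D2).
  - by near=> s; apply: lb; exact: h.
move=> [c [c1 c2]]; rewrite velocity_geo /velocity => vE cB.
have c0 : c 0 = geo m t := congr1 fst vE.
have cd : curve_deriv c 0 = gvel m t := congr1 snd vE.
have [q lE] := leaf_formP ll.
have z0 : \forall s \near (0 : R), Phi q (c s) = 0.
  have N : \forall w \near c 0, forall l', is_leaf l' -> l' w -> l' (c 0) by rewrite c0; exact: leaf_near.
  have cc : {for 0, continuous c}.
    have -> : c = fun s => (Re \o c) s +i* (Im \o c) s by apply/funext => s; apply: complex_ext.
    have k1 : {for 0, continuous (Re \o c : R^o -> R^o)}.
      by apply: differentiable_continuous; apply/derivable1_diffP; exact: c1.
    have k2 : {for 0, continuous (Im \o c : R^o -> R^o)}.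
      by apply: differentiable_continuous; apply/derivable1_diffP; exact: c2.
    move=> V /nbhs_box[e e0 He].
    have h1 : \forall s \near (0 : R), `|(Re \o c) 0 - (Re \o c) s| < e by have /cvgrPdist_lt/(_ e e0) := k1.
    have h2 : \forall s \near (0 : R), `|(Im \o c) 0 - (Im \o c) s| < e by have /cvgrPdist_lt/(_ e e0) := k2.
    have : \forall s \near (0 : R), V ((Re \o c) s +i* (Im \o c) s).
      by near=> s; apply: He => /=; rewrite distrC; near: s.
    by [].
  have N' : \forall s \near (0 : R), forall l', is_leaf l' -> l' (c s) -> l' (c 0) by exact: (cc _ N).
  near=> s; have Bs : BS Gamma AA (c s) by near: s.
  have Hs : forall l', is_leaf l' -> l' (c s) -> l' (c 0) by near: s.
  have [_ [l' ll' ls]] := BS_onleaf Bs.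
  have := Hs l' ll' ls; rewrite c0 => lt'.
  by move: ls; rewrite (leaf_uniq ll' ll lt' lt) lE => -[].
have {}c1 : is_derive (0 : R^o) 1 (Re \o c : R^o -> R^o) (Re (gvel m t)).
  by apply: (DeriveDef c1); rewrite -cd /= derive1E.
have {}c2 : is_derive (0 : R^o) 1 (Im \o c : R^o -> R^o) (Im (gvel m t)).
  by apply: (DeriveDef c2); rewrite -cd /= derive1E.
have [d1 d2] := geo_derive m t.
have chain (x y : R^o -> R^o) (s dx dy : R) : is_derive (s : R^o) 1 x dx -> is_derive (s : R^o) 1 y dy ->
    is_derive (s : R^o) 1 (fun s => q.1.1 * (x s * x s + y s * y s) + q.1.2 * x s + q.2 : R^o)
      (q.1.1 * (2 * x s * dx + 2 * y s * dy) + q.1.2 * dx).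
  move=> hx hy.
  apply: (@is_derive_eq _ _ _ _ _ _ _ _ (is_deriveD (is_deriveD (is_deriveM (is_derive_cst q.1.1 _ _) (is_deriveD (is_deriveM hx hx) (is_deriveM hy hy))) (is_deriveM (is_derive_cst q.1.2 _ _) hx)) (is_derive_cst q.2 _ _))).
  by rewrite /GRing.scale /=; ring.
have D0 := chain _ _ _ _ _ c1 c2; have D1 := chain _ _ _ _ _ d1 d2.
have v0 : q.1.1 * (2 * Re (geo m t) * Re (gvel m t) + 2 * Im (geo m t) * Im (gvel m t)) + q.1.2 * Re (gvel m t) = 0.
  have : is_derive (0 : R^o) 1 (cst 0 : R^o -> R^o) (q.1.1 * (2 * Re (geo m t) * Re (gvel m t) + 2 * Im (geo m t) * Im (gvel m t)) + q.1.2 * Re (gvel m t)).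
    rewrite -c0; apply: (near_eq_is_derive _ D0).
    by apply: filterS z0 => s; rewrite /Phi /=.
  by move=> d; have := @derive_val _ _ _ _ _ _ _ d; rewrite derive_cst.
have [_ p0] : HH (geo m t) /\ Phi q (geo m t) = 0 by move: lt; rewrite lE.
exists l; split => //.
have := geo_Phi q m t; rewrite p0 mul0r.
set a := (fmob q m).1.1; set b := (fmob q m).2 => e0.
(* The derivative of [Phi q (geo m s) * nd m (std s)] at [s = t]. *)
have a0 : a = 0.
  have dn : is_derive (t : R^o) 1 (fun s : R^o => (q.1.1 * ((Re \o geo m) s ^+ 2 + (Im \o geo m) s ^+ 2) + q.1.2 * (Re \o geo m) s + q.2) * (pc m ^+ 2 * expR s ^+ 2 + pd m ^+ 2) : R^o) 0.
    have e2 : is_derive (t : R^o) 1 (fun s : R^o => expR s ^+ 2 : R^o) (2 * expR t ^+ 2).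
      apply: (@is_derive_eq _ _ _ _ _ _ _ _ (is_deriveX 1 _)).
      by rewrite /GRing.scale /=; ring.
    apply: (@is_derive_eq _ _ _ _ _ _ _ _ (is_deriveM D1 (is_deriveD (is_deriveM (is_derive_cst (pc m ^+ 2) _ _) e2) (is_derive_cst (pd m ^+ 2) _ _)))).
    rewrite /GRing.scale /= v0 !mulr0 !addr0.
    transitivity (Phi q (geo m t) * (pc m ^+ 2 * (2 * expR t ^+ 2))); first by [].
    by rewrite p0 mul0r.
  have E : (fun s : R^o => (q.1.1 * ((Re \o geo m) s ^+ 2 + (Im \o geo m) s ^+ 2) + q.1.2 * (Re \o geo m) s + q.2) * (pc m ^+ 2 * expR s ^+ 2 + pd m ^+ 2) : R^o) = (fun s : R^o => a * expR s ^+ 2 + b : R^o).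
    by apply/funext => s; rewrite -geo_Phi nd_std.
  rewrite E in dn.
  have dn' : is_derive (t : R^o) 1 (fun s : R^o => a * expR s ^+ 2 + b : R^o) (a * (2 * expR t ^+ 2)).
    have e2 : is_derive (t : R^o) 1 (fun s : R^o => expR s ^+ 2 : R^o) (2 * expR t ^+ 2).
      apply: (@is_derive_eq _ _ _ _ _ _ _ _ (is_deriveX 1 _)).
      by rewrite /GRing.scale /=; ring.
    apply: (@is_derive_eq _ _ _ _ _ _ _ _ (is_deriveD (is_deriveM (is_derive_cst a _ _) e2) (is_derive_cst b _ _))).
    by rewrite /GRing.scale /=; ring.
  have := @derive_val _ _ _ _ _ _ _ dn; rewrite (@derive_val _ _ _ _ _ _ _ dn') => /eqP.
  rewrite mulf_eq0 => /orP[/eqP //|].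
  by rewrite mulf_eq0 pnatr_eq0 /= expf_eq0 /= gt_eqF ?expR_gt0.
have [h|h] := leaf_once ll lt; first exact: h.
move=> s; rewrite lE; split; first exact: geo_HH.
have := geo_Phi q m s; rewrite -/a -/b a0 mul0r add0r.
have -> : b = 0 by rewrite e0 a0 mul0r add0r.
by move=> /eqP; rewrite mulf_eq0 => /orP[/eqP //|]; rewrite gt_eqF // nd_gt0 //; exact: HH_std.
Unshelve. all: by end_near. Qed.

Lemma dmob1 (w : C * C) : dmob 1%g w = w.
Proof.
have [s s1 [_ _ c1 d1]] := psl2_one_entries R.
case: w => z v; rewrite /dmob /= mob1 denomE c1 d1 !mul0r add0r.
have -> : (s +i* 0) ^+ 2 = 1 :> C by rewrite -[s +i* 0]/(s%:C) -rmorphXn s1.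
by rewrite divr1.
Qed.

Lemma dmob_velocity g m t : dmob g (velocity (geo m) t) = velocity (geo (g * m)%g) t.
Proof. by rewrite !velocity_geo /dmob /= geo_mul gvel_mul. Qed.

Lemma CShatP m t : CShat Gamma AA (piS Gamma (velocity (geo m) t)) <-> crosses m t.
Proof.
split.
  move=> [w [SHw Bw nt] E].
  have : piS Gamma w w by exists 1%g; [exact: Gamma1 hF|exact: dmob1].
  rewrite E => -[g Gg wE]; rewrite dmob_velocity in wE; rewrite -wE in Bw nt.
  apply/(crosses_mul m t Gg); split; first by move: Bw; rewrite velocity_geo.
  move=> il; apply: nt; apply/tangentP => //; by move: Bw; rewrite velocity_geo.
move=> [Bt nl]; exists (velocity (geo m) t) => //; split.
- by rewrite velocity_geo; split; [exact: geo_HH|exact: gvel_norm].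
- by rewrite velocity_geo.
- by move/(tangentP Bt).
Qed.

(** Close to [geo m t] only the leaf through that point is met, and a geodesic not contained in it
    meets it once. *)
Lemma crosses_discrete m t : crosses m t -> exists2 e, 0 < e & forall s, t - e < s < t + e -> crosses m s -> s = t.
Proof.
move=> [Bt nl]; have [Ht [l ll lt]] := BS_onleaf Bt.
have N : \forall s \near t, forall l', is_leaf l' -> l' (geo m s) -> l' (geo m t).
  exact: (@geo_cont m t [set v | forall l', is_leaf l' -> l' v -> l' (geo m t)] (leaf_near Ht)).
have /(@nbhs_ballP _ R^o)[e e0 He] := N.
exists e; first exact: e0.
move=> s /andP[s1 s2] [Bs _]; have [_ [l' ll' ls]] := BS_onleaf Bs.
have ts : ball (t : R^o) e s by rewrite /ball /= distrC ltr_norml; apply/andP; split; lra.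
have lt' := He s ts l' ll' ls; rewrite (leaf_uniq ll' ll lt' lt) in ls.
by have [h|h] := leaf_once ll lt; [case: nl; exists l|exact: h].
Qed.

(** * Ends of geodesics and the set [bd] *)

Lemma reaches_geo_p m : reaches (geo m) +oo%E (mobhat m None).
Proof. by apply: reaches_mob; [exact: HH_std|by []|exact: reaches_std_p]. Qed.

Lemma reach_near m (V : set (one_point_compactification R[i])) : nbhs (mobhat m None) V ->
  exists T, forall t, T <= t -> V (Some (geo m t)).
Proof.
move=> nV; have [M [_ HM]] := @reaches_geo_p m V nV.
by exists (M + 1) => t Mt; apply: HM; rewrite (lt_le_trans _ Mt) // ltrDl.
Qed.

Lemma end_bdg m : bdgH (mobhat m None : one_point_compactification R[i]).
Proof. exact: mobhat_bdg. Qed.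

Lemma end_closure m : closure (Some @` @HH R : set (one_point_compactification R[i])) (mobhat m None).
Proof.
move=> V /reach_near[T HT]; exists (Some (geo m T)); split; last exact: HT.
by exists (geo m T) => //; exact: geo_HH.
Qed.

Lemma bdgH_closure (x : one_point_compactification R[i]) : bdgH x -> closure (Some @` @HH R : set (one_point_compactification R[i])) x.
Proof.
case: x => [z|] bx.
  move=> V nV; have /nbhs_box[e e0 He] : nbhs z [set w | V (Some w)] by exact: nV.
  have e2 : 0 < e / 2 by rewrite divr_gt0.
  have z0 : Im z = 0 by [].
  exists (Some (Re z +i* (e / 2))); split; first by exists (Re z +i* (e / 2)).
  apply: He => /=; first by rewrite subrr normr0.
  by rewrite z0 subr0 gtr0_norm // ltr_pdivrMr // ltr_pMr // ltr1n.
have [s s1 [_ _ c1 _]] := psl2_one_entries R.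
have := @end_closure 1%g; by rewrite /= -/(pc 1%g) c1 eqxx.
Qed.

Lemma mobhat1 (x : one_point_compactification R[i]) : mobhat 1%g x = x.
Proof.
have [s s1 [a1 b1 c1 d1]] := psl2_one_entries R; have s0 := sqr1_neq0 s1.
case: x => [z|] /=.
  rewrite denom_eq0 nd1 oner_eq0 mob1 //.
by rewrite -/(pc 1%g) c1 eqxx.
Qed.

Lemma mobhatM g h (x : one_point_compactification R[i]) : bdgH x -> closure (Some @` @HH R : set (one_point_compactification R[i])) x ->
  mobhat (g * h)%g x = mobhat g (mobhat h x).
Proof.
move=> bx cx; apply: contrapT => /nbhs_opc_sep[U [V [nU nV UV]]].
have N1 := mobhat_nbhs (clH_bdg bx) nU.
have N2 := mobhat_nbhs (clH_bdg bx) (mobhat_nbhs (clH_bdg (mobhat_bdg h bx)) nV).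
have [_ [[w Hw <-] [/= h1 h2]]] := cx _ (filterI N1 N2).
have Hhw := HH_mob h Hw.
by apply: (UV (Some (mob g (mob h w)))); [rewrite -mob_mul //; exact: h1|exact: h2].
Qed.

Definition bd_point (x : one_point_compactification R[i]) : Prop :=
  exists g B y, [/\ Gamma g, cells Gamma AA B, bdg B y & x = mobhat g y].

Lemma bdg_closure B y : cells Gamma AA B -> bdg B y ->
  bdgH y /\ closure (Some @` @HH R : set (one_point_compactification R[i])) y.
Proof.
move=> cB [cy by_]; split => //; have [BH _ _ _ _] := cells_cellish cB.
by move=> V nV; have [_ [[w Bw <-] Vw]] := cy _ nV; exists (Some w); split => //; exists w => //; exact: BH.
Qed.

Lemma bd_pointP x : (pihat Gamma @` bd Gamma AA) (pihat Gamma x) <-> bd_point x.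
Proof.
split.
  move=> [y [g Gg [B cB [y' by' yE]]] E].
  have : pihat Gamma x x by exists 1%g; [exact: Gamma1 hF|exact: mobhat1].
  rewrite -E => -[h Gh hx]; have [b' c'] := bdg_closure cB by'.
  exists (h * g)%g, B, y'; split => //; first exact: GammaM.
  by rewrite mobhatM // yE.
move=> [g [B [y [Gg cB by_ ->]]]]; exists (mobhat g y) => //.
by exists g => //; exists B => //; exists y.
Qed.

Lemma tail_bd m T g B : Gamma g -> cells Gamma AA B -> (forall t, T <= t -> B (mob g (geo m t))) ->
  bd_point (mobhat m None).
Proof.
move=> Gg cB HB; exists g^-1%g, B, (mobhat g (mobhat m None)); split => //.
- exact: GammaV.
- split; last by apply: mobhat_bdg; exact: end_bdg.
  move=> V nV; have [T' HT'] := reach_near (mobhat_nbhs (clH_bdg (end_bdg m)) nV).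
  pose t := Num.max T T'; exists (Some (mob g (geo m t))); split.
    by exists (mob g (geo m t)) => //; apply: HB; rewrite le_max lexx.
  have /= := HT' t; rewrite le_max lexx orbT => /(_ isT); apply; exact: geo_HH.
- by rewrite mobhatK //; [exact: end_bdg|exact: end_closure].
Qed.

(** Either the geodesic runs along a side, hence in a closed cell, or it misses [BS] from time [T]
    on and cannot leave the translated cell it is then in. In both cases its end is adherent to a
    translate of a cell. *)
Lemma noncrossing_tail m T : (forall t, T <= t -> ~ crosses m t) -> bd_point (mobhat m None).
Proof.
move=> nc; have [il|nil] := pselect (in_leaf m /\ exists t, BS Gamma AA (geo m t)).
  move: il => [[l [ll h]] [t0 Bt0]].
  move/BSP: Bt0 => [g [B [Gg cB [q bq E]]]].
  have ll' := leaf_lmul ll (GammaV hF Gg); rewrite invgK in ll'.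
  have Hq := boundaryH_HH bq; have pB := cellish_polyhedral (cells_cellish cB).
  have lb : [set p | HH p /\ l (mob g p)] `<=` boundaryH B.
    by apply: (leaf_bd pB ll' _ bq); split => //; rewrite -E.
  apply: (@tail_bd m 0 g^-1%g B) => //; first exact: GammaV.
  move=> t _; have : boundaryH B (mob g^-1%g (geo m t)).
    by apply: lb; split; [apply: HH_mob; exact: geo_HH|rewrite mobVK //; exact: geo_HH].
  by move/(bdHP _ pB) => [].
have nB t : T <= t -> ~ BS Gamma AA (geo m t).
  move=> Tt Bt; apply: (nc t Tt); split => // il; apply: nil; split => //; by exists t.
have [g [B [Gg cB BT]]] := cells_cover (geo_HH m T).
have pB := cellish_polyhedral (cells_cellish cB).
apply: (tail_bd Gg cB (T := T)) => t Tt.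
rewrite -geo_mul in BT *.
rewrite -geo_mul; apply: (@path_stay R (geo (g * m)%g) B T t Tt _ _ _ BT); first exact: geo_cont.
  move=> s /andP[Ts _] Bs; apply: contrapT => nn; apply: (nB s Ts).
  apply/BSP; exists g^-1%g, B; split => //; first exact: GammaV.
  exists (geo (g * m)%g s); last by rewrite geo_mul mobK //; exact: geo_HH.
  exact: (bdHP _ pB).2.
by move=> s _; have [_ Bc _ _] := pB; apply: Bc; exact: geo_HH.
Qed.

Lemma KK_high : exists M : R, forall p, HH p -> M < Im p -> KK Gamma p.
Proof.
have [M M0 HM] := rad_bound; exists M => p Hp Mp; apply/KKP; split => // g Gg g0; rewrite nd_gt1 //.
have := HM _ Gg g0; have r0 := rad_gt0 g0 => h; have := sqr_ge0 (Re p - cen g) => h2.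
have : rad g ^+ 2 < Im p ^+ 2 by rewrite ltrXn2r ?nnegrE //; lra.
lra.
Qed.

Lemma vline_in_leaf m e : EE e -> (forall s, Re (geo m s) = e) -> in_leaf m.
Proof.
move=> Ee h; exists (leaf 1%g e); split; first exact: is_leaf1.
by move=> s; apply/leaf1; split; [exact: geo_HH|exact: h].
Qed.

(** The geodesic is vertical and eventually in [KK], where all leaves are vertical; meeting one
    means running inside it. *)
Lemma escape_None m : mobhat m None = None -> exists T, forall t, T <= t -> ~ crosses m t.
Proof.
move=> /=; rewrite -/(pc m); case: eqVneq => // c0 _.
have d0 : pd m != 0.
  by have := pdet m; rewrite c0 mulr0 subr0; apply: contra_eq_neq => ->; rewrite mulr0 eq_sym oner_eq0.
have d2 : 0 < pd m ^+ 2 by rewrite lt_def sqr_ge0 sqrf_eq0 d0.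
have [M HM] := KK_high; exists (M * pd m ^+ 2) => t Tt [Bt nl]; apply: nl.
have Re_ s : Re (geo m s) = pb m * pd m / pd m ^+ 2 by rewrite /geo Re_std /= c0; congr (_ / _); ring.
have Kt : KK Gamma (geo m t).
  apply: HM; first exact: geo_HH.
  rewrite /geo Im_std /= c0 expr0n /= mul0r add0r ltr_pdivlMr //.
  by apply: le_lt_trans Tt _; apply: lt_le_trans (expR_ge1Dx t); rewrite ltrDr.
have [_ ol] := BS_onleaf Bt.
have Et := (onleaf_KKb (KK_KKb Kt)).1 ol.
by apply: (vline_in_leaf Et) => s; rewrite !Re_.
Qed.

(** Each point of the compact horizontal segment has a neighbourhood met by at most one leaf, and a
    leaf not containing the geodesic is met at only one time; so the leaves through the segment are
    all behind after some time. *)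
Lemma sweep m (y0 x0 x1 : R) : 0 < y0 -> x0 <= x1 -> exists T, forall t, T <= t -> forall l p, is_leaf l -> l p -> Im p = y0 ->
  x0 <= Re p <= x1 -> l (geo m t) -> in_leaf m.
Proof.
move=> h0 x01.
pose P : set R := [set x | exists T, forall t, T <= t -> forall l p, is_leaf l -> l p -> Im p = y0 -> x0 <= Re p <= x -> l (geo m t) -> in_leaf m].
have loc x : exists d T, 0 < d /\ forall t, T <= t -> forall l p, is_leaf l -> l p -> Im p = y0 -> `|Re p - x| < d -> l (geo m t) -> in_leaf m.
  have Hx : HH (x +i* y0) by [].
  have /nbhs_box[d d0 Hd] := leaf_near Hx.
  have [[l [ll lx]]|none] := pselect (exists l, is_leaf l /\ l (x +i* y0)); last first.
    exists d, 0; split => // t _ l p ll lp pi pr _; exfalso; apply: none; exists l; split => //.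
    by apply: (Hd p) => //=; rewrite ?pi ?subrr ?normr0.
  have same l' p : is_leaf l' -> l' p -> Im p = y0 -> `|Re p - x| < d -> l' = l.
    move=> ll' lp pi pr; apply: (leaf_uniq ll' ll _ lx).
    by apply: (Hd p) => //=; rewrite ?pi ?subrr ?normr0.
  have [[t0 lt0]|none] := pselect (exists t, l (geo m t)); last first.
    exists d, 0; split => // t _ l' p ll' lp pi pr lt; exfalso; apply: none; exists t.
    by rewrite -(same l' p).
  have [al|once] := leaf_once ll lt0.
    by exists d, 0; split => // *; exists l.
  exists d, (t0 + 1); split => // t Tt l' p ll' lp pi pr lt.
  have : t = t0 by apply: once; rewrite -(same l' p).
  by move=> E; move: Tt; rewrite E gerDl leNgt ltr01.
have key x y d T : P x -> 0 < d -> (forall t, T <= t -> forall l p, is_leaf l -> l p -> Im p = y0 -> `|Re p - x| < d \/ `|Re p - y| < d -> l (geo m t) -> in_leaf m) -> `|x - y| < d -> P y.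
  move=> [T' HT'] d0 HT xy; exists (Num.max T T') => t; rewrite ge_max => /andP[t1 t2] l p ll lp pi /andP[p1 p2] lt.
  have [le|gt] := leP (Re p) x; first by apply: (HT' t t2 l p) => //; rewrite p1.
  apply: (HT t t1 l p) => //; left; move: xy; rewrite !ltr_norml => /andP[? ?]; apply/andP; split; lra.
have P0 : P x0.
  have [d [T [d0 HT]]] := loc x0; exists T => t Tt l p ll lp pi /andP[p1 p2].
  by apply: (HT t Tt l p) => //; rewrite (_ : Re p - x0 = 0) ?normr0 //; apply/eqP; rewrite subr_eq0 eq_le p1 p2.
suff : P x1 by [].
apply: (clopen_seg x01 _ _ P0) => x xr.
  move=> [T HT]; have [d [T' [d0 HT']]] := loc x.
  apply/(@nbhs_ballP _ R^o); exists d; first exact: d0.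
  move=> y; rewrite /ball /= => xy yr; exists (Num.max T T') => t; rewrite ge_max => /andP[t1 t2] l p ll lp pi /andP[p1 p2] lt.
  have [le|gt] := leP (Re p) x; first by apply: (HT t t1 l p) => //; rewrite p1.
  apply: (HT' t t2 l p) => //; move: xy; rewrite !ltr_norml => /andP[? ?]; apply/andP; split; lra.
move=> nP; have [d [T' [d0 HT']]] := loc x.
apply/(@nbhs_ballP _ R^o); exists d; first exact: d0.
move=> y; rewrite /ball /= => xy yr [T HT]; apply: nP; exists (Num.max T T') => t; rewrite ge_max => /andP[t1 t2] l p ll lp pi /andP[p1 p2] lt.
have [le|gt] := leP (Re p) y; first by apply: (HT t t1 l p) => //; rewrite p1.
apply: (HT' t t2 l p) => //; move: xy; rewrite !ltr_norml => /andP[? ?]; apply/andP; split; lra.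
Qed.

Lemma root_between (A B D h : R) : 0 < h -> 0 < A * h ^+ 2 + D -> A * (h ^+ 2 + h ^+ 2) + B * h + D < 0 ->
  exists2 U, 0 <= U <= h & A * (U ^+ 2 + h ^+ 2) + B * U + D = 0.
Proof.
move=> h0 f0 fh; pose p : {poly R} := - (A *: 'X^2 + B *: 'X + (A * h ^+ 2 + D)%:P).
have pE x : p.[x] = - (A * (x ^+ 2 + h ^+ 2) + B * x + D) by rewrite /p !(hornerN, hornerD, hornerZ, hornerXn, hornerX, hornerC); ring.
have [||x xr] := @poly_ivt R p 0 h; first exact: ltW.
  rewrite !pE expr0n /= add0r mulr0 addr0 oppr_le0 oppr_ge0; apply/andP; split; exact: ltW.
by rewrite /root pE oppr_eq0 => /eqP ?; exists x.
Qed.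

(** Unless vertical, the geodesic runs down a half circle of radius [h] to [e]. A leaf met close to
    [e] cannot cross the leaf over [e]; it therefore separates that line from the top of the half
    circle and has to cross the horizontal segment between them at height [h]. After the time given
    by [sweep] no such leaf is met. *)
Lemma escape_EE m e : EE e -> mobhat m None = Some e%:C -> exists T, forall t, T <= t -> ~ crosses m t.
Proof.
move=> Ee /=; rewrite -/(pc m) -/(pa m); case: eqVneq => // c0 [eE].
have [d0|d0] := eqVneq (pd m) 0.
  exists 0 => t _ [_]; apply; apply: (vline_in_leaf Ee) => s.
  rewrite /geo Re_std /= d0 -eE; have E0 := expR_gt0 s; field.
  by rewrite c0 gt_eqF.
(* The other end of the geodesic is [e + 2 * k]; thus [k] is the signed radius of the half circle,
   [s] its side and [U] the horizontal distance from [e]. *)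
pose k : R := - (pc m * pd m)^-1 / 2.
have k0 : k != 0 by rewrite /k mulf_neq0 ?oppr_eq0 ?invr_eq0 ?mulf_neq0 ?pnatr_eq0.
pose s : R := if 0 < k then 1 else -1.
have s1 : s ^+ 2 = 1 by rewrite /s; case: ifP => _; ring.
pose h : R := s * k.
have h0 : 0 < h by rewrite /h /s; case: (ltgtP 0 k) k0 => [lt _|gt _|->]; rewrite ?eqxx // ?mul1r // mulN1r oppr_gt0.
pose U t : R := s * (Re (geo m t) - e).
have n0 t : 0 < pc m ^+ 2 * expR t ^+ 2 + pd m ^+ 2 by have := vw_gt0 m t.
have XE t : Re (geo m t) - e = 2 * k * pd m ^+ 2 / (pc m ^+ 2 * expR t ^+ 2 + pd m ^+ 2).
  rewrite /geo Re_std /= -eE /k; have := pdet m; have nt := n0 t; move: nt.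
  set n := _ + _ => nt dt.
  have -> : pa m * pc m * expR t ^+ 2 + pb m * pd m = pa m / pc m * n - pd m / pc m.
    rewrite /n -[in X in _ - X](mulr1 (pd m)) -dt; field; exact: c0.
  field; by rewrite c0 d0 gt_eqF.
have UE t : U t = 2 * h * pd m ^+ 2 / (pc m ^+ 2 * expR t ^+ 2 + pd m ^+ 2) by rewrite /U XE /h; ring.
have pd2 : 0 < pd m ^+ 2 by rewrite lt_def sqr_ge0 sqrf_eq0 d0.
have U0 t : 0 < U t.
  by rewrite UE; apply: divr_gt0 => //; apply: mulr_gt0 => //; apply: mulr_gt0.
have circE t : U t ^+ 2 + Im (geo m t) ^+ 2 = 2 * h * U t.
  have -> : U t ^+ 2 = (Re (geo m t) - e) ^+ 2 by rewrite /U exprMn s1 mul1r.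
  have -> : 2 * h * U t = 2 * k * (Re (geo m t) - e) by rewrite /h /U -[in RHS](mul1r k) -s1; ring.
  rewrite XE /geo Im_std /= /k; field.
  by rewrite exprMn c0 d0 gt_eqF ?n0.
have hh : e - h <= e + h by lra.
have [T1 HT1] := @sweep m h (e - h) (e + h) h0 hh.
have T0 : exists T, forall t, T <= t -> U t < h.
  exists (pd m ^+ 2 / pc m ^+ 2) => t Tt.
  have c2 : 0 < pc m ^+ 2 by rewrite lt_def sqr_ge0 sqrf_eq0 c0.
  rewrite UE ltr_pdivrMr ?n0 // -mulrA [ltLHS]mulrCA ltr_pM2l // mulr_natl mulr2n ltrD2r mulrC -ltr_pdivrMr //.
  have E1 := expR_ge1Dx t; have T00 : 0 <= pd m ^+ 2 / pc m ^+ 2 by rewrite divr_ge0 ?sqr_ge0.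
  nra.
have [T2 HT2] := T0.
exists (Num.max T1 T2) => t; rewrite ge_max => /andP[t1 t2] [Bt nl].
have [_ [l ll lt]] := BS_onleaf Bt.
have [[q lE] Ult] := (leaf_formP ll, HT2 t t2).
have nall : ~ forall s, l (geo m s) by move=> al; apply: nl; exists l.
have nLe p : l p -> Re p <> e.
  move=> lp pe; have Hp := leaf_HH ll lp.
  have E : l = leaf 1%g e by apply: (leaf_uniq ll (is_leaf1 Ee) lp); apply/leaf1.
  move: lt; rewrite E => /leaf1[_ re]; have := U0 t; rewrite /U re subrr mulr0 ltxx //.
pose A := q.1.1; pose B : R := s * (2 * A * e + q.1.2); pose D : R := A * e ^+ 2 + q.1.2 * e + q.2.
have PhiE (u y : R) : Phi q ((e + s * u) +i* y) = A * (u ^+ 2 + y ^+ 2) + B * u + D.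
  rewrite /Phi /= /B /D -/A.
  have -> : (e + s * u) ^+ 2 = e ^+ 2 + 2 * e * s * u + s ^+ 2 * u ^+ 2 by ring.
  by rewrite s1; ring.
have geoU t' : geo m t' = (e + s * U t') +i* Im (geo m t').
  by apply: complex_ext => //=; rewrite /U mulrA -expr2 s1 mul1r; ring.
have PhiG t' : Phi q (geo m t') = U t' * (2 * h * A + B) + D.
  by rewrite {1}geoU PhiE circE; ring.
have e0 : U t * (2 * h * A + B) + D = 0 by rewrite -PhiG; move: lt; rewrite lE => -[].
(* The leaf does not meet the vertical line over [e]; this fixes the relative signs of [A] and
   [D]. *)
have AD y : 0 < y -> A * y ^+ 2 + D != 0.
  move=> y0; apply/eqP => E; apply: (nLe (e +i* y)) => //; rewrite lE; split => //.
  have := PhiE 0 y; rewrite mulr0 addr0 expr0n /= add0r mulr0 addr0 => ->; exact: E.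
have AD0 : 0 <= A * D.
  rewrite leNgt; apply/negP => lt0.
  have A0 : A != 0 by apply/eqP => E; move: lt0; rewrite E mul0r ltxx.
  have r0 : 0 < - D / A.
    have -> : - D / A = - (A * D) / A ^+ 2 by field.
    by rewrite divr_gt0 ?oppr_gt0 // lt_def sqr_ge0 sqrf_eq0 A0.
  have := AD (Num.sqrt (- D / A)); rewrite sqrtr_gt0 => /(_ r0) /eqP; apply.
  by rewrite sqr_sqrtr ?(ltW r0) //; field.
have D0 : D != 0.
  apply/eqP => D0; move: e0; rewrite D0 addr0 => /eqP; rewrite mulf_eq0 gt_eqF ?U0 //= => /eqP e0.
  by apply: nall => t'; rewrite lE; split; [exact: geo_HH|rewrite PhiG D0 e0 mulr0 addr0].
have found (a b d : R) : (forall u y, Phi q ((e + s * u) +i* y) = 0 <-> a * (u ^+ 2 + y ^+ 2) + b * u + d = 0) ->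
    0 <= a -> 0 < d -> U t * (2 * h * a + b) + d = 0 -> False.
  move=> iffP a0 d00 e1.
  have [||u ur ue] := @root_between a b d h h0.
  - by rewrite ltr_wpDl // mulr_ge0 // sqr_ge0.
  - have Ut := U0 t; have G0 : 2 * h * a + b < 0 by rewrite -(pmulr_rlt0 _ Ut); lra.
    have -> : a * (h ^+ 2 + h ^+ 2) + b * h + d = (2 * h * a + b) * (h - U t) + (U t * (2 * h * a + b) + d) by ring.
    by rewrite e1 addr0 pmulr_llt0 // subr_gt0.
  apply: nl; apply: (HT1 t t1 l ((e + s * u) +i* h) ll) => //=.
    by rewrite lE; split => //; apply/iffP.
  by rewrite /s; case: ifP => _; case/andP: ur => ? ?; apply/andP; split; lra.
have [D1|D1|] := ltgtP D 0; last by move/eqP; rewrite (negbTE D0).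
  apply: (found (- A) (- B) (- D)).
  - move=> u y; rewrite PhiE; split=> E; first by rewrite -[RHS]oppr0 -E; ring.
    by rewrite -[RHS]oppr0 -E; ring.
  - by rewrite oppr_ge0 -(nmulr_lge0 _ D1).
  - by rewrite oppr_gt0.
  - by rewrite -[RHS]oppr0 -e0; ring.
apply: (found A B D) => //; first by move=> u y; rewrite PhiE.
by rewrite -(pmulr_lge0 _ D1).
Qed.

Lemma escape_strip m e lo hi : lo < e < hi -> (forall p, HH p -> lo <= Re p <= hi -> KK Gamma p) -> (forall x, lo < x < hi -> ~ EE x) ->
  mobhat m None = Some e%:C -> exists T, forall t, T <= t -> ~ crosses m t.
Proof.
move=> /andP[l1 l2] K G mE.
have nV : nbhs (mobhat m None) (Some @` [set w : C | lo < Re w < hi] : set (one_point_compactification R[i])).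
  rewrite mE; apply: one_point_compactification_some_nbhs; apply/nbhs_box.
  exists (Num.min (e - lo) (hi - e)); first by rewrite lt_min !subr_gt0 l1.
  move=> w /=; rewrite lt_min !ltr_norml => /andP[/andP[? ?] /andP[? ?]] _; apply/andP; split; lra.
have [T HT] := reach_near nV; exists T => t Tt [Bt _].
have [w wr [E]] := HT t Tt; rewrite E in wr; have Hg := geo_HH m t.
have Kt : KK Gamma (geo m t) by apply: K => //; case/andP: wr => ? ?; rewrite !ltW.
have [_ ol] := BS_onleaf Bt; exact: (G _ wr ((onleaf_KKb (KK_KKb Kt)).1 ol)).
Qed.

(** An element of [Gamma] moves the end to one of the [good] points, and crossings are invariant. *)
Lemma escape m : bd_point (mobhat m None) -> exists T, forall t, T <= t -> ~ crosses m t.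
Proof.
move=> [g [B [y [Gg cB by_ xE]]]].
have [_ _ _ _ /(_ y by_)[g' [y' [Gg' yE gy]]]] := cells_cellish cB.
have [b_ c_] := bdg_closure cB by_.
pose k := (g'^-1 * g^-1)%g; have Gk : Gamma k by apply: GammaM => //; exact: GammaV.
have by' : bdgH y' by case: gy => [->//|[e -> _]].
have kE : mobhat (k * m)%g None = y'.
  rewrite mobhatM //; last exact: bdgH_closure.
  rewrite /k mobhatM; [|exact: end_bdg|exact: end_closure].
  rewrite xE mobhatK // yE mobhatK //; exact: bdgH_closure.
suff [T HT] : exists T, forall t, T <= t -> ~ crosses (k * m)%g t.
  by exists T => t Tt cr; apply: (HT t Tt); exact/crosses_mul.
case: gy => [y0|[e y0 [Ee|[lo [hi [er K G]]]]]]; rewrite y0 in kE.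
- exact: escape_None.
- exact: escape_EE Ee kE.
- exact: escape_strip er K G kE.
Qed.

(** The map [w], which is [z -> -1 / z], reverses [std_geodesic]; past behaviour is thereby reduced
    to future behaviour. *)
Lemma reverse_geo m : exists m', (forall t, geo m' t = geo m (- t)) /\ mobhat m' None = mobhat m (Some 0).
Proof.
have d1 : 0 * 0 - (-1) * 1 = 1 :> R by ring.
have [w [s s1 [aw bw cw dw]]] := psl2_mk d1.
rewrite !mulr0 in aw dw; rewrite mulr1 in cw; rewrite mulrN1 in bw.
have s0 := sqr1_neq0 s1.
exists (m * w)%g; split.
  move=> t; rewrite geo_mul /geo; congr (mob m _).
  have n : nd w (std_geodesic t) = expR t ^+ 2 by rewrite nd_std /= cw dw s1 expr0n /= addr0 mul1r.
  have E0 : expR t != 0 by rewrite gt_eqF ?expR_gt0.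
  apply: complex_ext; first by rewrite Re_mob ?n; [rewrite /= aw dw bw cw; field|exact: HH_std].
  by rewrite Im_mob ?n; [rewrite /= expRN; field|exact: HH_std].
rewrite mobhatM //; last exact: bdgH_closure.
congr (mobhat m _); rewrite /= -/(pc w) -/(pa w) cw aw (negbTE s0) mul0r.
by congr Some; apply: complex_ext.
Qed.

Lemma crosses_reverse m m' t : (forall t, geo m' t = geo m (- t)) -> crosses m' t <-> crosses m (- t).
Proof.
move=> E; rewrite /crosses E; split=> -[b nl]; split => // -[l [ll h]]; apply: nl; exists l; split => // s.
  by rewrite E.
by rewrite -[s]opprK -E.
Qed.

Lemma forward_io m : (exists2 u : R^nat, u n @[n --> \oo] --> +oo & forall n, crosses m (u n)) <-> ~ bd_point (mobhat m None).
Proof.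
split.
  move=> [u /cvgryPge cu hu] /escape[T HT].
  have [n Tn] := filter_ex (cu T); exact: HT Tn (hu n).
move=> nbd.
have [u Hu] : {u : nat -> R & forall n, n%:R <= u n /\ crosses m (u n)}.
  apply: (@choice _ _ (fun n t => n%:R <= t /\ crosses m t)) => n; apply: contrapT => nn; apply: nbd.
  by apply: (@noncrossing_tail m n%:R) => t nt cr; apply: nn; exists t.
exists u; last by move=> n; have [] := Hu n.
apply/cvgryPge => A; have N := nbhs_infty_ger A.
by apply: filterS N => n An; apply: le_trans An _; have [] := Hu n.
Qed.

Lemma backward_io m : (exists2 u : R^nat, u n @[n --> \oo] --> -oo & forall n, crosses m (u n)) <-> ~ bd_point (mobhat m (Some 0)).
Proof.
have [m' [E <-]] := reverse_geo m.
rewrite -forward_io; split=> -[u cu hu]; exists (fun n => - u n).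
- by apply/cvgryPge => A; move/cvgrNyPle/(_ (- A)) : cu; apply: filterS => n; rewrite lerNr.
- by move=> n; apply/(crosses_reverse _ E); rewrite opprK.
- by apply/cvgrNyPle => A; move/cvgryPge/(_ (- A)) : cu; apply: filterS => n; rewrite lerNl.
- by move=> n; apply/(crosses_reverse _ E).
Qed.

Lemma lift_geo (c : geodesicY Gamma) : exists m, liftY c = geo m.
Proof.
have gc : is_geodesic (liftY c) := (svalP (cid (liftY_subproof c))).1.
by have [m hm] := geodesicP gc; exists m; apply/funext.
Qed.

Lemma io_NIC (c : geodesicY Gamma) : intersects_infinitely_often (CShat Gamma AA) c <-> ~ NIC AA c.
Proof.
have [m mE] := lift_geo c.
have cE t : CShat Gamma AA (velocityY c t) <-> crosses m t by rewrite /velocityY mE; exact: CShatP.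
have io_p : (exists2 u : R^nat, u n @[n --> \oo] --> +oo & forall n, CShat Gamma AA (velocityY c (u n))) <-> ~ bd_point (mobhat m None).
  rewrite -forward_io; split=> -[u cu hu]; exists u => // n; exact/cE.
have io_n : (exists2 u : R^nat, u n @[n --> \oo] --> -oo & forall n, CShat Gamma AA (velocityY c (u n))) <-> ~ bd_point (mobhat m (Some 0)).
  rewrite -backward_io; split=> -[u cu hu]; exists u => // n; exact/cE.
have rn : reaches (geo m) -oo%E (mobhat m (Some 0)).
  by apply: reaches_mob; [exact: HH_std|rewrite /= lexx|exact: reaches_std_n].
have nic : NIC AA c <-> bd_point (mobhat m None) \/ bd_point (mobhat m (Some 0)).
  split.
    move=> [e [->|->] [x rx /bd_pointP bx]]; rewrite mE in rx; [left|right].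
      by have -> : mobhat m None = x := reaches_unique (@reaches_geo_p m) rx.
    by have -> : mobhat m (Some 0) = x := reaches_unique rn rx.
  rewrite /NIC /mkset mE; move=> [b|b]; [exists +oo%E; [by left|]|exists -oo%E; [by right|]].
    by exists (mobhat m None); [exact: reaches_geo_p|apply/bd_pointP].
  by exists (mobhat m (Some 0)); [exact: rn|apply/bd_pointP].
by rewrite /intersects_infinitely_often io_p io_n nic not_orP.
Qed.

(** Isolation of the intersection times holds for every geodesic, so only (C1) depends on [mu], and
    its exceptional set is exactly [NIC]. *)
Lemma cross_section_iff (G : set (set (geodesicY Gamma))) (mu : {measure set (g_sigma_algebraType G) -> \bar R}) :
  is_cross_section mu (CShat Gamma AA) <-> mu.-negligible (NIC AA).
Proof.
have E : ~` [set c : geodesicY Gamma | intersects_infinitely_often (CShat Gamma AA) c] = NIC AA.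
  by rewrite eqEsubset; split=> c /=; [move=> h; apply: contrapT => /io_NIC|move=> nc /io_NIC].
split=> [[_ ae _]|neg].
  by rewrite -E; exact: ae.
split.
- by move=> _ [v [SHv _ _] <-]; exists v.
- by rewrite -E in neg; exact: neg.
- move=> c t ct; have [m mE] := lift_geo c.
  have cE s : CShat Gamma AA (velocityY c s) <-> crosses m s by rewrite /velocityY mE; exact: CShatP.
  have [e e0 He] := crosses_discrete ((cE t).1 ct).
  exists e => //; rewrite eqEsubset; split.
    move=> _ [[s sr <-] cs]; have -> : s = t; last by [].
    by apply: He; [move: sr; rewrite /= in_itv|exact/cE].
  move=> _ ->; split => //; exists t => //=; rewrite in_itv /=; apply/andP; split; lra.
Qed.

End IsometricSpheres.

(** * The translates of the Ford domain cover the plane *)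

Section Covering.
Variables (R : realType) (Gamma : set (PSL2 R)).
Local Notation C := R[i].
Implicit Types (g h k : PSL2 R) (z w p : C).
Hypothesis hne : Gamma <> stab_infty Gamma.
Hypothesis hA : conditionA Gamma.

Lemma closure_KK_KKb p : closureH (KK Gamma) p -> KKb Gamma p.
Proof.
move=> [cp Hp]; split => // g Gg g0; rewrite leNgt; apply/negP => lt.
rewrite nd_Phi in lt; have [w Kw] := closure_near cp (Phi_lt_near lt).
rewrite -nd_Phi => ltw; have := ((KKP hne w).1 Kw).2 g Gg g0; lra.
Qed.

(** The closed Ford domain together with its real points, since cuspidal precells have vertices on
    the real axis. *)
Definition KKc : set C := [set z | 0 <= Im z /\ forall g, Gamma g -> pc g != 0 -> 1 <= nd g z].

Lemma gseg_KKc (x y : one_point_compactification C) :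
  (forall z, x = Some z -> KKc z) -> (forall z, y = Some z -> KKc z) -> gseg x y `<=` KKb Gamma.
Proof.
have ray z : KKc z -> gseg (Some z) None `<=` KKb Gamma.
  move=> [z0 Kz] p /gseg_ray_sub[Hp re im]; split => // g Gg g0.
  apply: le_trans (Kz g Gg g0) _; rewrite /nd re lerD2l !exprMn ler_wpM2l ?sqr_ge0 //.
  by rewrite lerXn2r // nnegrE (le_trans z0).
case: x => [z|]; case: y => [w|] Kx Ky p gp.
- have [z0 Kz] := Kx _ erefl; have [w0 Kw] := Ky _ erefl.
  have [s /andP[s0 s1] K] := gseg_sub gp; split; first exact: gseg_HH gp.
  move=> g Gg g0; have := Kz g Gg g0; have := Kw g Gg g0.
  rewrite !nd_Phi (kl_Phi _ K); nra.
- exact: ray (Kx _ erefl) _ gp.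
- by rewrite gseg_sym in gp; exact: ray (Ky _ erefl) _ gp.
- by have [_ _ []] := gseg_cl gp.
Qed.

Lemma hpolygon_KKb (X : set (one_point_compactification C)) :
  (forall z, X (Some z) -> KKc z) -> hpolygon X `<=` KKb Gamma.
Proof.
move=> HX p; apply; split; first exact: hconvex_KKb.
by move=> x y Xx Xy; apply: gseg_KKc => z e; apply: HX; rewrite -e.
Qed.

Lemma summit_KKc I s : relevant Gamma I -> is_summit I s -> KKc s.
Proof.
move=> rI sI; have [[cs _] _] := hA rI sI.
by have [Hs Ks] := closure_KK_KKb cs; split => //; exact: ltW.
Qed.

(** The inequalities hold inside the segment and pass to its end [z]: by affinity along the chord if
    the other end is finite, and by points descending to [z] if it is infinity. *)
Lemma vertex_KKc I z : relevant Gamma I -> is_endpoint (relevant_part Gamma I) (Some z) -> KKc z.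
Proof.
move=> [_ [S [[p0 Sp0] _ _] SI]] [y yz E].
have sub : gseg (Some z) y `<=` KKb Gamma.
  by rewrite -E => p [_ [cp _]]; exact: closure_KK_KKb.
have [z0 y0 _] : [/\ clH (Some z), clH y & Some z <> None \/ y <> None].
  by apply: (@gseg_cl R _ _ p0); rewrite -E; exact: SI.
split; first exact: z0.
move=> g Gg g0; move: y0 sub yz {E} => /=; case: y => [w|] y0 sub yz.
  have zw : z <> w by move=> e; apply: yz; rewrite e.
  have [] := @aff_ends R (nd g z - 1) (nd g w - 1); last by rewrite subr_ge0.
  move=> s sr; have sr' : 0 <= s <= 1 by case/andP: sr => ? ?; rewrite !ltW.
  have [p p0' K] := kl_ex z0 y0 sr'.
  have Hp : HH p by exact: kl_HH K z0 y0 sr zw p0'.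
  have [_ /(_ g Gg g0)] := sub _ (gseg_kl z0 y0 zw Hp sr' K).
  by rewrite !nd_Phi (kl_Phi _ K); lra.
apply/ler_addgt0Pr => e e0.
have c0 : 0 < pc g ^+ 2 by rewrite exprn_even_gt0.
pose p : C := Re z +i* Num.sqrt (Im z ^+ 2 + e / pc g ^+ 2).
have q0 : 0 < e / pc g ^+ 2 by rewrite divr_gt0.
have s0 : 0 < Im z ^+ 2 + e / pc g ^+ 2 by rewrite ltr_pwDr // sqr_ge0.
have gp : gseg (Some z) None p.
  rewrite (gseg_ray z0); split => //=; first by rewrite /HH /= sqrtr_gt0.
  by rewrite -[leLHS](ger0_norm z0) -sqrtr_sqr; apply: ler_wsqrtr; rewrite lerDl ltW.
have [_ /(_ g Gg g0)] := sub _ gp.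
rewrite /nd /= !exprMn sqr_sqrtr ?(ltW s0) //.
have -> : (pc g * Re z + pd g) ^+ 2 + pc g ^+ 2 * (Im z ^+ 2 + e / pc g ^+ 2) =
  (pc g * Re z + pd g) ^+ 2 + pc g ^+ 2 * Im z ^+ 2 + e by field.
by [].
Qed.

(** The description of precells as columns already rests on [hcov], which is to be proved here; so
    the inclusion is obtained from the vertices and the convexity of [KKb]. *)
Lemma precell_KKb A : is_precell Gamma A -> A `<=` KKb Gamma.
Proof.
case=> [[z [b1 [b2 [_ [I1 [I2 [s1 [s2 [[r1 r2 _] e1 e2 [su1 su2] [_ _ ->]]]]]]]]]]|[v [b [_ [I [s [rI ev su _ ->]]]]]]|[z [w [_ _ _ sK ->]]]].
- apply: hpolygon_KKb => p [[->]|[->]|[->]|//]; [exact: summit_KKc r1 su1|exact: vertex_KKc r1 e1|exact: summit_KKc r2 su2].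
- apply: hpolygon_KKb => p [e|[->]|//]; last exact: summit_KKc rI su.
  by apply: vertex_KKc rI _; rewrite e.
- by move=> p /sK; exact: KK_KKb.
Qed.

Lemma KKb_cover (hF : is_fuchsian Gamma) (AA : set (set C)) : basal_family Gamma AA ->
  forall z, HH z -> exists g, Gamma g /\ KKb Gamma (mob g z).
Proof.
move=> [pre [clE [_ _ _ cov]]] z Hz.
move: (Hz); rewrite -{1}cov => -[g Gg [w [cw Hw] E]].
have [A AAA Aw] : (\bigcup_(A in AA) A) w.
  rewrite -clE; split => //; move: cw; apply: closure_subset; exact: interior_subset.
exists g^-1%g; split; first exact: GammaV.
by rewrite -E mobK //; exact: (precell_KKb (pre _ AAA)).
Qed.

End Covering.

(** * The centers of relevant spheres are isolated *)

Section CentersDiscrete.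
Variables (R : realType) (Gamma : set (PSL2 R)).
Local Notation C := R[i].
Implicit Types (g h k : PSL2 R) (z w p : C).
Hypothesis hF : is_fuchsian Gamma.
Hypothesis hC : cuspidal_infty Gamma.
Hypothesis hne : Gamma <> stab_infty Gamma.
Hypothesis hcov : forall z, HH z -> exists g, Gamma g /\ KKb Gamma (mob g z).
Variable F : set C.
Hypothesis hFR : fundamental_region Gamma F.
Hypothesis Fc : hconvex F.

Let Fo : open F. Proof. by have [] := hFR. Qed.

Lemma mob_closure_inside h w (r : cform R) : HH w -> 0 < Phi r w ->
  (forall u, HH u -> 0 < Phi r u -> closureH F (mob h u)) -> F (mob h w).
Proof.
move=> Hw rw H; apply: (interior_closure Fo Fc); first exact: HH_mob.
have N : \forall u \near mob h^-1%g (mob h w), HH u /\ 0 < Phi r u.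
  by rewrite mobK //; exact: filterI (HH_near Hw) (Phi_gt_near rw).
have N2 : \forall u \near mob h w, HH u /\ HH (mob h^-1%g u) /\ 0 < Phi r (mob h^-1%g u).
  exact: filterI (HH_near (HH_mob h Hw)) (mob_near (HH_mob h Hw) N).
by apply: filterS N2 => u [Hu [Hv ru]]; rewrite -(mobVK h Hu); exact: H.
Qed.

(* The translates of a half-plane containing a neighbourhood of the cusp would overlap. *)
Lemma half_plane_lead_le0 h (r : cform R) : Gamma h ->
  (forall u, HH u -> 0 < Phi r u -> closureH F (mob h u)) -> r.1.1 <= 0.
Proof.
move=> Gh H; rewrite leNgt; apply/negP => a0.
have [t [Gt t0] tau0] := width hF hC.
(* At height [Y] the leading term dominates, so both the point above 0 and its translate by [t] are
   in the half-plane. *)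
pose Y : R := 1 + (`|r.1.2 * tau t| + `|r.2|) / r.1.1.
have q0 : 0 <= (`|r.1.2 * tau t| + `|r.2|) / r.1.1 by rewrite divr_ge0 ?addr_ge0 // ltW.
have Y1 : 1 <= Y by rewrite /Y lerDl.
have aY : r.1.1 * Y = r.1.1 + (`|r.1.2 * tau t| + `|r.2|) by rewrite /Y; field; rewrite gt_eqF.
have YY : r.1.1 * Y <= r.1.1 * Y ^+ 2 by rewrite ler_pM2l // expr2 ler_peMr //; lra.
have h1 : - `|r.1.2 * tau t| <= r.1.2 * tau t by rewrite lerNl -normrN ler_norm.
have h2 : - `|r.2| <= r.2 by rewrite lerNl -normrN ler_norm.
have h3 := normr_ge0 (r.1.2 * tau t).
pose w : C := 0 +i* Y; have Hw : HH w by rewrite /HH /=; lra.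
have twE : mob t w = tau t +i* Y by rewrite (stab_mob hF hC) //= add0r.
have Fw : F (mob h w) by apply: (mob_closure_inside Hw _ H); rewrite /Phi /= expr0n /= add0r mulr0; lra.
have Ftw : F (mob h (mob t w)).
  apply: (mob_closure_inside (HH_mob t Hw) _ H); rewrite twE /Phi /= mulrDr.
  have : 0 <= r.1.1 * tau t ^+ 2 by rewrite mulr_ge0 ?sqr_ge0 // ltW.
  lra.
have [_ _ triv _] := hFR.
have Ght : Gamma (h * t)%g by exact: GammaM.
have e : h^-1%g = (h * t)^-1%g.
  apply: (triv _ _ (GammaV hF Gh) (GammaV hF Ght)); exists w; split.
    by exists (mob h w) => //; rewrite mobK.
  by exists (mob h (mob t w)) => //; rewrite -(mob_mul h t Hw) mobK.
have t1 : t = 1%g by rewrite -(mulKg h t) -[X in (_ * X)%g]invgK -e invgK mulVg.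
by move: twE; rewrite t1 mob1 /w => -[/esym e0]; rewrite -t1 in e0; move: tau0; rewrite e0 ltxx.
Qed.

(** The center of [g] is the preimage of infinity, hence a cusp; apply [half_plane_lead_le0] after
    moving it to infinity by [g]. *)
Lemma half_plane_center_le0 h (r : cform R) g : Gamma h -> Gamma g -> pc g != 0 ->
  (forall u, HH u -> 0 < Phi r u -> closureH F (mob h u)) -> Phi r (cen g)%:C <= 0.
Proof.
move=> Gh Gg g0 H; have Gi := GammaV hF Gg.
have : (fmob r g^-1%g).1.1 <= 0.
  apply: (@half_plane_lead_le0 (h * g^-1)%g); first exact: GammaM.
  move=> u Hu; rewrite -Phi_mob // pmulr_lgt0 ?nd_gt0 // mob_mul // => ru.
  by apply: H => //; exact: HH_mob.
rewrite /fmob /=; have [s s2 [-> _ -> _]] := psl2_inv_entries g.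
have -> : r.1.1 * (s * pd g) ^+ 2 + r.1.2 * (s * pd g * - (s * pc g)) + r.2 * (- (s * pc g)) ^+ 2 =
  s ^+ 2 * (pc g ^+ 2 * Phi r (cen g)%:C) by rewrite /Phi /cen /=; field.
by rewrite s2 mul1r pmulr_rle0 // exprn_even_gt0.
Qed.

Lemma finite_isolated (X : set R) v : finite_set X -> exists2 d : R, 0 < d & forall x, X x -> `|x - v| < d -> x = v.
Proof.
move=> fX; have N : forall x, X x -> \forall d \near (0 : R)^'+, x = v \/ d <= `|x - v|.
  move=> x _; have [->|n] := eqVneq x v; first by near=> d; left.
  by near=> d; right; near: d; apply: nbhs_right_le; rewrite normr_gt0 subr_eq0.
have [d [d0 Hd]] := filter_ex (filterI (nbhs_right_gt (0 : R)) (finite_near (_ : Filter (0 : R)^'+) fX N)).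
by exists d => // x Xx; case: (Hd x Xx) => // le; rewrite ltNge le.
Unshelve. all: by end_near.
Qed.

Definition center_limit v := forall e : R, 0 < e -> exists g al be,
  [/\ Arc Gamma g al be, cen g != v & `|cen g - v| < e].

(** Only finitely many centers near [v] belong to circles of radius at least [e]; closer centers
    different from [v] belong to smaller circles. *)
Lemma center_limit_small v : center_limit v -> forall e : R, 0 < e -> exists g al be,
  [/\ Arc Gamma g al be, cen g != v, `|cen g - v| < e & rad g < e].
Proof.
move=> acc e e0; have fin := finite_image (fun x => x.1) (circles_finite hF hC hcov (`|v| + 1) e0).
have [d d0 Hd] := finite_isolated v fin.
have m0 : 0 < Num.min (Num.min 1 e) d by rewrite !lt_min ltr01 e0 d0.
have [g [al [be [A n]]]] := acc _ m0; rewrite !lt_min => /andP[/andP[h1 h2] h3].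
have [[Gg g0] _ _ _ _] := A.
exists g, al, be; split => //; rewrite ltNge; apply/negP => er.
move/eqP: n; apply; apply: Hd => //; exists (cen g, rad g) => //; exists g; split => //.
have := ler_normD (cen g - v) v; rewrite subrK; lra.
Qed.

(** By [center_limit_small], [v] is a limit of summits, and these lie in the closed Ford domain. *)
Lemma nd_limit v k : center_limit v -> Gamma k -> pc k != 0 -> 1 <= nd k v%:C.
Proof.
move=> acc Gk k0; rewrite leNgt; apply/negP => lt; rewrite nd_Phi in lt.
have /nbhs_box[e e0 He] := Phi_lt_near lt.
have [g [al [be [A _ h1 h2]]]] := center_limit_small acc e0; have [[Gg g0] _ _ _ _] := A.
have [Ks _] := (bKP hF hC hne hcov _).1 (Arc_summit_bK hF hC hne hcov A).
have r0 := rad_gt0 g0.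
have := He (summit g) h1; rewrite /= subr0 gtr0_norm // => /(_ h2); rewrite -nd_Phi.
by have := Ks.2 k Gk k0; lra.
Qed.

Lemma Phi_limit v (r : cform R) : center_limit v -> (forall g, Gamma g -> pc g != 0 -> Phi r (cen g)%:C <= 0) -> Phi r v%:C <= 0.
Proof.
move=> acc H; rewrite leNgt; apply/negP => gt.
have /nbhs_box[e e0 He] := Phi_gt_near gt.
have [g [al [be [A _ h1 _]]]] := center_limit_small acc e0; have [[Gg g0] _ _ _ _] := A.
have := He (cen g)%:C h1; rewrite /= subrr normr0 => /(_ e0).
by have := H g Gg g0; lra.
Qed.

(** The real part of [z] is between [v] and [e = cen g]. Neither [v] nor the summit of [g] is inside
    the circle of [k]. If [v] or [e] is at most as far from [cen k] as [Re z], then so is [z]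
    outside; otherwise [cen k] is within [d] of [v], and the radius is at most [d < Im z]. *)
Lemma KK_between v g al be z : center_limit v -> Arc Gamma g al be ->
  `|Re z - v| <= `|cen g - v| -> `|Re z - cen g| <= `|cen g - v| -> `|cen g - v| < Im z -> KK Gamma z.
Proof.
move=> acc A; have [[Gg g0] _ _ _ _] := A.
have d0 := normr_ge0 (cen g - v); have d2 : `|cen g - v| ^+ 2 = (cen g - v) ^+ 2 by rewrite real_normK // num_real.
set d := `|cen g - v| in d0 d2 *; set e := cen g in d2 *; rewrite !ler_norml => /andP[x1 x2] /andP[x3 x4] dz.
have z0 : 0 < Im z by exact: le_lt_trans dz.
apply/(KKP hne); split => // k Gk k0; rewrite nd_gt1 //.
have y2 : d ^+ 2 < Im z ^+ 2 by rewrite ltr_pXn2r // nnegrE // ltW.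
have y20 : 0 < Im z ^+ 2 by rewrite exprn_gt0.
have := nd_limit acc Gk k0; rewrite nd_ge1 //= expr0n addr0 => r1.
have re : rad g ^+ 2 <= d ^+ 2.
  by have := nd_limit acc Gg g0; rewrite nd_ge1 //= expr0n addr0 -/e d2 -(sqrrN (v - e)) opprB.
have [Ks _] := (bKP hF hC hne hcov _).1 (Arc_summit_bK hF hC hne hcov A).
have := Ks.2 k Gk k0; rewrite nd_ge1 //= -/e => r2.
have [c1|c1] := leP ((v - cen k) ^+ 2) ((Re z - cen k) ^+ 2); first by lra.
have [c2|c2] := leP ((e - cen k) ^+ 2) ((Re z - cen k) ^+ 2); first by lra.
suff : (v - cen k) ^+ 2 <= d ^+ 2 by have := sqr_ge0 (Re z - cen k); lra.
have f1 : 0 < (v - Re z) * (v + Re z - 2 * cen k).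
  by have -> : (v - Re z) * (v + Re z - 2 * cen k) = (v - cen k) ^+ 2 - (Re z - cen k) ^+ 2 by [ring|]; rewrite subr_gt0.
have f2 : 0 < (e - Re z) * (e + Re z - 2 * cen k).
  by have -> : (e - Re z) * (e + Re z - 2 * cen k) = (e - cen k) ^+ 2 - (Re z - cen k) ^+ 2 by [ring|]; rewrite subr_gt0.
rewrite d2 -subr_ge0; have -> : (e - v) ^+ 2 - (v - cen k) ^+ 2 = (e - cen k) * (e + cen k - 2 * v) by ring.
have [le|lt] := leP e v.
  have de : d = v - e by rewrite /d distrC ger0_norm // subr_ge0.
  have xv : 0 < v - Re z by rewrite lt_neqAle; apply/andP; split; [apply/eqP => e0; move: f1; rewrite -e0 mul0r ltxx|lra].
  have xe : 0 < Re z - e by rewrite lt_neqAle; apply/andP; split; [apply/eqP => e0; move: f2; rewrite -opprB -e0 oppr0 mul0r ltxx|lra].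
  rewrite pmulr_rgt0 // in f1; rewrite -opprB mulNr oppr_gt0 pmulr_rlt0 // in f2.
  by rewrite -mulrNN mulr_ge0 //; lra.
have de : d = e - v by rewrite /d gtr0_norm // subr_gt0.
have xv : 0 < Re z - v by rewrite lt_neqAle; apply/andP; split; [apply/eqP => e0; move: f1; rewrite -opprB -e0 oppr0 mul0r ltxx|lra].
have xe : 0 < e - Re z by rewrite lt_neqAle; apply/andP; split; [apply/eqP => e0; move: f2; rewrite -e0 mul0r ltxx|lra].
rewrite pmulr_rgt0 // in f2; rewrite -opprB mulNr oppr_gt0 pmulr_rlt0 // in f1.
by rewrite mulr_ge0 //; lra.
Qed.

(** The form of such a half-plane would be nonpositive at the cusp [cen g], at the limit [v] of
    cusps, and in its leading coefficient. *)
Lemma half_plane_low v g h z : center_limit v -> Gamma g -> pc g != 0 -> Gamma h -> HH z ->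
  `|Re z - v| <= `|cen g - v| -> `|Re z - cen g| <= `|cen g - v| -> `|cen g - v| < Im z ->
  ~ in_half_plane (closureH F) (mob h z).
Proof.
move=> acc Gg g0 Gh Hz x1 x2 dz [r0 r0z Hr].
pose r := fmob r0 h.
have H u : HH u -> 0 < Phi r u -> closureH F (mob h u).
  by move=> Hu; rewrite -Phi_mob // pmulr_lgt0 ?nd_gt0 // => ru; apply: Hr => //; exact: HH_mob.
have rz : 0 < Phi r z by rewrite -Phi_mob // mulr_gt0 // nd_gt0.
have a0 := half_plane_lead_le0 Gh H.
have pe := half_plane_center_le0 Gh Gg g0 H.
have pv := Phi_limit acc (fun k Gk nk => half_plane_center_le0 Gh Gk nk H).
have d0 := normr_ge0 (cen g - v).
clearbody r; move: rz pe pv a0 x1 x2 dz; rewrite /Phi /= !expr0n /= !addr0.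
move: (Im z) (Re z) (cen g) d0 (r.1.1) (r.1.2) (r.2) => y x e d0 a b c rz pe pv a0 x1 x2 dz.
set d := `|e - v| in d0 x1 x2 dz.
have y2 : d ^+ 2 < y ^+ 2 by rewrite ltr_pXn2r // nnegrE // ltW // (le_lt_trans d0).
have d2 : d ^+ 2 = (e - v) ^+ 2 by rewrite /d real_normK // num_real.
have k1 : 0 <= (x - v) * (e - v).
  move: x2; rewrite -ler_sqr ?nnegrE // real_normK ?num_real // d2 => x2.
  have := sqr_ge0 (x - v).
  move: x2; have -> : (x - e) ^+ 2 = (x - v) ^+ 2 - 2 * ((x - v) * (e - v)) + (e - v) ^+ 2 by ring.
  by clear -hF hC hne hcov hFR Fc Fo; lra.
have k2 : 0 <= (e - x) * (e - v).
  move: x1; rewrite -ler_sqr ?nnegrE // real_normK ?num_real // d2 => x1.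
  have := sqr_ge0 (x - e).
  move: x1; have -> : (x - v) ^+ 2 = (x - e) ^+ 2 - 2 * ((e - x) * (e - v)) + (e - v) ^+ 2 by ring.
  by clear -hF hC hne hcov hFR Fc Fo; lra.
have [ev|ev] := eqVneq e v.
  have xv : x = v by apply/eqP; rewrite -subr_eq0 -normr_le0; move: x1; rewrite /d ev subrr normr0.
  rewrite xv in rz; have : a * y ^+ 2 <= 0 by rewrite mulr_le0_ge0 // sqr_ge0.
  lra.
have dd : 0 < (e - v) ^+ 2 by rewrite exprn_even_gt0 // subr_eq0.
suff : (a * (x ^+ 2 + y ^+ 2) + b * x + c) * (e - v) ^+ 2 <= 0 by apply/negP; rewrite -ltNge mulr_gt0.
(* Interpolation between [v] and [e]: the quadratic exceeds its chord by at most [- a * d ^+ 2],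
   which [a * y ^+ 2] outweighs because [y > d]. *)
have -> : (a * (x ^+ 2 + y ^+ 2) + b * x + c) * (e - v) ^+ 2 =
  (x - v) * (e - v) * (a * e ^+ 2 + b * e + c) + (e - x) * (e - v) * (a * v ^+ 2 + b * v + c)
  + a * (y ^+ 2 * (e - v) ^+ 2 - (x - v) * (e - v) * ((e - x) * (e - v))) by ring.
have t1 : (x - v) * (e - v) * (a * e ^+ 2 + b * e + c) <= 0 by rewrite mulr_ge0_le0.
have t2 : (e - x) * (e - v) * (a * v ^+ 2 + b * v + c) <= 0 by rewrite mulr_ge0_le0.
suff : a * (y ^+ 2 * (e - v) ^+ 2 - (x - v) * (e - v) * ((e - x) * (e - v))) <= 0 by lra.
rewrite mulr_le0_ge0 // subr_ge0.
have : (x - v) * (e - v) * ((e - x) * (e - v)) <= (e - v) ^+ 2 * (e - v) ^+ 2.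
  have s : (x - v) * (e - v) + (e - x) * (e - v) = (e - v) ^+ 2 by ring.
  by apply: ler_pM => //; lra.
have : (e - v) ^+ 2 * (e - v) ^+ 2 <= y ^+ 2 * (e - v) ^+ 2 by rewrite ler_wpM2r ?sqr_ge0 // -d2 ltW.
lra.
Qed.

Lemma ds_ratio g z w : HH z -> HH w ->
  ds (mob g z) (mob g w) / (Im (mob g z) * Im (mob g w)) = ds z w / (Im z * Im w).
Proof.
move=> Hz Hw; rewrite ds_mob // !Im_mob //.
have nz := nd_gt0 g Hz; have nw := nd_gt0 g Hw.
have [iz iw] : 0 < Im z /\ 0 < Im w by [].
by field; rewrite !gt_eqF.
Qed.

Section Blocks.
Variables (v : R) (Psi : set (cform R)).
Hypothesis acc : center_limit v.
Hypothesis fPsi : finite_set Psi.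
Hypothesis FE : forall p, closureH F p <-> HH p /\ forall q, Psi q -> 0 <= Phi q p.

Definition in_block (l : PSL2 R * R) (m : nat) z := exists h,
  [/\ Gamma h, `|Re (mob l.1 (mob h z))| <= l.2 & m%:R <= Im (mob l.1 (mob h z)) <= m%:R + 1].

(* Two points of a block are close to each other in the hyperbolic metric, so one is close to a
   translate of the other; if both are far above the boundary this translate is trivial. *)
Lemma block_diam g al be (l : PSL2 R * R) (K e : R) (m : nat) z w : Arc Gamma g al be ->
  (forall k, Gamma k -> pc k = 0 -> `|tau k| < e -> k = 1%g) ->
  let d := `|cen g - v| in
  0 < d -> d < e -> 0 <= K -> l.2 <= K -> (0 < m)%N -> 3 * (3 * (2 * K + 1)) <= m%:R ->
  (forall u, u = z \/ u = w -> [/\ `|Re u - v| <= 2 * d / 3, `|Re u - cen g| <= 2 * d / 3,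
    `|Re z - Re u| <= d / 3 & 2 * d <= Im u <= 3 * d]) ->
  in_block l m z -> in_block l m w ->
  `|Re z - Re w| <= 3 * (2 * K + 1) * d / m%:R /\ `|Im z - Im w| <= 3 * (2 * K + 1) * d / m%:R.
Proof.
move=> A tmin d d0 de K0 lK m0 mK box [h [Gh hz1 /andP[hz2 hz3]]] [h' [Gh' hw1 /andP[hw2 hw3]]].
have [] := box _ (or_introl erefl) => zv ze _ /andP[z2 z3].
have [] := box _ (or_intror erefl) => wv we zw /andP[w2 w3].
have dg u : `|Re u - v| <= d -> `|Re u - cen g| <= d -> d < Im u -> KK Gamma u by exact: KK_between acc A.
have d23 : 2 * d / 3 <= d by clear -hF hC hne hcov hFR Fc Fo acc fPsi FE d0; lra.
have d2d : d < 2 * d by clear -hF hC hne hcov hFR Fc Fo acc fPsi FE d0; lra.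
have Kz : KK Gamma z by apply: dg; [exact: le_trans zv d23|exact: le_trans ze d23|exact: lt_le_trans z2].
have Kw : KK Gamma w by apply: dg; [exact: le_trans wv d23|exact: le_trans we d23|exact: lt_le_trans w2].
have [Hz _] := KK_KKb hne Kz; have [Hw _] := KK_KKb hne Kw.
pose u := mob h z; pose u' := mob h' w; have Hu : HH u by exact: HH_mob.
have Hu' : HH u' by exact: HH_mob.
have Gk : Gamma (h^-1 * h')%g by apply: GammaM => //; exact: GammaV.
set k := (h^-1 * h')%g in Gk; set w' := mob k w.
have w'E : w' = mob h^-1%g u' by rewrite /w' mob_mul.
have Hw' : HH w' by exact: HH_mob.
have im' : Im w' <= 3 * d by apply: le_trans w3; exact: (KKb_Im hF hC (KK_KKb hne Kw) Gk).
have [iz iw'] : 0 < Im z /\ 0 < Im w' by [].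
have E : ds z w' / (Im z * Im w') = ds (mob l.1 u) (mob l.1 u') / (Im (mob l.1 u) * Im (mob l.1 u')).
  by rewrite ds_ratio // -(ds_ratio h^-1%g Hu Hu') -w'E /u mobK.
have M0 : 0 < (m%:R : R) by rewrite ltr0n.
have b1 : ds (mob l.1 u) (mob l.1 u') <= (2 * K + 1) ^+ 2.
  have x2 : (Re (mob l.1 u) - Re (mob l.1 u')) ^+ 2 <= (2 * K) ^+ 2.
    rewrite -[leLHS]real_normK ?num_real // ler_sqr ?nnegrE ?mulr_ge0 //.
    by have := ler_normB (Re (mob l.1 u)) (Re (mob l.1 u')); lra.
  have y2 : (Im (mob l.1 u) - Im (mob l.1 u')) ^+ 2 <= 1.
    by rewrite -[leRHS](expr1n _ 2) -[leLHS]real_normK ?num_real // ler_sqr ?nnegrE // ler_norml; clear -hF hC hne hcov hFR Fc Fo acc fPsi FE hz2 hz3 hw2 hw3; apply/andP; split; lra.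
  have : (2 * K + 1) ^+ 2 = (2 * K) ^+ 2 + 4 * K + 1 by ring.
  rewrite /ds; lra.
have b2 : m%:R ^+ 2 <= Im (mob l.1 u) * Im (mob l.1 u') by rewrite expr2 ler_pM.
have p0 : 0 < Im (mob l.1 u) * Im (mob l.1 u') by apply: mulr_gt0; exact: HH_mob.
(* A block at height at least [m] has Euclidean diameter at most [2 * K + 1], and [z], [w'] have
   height at most [3 * d]; the quotient of [ds] by the product of heights is invariant. *)
have b3 : ds z w' <= (3 * (2 * K + 1) * d / m%:R) ^+ 2.
  have -> : ds z w' = ds z w' / (Im z * Im w') * (Im z * Im w') by field; rewrite !gt_eqF.
  rewrite E; have -> : (3 * (2 * K + 1) * d / m%:R) ^+ 2 = (2 * K + 1) ^+ 2 / m%:R ^+ 2 * ((3 * d) * (3 * d)) by field; rewrite gt_eqF.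
  apply: ler_pM; [by rewrite divr_ge0 ?ds_ge0 // ltW|by rewrite mulr_ge0 // ltW| |by rewrite ler_pM // ltW].
  apply: ler_pM; [exact: ds_ge0|by rewrite invr_ge0 ltW|exact: b1|].
  by rewrite lef_pV2 // posrE exprn_gt0.
set rr := 3 * (2 * K + 1) * d / m%:R in b3 *.
have rr0 : 0 <= rr by rewrite /rr !mulr_ge0 ?invr_ge0 ?addr_ge0 ?mulr_ge0 // ltW.
have rr3 : rr <= d / 3.
  rewrite /rr ler_pdivrMr //; have := ler_wpM2l (ltW d0) mK; lra.
have c1 : `|Re z - Re w'| <= rr by rewrite -ler_sqr ?nnegrE // real_normK ?num_real //; apply: le_trans b3; rewrite lerDl sqr_ge0.
have c2 : `|Im z - Im w'| <= rr by rewrite -ler_sqr ?nnegrE // real_normK ?num_real //; apply: le_trans b3; rewrite lerDr sqr_ge0.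
suff k1 : k = 1%g by move: c1 c2; rewrite /w' k1 mob1.
have Kw' : KK Gamma w'.
  have t x : `|Re z - x| <= 2 * d / 3 -> `|Re w' - x| <= d.
    move=> zx; apply: le_trans (ler_distD (Re z) _ _) _; rewrite (distrC (Re w')).
    by move: zx c1 rr3; clear -hF hC hne hcov hFR Fc Fo acc fPsi FE; lra.
  apply: dg; [exact: t|exact: t|].
  have := le_trans (ler_norm _) c2; move: rr3 z2 d0; clear -hF hC hne hcov hFR Fc Fo acc fPsi FE; lra.
have k0 : pc k = 0 by exact: (KK_KKb_stab hF hC hne Kw Gk (KK_KKb hne Kw')).
apply: tmin => //; have -> : tau k = Re w' - Re w by rewrite /w' (stab_mob hF hC) //= addrAC subrr add0r.
apply: le_lt_trans (ler_distD (Re z) _ _) _; rewrite (distrC (Re w')).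
by move: zw c1 rr3 d0 de; clear -hF hC hne hcov hFR Fc Fo acc fPsi FE; lra.
Qed.

(** As [z] is highest in its orbit, its translate [q] in the closure of [F] is low as well. By
    [half_plane_low] it is in no half-plane contained there, so it is in one of the ends of [L], and
    the integer part of its height in that end is the number of the block. *)
Lemma block_exists g al be (L : seq (PSL2 R * R)) (y0 : R) (k0 : nat) z : Arc Gamma g al be -> cen g != v ->
  (forall p, closureH F p -> Im p < y0 -> in_half_plane (closureH F) p \/
    exists2 l, l \in L & `|Re (mob l.1 p)| <= l.2 /\ (2 * Im p)^-1 <= Im (mob l.1 p)) ->
  `|Re z - v| <= `|cen g - v| -> `|Re z - cen g| <= `|cen g - v| -> `|cen g - v| < Im z -> Im z < y0 ->
  k0%:R <= (2 * Im z)^-1 ->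
  exists i n, (i < size L)%N /\ in_block (nth (1%g, 0) L i) (k0 + n) z.
Proof.
move=> A nv low zv ze dz zy zk; have [[Gg g0] _ _ _ _] := A.
have Kz := KK_between acc A zv ze dz; have [Hz _] := KK_KKb hne Kz.
have [_ _ _ cov] := hFR.
move: (Hz); rewrite -{1}cov => -[f Gf [q cq E]].
have Gi := GammaV hF Gf; have qE : q = mob f^-1%g z by rewrite -E mobK //; exact: cq.2.
have imq : Im q <= Im z by rewrite qE; exact: (KKb_Im hF hC (KK_KKb hne Kz) Gi).
have [A'|[l lL [b1 b2]]] := low q cq (le_lt_trans imq zy).
  by case: (half_plane_low acc Gg g0 Gi Hz zv ze dz); rewrite -qE.
have iq : 0 < Im q by exact: cq.2.
have b3 : k0%:R <= Im (mob l.1 q).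
  by apply: le_trans b2; apply: (le_trans zk); rewrite lef_pV2 ?posrE ?mulr_gt0 ?ler_pM2l //; exact: lt_le_trans imq.
have im0 : 0 <= Im (mob l.1 q) by apply: ltW; exact: (HH_mob l.1 cq.2).
have kt : (k0 <= Num.truncn (Im (mob l.1 q)))%N by rewrite truncn_ge_nat.
exists (index l L), (Num.truncn (Im (mob l.1 q)) - k0)%N; rewrite index_mem; split => //.
rewrite subnKC // nth_index //; exists f^-1%g; rewrite -qE; split => //.
by have /andP[t1 /ltW t2] := truncn_itv im0; rewrite t1 natr1 t2.
Qed.

(* The blocks meeting a fixed square have total area smaller than the square. *)
Lemma no_center_limit : False.
Proof.
have [L [y0 [y00 low]]] := low_points fPsi FE.
have [e e0 tmin] := tau_min hF hC.
have [K K0 HK] : exists2 K : R, 0 <= K & forall l, l \in L -> l.2 <= K.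
  elim: {low} L => [|l L [K K0 HK]]; first by exists 0.
  exists (Num.max l.2 K); first by rewrite le_max K0 orbT.
  by move=> l'; rewrite inE le_max => /orP[/eqP ->|/HK ->]; rewrite ?lexx ?orbT.
pose N := size L; pose c1 : R := 3 * (2 * K + 1).
have c10 : 3 <= c1 by rewrite /c1; lra.
have Nc : 0 <= 36 * N%:R * c1 ^+ 2 by rewrite mulr_ge0 ?sqr_ge0 // mulr_ge0.
(* Large enough for [block_diam], which needs [3 * c1 <= k0], and for the total area: 36 is the 4
   from the side [2 * r] squared times the 9 from the square of side [d / 3]. *)
pose k0 : nat := (Num.truncn (36 * N%:R * c1 ^+ 2 + 3 * c1 + 2)).+1.
have k0B : 36 * N%:R * c1 ^+ 2 + 3 * c1 + 2 < k0%:R by exact: truncnS_gt.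
have k01 : (1 < k0)%N by rewrite -(ltr_nat R); lra.
have k0p : (k0.-1%:R : R) = k0%:R - 1 by rewrite -subn1 natrB // ltnW.
have k00 : 0 < (k0%:R : R) by rewrite ltr0n ltnW.
(* Heights are at most [3 * d], so [d] below these bounds gives trivial small translations,
   [Im z < y0], and [k0 <= 1 / (2 * Im z)]. *)
have m0 : 0 < Num.min (Num.min e (y0 / 3)) (6 * k0%:R)^-1.
  by rewrite !lt_min e0 divr_gt0 // invr_gt0 mulr_gt0.
have [g [al [be [A nv]]]] := acc m0; rewrite !lt_min => /andP[/andP[de dy] dk].
pose d := `|cen g - v|; rewrite -/d in de dy dk.
have d0 : 0 < d by rewrite normr_gt0 subr_eq0.
have d3y : 3 * d < y0 by clear -hF hC hne hcov hFR Fc Fo acc fPsi FE dy; lra.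
have d6k : 6 * d * k0%:R <= 1.
  have := ltW dk; rewrite -(ler_pM2l (mulr_gt0 (ltr0n R 6) k00)) mulfV ?gt_eqF ?mulr_gt0 // => h.
  by rewrite mulrAC.
pose a := Num.min (cen g) v + d / 3.
(* The square stands over the middle third of the interval between [v] and the center, leaving a
   margin of [d / 3] for the nearby translate in [block_diam]. *)
pose Q z := a <= Re z <= a + d / 3 /\ 2 * d <= Im z <= 2 * d + d / 3.
have QP u : Q u -> `|Re u - v| <= 2 * d / 3 /\ `|Re u - cen g| <= 2 * d / 3.
  rewrite /Q /a => -[/andP[u1 u2] _]; clear -hF hC hne hcov hFR Fc Fo acc fPsi FE u1 u2.
  move: u1 u2; rewrite /d !ler_norml; case: (lerP (cen g) v) => [h|h].
    move=> u1 u2; split; apply/andP; split; lra.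
  move=> u1 u2; split; apply/andP; split; lra.
have QQ u w : Q u -> Q w -> `|Re u - Re w| <= d / 3.
  rewrite /Q ler_norml => -[/andP[u1 u2] _] [/andP[w1 w2] _].
  clear -hF hC hne hcov hFR Fc Fo acc fPsi FE u1 u2 w1 w2; apply/andP; split; lra.
have QI u : Q u -> 2 * d <= Im u <= 3 * d.
  move=> [_ /andP[u1 u2]]; rewrite u1 /=; move: u2 d0; clear -hF hC hne hcov hFR Fc Fo acc fPsi FE; lra.
pose r (n : nat) : R := c1 * d / (k0 + n)%:R.
(* Any point of the block in the square serves as center; if there is none, 0 is a dummy. *)
have cent n i : exists c : C, (i < N)%N -> forall w, Q w -> in_block (nth (1%g, 0) L i) (k0 + n) w ->
    `|Re w - Re c| <= r n /\ `|Im w - Im c| <= r n.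
  have [[z [Qz bz]]|none] := pselect (exists z, Q z /\ in_block (nth (1%g, 0) L i) (k0 + n) z); last first.
    by exists 0 => _ w Qw bw; case: none; exists w.
  exists z => iN w Qw bw; apply: (block_diam A tmin d0 de K0 _ _ _ _ bw bz).
  - by apply: HK; exact: mem_nth.
  - by rewrite addn_gt0 (ltnW k01).
  - rewrite natrD; have : 0 <= (n%:R : R) by []; rewrite -/c1; lra.
  - by move=> u [->|->]; have [] := QP _ Qw; have [] := QP _ Qz; split => //; [exact: QQ|exact: QI|exact: QQ|exact: QI].
pose c n i := sval (cid (cent n i)).
have Hc n i : (i < N)%N -> forall w, Q w -> in_block (nth (1%g, 0) L i) (k0 + n) w ->
    `|Re w - Re (c n i)| <= r n /\ `|Im w - Im (c n i)| <= r n by exact: (svalP (cid (cent n i))).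
have w0 : 0 < d / 3 by rewrite divr_gt0.
have r0 n : 0 <= r n by rewrite /r divr_ge0 // mulr_ge0 ?(ltW d0) // (le_trans _ c10).
have k0p0 : 0 < k0%:R - 1 :> R by rewrite -k0p ltr0n -ltnS prednK // ltnW.
pose s : R := 4 * N%:R * (c1 * d) ^+ 2 / (k0%:R - 1).
have sum n : \sum_(k < n) N%:R * (2 * r k) ^+ 2 <= s.
  rewrite (eq_bigr (fun k : 'I_n => 4 * N%:R * (c1 * d) ^+ 2 * ((k0 + k)%:R ^+ 2)^-1)); last first.
    move=> k _; rewrite /r.
    have : ((k0 + k)%:R : R) != 0 by rewrite pnatr_eq0 addn_eq0 negb_and -lt0n (ltnW k01).
    by move: ((k0 + k)%:R : R) => t t0; field.
  rewrite -mulr_sumr /s; apply: ler_wpM2l; first by rewrite mulr_ge0 ?sqr_ge0 // mulr_ge0.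
  by rewrite -k0p; exact: sum_inv_sqr.
have sw : s < (d / 3) ^+ 2.
  rewrite /s ltr_pdivrMr // -(ltr_pM2r (_ : 0 < (9 : R))) //.
  have -> : (d / 3) ^+ 2 * (k0%:R - 1) * 9 = d ^+ 2 * (k0%:R - 1) by field.
  have -> : 4 * N%:R * (c1 * d) ^+ 2 * 9 = d ^+ 2 * (36 * N%:R * c1 ^+ 2) by ring.
  by rewrite ltr_pM2l ?exprn_gt0 //; lra.
have [x [y [xQ yQ nc]]] := square_cover (fun n i => Re (c n i)) (fun n i => Im (c n i)) a (2 * d) w0 r0 sum sw.
pose z : C := x +i* y; have Qz : Q z by [].
have [zv ze] := QP _ Qz; have /andP[z2 z3] := QI _ Qz.
have d23 : 2 * d / 3 <= d by move: d0; clear -hF hC hne hcov hFR Fc Fo acc fPsi FE; lra.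
have d2d : d < 2 * d by move: d0; clear -hF hC hne hcov hFR Fc Fo acc fPsi FE; lra.
have [|||||i [n [iN bz]]] := @block_exists g al be L y0 k0 z A nv low.
- exact: le_trans zv d23.
- exact: le_trans ze d23.
- exact: lt_le_trans z2.
- exact: le_lt_trans d3y.
- have zi : 0 < 2 * Im z by rewrite mulr_gt0 // (lt_le_trans _ z2) // mulr_gt0.
  rewrite -(ler_pM2r zi) mulVf ?gt_eqF //; apply: le_trans d6k.
  have := ler_wpM2l (ltW k00) z3; clear -hF hC hne hcov hFR Fc Fo acc fPsi FE; lra.
by apply: (nc n i iN); exact: (Hc n i iN z Qz bz).
Qed.

End Blocks.

Lemma centers_isolated v : finite_set (is_side F) -> exists2 d : R, 0 < d & forall g al be, Arc Gamma g al be -> `|cen g - v| < d -> cen g = v.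
Proof.
move=> fS; apply: contrapT => none.
have [F0] : F !=set0.
  have [_ _ _ cov] := hFR; have : HH (0 +i* 1 : C) by rewrite /HH /=.
  rewrite -cov => -[g _ [w [cw _] _]]; have [w' Fw' _] := closure_near cw filterT.
  by exists w'.
move=> FF0; have [Fs [fFs FE]] := polygon_forms Fo Fc (ex_intro _ F0 FF0) fS.
apply: (@no_center_limit v Fs _ fFs FE) => e e0; apply: contrapT => H; apply: none; exists e => // g al be A ge.
by apply/eqP; apply: contrapT => /negP n; apply: H; exists g, al, be.
Qed.

(* An infinite vertex lies on an isometric circle with the same center as a relevant one:
   a short circle has its center near [v], and only finitely many are not short. *)
Lemma EE_isolated v : finite_set (is_side F) -> exists2 d : R, 0 < d & forall x, EE Gamma x -> `|x - v| < d -> x = v.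
Proof.
move=> fS; have [d d0 Hd] := centers_isolated v fS.
have d20 : 0 < d / 2 by rewrite divr_gt0.
have [e e0 [ed He]] : exists2 e : R, 0 < e & e <= d / 2 /\ forall g al be, Arc Gamma g al be -> cen g = v -> e <= rad g.
  have [[g [al [be [A gv]]]]|none] := pselect (exists g al be, Arc Gamma g al be /\ cen g = v); last first.
    by exists (d / 2) => //; split => // g al be A gv; case: none; exists g, al, be.
  have [[Gg g0] _ _ _ _] := A.
  exists (Num.min (d / 2) (rad g)); first by rewrite lt_min d20 rad_gt0.
  split; first by rewrite ge_min lexx.
  move=> h al' be' A' hv; have [[Gh h0] _ _ _ _] := A'.
  by rewrite ge_min (same_circle hF hC Gh Gg h0 g0) ?hv ?gv // lexx orbT.
have [M M0 HM] := rad_bound hF hC hcov.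
have fin := circles_finite hF hC hcov (`|v| + d + M) e0.
have fX := finite_image (fun x => x.1 - x.2) fin; have fY := finite_image (fun x => x.1 + x.2) fin.
have := conj fX fY; rewrite -finite_setU => fXY.
have [d' d'0 Hd'] := finite_isolated v fXY.
exists (Num.min d' (d / 2)); first by rewrite lt_min d'0.
move=> x [g [al [be [A H]]]]; rewrite lt_min => /andP[x1 x2].
have [[Gg g0] _ _ _ _] := A; have r0 := rad_gt0 g0.
have dd : d / 2 < d by rewrite ltr_pdivrMr // ltr_pMr // ltr1n.
have near_r : `|cen g - x| <= rad g -> e <= rad g /\ `|cen g| <= `|v| + d + M.
  move=> cx; split.
    rewrite leNgt; apply/negP => lt; have cv : cen g = v.
      apply: Hd A _; apply: le_lt_trans (ler_distD x _ _) _.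
      by rewrite [ltRHS](_ : _ = d / 2 + d / 2); [apply: ltrD => //; lra|field].
    by have := He _ _ _ A cv; rewrite leNgt lt.
  have -> : cen g = v + (x - v) + (cen g - x) by ring.
  apply: le_trans (ler_normD _ _) _; apply: lerD; last by apply: le_trans cx _; exact: HM.
  by apply: le_trans (ler_normD _ _) _; rewrite lerD2l ltW // (lt_trans x2).
case: H => [xE|[xa aE]|[xb bE]].
- by rewrite xE; apply: Hd A _; rewrite -xE; exact: lt_trans dd.
- have [|h1 h2] := near_r; first by rewrite xa aE opprB addrC subrK gtr0_norm.
  by apply: Hd' => //; left; exists (cen g, rad g); [exists g|rewrite xa aE].
- have [|h1 h2] := near_r; first by rewrite xb bE opprD addNKr normrN gtr0_norm.
  by apply: Hd' => //; right; exists (cen g, rad g); [exists g|rewrite xb bE].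
Qed.

End CentersDiscrete.

Theorem theorem8p15 (R : realType) (Gamma : set (PSL2 R)) (AA : set (set R[i]))
    (G : set (set (geodesicY Gamma)))
    (mu : {measure set (g_sigma_algebraType G) -> \bar R}) :
  is_fuchsian Gamma ->
  geometrically_finite Gamma ->
  cuspidal_infty Gamma ->
  Gamma <> stab_infty Gamma ->
  conditionA Gamma ->
  basal_family Gamma AA ->
  is_cross_section mu (CShat Gamma AA) <-> mu.-negligible (NIC AA).
Proof.
move=> hF [F [FR Fc fS]] hC hne hA hB; have hcov := KKb_cover hne hA hF hB.
apply: cross_section_iff => // v.
exact: (EE_isolated hF hC hne hcov FR Fc v fS).
Qed.
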